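(* Let $X(\mathbb D)$ and $u$ be as in any one of the following three cases: (a) $X(\mathbb D)=A^p_{\alpha,\beta}(\mathbb D)$ with $p\ge1$, $\alpha>-1$ and $0\le\beta<\frac{1+\alpha}{p}$, and $u\in M(A^p_{\alpha,\beta}(\mathbb D))$; (b) $X(\mathbb D)=\mathcal B_\alpha(\mathbb D)$ with $\alpha>1$, and $u\in M(\mathcal B_\alpha(\mathbb D))$; (c) $X(\mathbb D)=H^p_w(\mathbb D)$ with $p>1$ and $w\in(A^p)$, and $u\in M(H^p_w(\mathbb D))$. Then the essential spectrum of $M_u:X(\mathbb D)\to X(\mathbb D)$, $M_uf=uf$, is $$\sigma_e(M_u)=\bigcap_{0<r<1}\overline{u(\mathbb D\setminus r\mathbb D)}.$$
   Context: $\mathbb D$ is the open unit disk and $\mathcal H(\mathbb D)$ the space of analytic functions on it. $M(X)=\{u\in\mathcal H(\mathbb D):uf\in X\ \forall f\in X\}$. A bounded operator on a Banach space is Fredholm if it has closed range and finite-dimensional kernel and cokernel; $\sigma_e(T)=\{\lambda\in\mathbb C:T-\lambda I\text{ is not Fredholm}\}$. For $\beta\ge0$ and $f(z)=\sum_{k\ge0}a_kz^k$ put $(I+R)^\beta f(z)=\sum_{k\ge0}(1+k)^\beta a_kz^k$. For $p\ge1$, $\alpha>-1$, $\beta\ge0$, $A^p_{\alpha,\beta}(\mathbb D)$ is the space of $f\in\mathcal H(\mathbb D)$ with $\|f\|_{A^p_{\alpha,\beta}}=\left(\int_{\mathbb D}|(I+R)^\beta f|^p\,dA_\alpha\right)^{1/p}<\infty$,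 where $dA_\alpha(z)=(\alpha+1)(1-|z|^2)^\alpha dA(z)$ and $dA$ is area measure normalized to $\int_{\mathbb D}dA=1$. For $\alpha>0$, $\mathcal B_\alpha(\mathbb D)$ is the space of $f\in\mathcal H(\mathbb D)$ with $\|f\|_{\mathcal B_\alpha}=|f(0)|+\sup_{z\in\mathbb D}(1-|z|^2)^\alpha|f'(z)|<\infty$. For $p>1$, $w\in(A^p)$ means that $w$ is a $2\pi$-periodic nonnegative weight, positive a.e. and integrable over a period, satisfying the Muckenhoupt condition $\sup_I\left(\frac1{|I|}\int_Iw\right)\left(\frac1{|I|}\int_Iw^{-1/(p-1)}\right)^{p-1}<\infty$, the supremum over intervals $I$ of length at most $2\pi$. $H^p_w(\mathbb D)$ is the Banach space of $f\in\mathcal H(\mathbb D)$ with $\|f\|_{H^p_w}=\sup_{0<r<1}\left(\int_{-\pi}^{\pi}|f(re^{i\theta})|^pw(\theta)\,d\theta\right)^{1/p}<\infty$. *)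

(* Defs.v *)
From HB Require Import structures.
From mathcomp Require Import all_boot all_order all_algebra.
From mathcomp Require Import all_classical all_reals all_analysis.
From mathcomp Require Import complex.

Set Implicit Arguments.
Unset Strict Implicit.
Unset Printing Implicit Defensive.

Import Order.TTheory GRing.Theory Num.Theory.
Import numFieldNormedType.Exports.

Local Open Scope classical_set_scope.
Local Open Scope complex_scope.
Local Open Scope ring_scope.

(* MathComp-Analysis gives every numFieldType its metric topology, but that
   instance is not found on the concrete carrier R[i]. *)
HB.instance Definition _ (R : rcfType) :=
  NormedModule.copy R[i] (R[i] : numFieldType).

(* The norm of R[i] takes its values in R[i]; this is the same number in R. *)
Definition cabs (R : realType) (z : R[i]) : R := complex.Re `|z|.

(* A normed space is given by a linear subspace X of V and a norm N on X.
   N has values in \bar R because the function spaces below consist of the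
   functions whose norm is finite. *)
Section FredholmOperators.
Variables (R : realType) (V : lmodType R[i]).
Implicit Types (A B X : set V) (N : V -> \bar R) (T : V -> V).

Definition bounded_operator X N T : Prop :=
  [/\ forall f, X f -> X (T f),
      forall (c : R[i]) f g, X f -> X g -> T (c *: f + g) = c *: T f + T g
    & exists C : R, forall f, X f -> (N (T f) <= C%:E * N f)%E].

(* The quotient A / B of linear subspaces B <= A is spanned by the classes of
   finitely many elements of A. *)
Definition finite_dim_quotient A B : Prop :=
  exists (n : nat) (e : 'I_n -> V), (forall i, A (e i)) /\
    forall x, A x -> exists c : 'I_n -> R[i], B (x - \sum_(i < n) c i *: e i).

Definition closed_in X N A : Prop :=
  forall g, X g ->
    (forall eps : R, 0 < eps -> exists2 h, A h & (N (g - h)%R < eps%:E)%E) ->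
    A g.

Definition fredholm X N T : Prop :=
  [/\ bounded_operator X N T,
      closed_in X N (T @` X),
      finite_dim_quotient [set f | X f /\ T f = 0] [set 0]
    & finite_dim_quotient X (T @` X)].

Definition essential_spectrum X N T : set R[i] :=
  [set l | ~ fredholm X N (fun f => T f - l *: f)].

End FredholmOperators.

Definition disk (R : realType) : Type := {z : R[i] | `|z| < 1}.

Section FunctionsOnTheDisk.
Variable R : realType.
Implicit Types (f u : disk R -> R[i]).

Definition analytic f : Prop :=
  forall z0 : disk R, exists (a : nat -> R[i]) (r : R), 0 < r /\
    forall z : disk R, `|val z - val z0| < r%:C ->
      series (fun k => a k * (val z - val z0) ^+ k) @ \oo --> f z.

(* The sequence of the a_k with f(z) = \sum_k a_k z^k on the whole disk; it
   exists and is unique for f analytic. *)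
Definition coefs f : nat -> R[i] :=
  get [set a | forall z : disk R,
         series (fun k => a k * val z ^+ k) @ \oo --> f z].

(* (I + R)^beta f *)
Definition IR_pow (beta : R) f : disk R -> R[i] := fun z =>
  lim (series (fun k => (k.+1%:R `^ beta)%:C * coefs f k * val z ^+ k) @ \oo).

(* Extension by 0, used to differentiate f and to integrate it in coordinates *)
Definition ext0 f : R[i] -> R[i] := fun z => if insub z is Some d then f d else 0.

Definition function_space (N : (disk R -> R[i]) -> \bar R) :
    set (disk R -> R[i]) :=
  [set f | analytic f /\ (N f < +oo)%E].

Definition mul_op u : (disk R -> R[i]) -> (disk R -> R[i]) :=
  fun f z => u z * f z.

Definition multipliers (X : set (disk R -> R[i])) : set (disk R -> R[i]) :=
  [set u | analytic u /\ forall f, X f -> X (mul_op u f)].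

(* The space A^p_{alpha,beta}. Area measure is normalized by 1 / pi. *)
Definition bergman_norm (p alpha beta : R) f : \bar R :=
  ((\int[(@lebesgue_measure R \x @lebesgue_measure R)%E]_(q in
        [set q : R * R | q.1 ^+ 2 + q.2 ^+ 2 < 1]%R)
     (cabs (ext0 (IR_pow beta f) (q.1 +i* q.2)) `^ p *
      ((alpha + 1) * (1 - (q.1 ^+ 2 + q.2 ^+ 2)) `^ alpha / pi))%R%:E)
   `^ p^-1)%E.

Definition bloch_norm (alpha : R) f : \bar R :=
  ((cabs (ext0 f 0))%:E +
   ereal_sup [set ((1 - cabs (val z) ^+ 2) `^ alpha *
                   cabs ((ext0 f)^`()%classic (val z)))%R%:E | z in [set: disk R]])%E.

Definition hardy_norm (p : R) (w : R -> R) f : \bar R :=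
  ereal_sup [set ((\int[@lebesgue_measure R]_(t in `[(- pi)%R, pi])
       (cabs (ext0 f ((r * cos t) +i* (r * sin t))) `^ p * w t)%R%:E)
     `^ p^-1)%E | r in [set r : R | 0 < r < 1]].

(* At zeros of w, a null set for the weights considered, the value of
   w `^ (- (p - 1)^-1) is 0 instead of +oo. *)
Definition muckenhoupt_product (p : R) (w : R -> R) (a b : R) : \bar R :=
  (((b - a)^-1%:E * (\int[@lebesgue_measure R]_(t in `[a, b]) (w t)%:E)) *
   ((b - a)^-1%:E * (\int[@lebesgue_measure R]_(t in `[a, b])
      (w t `^ (- (p - 1)^-1))%:E)) `^ (p - 1))%E.

Definition muckenhoupt (p : R) (w : R -> R) : Prop :=
  [/\ forall t, w (t + 2 * pi) = w t,
      forall t, 0 <= w t,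
      {ae @lebesgue_measure R, forall t, 0 < w t},
      (@lebesgue_measure R).-integrable `[- pi, pi] (EFin \o w)
    & (ereal_sup [set muckenhoupt_product p w I.1 I.2
         | I in [set I : R * R | (I.1 < I.2 <= I.1 + 2 * pi)%R]] < +oo)%E].

End FunctionsOnTheDisk.

(* Main.v *)
(* Each of the three norms is equivalent to a norm N0 for which |h| <= A |f| + B |g| implies
   N0 h <= K (A N0 f + B N0 g). For the Bloch space N0 is the supremum of
   (1 - |z|^2)^(alpha - 1) |f|, and A^p_{alpha,beta} is the weighted Bergman space of exponent
   alpha - p beta: (I + R)^1 is bounded by Cauchy's estimate on discs of radius comparable to
   1 - |z|, and (I + R)^(-s) g(z) = Gamma(s)^-1 int_0^oo t^(s-1) e^-t g(e^-t z) dt is bounded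
   by a Schur test.

   If |u - lambda| is bounded below near the circle, u - lambda has finitely many zeros, and
   dividing by them shows that its multiples form a closed subspace of finite codimension.
   Otherwise u - lambda is as small as theta^(2k) at points z_k tending to some zeta of
   modulus 1. On a sparse subsequence, a sum of theta^k b_k times extremal functions at z_k
   multiplied by peak functions has values close to theta^k b_k c_k, where c_k is the norm of
   the evaluation at z_k and |b_k| <= 1 is arbitrary, while the multiples of u - lambda are
   o(theta^k c_k) at z_k; hence their codimension is infinite. The same functions show that
   multipliers are bounded. *)

(* Holomorphy is handled as uniform approximability by polynomials on smaller discs: for polynomials
   Cauchy's estimate is the integral of a trigonometric polynomial, and estimates pass to the limit.
   The obstacle is to get from the local power series in [analytic] to one series on the whole disk;
   the disc of convergence is enlarged in equal steps.

   The triangle inequality of [N0] carries a constant [K], so sums are controlled for terms decaying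
   like [theta ^+ k] with [theta = (2 * K)^-1]. The data at the nodes grow or decay at the square of
   this rate, which leaves a factor [theta ^+ k] for the contradiction.

   Zeros are counted with Blaschke factors of a disc of radius s < 1: each division raises the
   modulus at a fixed point by a fixed factor and keeps the bound on |z| = s, so a maximum principle
   with a constant loss caps the number of divisions.

   In the Schur test the kernel is cut at t = 1 and the disk at |z| = 1/2; what is cut off is
   controlled by a bound of |g| on |z| <= 1/2, because e^-1 < 1/2. *)
Require Import Defs.
From HB Require Import structures.
From mathcomp Require Import all_boot all_order all_algebra.
From mathcomp Require Import all_classical all_reals all_analysis.
From mathcomp Require Import measurable_realfun complex.
From mathcomp Require Import ring lra.
Import Order.TTheory GRing.Theory Num.Theory.
Import numFieldNormedType.Exports.
Local Open Scope classical_set_scope.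
Local Open Scope complex_scope.
Local Open Scope ring_scope.

Set Implicit Arguments.
Unset Strict Implicit.
Unset Printing Implicit Defensive.

(** * Moduli and limits of complex numbers *)

Section CabsTheory.
Variable R : realType.
Implicit Types z w : R[i].

Lemma cabsE z : (cabs z)%:C = `|z|.
Proof. by rewrite /cabs; case: z => a b; rewrite normc_def. Qed.

Lemma cabs_re_im z : cabs z = Num.sqrt (complex.Re z ^+ 2 + complex.Im z ^+ 2).
Proof. by rewrite /cabs; case: z => a b; rewrite normc_def. Qed.

Lemma cabs_lt z r : (`|z| < r%:C) = (cabs z < r).
Proof. by rewrite -cabsE ltcR. Qed.

Lemma cabs_le z r : (`|z| <= r%:C) = (cabs z <= r).
Proof. by rewrite -cabsE lecR. Qed.

Lemma cabs_inj_eq z r : `|z| = r%:C -> cabs z = r.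
Proof. by rewrite -cabsE => /complexI. Qed.

Lemma cabs_ge0 z : 0 <= cabs z.
Proof. by rewrite cabs_re_im sqrtr_ge0. Qed.

Lemma cabs0 : cabs (0 : R[i]) = 0.
Proof. by apply: cabs_inj_eq; rewrite normr0. Qed.

Lemma cabs1 : cabs (1 : R[i]) = 1.
Proof. by apply: cabs_inj_eq; rewrite normr1. Qed.

Lemma cabsM z w : cabs (z * w) = cabs z * cabs w.
Proof. by apply: cabs_inj_eq; rewrite normrM -!cabsE -rmorphM. Qed.

Lemma cabsX z n : cabs (z ^+ n) = cabs z ^+ n.
Proof. by apply: cabs_inj_eq; rewrite normrX -cabsE -rmorphXn. Qed.

Lemma cabsV z : cabs z^-1 = (cabs z)^-1.
Proof. by apply: cabs_inj_eq; rewrite normfV -cabsE -fmorphV. Qed.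

Lemma cabsN z : cabs (- z) = cabs z.
Proof. by apply: cabs_inj_eq; rewrite normrN cabsE. Qed.

Lemma cabsC z w : cabs (z - w) = cabs (w - z).
Proof. by rewrite -cabsN opprB. Qed.

Lemma cabsD z w : cabs (z + w) <= cabs z + cabs w.
Proof. by rewrite -lecR rmorphD !cabsE ler_normD. Qed.

Lemma cabsB z w : cabs (z - w) <= cabs z + cabs w.
Proof. by rewrite (le_trans (cabsD _ _))// cabsN. Qed.

Lemma cabs_dist_add a z w : cabs (z - w) <= cabs (z - a) + cabs (a - w).
Proof. by rewrite (le_trans _ (cabsD _ _))// addrA subrK. Qed.

Lemma cabs_subl z w : cabs z - cabs w <= cabs (z - w).
Proof. by rewrite lerBlDr (le_trans _ (cabsD _ _))// subrK. Qed.

Lemma cabs_eq0 z : (cabs z == 0) = (z == 0).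
Proof.
by apply/eqP/eqP => [h|->]; [apply/normr0_eq0; rewrite -cabsE h|exact: cabs0].
Qed.

Lemma cabs_gt0 z : (0 < cabs z) = (z != 0).
Proof. by rewrite lt_def cabs_ge0 andbT cabs_eq0. Qed.

Lemma cabs_real (x : R) : cabs x%:C = `|x|.
Proof. by rewrite cabs_re_im /= expr0n addr0 sqrtr_sqr. Qed.

Lemma cabs_ge0_real (x : R) : 0 <= x -> cabs x%:C = x.
Proof. by move=> x0; rewrite cabs_real ger0_norm. Qed.

Lemma cabs_nat n : cabs (n%:R : R[i]) = n%:R.
Proof. by apply: cabs_inj_eq; rewrite normr_nat rmorph_nat. Qed.

Lemma cabs_conj z : cabs z^*%C = cabs z.
Proof. by case: z => a b; rewrite !cabs_re_im /= sqrrN. Qed.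

Lemma Re_le_cabs z : `|complex.Re z| <= cabs z.
Proof.
by rewrite cabs_re_im -sqrtr_sqr ler_wsqrtr// lerDl sqr_ge0.
Qed.

Lemma Im_le_cabs z : `|complex.Im z| <= cabs z.
Proof.
by rewrite cabs_re_im -sqrtr_sqr ler_wsqrtr// lerDr sqr_ge0.
Qed.

Lemma cabs_le_ReIm z : cabs z <= `|complex.Re z| + `|complex.Im z|.
Proof.
rewrite cabs_re_im -(ler_pXn2r (n := 2)) ?nnegrE// ?addr_ge0// sqr_sqrtr ?addr_ge0 ?sqr_ge0//.
by rewrite sqrrD !real_normK ?num_real// lerD2r lerDl mulrn_wge0// mulr_ge0.
Qed.

Lemma ReD z w : complex.Re (z + w) = complex.Re z + complex.Re w.
Proof. by case: z w => ? ? [? ?]. Qed.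

Lemma ImD z w : complex.Im (z + w) = complex.Im z + complex.Im w.
Proof. by case: z w => ? ? [? ?]. Qed.

Lemma ReN z : complex.Re (- z) = - complex.Re z.
Proof. by case: z. Qed.

Lemma ImN z : complex.Im (- z) = - complex.Im z.
Proof. by case: z. Qed.

Lemma Re_sum (I : Type) (s : seq I) (P : pred I) (F : I -> R[i]) :
  complex.Re (\sum_(i <- s | P i) F i) = \sum_(i <- s | P i) complex.Re (F i).
Proof. by apply: (big_morph _ ReD). Qed.

Lemma cabs_sum (I : Type) (s : seq I) (P : pred I) (F : I -> R[i]) :
  cabs (\sum_(i <- s | P i) F i) <= \sum_(i <- s | P i) cabs (F i).
Proof.
elim/big_rec2: _ => [|i y x _ h]; first by rewrite cabs0.
by rewrite (le_trans (cabsD _ _))// lerD2l.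
Qed.

(* Multiplication by a suitable unimodular number makes z real. *)
Lemma unimodularP z : exists2 c : R[i], cabs c = 1 & c * z = (cabs z)%:C.
Proof.
have [->|z0] := eqVneq z 0; first by exists 1; rewrite ?cabs1// mulr0 cabs0.
exists ((cabs z)%:C / z); last by rewrite mulfVK.
by rewrite cabsM cabsV cabs_ge0_real ?cabs_ge0// divff// cabs_eq0.
Qed.

Lemma cabs_cvgP (u : nat -> R[i]) (l : R[i]) :
  u @ \oo --> l <->
  forall e : R, 0 < e -> exists N, forall n, (N <= n)%N -> cabs (u n - l) < e.
Proof.
split=> [/cvgrPdist_lt ul e e0|ul].
  have := ul e%:C; rewrite ltcR => /(_ e0) [N _ hN]; exists N => n Nn.
  by rewrite cabsC -cabs_lt; exact: hN.
apply/cvgrPdist_lt => e; case: e => a b; rewrite ltcE/= => /andP[/eqP -> a0].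
have [N hN] := ul a a0; exists N => // n /= Nn.
by rewrite complexr0 cabs_lt cabsC hN.
Qed.

Lemma cabs_cvg0P (u : nat -> R[i]) (l : R[i]) :
  u @ \oo --> l <-> (fun n => cabs (u n - l)) @ \oo --> (0 : R).
Proof.
rewrite cabs_cvgP; split=> [h|/cvgrPdist_lt h e e0].
  apply/cvgrPdist_lt => e /h [N hN]; exists N => // n /= Nn.
  by rewrite sub0r normrN ger0_norm ?cabs_ge0 ?hN.
have [N _ hN] := h e e0; exists N => n Nn.
by have := hN n Nn; rewrite sub0r normrN ger0_norm ?cabs_ge0.
Qed.

Lemma complex_lim_unique (u : nat -> R[i]) (l l' : R[i]) :
  u @ \oo --> l -> u @ \oo --> l' -> l = l'.
Proof.
move=> /cabs_cvgP h /cabs_cvgP h'; apply/eqP; rewrite -subr_eq0 -cabs_eq0.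
apply/eqP/le_anti; rewrite cabs_ge0 andbT; apply/ler_addgt0Pr => e e0; rewrite add0r.
have [N hN] := h _ (divr_gt0 e0 (ltr0n _ 2)); have [N' hN'] := h' _ (divr_gt0 e0 (ltr0n _ 2)).
rewrite (splitr e) (le_trans (cabs_dist_add (u (maxn N N')) _ _))// lerD//.
  by rewrite cabsC ltW// hN// leq_maxl.
by rewrite ltW// hN'// leq_maxr.
Qed.

Lemma complex_limE (u : nat -> R[i]) (l : R[i]) : u @ \oo --> l -> lim (u @ \oo) = l.
Proof.
move=> h; have h' : u @ \oo --> lim (u @ \oo) by exact: (cvgP _ h).
exact: complex_lim_unique h' h.
Qed.

Lemma complex_cauchy_cvg (u : nat -> R[i]) :
  (forall e : R, 0 < e -> exists N, forall m n, (N <= m)%N -> (N <= n)%N ->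
     cabs (u m - u n) < e) -> exists l : R[i], u @ \oo --> l.
Proof.
move=> cu.
have H (P : R[i] -> R) : (forall z w, P (z - w) = P z - P w) ->
    (forall z, `|P z| <= cabs z) -> cvgn (P \o u).
  move=> PB Pc; apply/cauchy_cvgP/cauchy_exP => e e0.
  have [N hN] := cu e e0; exists (P (u N)); exists N => // n /= Nn.
  by rewrite /ball/= -PB (le_lt_trans (Pc _))// hN.
have hRe := H _ (fun z w => etrans (ReD z (- w)) (congr1 _ (ReN w))) Re_le_cabs.
have hIm := H _ (fun z w => etrans (ImD z (- w)) (congr1 _ (ImN w))) Im_le_cabs.
exists (limn (@complex.Re R \o u) +i* limn (@complex.Im R \o u)).
apply/cabs_cvgP => e e0.
have e2 : 0 < e / 2 by rewrite divr_gt0.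
have /cvgrPdist_lt/(_ _ e2)[N _ hN] := hRe.
have /cvgrPdist_lt/(_ _ e2)[N' _ hN'] := hIm.
exists (maxn N N') => n; rewrite geq_max => /andP[Nn N'n].
rewrite (le_lt_trans (cabs_le_ReIm _))// (splitr e) ltrD//.
  by rewrite ReD ReN distrC; apply: hN.
by rewrite ImD ImN distrC; apply: hN'.
Qed.

Lemma complex_bolzano (u : nat -> R[i]) (M : R) : (forall n, cabs (u n) <= M) ->
  exists l : R[i], forall (e : R) N, 0 < e ->
    exists2 n, (N <= n)%N & cabs (u n - l) < e.
Proof.
move=> uM; pose v n := (complex.Re (u n), complex.Im (u n)).
have cK := compact_setX (@segment_compact R (- M) M) (@segment_compact R (- M) M).
have [|[x y] [_ cl]] := cK (v @ \oo) _.
  exists 0%N => // n _; split; rewrite /v /= in_itv/= -ler_norml.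
    exact: le_trans (Re_le_cabs _) (uM n).
  exact: le_trans (Im_le_cabs _) (uM n).
exists (x +i* y) => e N e0.
have e2 : 0 < e / 2 by rewrite divr_gt0.
have [|_ [[n Nn <-] [/= hx hy]]] := cl (v @` [set n | (N <= n)%N]) (ball (x, y) (e / 2)) _ (nbhsx_ballx _ _ e2).
  by exists N => // n /= Nn; exists n.
exists n => //; rewrite (le_lt_trans (cabs_le_ReIm _))// (splitr e) ltrD//.
  by rewrite ReD ReN distrC.
by rewrite ImD ImN distrC.
Qed.

Lemma complex_bolzano_subseq (u : nat -> R[i]) (M : R) : (forall n, cabs (u n) <= M) ->
  exists (l : R[i]) (s : nat -> nat), (forall k, (k <= s k)%N) /\ (u \o s) @ \oo --> l.
Proof.
move=> /complex_bolzano[l hl]; exists l.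
have /choice[s hs] k : exists n, (k <= n)%N /\ cabs (u n - l) < k.+1%:R^-1.
  by have [|n kn h] := hl (k.+1%:R^-1) k; [rewrite invr_gt0|exists n].
exists s; split=> [k|]; first by have [] := hs k.
apply/cabs_cvgP => e e0; have [N _ hN] := near_infty_natSinv_lt (PosNum e0).
by exists N => n Nn; rewrite (lt_trans (hs n).2)// hN.
Qed.

End CabsTheory.

(** * Cauchy's estimate for polynomials as an integral over a circle *)

Section RealIntegrals.
Variable R : realType.
Local Notation mu := (@lebesgue_measure R).

(** The integral of [f] is [F b - F a] and is at most the integral of the positive part of [f],
    which [g] dominates because it is nonnegative and above [f]. In this form only nonnegative
    integrands have to be compared. *)
Lemma ftc_le_integral (F f g : R -> R) (a b : R) : a < b ->
  (forall x : R, is_derive x (1 : R) F (f x)) -> continuous f ->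
  measurable_fun `[a, b] g ->
  (forall x, x \in `[a, b] -> f x <= g x) -> (forall x, 0 <= g x) ->
  ((F b - F a)%:E <= \int[mu]_(x in `[a, b]) (g x)%:E)%E.
Proof.
move=> ab dF cf mg fg g0.
have cF : continuous F by move=> x; apply/differentiable_continuous/derivable1_diffP; case: (dF x).
have mf : measurable_fun `[a, b] f.
  by apply: measurable_funS (continuous_measurable_fun cf).
have cf' : {within `[a, b], continuous f} by exact: continuous_subspaceT.
rewrite EFinB -(continuous_FTC2 ab cf') => [||x _]; last 2 first.
- split=> [x _||]; first by case: (dF x).
  + exact/cvg_at_right_filter/cF.
  + exact/cvg_at_left_filter/cF.
- by rewrite derive1E; case: (dF x).
rewrite integralE (@le_trans _ _ (\int[mu]_(x in `[a, b]) (EFin \o f)^\+%E x)%E)//.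
  by rewrite geeDl// oppe_le0 integral_ge0.
apply: ge0_le_integral => //; [exact/measurable_funepos/measurable_EFinP|exact/measurable_EFinP|].
by move=> x /= /fg fgx; rewrite funeposE ge_max !lee_fin fgx g0.
Qed.
End RealIntegrals.

Section ComplexMeasurable.
Variables (R : realType) (d : measure_display) (T : measurableType d) (D : set T).
Implicit Types f g : T -> R[i].

Definition cmeasurable f :=
  measurable_fun D (@complex.Re R \o f) /\ measurable_fun D (@complex.Im R \o f).

Lemma cmeasurable_cst (c : R[i]) : cmeasurable (fun=> c).
Proof. by split; exact: measurable_cst. Qed.

Lemma cmeasurableD f g : cmeasurable f -> cmeasurable g -> cmeasurable (fun x => f x + g x).
Proof.
move=> [f1 f2] [g1 g2]; split.
- rewrite (_ : _ \o _ = (complex.Re (R:=R) \o f) \+ (complex.Re (R:=R) \o g)); first exact: measurable_funD.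
  by apply/funext => x; rewrite /= ReD.
- rewrite (_ : _ \o _ = (complex.Im (R:=R) \o f) \+ (complex.Im (R:=R) \o g)); first exact: measurable_funD.
  by apply/funext => x; rewrite /= ImD.
Qed.

Lemma cmeasurableM f g : cmeasurable f -> cmeasurable g -> cmeasurable (fun x => f x * g x).
Proof.
move=> [f1 f2] [g1 g2]; split.
- rewrite (_ : _ \o _ = ((complex.Re (R:=R) \o f) \* (complex.Re (R:=R) \o g)) \-
     ((complex.Im (R:=R) \o f) \* (complex.Im (R:=R) \o g))).
    by apply: measurable_funB; exact: measurable_funM.
  by apply/funext => x /=; case: (f x) (g x) => ? ? [? ?].
- rewrite (_ : _ \o _ = ((complex.Re (R:=R) \o f) \* (complex.Im (R:=R) \o g)) \+
     ((complex.Im (R:=R) \o f) \* (complex.Re (R:=R) \o g))).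
    by apply: measurable_funD; exact: measurable_funM.
  by apply/funext => x /=; case: (f x) (g x) => ? ? [? ?].
Qed.

Lemma cmeasurable_horner f (p : {poly R[i]}) : cmeasurable f -> cmeasurable (fun x => p.[f x]).
Proof.
move=> mf; elim/poly_ind: p => [|p c ih].
  by under eq_fun do rewrite horner0; exact: cmeasurable_cst.
under eq_fun do rewrite hornerMXaddC.
by apply: cmeasurableD (cmeasurable_cst _); exact: cmeasurableM.
Qed.

Lemma measurable_cabs f : cmeasurable f -> measurable_fun D (fun x => cabs (f x)).
Proof.
move=> [f1 f2]; under eq_fun do rewrite cabs_re_im.
apply: measurableT_comp (continuous_measurable_fun (@sqrt_continuous R)) _.
by apply: measurable_funD; exact: measurable_funX.
Qed.

End ComplexMeasurable.

Section CircleIntegral.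
Variable R : realType.
Local Notation mu := (@lebesgue_measure R).

Definition cexp (t : R) : R[i] := cos t +i* sin t.

Lemma cabs_cexp t : cabs (cexp t) = 1.
Proof. by rewrite cabs_re_im /= cos2Dsin2 sqrtr1. Qed.

Lemma cexpD s t : cexp (s + t) = cexp s * cexp t.
Proof. by rewrite /cexp cosD sinD; apply/eqP; rewrite eq_complex /= eqxx addrC eqxx. Qed.

Lemma cexp0 : cexp 0 = 1.
Proof. by rewrite /cexp cos0 sin0. Qed.

Lemma cexpX t n : cexp t ^+ n = cexp (n%:R * t).
Proof.
elim: n => [|n ih]; first by rewrite mul0r cexp0.
by rewrite exprS ih -cexpD -nat1r mulrDl mul1r.
Qed.

Lemma is_derive_Re_cexp (a : R[i]) (m t : R) :
  is_derive t (1 : R) (fun t => complex.Re (a * cexp (m * t)))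
     (complex.Re (a * 'i * m%:C * cexp (m * t))).
Proof.
have -> : (fun t => complex.Re (a * cexp (m * t))) =
   (fun t => complex.Re a * cos (m * t) - complex.Im a * sin (m * t)).
  by apply/funext => s; case: a.
apply: is_derive_eq; case: a => x y /=; rewrite /GRing.scale/=; ring.
Qed.

Lemma is_derive_continuous (F : R -> R) (f : R -> R) :
  (forall x : R, is_derive x (1 : R) F (f x)) -> continuous F.
Proof.
by move=> dF x; apply/differentiable_continuous/derivable1_diffP; case: (dF x).
Qed.

Lemma cmeasurable_cexp (D : set R) (r : R) : measurable D ->
  cmeasurable D (fun t => r%:C * cexp t).
Proof.
move=> mD; apply: cmeasurableM; first exact: cmeasurable_cst.
by split; apply: measurable_funS (continuous_measurable_fun _) => //;
  [exact: continuous_cos|exact: continuous_sin].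
Qed.

(* Cauchy's estimate: [p`_k r^k] is, up to a unimodular factor, the mean of
   [p (r e^{it}) e^{-ikt}]. *)
Lemma circle_cauchy (p : {poly R[i]}) (r : R) (k : nat) : 0 <= r ->
  ((2 * pi * (cabs p`_k * r ^+ k))%:E <=
   \int[mu]_(t in `[(- pi)%R, pi]) (cabs p.[r%:C * cexp t])%:E)%E.
Proof.
move=> r0; have pi0 := pi_gt0 R.
have [kp|pk] := ltnP k (size p); last first.
  rewrite nth_default// cabs0 mul0r mulr0; apply: integral_ge0 => t _.
  by rewrite lee_fin cabs_ge0.
have [c c1 cE] := unimodularP p`_k.
pose a (j : 'I_(size p)) := c * p`_j * (r ^+ j)%:C.
pose m (j : 'I_(size p)) : R := j%:R - k%:R.
(* [f] is the real part of c e^(-ikt) p(r e^(it)): its frequencies are [m j], and the term j = k is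
   the constant |p_k| r^k. The antiderivative [F] is linear in that term and periodic in the
   others. *)
pose f t := \sum_(j < size p) complex.Re (a j * cexp (m j * t)).
pose F t := \sum_(j < size p) (if j == k :> nat then complex.Re (a j) * t
   else complex.Re (a j / ('i * (m j)%:C) * cexp (m j * t))).
have dF (t : R) : is_derive t (1 : R) F (f t).
  have -> : F = \sum_(j < size p) (fun t => if j == k :> nat then complex.Re (a j) * t
   else complex.Re (a j / ('i * (m j)%:C) * cexp (m j * t))).
    by apply/funext => s; rewrite fct_sumE.
  apply: is_derive_sum => j; case: (eqVneq (j : nat) k) => jk.
    by apply: is_derive_eq; rewrite /m jk subrr mul0r cexp0 mulr1 /GRing.scale/= mulr1.
  have := is_derive_Re_cexp (a j / ('i * (m j)%:C)) (m j) t.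
  rewrite -(mulrA (a j / _)) divfK//.
  rewrite mulf_eq0 negb_or; apply/andP; split; first by rewrite -cabs_gt0 cabs_re_im /= expr0n expr1n add0r sqrtr1.
  by rewrite -cabs_gt0 cabs_real normr_gt0 subr_eq0 eqr_nat.
have cf : continuous f.
  have -> : f = \sum_(j < size p) (fun t => complex.Re (a j * cexp (m j * t))).
    by apply/funext => s; rewrite fct_sumE.
  apply: (big_ind (fun h : R -> R => continuous h)) => [|g h cg ch x|j _]; [exact: cst_continuous|exact: cvgD (cg x) (ch x)|].
  exact: is_derive_continuous (is_derive_Re_cexp _ _).
(* Both [pi] and [- pi] are sent to -1 by [cexp], so an oscillating term of [F] has the same value
   at the two ends and cancels in [F pi - F (- pi)]. *)
have cexpE x j : cexp x = -1 -> cexp (m j * x) = (-1) ^+ j / (-1) ^+ k.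
  move=> x1; rewrite /m mulrBl cexpD -!x1 !cexpX; congr (_ * _).
  rewrite -[RHS]mulr1 -[X in _ = _ * X]cexp0 -(subrr (k%:R * x)) cexpD mulKf//.
  by rewrite -cabs_gt0 cabs_cexp.
have -> : 2 * pi * (cabs p`_k * r ^+ k) = F pi - F (- pi).
  rewrite /F -sumrB (bigD1 (Ordinal kp))//= eqxx big1 ?addr0 => [|j jk].
    by rewrite /a cE -rmorphM/=; ring.
  have pE : cexp pi = -1 by rewrite /cexp cospi sinpi; apply/eqP; rewrite eq_complex /= oppr0 !eqxx.
  have pNE : cexp (- pi) = -1.
    by rewrite /cexp cosN sinN cospi sinpi oppr0; apply/eqP; rewrite eq_complex /= oppr0 !eqxx.
  by rewrite (negbTE (jk : (j : nat) != k)) !cexpE ?subrr.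
apply: ftc_le_integral dF cf _ _ _ => [||t _|t].
- by rewrite gtrN.
- by apply/measurable_cabs/cmeasurable_horner/cmeasurable_cexp.
- rewrite /f -Re_sum (le_trans (ler_norm _))// (le_trans (Re_le_cabs _))//.
  rewrite (_ : \sum_(_ < _) _ = c * cexp (- (k%:R * t)) * p.[r%:C * cexp t]).
    by rewrite !cabsM c1 cabs_cexp !mul1r.
  rewrite horner_coef mulr_sumr; apply: eq_bigr => j _.
  by rewrite /a /m exprMn cexpX mulrBl cexpD rmorphXn; ring.
- exact: cabs_ge0.
Qed.
End CircleIntegral.

(** * Locally uniform limits of polynomials *)

Section PolynomialEstimates.
Variable R : realType.
Local Notation mu := (@lebesgue_measure R).
Implicit Types (p : {poly R[i]}) (c z : R[i]).

(** Taylor coefficients at [c] become ordinary coefficients of the translate; this carries Cauchy's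
    estimate from 0 to any centre. *)
Lemma nderivn_comp p c k : (p \Po ('X + c%:P))`_k = p^`N(k).[c].
Proof.
rewrite /comp_poly addrC nderiv_taylor; last exact: mulrC.
rewrite size_map_polyC coef_sum.
under eq_bigr => i _.
  rewrite nderivn_map -[_.[c%:P]]/((p^`N(i) ^:P).[c%:P]) horner_map/= coefCM coefXn.
  over.
have [kp|pk] := ltnP k (size p).
  rewrite (bigD1 (Ordinal kp))//= eqxx mulr1 big1 ?addr0// => i ik.
  by rewrite eq_sym (negbTE (ik : (i : nat) != k)) mulr0.
rewrite big1 => [|i _]; last first.
  by rewrite [_ == _]gtn_eqF ?mulr0//; exact: leq_trans (ltn_ord i) pk.
by rewrite nderivn_poly0// horner0.
Qed.

Lemma cauchy_poly p c (r M : R) k : 0 <= r ->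
  (forall z, cabs (z - c) = r -> cabs p.[z] <= M) -> cabs p^`N(k).[c] * r ^+ k <= M.
Proof.
move=> r0 pM; have pi0 := pi_gt0 R.
have := circle_cauchy (p \Po ('X + c%:P)) k r0; rewrite nderivn_comp => h.
rewrite -(ler_pM2l (_ : 0 < 2 * pi))//; last by rewrite mulr_gt0.
rewrite -lee_fin (le_trans h)//.
rewrite (@le_trans _ _ (\int[mu]_(t in `[(- pi)%R, pi]) M%:E)%E)//.
  apply: ge0_le_integral => //.
  - by move=> t _; rewrite lee_fin cabs_ge0.
  - exact/measurable_EFinP/measurable_cabs/cmeasurable_horner/cmeasurable_cexp.
  move=> t _; rewrite lee_fin horner_comp !hornerE pM// addrK.
  by rewrite cabsM cabs_cexp mulr1 cabs_ge0_real.
rewrite integral_cst//= lebesgue_measure_itv/= lte_fin gtrN//= -EFinB -EFinM lee_fin.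
by rewrite (_ : M * _ = 2 * pi * M)//; ring.
Qed.

Lemma poly_taylor p c z : p.[z] = \sum_(k < size p) p^`N(k).[c] * (z - c) ^+ k.
Proof. by rewrite -nderiv_taylor ?subrKC//; exact: mulrC. Qed.

Lemma poly_taylor_wide p c z n : (size p <= n)%N ->
  p.[z] = \sum_(k < n) p^`N(k).[c] * (z - c) ^+ k.
Proof.
move=> pn; rewrite (poly_taylor p c) (big_ord_widen n (fun k => p^`N(k).[c] * (z - c) ^+ k) pn).
rewrite big_mkcond; apply: eq_bigr => i _; case: ltnP => // pi.
by rewrite nderivn_poly0// horner0 mul0r.
Qed.

Lemma poly_bounded p c (r : R) : exists2 M : R, 0 < M &
  forall z, cabs (z - c) <= r -> cabs p.[z] <= M.
Proof.
exists (\sum_(k < size p) cabs p^`N(k).[c] * `|r| ^+ k + 1).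
  by rewrite ltr_wpDl// sumr_ge0// => i _; rewrite mulr_ge0 ?cabs_ge0 ?exprn_ge0.
move=> z zr; rewrite (poly_taylor p c) (le_trans (cabs_sum _ _ _))// ler_wpDr//.
apply: ler_sum => i _; rewrite cabsM cabsX ler_wpM2l ?cabs_ge0//.
by rewrite lerXn2r ?nnegrE ?cabs_ge0// (le_trans zr)// ler_norm.
Qed.

Lemma geom_sum_le (q : R) (K S : nat) : 0 <= q -> q < 1 ->
  \sum_(K <= k < S) q ^+ k <= q ^+ K / (1 - q).
Proof.
move=> q0 q1; rewrite ler_pdivlMr ?subr_gt0// => {q1}.
have [SK|KS] := leqP S K; first by rewrite big_geq// mul0r exprn_ge0.
suff -> : (\sum_(K <= k < S) q ^+ k) * (1 - q) = q ^+ K - q ^+ S.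
  by rewrite gerBl exprn_ge0.
elim: S KS => // S ih; rewrite ltnS leq_eqVlt => /predU1P[->|KS].
  by rewrite big_nat1 exprSr; ring.
by rewrite big_nat_recr ?(ltnW KS)//= mulrDl ih// exprSr; ring.
Qed.
End PolynomialEstimates.

Section Papprox.
Variable R : realType.
Implicit Types (f g : R[i] -> R[i]) (c z : R[i]) (r rho e : R).

(** The working notion of holomorphy on the open disc of centre [c] and radius [rho]. It passes to
    sums, products and uniform limits without touching coefficients, and estimates proved for
    polynomials carry over to it. *)
Definition papprox c rho f := forall r e, r < rho -> 0 < e ->
  exists p : {poly R[i]}, forall z, cabs (z - c) <= r -> cabs (f z - p.[z]) <= e.

Lemma papprox_sub c c' rho rho' f : cabs (c' - c) + rho' <= rho ->
  papprox c rho f -> papprox c' rho' f.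
Proof.
move=> cc' pf r e rr e0; have [|p hp] := pf (cabs (c' - c) + r) e _ e0.
  by rewrite (lt_le_trans _ cc')// ltrD2l.
exists p => z zr; apply: hp; rewrite (le_trans (cabs_dist_add c' _ _))//.
by rewrite addrC lerD2l.
Qed.

Lemma papprox_eq c rho f g : (forall z, cabs (z - c) < rho -> f z = g z) ->
  papprox c rho f -> papprox c rho g.
Proof.
move=> fg pf r e rr e0; have [p hp] := pf r e rr e0.
by exists p => z zr; rewrite -fg ?hp// (le_lt_trans zr).
Qed.

Lemma papprox_bounded c rho f r : papprox c rho f -> r < rho ->
  exists2 M : R, 0 < M & forall z, cabs (z - c) <= r -> cabs (f z) <= M.
Proof.
move=> pf /(pf r 1)[//|p hp]; have [M M0 hM] := poly_bounded p c r.
exists (1 + M); first by rewrite addr_gt0.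
move=> z zr; rewrite -(subrK p.[z] (f z)) (le_trans (cabsD _ _))// lerD//.
  exact: hp.
exact: hM.
Qed.

Lemma papprox_poly c rho (p : {poly R[i]}) : papprox c rho (fun z => p.[z]).
Proof. by move=> r e _ e0; exists p => z _; rewrite subrr cabs0 ltW. Qed.

Arguments papprox_poly {c rho} p.

Lemma papprox_cst c rho (a : R[i]) : papprox c rho (fun=> a).
Proof. by apply: (papprox_eq _ (papprox_poly a%:P)) => z _; rewrite hornerC. Qed.

Arguments papprox_cst {c rho} a.

Lemma papproxD c rho f g : papprox c rho f -> papprox c rho g ->
  papprox c rho (fun z => f z + g z).
Proof.
move=> pf pg r e rr e0; have e2 : 0 < e / 2 by rewrite divr_gt0.
have [p hp] := pf r _ rr e2; have [q hq] := pg r _ rr e2.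
exists (p + q) => z zr; rewrite hornerD opprD addrACA (le_trans (cabsD _ _))//.
by rewrite (splitr e) lerD// ?hp ?hq.
Qed.

Lemma papproxM c rho f g : papprox c rho f -> papprox c rho g ->
  papprox c rho (fun z => f z * g z).
Proof.
move=> pf pg r e rr e0.
have [M M0 hM] := papprox_bounded pf rr; have [M' M'0 hM'] := papprox_bounded pg rr.
have [|q hq] := pg r (e / 2 / M) rr; first by rewrite !divr_gt0.
have [N N0 hN] := poly_bounded q c r.
have [|p hp] := pf r (e / 2 / N) rr; first by rewrite !divr_gt0.
exists (p * q) => z zr; rewrite hornerM.
have -> : f z * g z - p.[z] * q.[z] = f z * (g z - q.[z]) + (f z - p.[z]) * q.[z] by ring.
rewrite (le_trans (cabsD _ _))// !cabsM (splitr e) lerD//.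
  rewrite -[leRHS](divfK (lt0r_neq0 M0)) [leRHS]mulrC.
  by apply: ler_pM; rewrite ?cabs_ge0 ?hM ?hq.
rewrite -[leRHS](divfK (lt0r_neq0 N0)).
by apply: ler_pM; rewrite ?cabs_ge0 ?hN ?hp.
Qed.

Lemma papproxB c rho f g : papprox c rho f -> papprox c rho g ->
  papprox c rho (fun z => f z - g z).
Proof.
move=> pf pg; apply: (papprox_eq _ (papproxD pf (papproxM (papprox_cst (-1)) pg))).
by move=> z _; rewrite mulN1r.
Qed.

Lemma papproxX c rho f n : papprox c rho f -> papprox c rho (fun z => f z ^+ n).
Proof.
move=> pf; elim: n => [|n ih]; first by apply: (papprox_eq _ (papprox_cst 1)).
by apply: (papprox_eq _ (papproxM pf ih)) => z _; rewrite exprS.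
Qed.

Lemma papprox_sum c rho (F : nat -> R[i] -> R[i]) n : (forall k, papprox c rho (F k)) ->
  papprox c rho (fun z => \sum_(k < n) F k z).
Proof.
move=> pF; elim: n => [|n ih].
  by apply: (papprox_eq _ (papprox_cst 0)) => z _; rewrite big_ord0.
by apply: (papprox_eq _ (papproxD ih (pF n))) => z _; rewrite big_ord_recr.
Qed.

Lemma papprox_limit c rho f :
  (forall r e, r < rho -> 0 < e -> exists2 g, papprox c rho g &
     forall z, cabs (z - c) <= r -> cabs (f z - g z) <= e) -> papprox c rho f.
Proof.
move=> fg r e rr e0; have e2 : 0 < e / 2 by rewrite divr_gt0.
have [g pg hg] := fg _ _ rr e2; have [p hp] := pg _ _ rr e2.
exists p => z zr; rewrite (le_trans (cabs_dist_add (g z) _ _))// (splitr e) lerD//.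
  exact: hg.
exact: hp.
Qed.

(** The k-th coefficient is the limit of the k-th Taylor coefficients of approximating polynomials,
    a Cauchy sequence by [cauchy_poly]. Quantifying over every polynomial close to [f] characterises
    [a] without reference to a chosen sequence. *)
Lemma papprox_taylor c rho f : 0 < rho -> papprox c rho f -> exists a : nat -> R[i],
  forall r e (p : {poly R[i]}), 0 < r -> r < rho ->
    (forall z, cabs (z - c) <= r -> cabs (f z - p.[z]) <= e) ->
    forall k, cabs (p^`N(k).[c] - a k) * r ^+ k <= e.
Proof.
(* Radii increasing to [rho]; the shift [n.+2] makes already the first one positive. *)
move=> rho0 pf; pose rr n : R := rho * (1 - n.+2%:R^-1).
have rr_lt n : rr n < rho by rewrite gtr_pMr// gtrBl invr_gt0.
have /choice[q hq] n : exists p : {poly R[i]},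
    forall z, cabs (z - c) <= rr n -> cabs (f z - p.[z]) <= n.+1%:R^-1.
  by apply: pf; rewrite ?invr_gt0.
have qdiff n r e p k : 0 < r -> r <= rr n ->
    (forall z, cabs (z - c) <= r -> cabs (f z - p.[z]) <= e) ->
    cabs (p^`N(k).[c] - (q n)^`N(k).[c]) * r ^+ k <= e + n.+1%:R^-1.
  move=> r0 rn fp; have := @cauchy_poly R (p - q n) c r (e + n.+1%:R^-1) k (ltW r0).
  rewrite nderivnB hornerD hornerN; apply => z zr.
  rewrite hornerD hornerN (le_trans (cabs_dist_add (f z) _ _))// lerD//.
    by rewrite cabsC fp// zr.
  by rewrite hq// zr.
have inv_small e : 0 < e -> exists N, forall n, (N <= n)%N -> n.+1%:R^-1 < e.
  by move=> e0; have [N _ hN] := near_infty_natSinv_lt (PosNum e0); exists N.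
have rr_big r : r < rho -> exists N, forall n, (N <= n)%N -> r <= rr n.
  move=> rlt; have [|N hN] := inv_small (1 - r / rho).
    by rewrite subr_gt0 ltr_pdivrMr// mul1r.
  exists N => n Nn; rewrite /rr -ler_pdivrMl// mulrC lerBrDr -lerBrDl ltW//.
  by apply: hN; exact: leqW.
have hr : rho / 2 < rho by rewrite ltr_pdivrMr// ltr_pMr// ltr1n.
have hr0 : 0 < rho / 2 by rewrite divr_gt0.
have /choice[a ha] k : exists l : R[i], (fun n => (q n)^`N(k).[c]) @ \oo --> l.
  apply: complex_cauchy_cvg => e e0; have hrk : 0 < (rho / 2) ^+ k by rewrite exprn_gt0.
  have [N1 hN1] := rr_big _ hr.
  have [|N2 hN2] := inv_small (e * (rho / 2) ^+ k / 2); first by rewrite !mulr_gt0 ?invr_gt0.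
  exists (maxn N1 N2) => m n; rewrite !geq_max => /andP[m1 m2] /andP[n1 n2].
  rewrite -(ltr_pM2r hrk) (le_lt_trans (qdiff n _ m.+1%:R^-1 _ k hr0 _ _))//.
  - exact: hN1.
  - by move=> z zr; rewrite hq// (le_trans zr)// hN1.
  - by rewrite (splitr (e * _)) ltrD// hN2.
exists a => r e p r0 rlt fp k; have rk : 0 < r ^+ k by rewrite exprn_gt0.
apply/ler_addgt0Pr => d d0.
have [N1 hN1] := rr_big _ rlt.
have [|N2 hN2] := inv_small (d / 2); first by rewrite divr_gt0.
have [|N3 hN3] := (cabs_cvgP _ _).1 (ha k) (d / 2 / r ^+ k); first by rewrite !divr_gt0.
pose n := maxn N1 (maxn N2 N3).
rewrite (le_trans (_ : _ <= (cabs (p^`N(k).[c] - (q n)^`N(k).[c]) +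
  cabs ((q n)^`N(k).[c] - a k)) * r ^+ k))//.
  by rewrite ler_pM2r// cabs_dist_add.
rewrite mulrDl (splitr d) addrA lerD//.
  rewrite (le_trans (qdiff n _ _ _ _ r0 _ fp))//; first by rewrite hN1// leq_maxl.
  by rewrite lerD2l ltW// hN2// /n maxnCA leq_maxl.
by rewrite -ler_pdivlMr// ltW// hN3// /n maxnA leq_maxr.
Qed.

End Papprox.

Section Taylor.
Variable R : realType.
Implicit Types (f g : R[i] -> R[i]) (c z : R[i]) (r rho e : R) (a : nat -> R[i]).

(** The conclusion of [papprox_taylor], named so that [a] can be carried along as the Taylor
    sequence of [f] at [c]; [taylor_series_cvg] recovers the convergence of the series from it. *)
Definition taylor_coefs c rho f a := forall r e (p : {poly R[i]}), 0 < r -> r < rho ->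
  (forall z, cabs (z - c) <= r -> cabs (f z - p.[z]) <= e) ->
  forall k, cabs (p^`N(k).[c] - a k) * r ^+ k <= e.

Lemma taylor_cauchy c rho f a r (M : R) k : papprox c rho f -> taylor_coefs c rho f a ->
  0 < r -> r < rho -> (forall z, cabs (z - c) = r -> cabs (f z) <= M) ->
  cabs (a k) * r ^+ k <= M.
Proof.
move=> pf ta r0 rlt fM; apply/ler_addgt0Pr => e e0.
have e2 : 0 < e / 2 by rewrite divr_gt0.
have [p hp] := pf r _ rlt e2.
have h1 : cabs p^`N(k).[c] * r ^+ k <= M + e / 2.
  apply: cauchy_poly => [|z zr]; first exact: ltW.
  rewrite -(subrK (f z) p.[z]) addrC (le_trans (cabsD _ _))// lerD ?fM//.
  by rewrite cabsC hp// zr.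
have h2 := ta _ _ _ r0 rlt hp k.
have -> : M + e = M + e / 2 + e / 2 by rewrite -addrA -splitr.
rewrite (le_trans _ (lerD h1 h2))// -mulrDl.
apply: ler_wpM2r; first by rewrite exprn_ge0// ltW.
by rewrite -lerBlDl (cabsC p^`N(k).[c]) cabs_subl.
Qed.

(** For a polynomial [p] close to [f], the remainder splits into f - p, the errors of the first K
    coefficients, and the terms of [p] from K on. By Cauchy's estimate on |z - c| = r the last two
    are geometric sums of ratio s/r. *)
Lemma taylor_remainder c rho f a r s (M : R) K z : papprox c rho f -> taylor_coefs c rho f a ->
  0 < r -> r < rho -> (forall z, cabs (z - c) = r -> cabs (f z) <= M) ->
  0 <= s -> s < r -> cabs (z - c) <= s ->
  cabs (f z - \sum_(k < K) a k * (z - c) ^+ k) <= M * ((s / r) ^+ K / (1 - s / r)).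
Proof.
move=> pf ta r0 rlt fM s0 sr zs; have rN0 : r != 0 by rewrite gt_eqF.
pose q := s / r; have q0 : 0 <= q by rewrite divr_ge0// ltW.
have q1 : q < 1 by rewrite ltr_pdivrMr// mul1r.
have q1' : 0 < 1 - q by rewrite subr_gt0.
have M0 : 0 <= M.
  have := fM (c + r%:C); rewrite addrC addKr cabs_ge0_real ?(ltW r0)// => /(_ erefl).
  exact/le_trans/cabs_ge0.
apply/ler_addgt0Pr => d d0.
(* [C] collects the three occurrences of [e] in the final bound: f - p itself, the coefficient
   errors, and the excess of [p] over [M] in the tail, where [q ^+ K <= 1]. *)
pose C := 1 + 1 / (1 - q) + 1 / (1 - q).
have C0 : 0 < C by rewrite !addr_gt0 ?divr_gt0.
pose e := d / C; have e0 : 0 < e by rewrite divr_gt0.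
have [p hp] := pf r e rlt e0.
have pM k : cabs p^`N(k).[c] * r ^+ k <= M + e.
  apply: cauchy_poly => [|w wr]; first exact: ltW.
  rewrite -(subrK (f w) p.[w]) addrC (le_trans (cabsD _ _))// lerD ?fM//.
  by rewrite cabsC hp// wr.
have pa := ta _ _ _ r0 rlt hp.
have term (b : R[i]) (B : R) k : cabs b * r ^+ k <= B -> cabs (b * (z - c) ^+ k) <= B * q ^+ k.
  move=> bB; rewrite cabsM cabsX /q expr_div_n mulrA ler_pdivlMr ?exprn_gt0// mulrAC.
  by apply: ler_pM; rewrite ?mulr_ge0 ?exprn_ge0 ?cabs_ge0 ?(ltW r0)// lerXn2r ?nnegrE ?cabs_ge0.
pose S := maxn K (size p).
have pE : p.[z] = \sum_(0 <= k < S) p^`N(k).[c] * (z - c) ^+ k.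
  by rewrite big_mkord; apply: poly_taylor_wide; rewrite leq_maxr.
have -> : f z - \sum_(k < K) a k * (z - c) ^+ k = (f z - p.[z]) +
   (\sum_(0 <= k < K) (p^`N(k).[c] - a k) * (z - c) ^+ k +
    \sum_(K <= k < S) p^`N(k).[c] * (z - c) ^+ k).
  rewrite pE [X in _ = f z - X + _](big_cat_nat (n := K)) ?leq_maxl//=.
  under [X in _ = _ + (X + _)]eq_bigr do rewrite mulrBl.
  by rewrite sumrB big_mkord (big_mkord _ (fun k => a k * _)); ring.
apply: (@le_trans _ _ (e + (e / (1 - q) + (M + e) * (q ^+ K / (1 - q))))).
  rewrite (le_trans (cabsD _ _))// lerD//; first by rewrite hp// (le_trans zs)// ltW.
  rewrite (le_trans (cabsD _ _))// lerD//.
    rewrite (le_trans (cabs_sum _ _ _))//.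
    apply: (@le_trans _ _ (\sum_(0 <= k < K) e * q ^+ k)).
      by apply: ler_sum => k _; apply: term; exact: pa.
    rewrite -mulr_sumr ler_pM2l// (le_trans (geom_sum_le _ _ q0 q1))//.
    by rewrite expr0 mul1r.
  rewrite (le_trans (cabs_sum _ _ _))//.
  apply: (@le_trans _ _ (\sum_(K <= k < S) (M + e) * q ^+ k)).
    by apply: ler_sum => k _; exact: term.
  by rewrite -mulr_sumr ler_wpM2l ?addr_ge0 ?(ltW e0)// geom_sum_le.
have -> : d = e * C by rewrite /e divfK// gt_eqF.
rewrite -/q /C; set X := q ^+ K / (1 - q); set Y := 1 / (1 - q).
have XY : X <= Y by rewrite ler_wpM2r ?invr_ge0 ?(ltW q1')// exprn_ile1// ltW.
have -> : e / (1 - q) = e * Y by rewrite /Y div1r.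
have := ler_wpM2l (ltW e0) XY; clear -e; lra.
Qed.

Lemma cvg_scaled_geometric (C s r : R) : 0 <= s -> s < r ->
  (fun K => C * (s / r) ^+ K) @ \oo --> (0 : R).
Proof.
move=> s0 sr; have r0 : 0 < r by exact: le_lt_trans sr.
rewrite -(mulr0 C); apply: cvgMr; apply: cvg_expr.
by rewrite ger0_norm ?divr_ge0// ?ltr_pdivrMr ?mul1r// ltW.
Qed.

Lemma taylor_series_cvg c rho f a z : papprox c rho f -> taylor_coefs c rho f a ->
  cabs (z - c) < rho -> series (fun k => a k * (z - c) ^+ k) @ \oo --> f z.
Proof.
move=> pf ta zr; pose s := cabs (z - c); pose r := (s + rho) / 2.
have s0 : 0 <= s by exact: cabs_ge0.
have sr : s < r by rewrite ltr_pdivlMr// mulr_natr mulr2n ltrD2l.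
have rr : r < rho by rewrite ltr_pdivrMr// mulr_natr mulr2n ltrD2r.
have r0 : 0 < r by exact: le_lt_trans sr.
have [M M0 hM] := papprox_bounded pf rr.
apply/cabs_cvg0P; apply: (@squeeze_cvgr _ _ _ _ (fun=> 0) (fun K => M / (1 - s / r) * (s / r) ^+ K)).
- near=> K; rewrite cabs_ge0/= cabsC.
  rewrite [X in _ <= X](_ : _ = M * ((s / r) ^+ K / (1 - s / r))); last by rewrite mulrAC mulrA.
  have := @taylor_remainder c rho f a r s M K z pf ta r0 rr _ s0 sr (lexx _).
  by rewrite /series/= big_mkord; apply => w wr; rewrite hM// wr.
- exact: cvg_cst.
- exact: cvg_scaled_geometric.
Unshelve. all: by end_near. Qed.

(** The remainder estimate with K = 0: a maximum principle with the loss [1 / (1 - s / r)]. The loss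
    is harmless below, where the bound is zero, is absorbed by a power of a contraction factor, or
    only enters a constant. *)
Lemma papprox_weak_max c rho f r s (M : R) z : papprox c rho f ->
  0 < r -> r < rho -> (forall z, cabs (z - c) = r -> cabs (f z) <= M) ->
  0 <= s -> s < r -> cabs (z - c) <= s -> cabs (f z) <= M / (1 - s / r).
Proof.
move=> pf r0 rr fM s0 sr zs.
have [|a ta] := papprox_taylor _ pf; first exact: lt_trans rr.
have := @taylor_remainder c rho f a r s M 0 z pf ta r0 rr fM s0 sr zs.
by rewrite big_ord0 subr0 expr0 div1r.
Qed.

Definition taylor_poly a c K : {poly R[i]} := (\poly_(k < K) a k) \Po ('X - c%:P).

Lemma horner_taylor_poly a c K z : (taylor_poly a c K).[z] = \sum_(k < K) a k * (z - c) ^+ k.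
Proof. by rewrite horner_comp !hornerE horner_poly. Qed.

Lemma nderivn_taylor_poly a c K k : (taylor_poly a c K)^`N(k).[c] = if (k < K)%N then a k else 0.
Proof.
rewrite -nderivn_comp /taylor_poly -comp_polyA comp_polyB comp_polyX comp_polyC addrK comp_polyXr.
by rewrite coef_poly.
Qed.

Lemma series_tail c a (r s M : R) z : 0 < r -> 0 <= s -> s < r -> cabs (z - c) <= s ->
  (forall k, cabs (a k) * r ^+ k <= M) ->
  forall m n, (m <= n)%N -> cabs (series (fun k => a k * (z - c) ^+ k) n -
     series (fun k => a k * (z - c) ^+ k) m) <= M * ((s / r) ^+ m / (1 - s / r)).
Proof.
move=> r0 s0 sr zs aM m n mn; rewrite sub_series_geq//.
have M0 : 0 <= M by rewrite (le_trans _ (aM 0%N))// mulr_ge0 ?cabs_ge0 ?exprn_ge0 ?ltW.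
have q0 : 0 <= s / r by rewrite divr_ge0// ltW.
have q1 : s / r < 1 by rewrite ltr_pdivrMr// mul1r.
rewrite (le_trans (cabs_sum _ _ _))//.
apply: (@le_trans _ _ (\sum_(m <= k < n) M * (s / r) ^+ k)).
  apply: ler_sum => k _; rewrite cabsM cabsX expr_div_n mulrA ler_pdivlMr ?exprn_gt0// mulrAC.
  by apply: ler_pM; rewrite ?mulr_ge0 ?exprn_ge0 ?cabs_ge0 ?(ltW r0)// lerXn2r ?nnegrE ?cabs_ge0.
by rewrite -mulr_sumr ler_wpM2l// geom_sum_le.
Qed.

(** The coefficient bounds make the tails geometric, hence uniformly small on smaller discs.
    Cauchy's estimate, applied to [p] minus a partial sum longer than k, then identifies [a] as the
    Taylor sequence. *)
Lemma powerseries_papprox c rho f a :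
  (forall r, 0 < r -> r < rho -> exists M, forall k, cabs (a k) * r ^+ k <= M) ->
  (forall z, cabs (z - c) < rho -> series (fun k => a k * (z - c) ^+ k) @ \oo --> f z) ->
  papprox c rho f /\ taylor_coefs c rho f a.
Proof.
move=> aM fE.
have tail s e : 0 < s -> s < rho -> 0 < e -> exists K0, forall K, (K0 <= K)%N ->
   forall z, cabs (z - c) <= s -> cabs (f z - (taylor_poly a c K).[z]) <= e.
  move=> s0 sr e0; pose r := (s + rho) / 2.
  have sr' : s < r by rewrite ltr_pdivlMr// mulr_natr mulr2n ltrD2l.
  have rr : r < rho by rewrite ltr_pdivrMr// mulr_natr mulr2n ltrD2r.
  have r0 : 0 < r by exact: lt_trans sr'.
  have [M hM] := aM r r0 rr.
  have : (fun K => M / (1 - s / r) * (s / r) ^+ K) @ \oo --> (0 : R).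
    by apply: cvg_scaled_geometric => //; exact: ltW.
  have e2 : 0 < e / 2 by rewrite divr_gt0.
  move=> /cvgrPdist_lt/(_ _ e2)[K0 _ hK]; exists K0 => K K0K z zs.
  have /cabs_cvgP/(_ _ e2)[N hN] := fE z (le_lt_trans zs sr).
  pose n := maxn N K.
  rewrite (le_trans (cabs_dist_add (series (fun k => a k * (z - c) ^+ k) n) _ _))// (splitr e) lerD//.
    by rewrite cabsC ltW// hN// leq_maxl.
  have := @series_tail c a r s M z r0 (ltW s0) sr' zs hM K n (leq_maxr _ _).
  rewrite horner_taylor_poly {2}/series/= big_mkord => /le_trans; apply.
  have := hK K K0K; rewrite /= sub0r normrN => /ltW/(le_trans (ler_norm _)).
  by rewrite [X in X <= _ -> _](_ : _ = M * ((s / r) ^+ K / (1 - s / r)))//; ring.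
have pf : papprox c rho f.
  move=> r e rr e0; have [r0|r0] := ltP 0 r.
    by have [K0 hK] := tail r e r0 rr e0; exists (taylor_poly a c K0) => z; exact: hK.
  have [rho0|rho0] := ltP 0 rho; last first.
    exists 0 => z zr; suff : cabs (z - c) < 0 by rewrite ltNge cabs_ge0.
    exact: le_lt_trans (lt_le_trans rr rho0).
  have h0 : 0 < rho / 2 by rewrite divr_gt0.
  have h1 : rho / 2 < rho by rewrite ltr_pdivrMr// ltr_pMr// ltr1n.
  have [K0 hK] := tail _ e h0 h1 e0; exists (taylor_poly a c K0) => z zr.
  by apply: hK => //; rewrite (le_trans zr)// (le_trans r0)// ltW.
split=> // r e p r0 rr fp k; have rk : 0 < r ^+ k by rewrite exprn_gt0.
apply/ler_addgt0Pr => d d0; have [K0 hK] := tail r d r0 rr d0.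
have := @cauchy_poly R (p - taylor_poly a c (maxn K0 k.+1)) c r (e + d) k (ltW r0).
rewrite nderivnB hornerD hornerN nderivn_taylor_poly leq_maxr; apply => z zr.
rewrite hornerD hornerN (le_trans (cabs_dist_add (f z) _ _))// lerD//.
  by rewrite cabsC fp// zr.
by rewrite hK ?zr// leq_maxl.
Qed.

End Taylor.

(** * From local power series to one series on the whole disk *)

Section LocalToGlobal.
Variable R : realType.
Implicit Types (f g : R[i] -> R[i]) (c z : R[i]) (r rho e : R) (a : nat -> R[i]).

(** Cauchy's estimate on a small circle kills every Taylor coefficient at [c]. That the disc of
    zeros is concentric with the disc of approximation dictates the choice of the centre in
    [papprox_extension]. *)
Lemma papprox_identity c rho tau f z : papprox c rho f -> 0 < tau ->
  (forall w, cabs (w - c) < tau -> f w = 0) -> cabs (z - c) < rho -> f z = 0.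
Proof.
move=> pf tau0 f0 zr; have rho0 : 0 < rho by exact: le_lt_trans (cabs_ge0 _) zr.
have [a ta] := papprox_taylor rho0 pf.
pose r := Num.min tau rho / 2.
have m0 : 0 < Num.min tau rho by rewrite lt_min tau0.
have r0 : 0 < r by rewrite divr_gt0.
have rm : r < Num.min tau rho by rewrite ltr_pdivrMr// ltr_pMr// ltr1n.
have a0 k : a k = 0.
  apply/eqP; rewrite -cabs_eq0; apply/eqP/le_anti; rewrite cabs_ge0 andbT.
  have rk : 0 < r ^+ k by rewrite exprn_gt0.
  rewrite -(pmulr_lle0 _ rk); apply: (taylor_cauchy _ pf ta r0) => [|w wr].
    by rewrite (lt_le_trans rm)// ge_min lexx orbT.
  by rewrite f0 ?cabs0// wr (lt_le_trans rm)// ge_min lexx.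
have /cabs_cvgP h := taylor_series_cvg pf ta zr.
apply/eqP; rewrite -cabs_eq0; apply/eqP/le_anti; rewrite cabs_ge0 andbT.
apply/ler_addgt0Pr => e /h[N /(_ N (leqnn _))]; rewrite add0r /series/=.
by rewrite big1 ?sub0r ?cabsN => [/ltW|i _]//; rewrite a0 mul0r.
Qed.

(** Each of q^0, ..., q^k is at least q^k, so the product is below a geometric sum. *)
Lemma linear_geometric_bound (q : R) : 0 <= q -> q < 1 ->
  exists2 M : R, 0 < M & forall k, k.+1%:R * q ^+ k <= M.
Proof.
move=> q0 q1; have q1' : 0 < 1 - q by rewrite subr_gt0.
exists (1 / (1 - q)); first by rewrite divr_gt0.
move=> k; rewrite (le_trans (_ : _ <= \sum_(0 <= i < k.+1) q ^+ i))//.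
  rewrite mulr_natl -[X in _ *+ X]subn0 -sumr_const_nat big_nat_cond [leRHS]big_nat_cond.
  by apply: ler_sum => i; rewrite andbT => /andP[_ ik]; rewrite ler_wiXn2l// ltW.
by rewrite -(expr0 q) geom_sum_le.
Qed.

Lemma powerseries_exists c rho a :
  (forall r, 0 < r -> r < rho -> exists M, forall k, cabs (a k) * r ^+ k <= M) ->
  exists f : R[i] -> R[i],
    forall z, cabs (z - c) < rho -> series (fun k => a k * (z - c) ^+ k) @ \oo --> f z.
Proof.
move=> aM; suff /choice[f hf] z : exists l : R[i], cabs (z - c) < rho ->
    series (fun k => a k * (z - c) ^+ k) @ \oo --> l by exists f.
have [zr|?] := ltP (cabs (z - c)) rho; last by exists 0.
pose s := cabs (z - c); pose r := (s + rho) / 2.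
have s0 : 0 <= s by exact: cabs_ge0.
have sr : s < r by rewrite ltr_pdivlMr// mulr_natr mulr2n ltrD2l.
have rr : r < rho by rewrite ltr_pdivrMr// mulr_natr mulr2n ltrD2r.
have r0 : 0 < r by exact: le_lt_trans sr.
have [M hM] := aM r r0 rr.
suff [l hl] : exists l : R[i], series (fun k => a k * (z - c) ^+ k) @ \oo --> l by exists l.
apply: complex_cauchy_cvg => e e0.
have /cvgrPdist_lt/(_ _ e0)[N _ hN] := cvg_scaled_geometric (M / (1 - s / r)) s0 sr.
have tail m n : (N <= m)%N -> (m <= n)%N -> cabs (series (fun k => a k * (z - c) ^+ k) n -
     series (fun k => a k * (z - c) ^+ k) m) < e.
  move=> Nm mn; rewrite (le_lt_trans (series_tail r0 s0 sr (lexx _) hM mn))//.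
  have := hN m Nm; rewrite /= sub0r normrN => /(le_lt_trans (ler_norm _)).
  by rewrite [X in X < _ -> _](_ : _ = M * ((s / r) ^+ m / (1 - s / r)))// mulrAC mulrA.
exists N => m n Nm Nn; have [mn|/ltnW nm] := leqP m n; last exact: tail.
by rewrite cabsC tail.
Qed.

(** By compactness: centres violating the radii 1/(n+1) would accumulate at a point [l], and the
    disc around [l] contains the discs of radius 1/(n+1) around late centres close to [l]. *)
Lemma locally_uniform_radius f s : s < 1 ->
  (forall z, cabs z < 1 -> exists2 rho, 0 < rho & papprox z rho f) ->
  exists2 e, 0 < e & forall c, cabs c <= s -> papprox c e f.
Proof.
move=> s1 lf; apply: contrapT => H.
have /choice[u hu] (n : nat) : exists c, cabs c <= s /\ ~ papprox c n.+1%:R^-1 f.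
  apply: contrapT => h; apply: H; exists n.+1%:R^-1; first by rewrite invr_gt0.
  by move=> c cs; apply: contrapT => h'; apply: h; exists c.
have [l hl] := complex_bolzano (fun n => (hu n).1).
have ls : cabs l <= s.
  apply/ler_addgt0Pr => e /(hl _ 0%N)[n _ /ltW he].
  by rewrite -(subrK (u n) l) addrC (le_trans (cabsD _ _))// lerD ?(hu n).1// cabsC.
have [rho rho0 pf] := lf l (le_lt_trans ls s1).
have r2 : 0 < rho / 2 by rewrite divr_gt0.
have [N _ hN] := near_infty_natSinv_lt (PosNum r2).
have [n Nn hn] := hl _ N r2; apply: (hu n).2.
apply: papprox_sub pf; rewrite (splitr rho) lerD// ltW//; exact: hN.
Qed.

Lemma locally_bounded f s : s < 1 ->
  (forall z, cabs z < 1 -> exists2 rho, 0 < rho & papprox z rho f) ->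
  exists2 M, 0 < M & forall z, cabs z <= s -> cabs (f z) <= M.
Proof.
move=> s1 lf; apply: contrapT => H.
have /choice[u hu] (n : nat) : exists c, cabs c <= s /\ n.+1%:R < cabs (f c).
  apply: contrapT => h; apply: H; exists n.+1%:R => // z zs; rewrite leNgt; apply/negP => h'.
  by apply: h; exists z.
have [l hl] := complex_bolzano (fun n => (hu n).1).
have ls : cabs l <= s.
  apply/ler_addgt0Pr => e /(hl _ 0%N)[n _ /ltW he].
  by rewrite -(subrK (u n) l) addrC (le_trans (cabsD _ _))// lerD ?(hu n).1// cabsC.
have [rho rho0 pf] := lf l (le_lt_trans ls s1).
have r2 : 0 < rho / 2 by rewrite divr_gt0.
have hr : rho / 2 < rho by rewrite ltr_pdivrMr// ltr_pMr// ltr1n.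
have [M M0 hM] := papprox_bounded pf hr.
have [n Nn /ltW hn] := hl _ (Num.trunc M).+1 r2.
have := lt_le_trans (hu n).2 (hM _ hn); rewrite ltNge => /negP; apply.
rewrite (le_trans (ltW (truncnS_gt M)))// ler_nat leqW//.
Qed.

(** Cauchy's estimate around each [c] bounds the n-th Taylor coefficient at [c] by M / e^n for |c|
    <= r. As a function of [c] that coefficient has itself a (k - n)-th Taylor coefficient at 0,
    equal to a_k times binomial(k, n), so |a_k| binomial(k, n) r^(k-n) e^n <= M. Summing over n
    gives the binomial expansion of (r + e)^k and k + 1 times [M]. *)
Lemma extension_coef_bound f rho a r e0 e (M : R) k : papprox 0 rho f -> taylor_coefs 0 rho f a ->
  0 < r -> r < rho -> 0 < e -> e < e0 ->
  (forall c, cabs c <= r -> papprox c e0 f) ->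
  (forall z, cabs z <= r + e -> cabs (f z) <= M) ->
  cabs (a k) * (r + e) ^+ k <= k.+1%:R * M.
Proof.
move=> pf ta r0 rr e1 ee0 pc fM.
suff H n : (n <= k)%N -> cabs (a k) * (r ^+ (k - n) * e ^+ n *+ 'C(k, n)) <= M.
  rewrite exprDn mulr_sumr mulr_natl -[X in _ *+ X]card_ord -sumr_const.
  by apply: ler_sum => n _; apply: H; rewrite -ltnS.
move=> nk; pose r' := (r + rho) / 2.
have rr' : r < r' by rewrite ltr_pdivlMr// mulr_natr mulr2n ltrD2l.
have r'rho : r' < rho by rewrite ltr_pdivrMr// mulr_natr mulr2n ltrD2r.
(* On the disc of radius [tau] around any |c| <= r both the global approximant [p] and a local one
   [q] are close to [f], so Cauchy's estimate compares their n-th coefficients at [c]. *)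
pose tau := Num.min (r' - r) e.
have tau0 : 0 < tau by rewrite lt_min subr_gt0 rr'.
pose C := 1 + 2 / tau ^+ n * e ^+ n + r ^+ (k - n) * e ^+ n *+ 'C(k, n) / r ^+ k.
have C0 : 0 < C.
  have taun : 0 <= tau ^+ n by rewrite exprn_ge0// ltW.
  have en : 0 <= e ^+ n by rewrite exprn_ge0// ltW.
  have rj j : 0 <= r ^+ j by rewrite exprn_ge0// ltW.
  by rewrite /C -addrA ltr_pwDl// addr_ge0//; [exact/mulr_ge0/en/divr_ge0|apply/divr_ge0/rj/mulrn_wge0/mulr_ge0].
apply/ler_addgt0Pr => d d0; pose eta := d / C.
have eta0 : 0 < eta by rewrite divr_gt0.
have [p hp] := pf r' eta r'rho eta0.
have pB c : cabs c <= r -> cabs p^`N(n).[c] * e ^+ n <= M + eta + 2 * eta / tau ^+ n * e ^+ n.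
  move=> cr; have [q hq] := pc c cr e eta ee0 eta0.
  have h1 : cabs q^`N(n).[c] * e ^+ n <= M + eta.
    apply: cauchy_poly => [|z zc]; first exact: ltW.
    rewrite -(subrK (f z) q.[z]) addrC (le_trans (cabsD _ _))// lerD//.
      by rewrite fM// -(subrK c z) (le_trans (cabsD _ _))// addrC zc lerD.
    by rewrite cabsC hq// zc.
  have h2 : cabs (p - q)^`N(n).[c] * tau ^+ n <= 2 * eta.
    apply: cauchy_poly => [|z zc]; first exact: ltW.
    rewrite hornerD hornerN (le_trans (cabs_dist_add (f z) _ _))// mulr2n mulrDl mul1r lerD//.
      rewrite cabsC hp// subr0 -(subrK c z) (le_trans (cabsD _ _))// zc.
      rewrite -lerBrDr (le_trans _ (lerD (lexx r') (_ : - r <= - cabs c)))// ?lerN2//.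
      by rewrite ge_min lexx.
    by rewrite hq// zc ge_min lexx orbT.
  rewrite -(subrK q^`N(n).[c] p^`N(n).[c]) -hornerN -hornerD -nderivnB.
  apply: le_trans (ler_wpM2r _ (cabsD _ _)) _; first by rewrite exprn_ge0// ltW.
  rewrite mulrDl addrC lerD//.
  by rewrite ler_wpM2r ?exprn_ge0 ?(ltW e1)// ler_pdivlMr// exprn_gt0.
have coef0 (q : {poly R[i]}) j : q^`N(j).[0] = q`_j by rewrite -nderivn_comp addr0 comp_polyXr.
have h3 : cabs p`_k * (r ^+ (k - n) * e ^+ n *+ 'C(k, n)) <= M + eta + 2 * eta / tau ^+ n * e ^+ n.
  have := @cauchy_poly R (p^`N(n)) 0 r ((M + eta + 2 * eta / tau ^+ n * e ^+ n) / e ^+ n) (k - n) (ltW r0).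
  rewrite coef0 coef_nderivn subnKC// -(mulr_natr p`_k) cabsM cabs_nat => h.
  have en : 0 < e ^+ n by rewrite exprn_gt0.
  move: h; rewrite ler_pdivlMr// => h; apply: le_trans (h _) => [|z].
    by rewrite -(mulr_natr (r ^+ _ * _)) -!mulrA (mulrC 'C(k, n)%:R) -!mulrA.
  by rewrite subr0 => zr; rewrite ler_pdivlMr// pB// zr.
have h4 : cabs (a k) <= cabs p`_k + eta / r ^+ k.
  have := ta r' eta p (lt_trans r0 rr') r'rho hp k; rewrite coef0 => h.
  rewrite -lerBlDl (le_trans (cabs_subl _ _))// cabsC ler_pdivlMr ?exprn_gt0//.
  by rewrite (le_trans _ h)// ler_wpM2l ?cabs_ge0// lerXn2r ?nnegrE// ltW// (lt_trans r0).
rewrite (le_trans (ler_wpM2r _ h4))//; first by rewrite mulrn_wge0// mulr_ge0// exprn_ge0// ltW.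
rewrite mulrDl (le_trans (lerD h3 (lexx _)))//.
have -> : d = eta * C by rewrite /eta divfK// gt_eqF.
by rewrite /C le_eqVlt; apply/orP; left; apply/eqP; ring.
Qed.

End LocalToGlobal.

Section Globalisation.
Variable R : realType.
Implicit Types (f g : R[i] -> R[i]) (c z : R[i]) (r rho e : R) (a : nat -> R[i]).

(** The coefficient bound makes the series at 0 converge on the larger disc. Its sum agrees with [f]
    at a point z with |z| >= rho by the identity theorem around the point [c] of modulus rho - tau
    on the ray of z: both functions agree within [tau] of [c], and the disc of radius e0/2 + tau
    around [c] reaches z. *)
Lemma papprox_extension f s e0 rho (M : R) : 0 < rho -> rho <= s -> 0 < e0 ->
  (forall c, cabs c <= s -> papprox c e0 f) ->
  (forall z, cabs z <= s + e0 -> cabs (f z) <= M) ->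
  papprox 0 rho f -> papprox 0 (rho + e0 / 2) f.
Proof.
move=> rho0 rhos e00 pc fM pf; have [a ta] := papprox_taylor rho0 pf.
have aM r : 0 < r -> r < rho + e0 / 2 -> exists M', forall k, cabs (a k) * r ^+ k <= M'.
  (* The sum (rho - e0/4) + 3 e0/4 is rho + e0/2, with the first term below [rho] and the second
     below [e0]; the maximum with rho/2 keeps [r1] positive. *)
  move=> r0 rlt; pose r1 := Num.max (rho / 2) (rho - e0 / 4); pose e := e0 * (3 / 4).
  have r10 : 0 < r1 by rewrite lt_max divr_gt0.
  have r1lt : r1 < rho by rewrite gt_max; apply/andP; split; lra.
  have e1 : 0 < e by rewrite mulr_gt0// divr_gt0.
  have ee : e < e0 by rewrite /e; lra.
  have rt : r < r1 + e.
    by rewrite (lt_le_trans rlt)// /e (_ : rho + e0 / 2 = rho - e0 / 4 + e0 * (3/4)) ?lerD2r ?le_max ?lexx ?orbT//; lra.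
  have t0 : 0 < r1 + e by rewrite addr_gt0.
  have key k : cabs (a k) * (r1 + e) ^+ k <= k.+1%:R * M.
    apply: (extension_coef_bound k pf ta r10 r1lt e1 ee) => [c cr|z zr].
      by apply: pc; rewrite (le_trans cr)// (le_trans (ltW r1lt)).
    by apply: fM; rewrite (le_trans zr)// lerD ?(ltW ee)// (le_trans (ltW r1lt)).
  have M0 : 0 <= M by rewrite (le_trans (cabs_ge0 (f 0)))// fM// cabs0 addr_ge0 ?(ltW e00)// (le_trans (ltW rho0)).
  have q0 : 0 <= r / (r1 + e) by rewrite divr_ge0 ?(ltW r0) ?(ltW t0).
  have q1 : r / (r1 + e) < 1 by rewrite ltr_pdivrMr// mul1r.
  have [M' M'0 hM'] := linear_geometric_bound q0 q1.
  exists (M' * M) => k; apply: le_trans (ler_wpM2r M0 (hM' k)).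
  rewrite expr_div_n mulrAC mulrA ler_pdivlMr ?exprn_gt0// [leLHS]mulrAC.
  by rewrite ler_wpM2r ?exprn_ge0 ?(ltW r0).
have [g gE] := powerseries_exists 0 aM.
have [pg tg] := powerseries_papprox aM gE.
have fg w : cabs w < rho -> f w = g w.
  move=> wr; apply: (@complex_lim_unique _ (series (fun k => a k * (w - 0) ^+ k))).
    by apply: taylor_series_cvg pf ta _; rewrite subr0.
  by apply: gE; rewrite subr0 (lt_trans wr)// ltrDl divr_gt0.
apply: (papprox_eq _ pg) => z; rewrite subr0 => zr.
have [zr'|rz] := ltP (cabs z) rho; first by rewrite fg.
pose tau := Num.min (rho / 2) (e0 / 2).
have tau0 : 0 < tau by rewrite lt_min !divr_gt0.
have tau1 : tau < rho by rewrite gt_min; apply/orP; left; lra.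
have tau2 : tau <= e0 / 2 by rewrite ge_min lexx orbT.
have z0 : 0 < cabs z by exact: lt_le_trans rz.
pose c : R[i] := ((rho - tau) / cabs z)%:C * z.
have rt0 : 0 < rho - tau by rewrite subr_gt0.
have cE : cabs c = rho - tau.
  by rewrite cabsM cabs_ge0_real ?divfK ?gt_eqF// divr_ge0 ?(ltW z0) ?(ltW rt0).
have zc : cabs (z - c) = cabs z - (rho - tau).
  have -> : z - c = (1 - (rho - tau) / cabs z)%:C * z by rewrite rmorphB mulrBl mul1r.
  rewrite cabsM cabs_ge0_real; first by rewrite mulrBl mul1r divfK// gt_eqF.
  by rewrite subr_ge0 ler_pdivrMr// mul1r (le_trans _ rz)// gerBl ltW.
apply/eqP; rewrite -subr_eq0; apply/eqP.
apply: (@papprox_identity _ c (e0 / 2 + tau) tau (fun w => g w - f w)) => //.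
- apply: papproxB.
    by apply: papprox_sub pg; rewrite subr0 cE; lra.
  apply: papprox_sub (pc c _); first by rewrite subrr cabs0; lra.
  by rewrite cE (le_trans _ rhos)// gerBl ltW.
- move=> w wc; rewrite fg ?subrr// -(subrK c w) (le_lt_trans (cabsD _ _))// cE; lra.
- rewrite zc; lra.
Qed.

(** On |c| <= s the local radius has a uniform lower bound [e0], so every extension step gains the
    same e0/2 and finitely many steps reach radius [s]. Taking e0 <= (1 - s)/2 keeps the closed disc
    of radius s + e0, where a bound of [f] is needed, inside the unit disk. *)
Lemma papprox_local_global f :
  (forall z, cabs z < 1 -> exists2 rho, 0 < rho & papprox z rho f) -> papprox 0 1 f.
Proof.
move=> lf; suff H s : 0 < s -> s < 1 -> papprox 0 s f.
  move=> r e r1 e0; apply: (H (Num.max ((r + 1) / 2) (1/2))) => //.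
  - by rewrite lt_max [X in _ || X]divr_gt0 ?orbT.
  - by rewrite gt_max; apply/andP; split; lra.
  - by rewrite lt_max; apply/orP; left; lra.
move=> s0 s1; have [e1 e10 pe1] := locally_uniform_radius s1 lf.
pose e0 := Num.min e1 ((1 - s) / 2).
have s1' : 0 < (1 - s) / 2 by lra.
have e00 : 0 < e0 by rewrite lt_min e10.
have e0e1 : e0 <= e1 by rewrite ge_min lexx.
have e0s : e0 <= (1 - s) / 2 by rewrite ge_min lexx orbT.
have pe0 c : cabs c <= s -> papprox c e0 f.
  by move=> /pe1; apply: papprox_sub; rewrite subrr cabs0 add0r.
have [M M0 hM] : exists2 M, 0 < M & forall z, cabs z <= s + e0 -> cabs (f z) <= M.
  by apply: locally_bounded => //; lra.
have H n : papprox 0 (Num.min s (n.+1%:R * (e0 / 2))) f.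
  elim: n => [|n ih].
    apply: papprox_sub (pe0 0 _); last by rewrite cabs0 ltW.
    by rewrite subrr cabs0 add0r ge_min; apply/orP; right; lra.
  have m0 : 0 < Num.min s (n.+1%:R * (e0 / 2)) by rewrite lt_min s0 mulr_gt0 ?divr_gt0.
  have ms : Num.min s (n.+1%:R * (e0 / 2)) <= s by rewrite ge_min lexx.
  apply: papprox_sub (papprox_extension m0 ms e00 pe0 hM ih).
  have e2 : 0 < e0 / 2 by rewrite divr_gt0.
  have -> : n.+2%:R * (e0 / 2) = n.+1%:R * (e0 / 2) + e0 / 2 by rewrite -[n.+2%:R]natr1 mulrDl mul1r.
  by rewrite subrr cabs0 add0r addr_minl le_min !ge_min lerDl (ltW e2) lexx orbT.
pose n := Num.trunc (s / (e0 / 2)).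
apply: papprox_sub (H n); rewrite subrr cabs0 add0r le_min lexx/=.
by rewrite -ler_pdivrMr ?divr_gt0// ltW// truncnS_gt.
Qed.

Lemma taylor_coef0 c rho f a : 0 < rho -> papprox c rho f -> taylor_coefs c rho f a ->
  a 0%N = f c.
Proof.
move=> rho0 pf ta; apply: (@complex_lim_unique _ (series (fun k => a k * (c - c) ^+ k))).
  apply/cabs_cvgP => e e0; exists 1%N => -[//|n] _.
  rewrite /series/= big_nat_recl// big1 => [|i _]; last by rewrite subrr expr0n/= mulr0.
  by rewrite expr0 mulr1 addr0 subrr cabs0.
by apply: taylor_series_cvg pf ta _; rewrite subrr cabs0.
Qed.

Lemma papprox_lipschitz c rho f : 0 < rho -> papprox c rho f ->
  exists2 C, 0 < C & forall z, cabs (z - c) <= rho / 4 -> cabs (f z - f c) <= C * cabs (z - c).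
Proof.
move=> rho0 pf; have [a ta] := papprox_taylor rho0 pf.
have r0 : 0 < rho / 2 by rewrite divr_gt0.
have rlt : rho / 2 < rho by lra.
have [M M0 hM] := papprox_bounded pf rlt.
exists (M * (4 / rho)) => [|z zr]; first by rewrite mulr_gt0// divr_gt0.
have fM w : cabs (w - c) = rho / 2 -> cabs (f w) <= M by move=> wr; rewrite hM// wr.
have sr : cabs (z - c) < rho / 2 by lra.
have := taylor_remainder 1 pf ta r0 rlt fM (cabs_ge0 _) sr (lexx _).
rewrite big_ord1 (taylor_coef0 rho0 pf ta) mulr1 expr1 => /le_trans; apply.
rewrite -[leRHS]mulrA ler_pM2l//.
set s := cabs (z - c) in zr sr *; have s0 : 0 <= s by exact: cabs_ge0.
have q2 : s / (rho / 2) <= 1 / 2 by rewrite ler_pdivrMr//; lra.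
rewrite ler_pdivrMr; last by lra.
have -> : 4 / rho * s = 2 * (s / (rho / 2)) by field; rewrite gt_eqF.
have q0 : 0 <= s / (rho / 2) by rewrite divr_ge0// ltW.
by set q := s / _ in q2 q0 *; nra.
Qed.

(** Neumann series: 1/f = (1/f(c)) times the sum of the powers of w = 1 - f/f(c). The Lipschitz
    bound gives |w| <= 1/2 on the disc of radius [tau], so the partial sums converge uniformly
    there. *)
Lemma papprox_inv c rho f : 0 < rho -> papprox c rho f -> f c != 0 ->
  exists2 tau, 0 < tau & papprox c tau (fun z => (f z)^-1).
Proof.
move=> rho0 pf fc0; have [C C0 hC] := papprox_lipschitz rho0 pf.
pose b := cabs (f c); have b0 : 0 < b by rewrite cabs_gt0.
pose tau := Num.min (rho / 4) (b / (2 * C)).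
have tau0 : 0 < tau by rewrite lt_min !divr_gt0 ?mulr_gt0.
have tau1 : tau <= rho / 4 by rewrite ge_min lexx.
have tau2 : tau <= b / (2 * C) by rewrite ge_min lexx orbT.
pose w z : R[i] := 1 - f z / f c.
have fw z : f z = f c * (1 - w z) by rewrite /w opprB addrC subrK mulrC divfK.
have w2 z : cabs (z - c) <= tau -> cabs (w z) <= 1 / 2.
  move=> zt; have -> : w z = (f c - f z) / f c by rewrite /w mulrBl divff.
  rewrite cabsM cabsV ler_pdivrMr// cabsC (le_trans (hC _ (le_trans zt tau1)))//.
  have := le_trans zt tau2; rewrite ler_pdivlMr ?mulr_gt0//; rewrite -/b; lra.
have f2 z : cabs (z - c) <= tau -> b / 2 <= cabs (f z).
  move=> /w2 wz; rewrite fw cabsM -/b ler_pM2l//.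
  by have := cabs_subl 1 (w z); rewrite cabs1; lra.
exists tau => //; apply: papprox_limit => r e rt e0.
have /cvgrPdist_lt/(_ _ e0)[K _ hK] := @cvg_scaled_geometric R (2 / b) 1 2 ler01 (ltr1n _ 2).
exists (fun z => (f c)^-1 * \sum_(k < K) w z ^+ k).
  apply: (@papproxM _ _ _ (fun=> (f c)^-1)); first exact: papprox_cst.
  apply: (papprox_sum (F := fun k z => w z ^+ k)) => k.
  apply: papproxX; apply: (@papproxB _ _ _ (fun=> 1)); first exact: papprox_cst.
  apply: (@papproxM _ _ _ _ (fun=> (f c)^-1)); last exact: papprox_cst.
  by apply: papprox_sub pf; rewrite subrr cabs0; lra.
move=> z zr; have zt := le_trans zr (ltW rt).
have fz0 : f z != 0 by rewrite -cabs_gt0 (lt_le_trans _ (f2 z zt))// divr_gt0.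
have -> : (f z)^-1 - (f c)^-1 * (\sum_(k < K) w z ^+ k) = w z ^+ K / f z.
  set S := \sum_(k < K) _.
  have wK : w z ^+ K = 1 + (w z - 1) * S by rewrite -subrX1 addrC subrK.
  have wE : w z ^+ K = 1 - f z / f c * S by rewrite wK /w addrAC subrr add0r mulNr.
  by rewrite wE; field; apply/andP.
have := hK K (leqnn _); rewrite /= sub0r normrN => /(le_lt_trans (ler_norm _))/ltW; apply: le_trans.
rewrite cabsM cabsX cabsV mulrC; apply: ler_pM; rewrite ?invr_ge0 ?exprn_ge0 ?cabs_ge0//.
  by rewrite -[leRHS]invf_div lef_pV2 ?posrE ?cabs_gt0 ?divr_gt0// f2.
by rewrite lerXn2r ?nnegrE ?cabs_ge0// w2.
Qed.

End Globalisation.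

(* A name for [val], whose subType instance is slow to unify. *)
Definition point (R : realType) (d : disk R) : R[i] := val d.

Lemma point_inj (R : realType) : injective (@point R).
Proof. exact: val_inj. Qed.

Section DiskFunctions.
Variable R : realType.
Implicit Types (f g u : disk R -> R[i]) (z w : R[i]) (d : disk R) (a : nat -> R[i]).

Lemma disk_cabs d : cabs (point d) < 1.
Proof. by rewrite -cabs_lt; exact: (valP d). Qed.

Lemma diskP z : cabs z < 1 -> exists d, point d = z.
Proof. by rewrite -cabs_lt => h; exists (exist _ z h). Qed.

Lemma ext0_val f d : ext0 f (point d) = f d.
Proof. by rewrite /ext0 /point valK. Qed.

Lemma bounded_terms (v : nat -> R[i]) (l : R[i]) : series v @ \oo --> l ->
  exists M, forall k, cabs (v k) <= M.
Proof.
move=> /cabs_cvgP/(_ 1 ltr01)[N hN].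
exists (\sum_(k < N) cabs (v k) + 2) => k; have [kN|Nk] := ltnP k N.
  rewrite (bigD1 (Ordinal kN))//= -addrA lerDl addr_ge0// sumr_ge0// => i _.
  exact: cabs_ge0.
rewrite ler_wpDl ?sumr_ge0// => [i _|]; first exact: cabs_ge0.
have -> : v k = series v k.+1 - series v k by rewrite /series/= big_nat_recr//= addrAC subrr add0r.
rewrite (le_trans (cabs_dist_add l _ _))// -[leRHS]natr1 lerD//.
  by rewrite ltW// hN// leqW.
by rewrite cabsC ltW// hN.
Qed.

(** Abel's argument: convergence at the point c + r of the real direction bounds the terms a_k r^k,
    so pointwise convergence already yields the coefficient bounds. *)
Lemma series_papprox c rho (f : R[i] -> R[i]) a :
  (forall z, cabs (z - c) < rho -> series (fun k => a k * (z - c) ^+ k) @ \oo --> f z) ->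
  papprox c rho f /\ taylor_coefs c rho f a.
Proof.
move=> fE; apply: (powerseries_papprox _ fE) => r r0 rr.
have [|M hM] := bounded_terms (fE (c + r%:C) _); first by rewrite addrC addKr cabs_ge0_real// ltW.
exists M => k; have := hM k; rewrite addrC addKr cabsM cabsX cabs_ge0_real//.
exact: ltW.
Qed.

Lemma analytic_local f :
  (forall d, exists2 rho, 0 < rho & papprox (point d) rho (ext0 f)) -> papprox 0 1 (ext0 f).
Proof. by move=> H; apply: papprox_local_global => z /diskP[d <-]. Qed.

(** The bridge between the local series of [analytic] and polynomial approximation on the whole
    disk; all later closure properties of [analytic] go through the right-hand side. *)
Lemma analyticP f : analytic f <-> papprox 0 1 (ext0 f).
Proof.
split=> [af|pf d].
  apply: analytic_local => d; have [a [r [r0]]] := af d; rewrite -/(point d) => ha.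
  exists (Num.min r (1 - cabs (point d))); first by rewrite lt_min r0 subr_gt0 disk_cabs.
  apply: (proj1 (series_papprox (a := a) _)) => z; rewrite lt_min => /andP[zr zd].
  have [|d' d'z] := @diskP z.
    by rewrite -(subrK (point d) z) (le_lt_trans (cabsD _ _))// -ltrBrDr.
  by rewrite -d'z ext0_val; apply: ha; rewrite -/(point d) -/(point d') cabs_lt d'z.
have d0 : 0 < 1 - cabs (point d) by rewrite subr_gt0 disk_cabs.
have pd : papprox (point d) (1 - cabs (point d)) (ext0 f).
  by apply: papprox_sub pf; rewrite subr0 subrKC.
have [a ta] := papprox_taylor d0 pd.
exists a, (1 - cabs (point d)); split=> // d'; rewrite -/(point d) -/(point d') cabs_lt -(ext0_val f d').
exact: taylor_series_cvg.
Qed.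

Lemma papprox_ext0 f (F : R[i] -> R[i]) : (forall d, f d = F (point d)) ->
  papprox 0 1 F <-> papprox 0 1 (ext0 f).
Proof.
move=> fF; have E z : cabs (z - 0) < 1 -> F z = ext0 f z.
  by rewrite subr0 => /diskP[d <-]; rewrite ext0_val fF.
by split; apply: papprox_eq => z zr; rewrite E.
Qed.

Lemma analytic_poly (p : {poly R[i]}) : analytic (fun d : disk R => p.[point d]).
Proof. by apply/analyticP/(papprox_ext0 (F := fun z => p.[z])) => //; exact: papprox_poly. Qed.

Lemma analytic_cst (c : R[i]) : analytic (fun _ : disk R => c).
Proof. by apply/analyticP/(papprox_ext0 (F := fun=> c)) => //; exact: papprox_cst. Qed.

Lemma analyticD f g : analytic f -> analytic g -> analytic (fun d => f d + g d).
Proof.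
move=> /analyticP pf /analyticP pg.
apply/analyticP/(papprox_ext0 (F := fun z => ext0 f z + ext0 g z)) => [d|]; first by rewrite !ext0_val.
exact: papproxD.
Qed.

Lemma analyticM f g : analytic f -> analytic g -> analytic (fun d => f d * g d).
Proof.
move=> /analyticP pf /analyticP pg.
apply/analyticP/(papprox_ext0 (F := fun z => ext0 f z * ext0 g z)) => [d|]; first by rewrite !ext0_val.
exact: papproxM.
Qed.

Lemma analyticZ (c : R[i]) f : analytic f -> analytic (fun d => c * f d).
Proof. by move=> af; apply: analyticM af; exact: analytic_cst. Qed.

Lemma analyticB f g : analytic f -> analytic g -> analytic (fun d => f d - g d).
Proof.
move=> af ag; rewrite (_ : (fun _ => _) = fun d => f d + (-1) * g d).
  exact: analyticD af (analyticZ (-1) ag).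
by apply/funext => d; rewrite mulN1r.
Qed.

Lemma analytic_papprox_at f d : analytic f -> papprox (point d) (1 - cabs (point d)) (ext0 f).
Proof. by move=> /analyticP; apply: papprox_sub; rewrite subr0 subrKC. Qed.

Arguments analytic_papprox_at {f} d _.

Lemma analyticV f : analytic f -> (forall d, f d != 0) -> analytic (fun d => (f d)^-1).
Proof.
move=> af f0; apply/analyticP/(papprox_ext0 (F := fun z => (ext0 f z)^-1)).
  by move=> d; rewrite ext0_val.
apply: papprox_local_global => _ /diskP[d <-].
have d0 : 0 < 1 - cabs (point d) by rewrite subr_gt0 disk_cabs.
have [|tau tau0 ptau] := papprox_inv d0 (analytic_papprox_at d af); first by rewrite ext0_val.
by exists tau.
Qed.

Lemma analytic_limit f : (forall r e, r < 1 -> 0 < e -> exists2 g, analytic g &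
    forall d, cabs (point d) <= r -> cabs (f d - g d) <= e) -> analytic f.
Proof.
move=> H; apply/analyticP/papprox_limit => r e r1 e0.
have [g /analyticP ag gP] := H r e r1 e0; exists (ext0 g) => // z; rewrite subr0 => zr.
have [d dz] := diskP (le_lt_trans zr r1).
by rewrite -dz !ext0_val gP// dz.
Qed.

(** Near [w] the quotient is the Taylor series with its index shifted by one, elsewhere it is
    f(z)/(z - w). Both descriptions agree where they overlap, so [G] is locally approximable and
    [papprox_local_global] applies. *)
Lemma analytic_div f (w : disk R) : analytic f -> f w = 0 ->
  exists2 g, analytic g & forall d, f d = (point d - point w) * g d.
Proof.
move=> af fw0; have w0 : 0 < 1 - cabs (point w) by rewrite subr_gt0 disk_cabs.
have pw := analytic_papprox_at w af.
have [a ta] := papprox_taylor w0 pw.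
have a0 : a 0%N = 0 by rewrite (taylor_coef0 w0 pw ta) ext0_val.
have fM r : 0 < r -> r < 1 - cabs (point w) -> exists M, forall k, cabs (a k.+1) * r ^+ k <= M.
  move=> r0 rr; have [M M0 hM] := papprox_bounded pw rr; exists (M / r) => k.
  rewrite ler_pdivlMr// -mulrA -exprSr; apply: (taylor_cauchy _ pw ta r0 rr) => z zr.
  by rewrite hM// zr.
have [g0 g0E] := powerseries_exists (point w) fM.
have [pg0 _] := powerseries_papprox fM g0E.
have fE z : cabs (z - point w) < 1 - cabs (point w) -> ext0 f z = (z - point w) * g0 z.
  move=> zw; apply: complex_lim_unique (taylor_series_cvg pw ta zw) _.
  have /cabs_cvgP gE := g0E z zw; apply/cabs_cvgP => e e0.
  have [|N hN] := gE (e / (cabs (z - point w) + 1)); first by rewrite divr_gt0// ltr_wpDl ?cabs_ge0.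
  exists N.+1 => -[//|n]; rewrite ltnS => Nn.
  rewrite /series/= big_nat_recl//= a0 mul0r add0r.
  under eq_bigr do rewrite exprS mulrCA.
  rewrite -mulr_sumr -mulrBr cabsM.
  rewrite (@le_lt_trans _ _ ((cabs (z - point w)+1) * cabs (series (fun k => a k.+1 * (z - point w) ^+ k) n - g0 z)))//.
    by rewrite ler_wpM2r ?cabs_ge0// lerDl.
  by rewrite mulrC -ltr_pdivlMr ?hN// ltr_wpDl ?cabs_ge0.
pose G z := if z == point w then g0 z else ext0 f z / (z - point w).
have Gw z : cabs (z - point w) < 1 - cabs (point w) -> g0 z = G z.
  move=> zw; rewrite /G; case: eqP => // /eqP zw0.
  by rewrite fE// mulrC mulKf// subr_eq0.
have pG : papprox 0 1 G.
  apply: papprox_local_global => _ /diskP[d <-].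
  have [->|dw] := eqVneq d w.
    by exists (1 - cabs (point w)) => //; exact: papprox_eq pg0.
  have dw' : point d - point w != 0 by rewrite subr_eq0; apply: contra dw => /eqP/point_inj ->.
  have dw0 : 0 < cabs (point d - point w) by rewrite cabs_gt0.
  have [tau tau0 ptau] : exists2 tau, 0 < tau & papprox (point d) tau (fun z => (z - point w)^-1).
    have pX : papprox (point d) (cabs (point d - point w)) (fun z => z - point w).
      apply: (@papprox_eq _ _ _ (horner ('X - (point w)%:P))); last exact: papprox_poly.
      by move=> z _; rewrite !hornerE.
    by have [tau tau0 ptau] := papprox_inv dw0 pX dw'; exists tau.
  pose rho := Num.min (cabs (point d - point w)) (Num.min tau (1 - cabs (point d))).
  have rho1 : rho <= cabs (point d - point w) by rewrite ge_min lexx.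
  have rho2 : rho <= tau by rewrite !ge_min lexx orbT.
  have rho3 : rho <= 1 - cabs (point d) by rewrite !ge_min lexx !orbT.
  exists rho; first by rewrite !lt_min dw0 tau0 subr_gt0 disk_cabs.
  apply: (@papprox_eq _ _ _ (fun z => ext0 f z * (z - point w)^-1)) => [z zd|].
    rewrite /G; case: eqP => // zw; move: zd; rewrite zw cabsC.
    by rewrite ltNge rho1.
  apply: papproxM.
    by apply: papprox_sub (analytic_papprox_at d af); rewrite subrr cabs0 add0r.
  by apply: papprox_sub ptau; rewrite subrr cabs0 add0r.
exists (fun d => G (point d)) => [|d]; first by apply/analyticP/(papprox_ext0 (F := G)).
rewrite /G; case: eqP => [/point_inj ->|/eqP dw]; first by rewrite subrr mul0r.
by rewrite ext0_val mulrC divfK// subr_eq0.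
Qed.

End DiskFunctions.

#[global] Opaque analytic.

(** * Peak functions and multipliers of solid spaces *)

Section Peaks.
Variable R : realType.
Implicit Types (z w : R[i]) (d : disk R).

(* Bounded by 16, equal to 1 at z, and small at w when z or w is close to zeta. *)
Definition peak (zeta z w : R[i]) : R[i] :=
  ((1 - z^*%C * z) / (1 - z^*%C * w)) ^+ 2 * ((zeta - w) / (zeta - z)).

Lemma conjc_mul_cabs z : z^*%C * z = (cabs z ^+ 2)%:C.
Proof. by rewrite mulrC -sqr_normc -cabsE -rmorphXn. Qed.

Lemma cabs_one_minus z : cabs z < 1 -> cabs (1 - z^*%C * z) = 1 - cabs z ^+ 2.
Proof.
move=> z1; rewrite conjc_mul_cabs -(rmorph1 (real_complex R)) -rmorphB cabs_ge0_real//.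
by rewrite subr_ge0 exprn_ile1 ?cabs_ge0// ltW.
Qed.

Lemma one_minus_conj_ge z w : cabs z < 1 -> cabs w < 1 ->
  1 - cabs z <= cabs (1 - z^*%C * w) /\ 1 - cabs w <= cabs (1 - z^*%C * w).
Proof.
move=> z1 w1; have := cabs_subl 1 (z^*%C * w); rewrite cabs1 cabsM cabs_conj => h.
have z0 := cabs_ge0 z; have w0 := cabs_ge0 w.
by split; apply: le_trans h; rewrite lerD2l lerN2; [rewrite ler_piMr// ltW|rewrite ler_piMl// ltW].
Qed.

Section Bounds.
Variables (zeta z w : R[i]).
Hypotheses (zeta1 : cabs zeta = 1) (z1 : cabs z < 1) (w1 : cabs w < 1).

Let P := (1 - cabs z ^+ 2) / cabs (1 - z^*%C * w).
Let Q := cabs (zeta - w) / cabs (zeta - z).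

Let peakE : cabs (peak zeta z w) = P ^+ 2 * Q.
Proof. by rewrite /peak cabsM cabsX !cabsM !cabsV cabs_one_minus. Qed.

Let z0 : 0 <= cabs z. Proof. exact: cabs_ge0. Qed.
Let w0 : 0 <= cabs w. Proof. exact: cabs_ge0. Qed.
Let den0 : 0 < cabs (1 - z^*%C * w).
Proof. by have [h _] := one_minus_conj_ge z1 w1; apply: lt_le_trans h; rewrite subr_gt0. Qed.
Let zeta_z : 1 - cabs z <= cabs (zeta - z).
Proof. by rewrite -zeta1 cabs_subl. Qed.
Let zeta_z0 : 0 < cabs (zeta - z).
Proof. by apply: lt_le_trans zeta_z; rewrite subr_gt0. Qed.
Let P0 : 0 <= P.
Proof. by rewrite divr_ge0 ?cabs_ge0// subr_ge0 exprn_ile1// ltW. Qed.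
Let P2 : P <= 2.
Proof.
rewrite ler_pdivrMr//; have [h _] := one_minus_conj_ge z1 w1.
have := sqr_ge0 (1 - cabs z); rewrite sqrrB expr1n; lra.
Qed.
Let Q0 : 0 <= Q.
Proof. by rewrite divr_ge0 ?cabs_ge0. Qed.

Lemma peak_diag : peak zeta z z = 1.
Proof.
have h : 1 - z^*%C * z != 0.
  by rewrite -cabs_gt0 cabs_one_minus// subr_gt0 expr_lt1.
by rewrite /peak !divff ?expr1n ?mulr1// -cabs_gt0.
Qed.

(** The denominator zeta - z is small, but |zeta - w| <= |zeta - z| + |z - w|, and [P] absorbs |z -
    w|, since P |z - w| <= 6 (1 - |z|) <= 6 |zeta - z|. Hence P Q <= 2 + 6, and the remaining factor
    P is at most 2. *)
Lemma peak_bounded : cabs (peak zeta z w) <= 16.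
Proof.
rewrite peakE expr2 -mulrA -[leRHS](_ : 2 * 8 = 16); last by ring.
apply: ler_pM => //; first exact: mulr_ge0.
have h1 : cabs (z - w) <= cabs (1 - z^*%C * w) + (1 - cabs z ^+ 2).
  have -> : z - w = z * (1 - z^*%C * w) - (1 - z^*%C * z) * w by ring.
  rewrite (le_trans (cabsB _ _))// !cabsM cabs_one_minus// lerD//.
    by rewrite ler_piMl ?cabs_ge0// ltW.
  by rewrite ler_piMr ?(ltW w1)// subr_ge0 exprn_ile1// ltW.
have h2 : P * cabs (z - w) <= 6 * (1 - cabs z).
  rewrite (le_trans (ler_wpM2l P0 h1))// mulrDr /P divfK ?gt_eqF// -/P.
  have := P2; have := z0; have := z1; set x := cabs z; move=> *.
  rewrite (@le_trans _ _ ((1 - x ^+ 2) + 2 * (1 - x ^+ 2)))//; last by nra.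
  by rewrite lerD2l ler_wpM2r// subr_ge0 exprn_ile1// ltW.
rewrite /Q mulrA ler_pdivrMr//.
have h3 : cabs (zeta - w) <= cabs (zeta - z) + cabs (z - w) by exact: cabs_dist_add.
rewrite (le_trans (ler_wpM2l P0 h3))// mulrDr.
have h4 := ler_wpM2r (ltW zeta_z0) P2.
rewrite (le_trans (lerD h4 h2))//; have := zeta_z; lra.
Qed.

Lemma peak_le_near : cabs (peak zeta z w) <= 4 / cabs (zeta - z) * cabs (zeta - w).
Proof.
have -> : 4 / cabs (zeta - z) * cabs (zeta - w) = 4 * Q by rewrite /Q mulrAC mulrA.
by rewrite peakE; apply: ler_wpM2r => //; have := P0; have := P2; nra.
Qed.

(** For fixed w the factor [P] is of order |zeta - z|; its square outweighs the 1/|zeta - z| in [Q].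
    This is the reason for the exponent 2 in [peak]. *)
Lemma peak_le_far : cabs (peak zeta z w) <= 8 / (1 - cabs w) ^+ 2 * cabs (zeta - z).
Proof.
have [_ hw] := one_minus_conj_ge z1 w1.
have w1' : 0 < 1 - cabs w by rewrite subr_gt0.
have hP : P <= 2 * cabs (zeta - z) / (1 - cabs w).
  apply: ler_pM; rewrite ?invr_ge0 ?cabs_ge0 ?subr_ge0 ?exprn_ile1 ?(ltW z1)//.
    by have := zeta_z; have := z0; have := z1; nra.
  by rewrite lef_pV2 ?posrE.
have hQ : Q <= 2 / cabs (zeta - z).
  rewrite ler_pM2r ?invr_gt0// (le_trans (cabsB _ _))// zeta1; have := w1; lra.
rewrite peakE (le_trans (ler_pM _ Q0 (_ : P ^+ 2 <= (2 * cabs (zeta - z) / (1 - cabs w)) ^+ 2) hQ))//.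
- exact: sqr_ge0.
- by rewrite lerXn2r ?nnegrE// divr_ge0 ?mulr_ge0 ?cabs_ge0 ?(ltW w1').
rewrite le_eqVlt; apply/orP; left; apply/eqP; field.
by rewrite !gt_eqF.
Qed.

End Bounds.

Arguments peak_bounded {zeta z w}.
Arguments peak_le_near {zeta z w}.
Arguments peak_le_far {zeta z w}.

Lemma analytic_peak zeta z : cabs zeta = 1 -> cabs z < 1 ->
  analytic (fun d : disk R => peak zeta z (point d)).
Proof.
move=> zeta1 z1; have aden : analytic (fun d : disk R => (1 - z^*%C * point d)^-1).
  apply: analyticV => [|d].
    rewrite (_ : (fun _ => _) = fun d : disk R => (1 - z^*%C%:P * 'X).[point d]); first exact: analytic_poly.
    by apply/funext => d; rewrite !hornerE.
  have [h _] := one_minus_conj_ge z1 (disk_cabs d).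
  by rewrite -cabs_gt0 (lt_le_trans _ h)// subr_gt0.
have a1 := analyticZ (1 - z^*%C * z) aden.
have a2 : analytic (fun d : disk R => (zeta - z)^-1 * (zeta%:P - 'X).[point d]).
  exact: analyticZ (analytic_poly _).
rewrite (_ : (fun _ => _) = fun d => (1 - z^*%C * z) * (1 - z^*%C * point d)^-1 *
   ((1 - z^*%C * z) * (1 - z^*%C * point d)^-1) * ((zeta - z)^-1 * (zeta%:P - 'X).[point d])).
  exact: analyticM (analyticM a1 a1) a2.
by apply/funext => d; rewrite /peak expr2 hornerD hornerN hornerC hornerX; congr (_ * _); exact: mulrC.
Qed.

(* A sparse subsequence along which the peaks are almost mutually orthogonal. *)
Lemma sparse_peaks zeta (d : nat -> disk R) (eps : nat -> R) : cabs zeta = 1 ->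
  (@point R \o d) @ \oo --> zeta -> (forall k, 0 < eps k) ->
  exists s : nat -> nat, (forall k, (k <= s k)%N) /\
    forall l k, l <> k -> cabs (peak zeta (point (d (s l))) (point (d (s k)))) <= eps (maxn l k).
Proof.
move=> zeta1 dz eps0.
have /choice[T hT] (nk : nat * nat) : exists N, forall m, (N <= m)%N ->
   cabs (peak zeta (point (d nk.1)) (point (d m))) <= eps nk.2 /\
   cabs (peak zeta (point (d m)) (point (d nk.1))) <= eps nk.2.
  case: nk => n k /=; have dn1 := disk_cabs (d n).
  have zn : 0 < cabs (zeta - point (d n)).
    by rewrite (lt_le_trans _ (cabs_subl _ _))// zeta1 subr_gt0.
  have wn : 0 < (1 - cabs (point (d n))) ^+ 2 by rewrite exprn_gt0// subr_gt0.
  pose C := 4 / cabs (zeta - point (d n)) + 8 / (1 - cabs (point (d n))) ^+ 2.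
  have C1 : 4 / cabs (zeta - point (d n)) <= C by rewrite lerDl divr_ge0 ?(ltW wn).
  have C2 : 8 / (1 - cabs (point (d n))) ^+ 2 <= C by rewrite lerDr divr_ge0 ?(ltW zn).
  have C0 : 0 < C by rewrite addr_gt0 ?divr_gt0.
  have [|N hN] := (cabs_cvgP _ _).1 dz (eps k / C); first by rewrite divr_gt0.
  exists N => m /hN; rewrite cabsC ltr_pdivlMr// mulrC => /ltW h; have dm1 := disk_cabs (d m).
  split.
    by rewrite (le_trans (peak_le_near dn1 dm1))// (le_trans _ h)// ler_wpM2r ?cabs_ge0.
  by rewrite (le_trans (peak_le_far zeta1 dm1 dn1))// (le_trans _ h)// ler_wpM2r ?cabs_ge0.
(* The next index passes the thresholds of all indices up to the previous one, not just of those
   selected, so the recursion only has to remember its last value. *)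
pose M n k := \max_(l < n.+1) T (val l, k).
pose s := fix s k := if k is k'.+1 then maxn (s k').+1 (M (s k') k) else 0%N.
have sS k : s k.+1 = maxn (s k).+1 (M (s k) k.+1) by [].
have smono k l : (l <= k)%N -> (s l <= s k)%N.
  elim: k => [|k ih]; first by rewrite leqn0 => /eqP ->.
  rewrite leq_eqVlt => /predU1P[->//|/ih]; rewrite sS => /leq_trans; apply.
  by rewrite (leq_trans (leqnSn _))// leq_maxl.
have lt_case l k : (l < k)%N -> cabs (peak zeta (point (d (s l))) (point (d (s k)))) <= eps k /\
   cabs (peak zeta (point (d (s k))) (point (d (s l)))) <= eps k.
  case: k => // k lk; apply: (hT (s l, k.+1)); rewrite sS leq_max; apply/orP; right.
  have sl : (s l < (s k).+1)%N by rewrite ltnS; exact: smono.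
  exact: (leq_bigmax (F := fun l' : 'I_(s k).+1 => T (val l', k.+1)) (Ordinal sl)).
exists s; split=> [k|l k].
  elim: k => // k ih; rewrite sS leq_max; apply/orP; left; exact: leq_ltn_trans ih _.
case: (ltngtP l k) => // [lk|kl] _.
  exact: (lt_case _ _ lk).1.
exact: (lt_case _ _ kl).2.
Qed.

End Peaks.

Section SolidNorms.
Variable R : realType.
Implicit Types (f g h u v : disk R -> R[i]) (d : disk R) (N : (disk R -> R[i]) -> \bar R).

(* All that the argument uses about the norm. *)
Record solid N (K : R) : Prop := Solid {
  solid_ge1 : 1 <= K;
  solid_lattice : forall f g h (A B s t : R), analytic f -> analytic g -> analytic h ->
    0 <= A -> 0 <= B -> (forall d, cabs (h d) <= A * cabs (f d) + B * cabs (g d)) ->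
    (N f <= s%:E -> N g <= t%:E -> N h <= (K * (A * s + B * t))%:E)%E;
  solid_one : exists t : R, (N (fun=> 1%R) <= t%:E)%E;
  solid_eval : forall r : R, r < 1 -> exists2 C : R, 0 < C & forall f (t : R) d, analytic f ->
    (N f <= t%:E)%E -> cabs (point d) <= r -> cabs (f d) <= C * t;
  solid_fatou : forall (F : nat -> disk R -> R[i]) f (C : R),
    (forall n, analytic (F n)) -> analytic f -> (forall d, F ^~ d @ \oo --> f d) ->
    (forall n, (N (F n) <= C%:E)%E) -> (N f <= C%:E)%E }.

Section Solid.
Variables (N : (disk R -> R[i]) -> \bar R) (K : R).
Hypothesis sN : solid N K.

Let K0 : 0 < K.
Proof. exact: lt_le_trans (solid_ge1 sN). Qed.

Lemma solid_scale f h (A s : R) : analytic f -> analytic h -> 0 <= A ->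
  (forall d, cabs (h d) <= A * cabs (f d)) -> (N f <= s%:E -> N h <= (K * (A * s))%:E)%E.
Proof.
move=> af ah A0 hf Nf; have := solid_lattice sN af af ah A0 (lexx 0) _ Nf Nf.
by rewrite mul0r addr0; apply => d; rewrite mul0r addr0.
Qed.

Lemma solid_one_pos : exists2 t : R, 0 < t & (N (fun=> 1%R) <= t%:E)%E.
Proof.
have [t ht] := solid_one sN; exists (Num.max t 1); first by rewrite lt_max ltr01 orbT.
by rewrite (le_trans ht)// lee_fin le_max lexx.
Qed.

Lemma solid_zero h : (forall d, h d = 0) -> (N h <= 0%:E)%E.
Proof.
move=> h0; have [t ht] := solid_one sN.
have ah : analytic h by rewrite (_ : h = fun=> 0); [exact: analytic_cst|exact/funext].
have := solid_scale (analytic_cst 1) ah (lexx 0) _ ht.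
by rewrite (mul0r t) mulr0; apply => d; rewrite h0 cabs0 mul0r.
Qed.

(** The supremum of |f d| over the unit ball is finite by [solid_eval] and positive because of the
    constants; the factor 2 allows a function that comes within half of it. *)
Lemma solid_extremal d : exists h, [/\ analytic h, (N h <= 1%:E)%E, 0 < cabs (h d) &
  forall f, analytic f -> (N f <= 1%:E)%E -> cabs (f d) <= 2 * cabs (h d)].
Proof.
have [C C0 hC] := solid_eval sN (disk_cabs d).
pose S := [set x : R | exists f, [/\ analytic f, (N f <= 1%:E)%E & x = cabs (f d)]].
have Sub : ubound S C by move=> _ [f [af Nf ->]]; have := hC f 1 d af Nf (lexx _); rewrite mulr1.
have [t t0 Nt] := solid_one_pos.
pose c := (K * t)^-1; have c0 : 0 < c by rewrite invr_gt0 mulr_gt0.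
have Sc : S c.
  exists (fun=> c%:C); split; [exact: analytic_cst| |by rewrite cabs_ge0_real// ltW].
  have := solid_scale (analytic_cst 1) (analytic_cst c%:C) (ltW c0) _ Nt.
  rewrite mulrCA mulVf ?gt_eqF ?mulr_gt0//; apply => d'.
  by rewrite cabs1 mulr1 cabs_ge0_real// ltW.
have hS : has_sup S by split; [exists c|exists C].
have sup0 : 0 < sup S by apply: lt_le_trans c0 _; exact: sup_upper_bound.
have s2 : 0 < sup S / 2 by rewrite divr_gt0.
have [_ [h [ah Nh ->]] hh] := sup_adherent s2 hS.
have hh' : sup S / 2 < cabs (h d) by lra.
exists h; split=> //; first exact: lt_trans hh'.
move=> f af Nf; apply: (@le_trans _ _ (sup S)); last by lra.
by apply: sup_upper_bound => //; exists f.
Qed.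

(** Every use of the triangle inequality costs a factor [K]. Adding terms from the last one
    backwards, the bound 2 K B theta^j for the tail from j reproduces itself: K (B theta^j + 2 K B
    theta^(j+1)) <= 2 K B theta^j as soon as 2 K theta <= 1. [solid_fatou] passes to the infinite
    sum. *)
Lemma solid_sum (G : nat -> disk R -> R[i]) (theta B : R) :
  (forall k, analytic (G k)) -> (forall k, (N (G k) <= (B * theta ^+ k)%:E)%E) ->
  0 < theta -> theta * (2 * K) <= 1 -> 0 <= B ->
  (forall r : R, r < 1 -> exists C : R, forall k d, cabs (point d) <= r -> cabs (G k d) <= C * theta ^+ k) ->
  exists F, [/\ analytic F, (N F <= (2 * K * B)%:E)%E &
    forall d, series (G ^~ d) @ \oo --> F d].
Proof.
move=> aG NG th0 thK B0 GC.
have th1 : theta < 1 by have := solid_ge1 sN; nra.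
have th1' : 0 < 1 - theta by rewrite subr_gt0.
have tail r : r < 1 -> exists2 C : R, 0 <= C & forall d m n, cabs (point d) <= r -> (m <= n)%N ->
    cabs (series (G ^~ d) n - series (G ^~ d) m) <= C * theta ^+ m.
  move=> r1; have [C hC] := GC r r1; exists (`|C| / (1 - theta)); first by rewrite divr_ge0// ltW.
  move=> d m n dr mn; rewrite sub_series_geq// (le_trans (cabs_sum _ _ _))//.
  apply: (@le_trans _ _ (\sum_(m <= k < n) `|C| * theta ^+ k)).
    apply: ler_sum => k _; rewrite (le_trans (hC k d dr))// ler_wpM2r ?exprn_ge0 ?(ltW th0)//.
    exact: ler_norm.
  by rewrite -mulr_sumr mulrAC -mulrA ler_wpM2l// geom_sum_le// ltW.
have small C e : 0 < e -> exists n0, forall n, (n0 <= n)%N -> C * theta ^+ n < e.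
  move=> e0; have /cvgrPdist_lt/(_ _ e0)[n0 _ hn] := @cvg_scaled_geometric R C theta 1 (ltW th0) th1.
  exists n0 => n /hn; rewrite /= divr1 sub0r normrN; exact/le_lt_trans/ler_norm.
have /choice[F hF] d : exists l : R[i], series (G ^~ d) @ \oo --> l.
  apply: complex_cauchy_cvg => e e0; have [C C0 hC] := tail _ (disk_cabs d).
  have [n0 hn0] := small C e e0; exists n0 => m n n0m n0n.
  have [mn|/ltnW nm] := leqP m n.
    by rewrite cabsC (le_lt_trans (hC _ _ _ (lexx _) mn))// hn0.
  by rewrite (le_lt_trans (hC _ _ _ (lexx _) nm))// hn0.
have aS n : analytic (fun d => series (G ^~ d) n).
  rewrite /series/=; elim: n => [|n ih].
    by rewrite (_ : (fun _ => _) = fun=> 0); [exact: analytic_cst|apply/funext => d; rewrite big_geq].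
  rewrite (_ : (fun _ => _) = fun d => \sum_(0 <= k < n) G k d + G n d); first exact: (analyticD ih (aG n)).
  by apply/funext => d; rewrite big_nat_recr.
have aF : analytic F.
  apply: analytic_limit => r e r1 e0; have [C C0 hC] := tail r r1.
  have e2 : 0 < e / 2 by rewrite divr_gt0.
  have [n0 hn0] := small C _ e2.
  exists (fun d => series (G ^~ d) n0); first exact: aS.
  move=> d dr; have /cabs_cvgP/(_ _ e2)[m hm] := hF d.
  rewrite (le_trans (cabs_dist_add (series (G ^~ d) (maxn m n0)) _ _))// (splitr e) lerD//.
    by rewrite cabsC ltW// hm// leq_maxl.
  by rewrite (le_trans (hC _ _ _ dr (leq_maxr _ _)))// ltW// hn0.
exists F; split=> //.
apply: (solid_fatou sN aS aF hF) => n.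
suff H m j : (j + m = n)%N ->
    (N (fun d => (\sum_(j <= k < n) G k d)%R) <= (2 * K * B * theta ^+ j)%:E)%E.
  by have := H n 0%N erefl; rewrite expr0 mulr1.
elim: m j => [j|m ih j jmn].
  rewrite addn0 => ->; apply: (@le_trans _ _ 0%:E).
    by apply: solid_zero => d; rewrite big_geq.
  by rewrite lee_fin !mulr_ge0 ?exprn_ge0 ?(ltW K0) ?(ltW th0).
have jn : (j < n)%N by rewrite -jmn addnS ltnS leq_addr.
have aT i : analytic (fun d => \sum_(i <= k < n) G k d).
  rewrite (_ : (fun _ => _) = fun d => if (i <= n)%N then series (G ^~ d) n - series (G ^~ d) i else 0).
    by case: leqP => _; [exact: (analyticB (aS n) (aS i))|exact: analytic_cst].
  by apply/funext => d; case: leqP => ni; [rewrite sub_series_geq|rewrite big_geq// ltnW].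
have := solid_lattice sN (aG j) (aT j.+1) (aT j) ler01 ler01 _ (NG j) (ih j.+1 _).
rewrite addSnnS !mul1r => H; apply: le_trans (H _ jmn) _ => [d|].
  by rewrite big_ltn// !mul1r cabsD.
rewrite lee_fin exprS -!mulrA mulrCA (mulrCA 2).
have tj : 0 <= theta ^+ j by rewrite exprn_ge0// ltW.
have h1 := ler_wpM2r (mulr_ge0 (mulr_ge0 (ltW K0) B0) tj) thK; rewrite mul1r in h1.
apply: (@le_trans _ _ (K * (B * theta ^+ j) + K * (B * theta ^+ j))); last by lra.
move: h1; set T := theta ^+ j => h1; rewrite mulrDr lerD2l.
have -> : K * (K * (B * (2 * (theta * T)))) = theta * (2 * K) * (K * B * T) by ring.
by rewrite [leRHS]mulrA.
Qed.

(* One family of peaks serves both the boundedness of multipliers and the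
   infinite codimension: the value of F at the k-th node is dominated by its
   k-th term. *)
Lemma solid_hump zeta (d_ : nat -> disk R) (kappa : R) : cabs zeta = 1 ->
  (@point R \o d_) @ \oo --> zeta -> 0 < kappa ->
  let theta := (2 * K)^-1 in
  exists (s : nat -> nat) (c : nat -> R[i]), [/\ forall k, (k <= s k)%N,
    forall k, 0 < cabs (c k),
    forall k f (t : R), analytic f -> 0 < t -> (N f <= t%:E)%E ->
      cabs (f (d_ (s k))) <= 2 * K * t * cabs (c k) &
    forall b : nat -> R[i], (forall k, cabs (b k) <= 1) -> exists F (C : R),
      [/\ analytic F, (N F <= C%:E)%E & forall k,
        cabs (F (d_ (s k)) - b k * (theta ^+ k)%:C * c k) <= kappa * theta ^+ k * cabs (c k)]].
Proof.
move=> zeta1 dz kappa0 theta.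
have K1 := solid_ge1 sN.
have th0 : 0 < theta by rewrite invr_gt0 mulr_gt0.
have th2 : theta <= 1 / 2 by rewrite div1r lef_pV2 ?posrE ?mulr_gt0// ler_peMr.
have thn k : 0 < theta ^+ k by rewrite exprn_gt0.
(* With near-extremality an off-diagonal term is at most kappa theta^k |c_k| theta^l / 4; since
   theta <= 1/2 their sum over l is at most half of the allowed error. *)
have [s [ks sp]] := sparse_peaks (eps := fun k => kappa * theta ^+ k / 8) zeta1 dz
  (fun k => divr_gt0 (mulr_gt0 kappa0 (thn k)) (ltr0n _ 8)).
have /choice[h hh] k := solid_extremal (d_ (s k)).
pose z k := point (d_ (s k)); have z1 k : cabs (z k) < 1 by exact: disk_cabs.
exists s, (fun k => h k (d_ (s k))); split=> // [k|k f t af t0 Nf|b b1].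
- by have [] := hh k.
- have [_ _ _ H] := hh k; have Kt : 0 < K * t by rewrite mulr_gt0.
  have := solid_scale af (analyticZ ((K * t)^-1)%:C af) (ltW (_ : 0 < (K * t)^-1)) _ Nf.
  rewrite invr_gt0 => /(_ Kt); rewrite mulrCA mulVf ?gt_eqF// => Hs.
  have := H _ (analyticZ _ af) (Hs _); rewrite cabsM cabs_ge0_real ?invr_ge0 ?(ltW Kt)//.
  rewrite ler_pdivrMl// => H'.
  rewrite (_ : 2 * K * t * cabs (h k (d_ (s k))) = K * t * (2 * cabs (h k (d_ (s k))))); last by ring.
  by apply: H' => d; rewrite cabsM cabs_ge0_real ?invr_ge0 ?(ltW Kt).
pose g k d := h k d * peak zeta (z k) (point d).
have ag k : analytic (g k).
  by have [ah _ _ _] := hh k; apply: analyticM ah (analytic_peak _ _).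
have gh k d : cabs (g k d) <= 16 * cabs (h k d).
  by rewrite cabsM mulrC ler_wpM2r ?cabs_ge0// peak_bounded// disk_cabs.
pose G k d := b k * (theta ^+ k)%:C * g k d.
have aG k : analytic (G k) by exact: analyticZ.
have cb k : cabs (b k * (theta ^+ k)%:C) <= theta ^+ k.
  by rewrite cabsM (cabs_ge0_real (ltW (thn k))) ler_piMl// ltW.
have Gh k d : cabs (G k d) <= 16 * theta ^+ k * cabs (h k d).
  rewrite cabsM (le_trans (ler_pM _ _ (cb k) (gh k d))) ?cabs_ge0//.
  by rewrite mulrCA mulrA.
have NG k : (N (G k) <= (16 * K * theta ^+ k)%:E)%E.
  have [ah Nh _ _] := hh k.
  have c16 : 0 <= 16 * theta ^+ k by rewrite mulr_ge0// ltW.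
  have := solid_scale ah (aG k) c16 (Gh k) Nh.
  by rewrite mulr1 (mulrCA K) mulrA.
have K16 : 0 <= 16 * K by rewrite mulr_ge0// ltW.
have thK : theta * (2 * K) <= 1 by rewrite mulVf// mulf_neq0// gt_eqF.
have GC r : r < 1 -> exists C : R, forall k d, cabs (point d) <= r -> cabs (G k d) <= C * theta ^+ k.
  move=> r1; have [C C0 hC] := solid_eval sN r1; exists (16 * C) => k d dr.
  have [ah Nh _ _] := hh k; rewrite (le_trans (Gh k d))// mulrAC ler_pM2r// ler_pM2l//.
  by have := hC _ 1 _ ah Nh dr; rewrite mulr1.
have [F [aF NF FE]] := solid_sum aG NG th0 thK K16 GC.
exists F, (2 * K * (16 * K)); split=> // k; set w := h k _.
have gk : g k (d_ (s k)) = w by rewrite /g peak_diag ?mulr1.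
rewrite -{1}gk -/(G k (d_ (s k))).
(* [h k] is nearly extremal at its own node, so [h l] is at most twice as large there and the peak
   alone makes the term small. *)
have wl l : l <> k -> cabs (G l (d_ (s k))) <= kappa * theta ^+ k * cabs w / 4 * theta ^+ l.
  move=> lk; rewrite cabsM mulrC; apply: ler_pM (cb l); rewrite ?cabs_ge0//.
  have [_ _ _ H] := hh k; have [ah Nh _ _] := hh l.
  have h1 := H _ ah Nh; have h2 := sp l k lk.
  have h3 : theta ^+ maxn l k <= theta ^+ k.
    by rewrite ler_wiXn2l ?leq_maxr ?(ltW th0)//; lra.
  rewrite cabsM (le_trans (ler_pM (cabs_ge0 _) (cabs_ge0 _) h1 h2))// -/w.
  rewrite (_ : kappa * theta ^+ k * cabs w / 4 = 2 * cabs w * (kappa * theta ^+ k / 8)); last by lra.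
  by rewrite ler_wpM2l ?mulr_ge0 ?cabs_ge0// ler_pM2r// ler_pM2l.
have W0 : 0 <= kappa * theta ^+ k * cabs w / 4 by rewrite !mulr_ge0 ?cabs_ge0 ?invr_ge0 ?(ltW kappa0) ?(ltW (thn k)).
have part n : (k < n)%N -> cabs (series (G ^~ (d_ (s k))) n - G k (d_ (s k))) <=
    kappa * theta ^+ k * cabs w / 2.
  move=> kn; rewrite /series/= big_mkord (bigD1 (Ordinal kn))//= addrC addrK.
  rewrite (le_trans (cabs_sum _ _ _))//.
  apply: (@le_trans _ _ (\sum_(l < n) kappa * theta ^+ k * cabs w / 4 * theta ^+ l)).
    rewrite [leRHS](bigD1 (Ordinal kn))//= ler_wpDl//; first by rewrite mulr_ge0// ltW.
    by apply: ler_sum => l lk; apply: wl => lk'; move: lk; rewrite -val_eqE/= lk' eqxx.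
  rewrite -mulr_sumr -(big_mkord xpredT (fun l => theta ^+ l)).
  apply: (@le_trans _ _ (kappa * theta ^+ k * cabs w / 4 * 2)); last by lra.
  rewrite ler_wpM2l//; have th1 : theta < 1 by lra.
  rewrite (le_trans (geom_sum_le 0 n (ltW th0) th1))// expr0 ler_pdivrMr ?subr_gt0//; lra.
apply/ler_addgt0Pr => e e0; have /cabs_cvgP/(_ _ e0)[n0 hn0] := FE (d_ (s k)).
rewrite (le_trans (cabs_dist_add (series (G ^~ (d_ (s k))) (maxn n0 k.+1)) _ _))// addrC lerD//.
  apply: le_trans (part _ _) _; first by rewrite leq_max leqnn orbT.
  by have := W0; lra.
by rewrite cabsC ltW// hn0// leq_maxl.
Qed.

End Solid.
End SolidNorms.

(** * Boundedness of multipliers and infinite codimension *)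

Section EssentialSpectrum.
Variable R : realType.
Implicit Types (f g h u v : disk R -> R[i]) (d : disk R) (N : (disk R -> R[i]) -> \bar R).

Lemma triangle_chain (a b y c t : R) :
  a < t / 2 -> y < t / 2 -> 1 - y <= b -> b - c <= a -> 1 <= c + t.
Proof. lra. Qed.

Lemma half_le_of_near (p s d : R) : p - s <= d -> d <= p / 4 -> 0 <= p -> p / 2 <= s.
Proof. lra. Qed.

Lemma quarter_split (a t w n : R) : n != 0 ->
  a * (t * w) / 4 = a * ((4 * n)^-1 * t * w) * n.
Proof. by move=> n0; field. Qed.

(** Points of [P n] are taken at distance at most 1/(n+1) from the circle and a convergent
    subsequence is extracted; monotonicity of [P] turns the property at index s n >= n into the one
    at n. *)
Lemma boundary_sequence (P : nat -> disk R -> Prop) :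
  (forall n m d, (n <= m)%N -> P m d -> P n d) ->
  (forall n (r : R), r < 1 -> exists2 d, r <= cabs (point d) & P n d) ->
  exists (d_ : nat -> disk R) (zeta : R[i]), [/\ cabs zeta = 1,
    (@point R \o d_) @ \oo --> zeta & forall n, P n (d_ n)].
Proof.
move=> Pmono HP.
have inv_small (e : R) : 0 < e -> exists n0, forall n, (n0 <= n)%N -> n.+1%:R^-1 < e.
  by move=> e0; have [n0 _ hN] := near_infty_natSinv_lt (PosNum e0); exists n0.
have /choice[e he] n : exists d, 1 - n.+1%:R^-1 <= cabs (point d) /\ P n d.
  by have [|d h1 h2] := HP n (1 - n.+1%:R^-1); [rewrite gtrBl invr_gt0|exists d].
have [zeta [s [ks sz]]] := complex_bolzano_subseq (fun n => ltW (disk_cabs (e n))).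
exists (e \o s), zeta; split=> [||n]; last 2 first.
- exact: sz.
- exact: Pmono (ks n) (he (s n)).2.
apply/le_anti/andP; split; apply/ler_addgt0Pr => x x0.
  have /cabs_cvgP/(_ x x0)[n hn] := sz; have := hn n (leqnn _); have := disk_cabs (e (s n)).
  by have := cabs_subl zeta (point (e (s n))); rewrite /= cabsC; lra.
have x2 : 0 < x / 2 by rewrite divr_gt0.
have /cabs_cvgP/(_ _ x2)[n1 hn1] := sz; have [n2 hn2] := inv_small _ x2.
pose n := maxn n1 n2.
have h1 : cabs (point (e (s n)) - zeta) < x / 2 := hn1 n (leq_maxl _ _).
have h2 := hn2 (s n) (leq_trans (leq_maxr _ _) (ks n)).
have h3 := (he (s n)).1; have h4 := cabs_subl (point (e (s n))) zeta.
exact: triangle_chain h1 h2 h3 h4.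
Qed.

Variables (N N0 : (disk R -> R[i]) -> \bar R) (K C : R).
Hypothesis sN : solid N0 K.
Hypothesis C0 : 0 < C.
Hypothesis N_ge0 : forall f, (0 <= N f)%E.
Hypothesis N_le : forall f (t : R), analytic f -> (N0 f <= t%:E -> N f <= (C * t)%:E)%E.
Hypothesis N0_le : forall f (t : R), analytic f -> (N f <= t%:E -> N0 f <= (C * t)%:E)%E.

Local Notation X := (function_space N).
Let K1 : 1 <= K. Proof. exact: (solid_ge1 sN). Qed.
Let K0 : 0 < K. Proof. exact: lt_le_trans K1. Qed.

Lemma function_spaceP f : X f <-> analytic f /\ exists2 t : R, 0 < t & (N0 f <= t%:E)%E.
Proof.
split=> [[af Nf]|[af [t t0 ht]]]; split=> //.
  have fin : N f \is a fin_num by rewrite ge0_fin_numE.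
  have := @N0_le f (fine (N f)) af; rewrite fineK// => /(_ (lexx _)) h.
  exists (Num.max (C * fine (N f)) 1); first by rewrite lt_max ltr01 orbT.
  by rewrite (le_trans h)// lee_fin le_max lexx.
by apply: le_lt_trans (N_le af ht) _; rewrite ltry.
Qed.

Lemma analytic_disk_bounded u (r : R) : analytic u -> r < 1 ->
  exists2 M : R, 0 < M & forall d, cabs (point d) <= r -> cabs (u d) <= M.
Proof.
move=> /analyticP pu r1; have [M M0 hM] := papprox_bounded pu r1.
by exists M => // d dr; rewrite -ext0_val hM// subr0.
Qed.

Lemma exp_growth_absurd (theta B : R) : 0 < theta -> theta < 1 ->
  ~ (forall k, theta ^- k <= B).
Proof.
move=> th0 th1 H; have B0 : 0 < B by apply: lt_le_trans (H 0%N); rewrite invr_gt0 exprn_gt0.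
have iB : 0 < B^-1 by rewrite invr_gt0.
have /cvgrPdist_lt/(_ _ iB)[n _ /(_ n (leqnn _))] := @cvg_scaled_geometric R 1 theta 1 (ltW th0) th1.
rewrite /= divr1 mul1r sub0r normrN => /(le_lt_trans (ler_norm _)).
by rewrite ltNge -(invrK (theta ^+ n)) lef_pV2 ?posrE ?invr_gt0 ?exprn_gt0// H.
Qed.

(** Large values of [u] occur only near the circle, so an unbounded [u] has nodes with |u| >=
    theta^(-2k). The function [F] with all b_k = 1 has size about theta^k |c_k| there, so |u F|
    exceeds theta^(-k) |c_k| / 2, whereas membership of u F in the space bounds it by a multiple of
    |c_k|. *)
Lemma solid_multiplier_bounded u : multipliers X u ->
  exists2 M : R, 0 < M & forall d, cabs (u d) <= M.
Proof.
move=> [au uX]; apply: contrapT => unb.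
pose theta : R := (2 * K)^-1.
have th0 : 0 < theta by rewrite invr_gt0 mulr_gt0.
have th1 : theta < 1.
  rewrite /theta invf_lt1 ?mulr_gt0//.
  by apply: lt_le_trans (_ : 2 <= _); [rewrite ltr1n|rewrite ler_peMr].
have big (B : R) : exists d, B < cabs (u d).
  apply: contrapT => H; apply: unb; exists (`|B| + 1); first by rewrite ltr_wpDl.
  move=> d; rewrite leNgt; apply/negP => h; apply: H; exists d; apply: le_lt_trans h.
  by rewrite ler_wpDr// ler_norm.
have [|n r r1|d_ [zeta [z1 dz ud]]] := @boundary_sequence (fun n d => theta ^- (2 * n) <= cabs (u d)).
- move=> n m d nm; apply: le_trans; rewrite lef_pV2 ?posrE ?exprn_gt0//.
  by rewrite ler_wiXn2l ?(ltW th0) ?(ltW th1)// leq_mul2l nm orbT.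
- have [M M0 hM] := analytic_disk_bounded au r1.
  have [d hd] := big (M + theta ^- (2 * n)); exists d.
    rewrite leNgt; apply/negP => /ltW/hM; rewrite leNgt (lt_trans _ hd)// ltrDl.
    by rewrite invr_gt0 exprn_gt0.
  by rewrite (le_trans _ (ltW hd))// ler_wpDl ?(ltW M0).
have k2 : 0 < 1 / 2 :> R by [].
have [s [c [ks c0 ev hF]]] := solid_hump sN z1 dz k2.
have [|F [B [aF NF FE]]] := hF (fun=> 1); first by rewrite cabs1.
have XF : X F.
  apply/function_spaceP; split=> //; exists (Num.max B 1); first by rewrite lt_max ltr01 orbT.
  by rewrite (le_trans NF)// lee_fin le_max lexx.
have /function_spaceP[auF [t t0 ht]] := uX F XF.
apply: (@exp_growth_absurd theta (4 * K * t) th0 th1) => k.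
have h1 := ev k _ t auF t0 ht; have h2 := FE k; have h3 := ud (s k).
rewrite /mul_op cabsM in h1.
have ck := c0 k; have thk : 0 < theta ^+ k by rewrite exprn_gt0.
have hFk : theta ^+ k * cabs (c k) / 2 <= cabs (F (d_ (s k))).
  have := cabs_subl (1 * (theta ^+ k)%:C * c k) (F (d_ (s k))).
  rewrite cabsC mul1r cabsM (cabs_ge0_real (ltW thk)) => h.
  move: h2; rewrite mul1r -/theta => h2; lra.
have h4 : theta ^- (2 * k) <= cabs (u (d_ (s k))).
  rewrite (le_trans _ h3)// lef_pV2 ?posrE ?exprn_gt0//.
  by rewrite ler_wiXn2l ?(ltW th0) ?(ltW th1)// leq_mul2l ks orbT.
have h5 : theta ^- (2 * k) * (theta ^+ k * cabs (c k) / 2) <= 2 * K * t * cabs (c k).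
  apply: le_trans h1; apply: ler_pM => //; first by rewrite invr_ge0 exprn_ge0// ltW.
  by rewrite divr_ge0// mulr_ge0 ?(ltW thk) ?(ltW ck).
have e1 : theta ^- (2 * k) * (theta ^+ k * cabs (c k) / 2) = theta ^- k / 2 * cabs (c k).
  by rewrite mul2n -addnn exprD; field; rewrite gt_eqF.
move: h5; rewrite e1 ler_pM2r// => h5; lra.
Qed.

(** Suppose m classes span the quotient. Of m + 1 functions, [F j] is large exactly at the nodes
    with index j modulo m + 1, and a nontrivial combination of them is a multiple of [v]. At the
    nodes of the class with largest coefficient the combination has order theta^k |c_k|, while a
    multiple of [v] has order at most theta^(2k) |c_k|. *)
Lemma vanishing_infinite_codim v (d_ : nat -> disk R) (zeta : R[i]) :
  let theta := (2 * K)^-1 in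
  cabs zeta = 1 -> (@point R \o d_) @ \oo --> zeta ->
  (forall n, cabs (v (d_ n)) <= theta ^+ (2 * n)) ->
  ~ finite_dim_quotient X ((fun f d => v d * f d) @` X).
Proof.
move=> theta z1 dz vd [m [e [Xe H]]].
have th0 : 0 < theta by rewrite invr_gt0 mulr_gt0.
have th1 : theta < 1.
  rewrite /theta invf_lt1 ?mulr_gt0//.
  by apply: lt_le_trans (_ : 2 <= _); [rewrite ltr1n|rewrite ler_peMr].
(* This precision keeps the joint error of the m + 1 functions, with coefficients bounded by the
   largest one, within a quarter of the main term. *)
have kap0 : 0 < (4 * m.+1%:R)^-1 :> R by rewrite invr_gt0 mulr_gt0.
have [s [c [ks c0 ev hF]]] := solid_hump sN z1 dz kap0.
pose b (j : 'I_m.+1) k : R[i] := ((k %% m.+1)%N == j)%:R.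
have b1 j k : cabs (b j k) <= 1 by rewrite /b cabs_nat; case: eqP => _; rewrite ?lexx ?ler01.
have /choice[F hFj] j : exists F, X F /\ forall k,
    cabs (F (d_ (s k)) - b j k * (theta ^+ k)%:C * c k) <= (4 * m.+1%:R)^-1 * theta ^+ k * cabs (c k).
  have [F [B [aF NF FE]]] := hF (b j) (b1 j); exists F; split=> //.
  apply/function_spaceP; split=> //; exists (Num.max B 1); first by rewrite lt_max ltr01 orbT.
  by rewrite (le_trans NF)// lee_fin le_max lexx.
have /choice[A hA] j : exists af : ('I_m -> R[i]) * (disk R -> R[i]),
   X af.2 /\ forall d, F j d = \sum_(i < m) af.1 i * e i d + v d * af.2 d.
  have [a [f Xf fE]] := H (F j) (hFj j).1; exists (a, f); split=> // d /=.
  have /(congr1 (fun g => g d)) := fE; rewrite /= => ->.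
  rewrite -[X in _ = _ + X]/(F j d + (- \sum_(i < m) a i *: e i) d).
  rewrite [(- _) d]/(- (\sum_(i < m) a i *: e i) d) fct_sumE.
  by rewrite addrC subrK.
(* There is one more row than columns, so a nonzero row vector [x] annihilates the matrix: in the
   combination of the [F j] with coefficients [x] the generators [e i] cancel. *)
pose M := \matrix_(j < m.+1, i < m) (A j).1 i.
have kM : kermx M != 0.
  by rewrite -mxrank_eq0 mxrank_ker subn_eq0 -ltnNge ltnS rank_leq_col.
pose x := nz_row (kermx M).
have x0 : x != 0 by rewrite nz_row_eq0.
have xM : x *m M = 0 by apply/sub_kermxP; exact: nz_row_sub.
have xMi i : \sum_(j < m.+1) x 0 j * (A j).1 i = 0.
  have /matrixP/(_ 0 i) := xM; rewrite !mxE => {2}<-.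
  by apply: eq_bigr => j _; rewrite mxE.
pose j0 := [arg max_(j > ord0) cabs (x 0 j)]%O.
have j0max j : cabs (x 0 j) <= cabs (x 0 j0).
  by rewrite /j0; case: arg_maxP => // i _; apply.
have xj0 : 0 < cabs (x 0 j0).
  rewrite cabs_gt0; apply: contra x0 => /eqP x00; apply/eqP/rowP => j; rewrite mxE.
  by apply/eqP; rewrite -cabs_eq0; apply/eqP/le_anti; rewrite cabs_ge0 andbT (le_trans (j0max j))// x00 cabs0.
pose f d := \sum_(j < m.+1) x 0 j * (A j).2 d.
have fE d : \sum_(j < m.+1) x 0 j * F j d = v d * f d.
  under eq_bigr => j _ do rewrite (hA j).2 mulrDr mulr_sumr.
  rewrite big_split/= exchange_big/= big1 ?add0r => [|i _].
    by rewrite mulr_sumr; apply: eq_bigr => j _; rewrite mulrCA.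
  under eq_bigr do rewrite mulrA.
  by rewrite -mulr_suml xMi mul0r.
have [B B0 fB] : exists2 B : R, 0 < B & forall k, cabs (f (d_ (s k))) <= B * cabs (c k).
  have /choice[t ht] j : exists t : R, 0 < t /\ (N0 (A j).2 <= t%:E)%E.
    by have /function_spaceP[_ [t t0 ht]] := (hA j).1; exists t.
  exists (\sum_(j < m.+1) cabs (x 0 j) * (2 * K * t j) + 1).
    rewrite ltr_wpDl// sumr_ge0// => j _; rewrite mulr_ge0 ?cabs_ge0// ?mulr_ge0 ?(ltW K0)//.
    exact: ltW (ht j).1.
  move=> k; rewrite mulrDl mul1r (le_trans (cabs_sum _ _ _))// ler_wpDr ?cabs_ge0// mulr_suml.
  apply: ler_sum => j _; rewrite cabsM -mulrA ler_wpM2l ?cabs_ge0//.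
  have /function_spaceP[aA _] := (hA j).1.
  exact: ev (ht j).1 (ht j).2.
(* Along the class of [j0] the index is k = q (m + 1) + j0, hence growth in q with base
   theta^(m+1). *)
apply: (@exp_growth_absurd (theta ^+ m.+1) (2 * B / cabs (x 0 j0))) => [||q].
- exact: exprn_gt0.
- by rewrite exprn_ilt1 ?(ltW th0).
pose k := (q * m.+1 + j0)%N.
have km : (k %% m.+1)%N = j0 by rewrite /k modnMDl modn_small.
have thk : 0 < theta ^+ k by rewrite exprn_gt0.
have ck := c0 k.
have h1 : cabs (\sum_(j < m.+1) x 0 j * F j (d_ (s k)) - x 0 j0 * ((theta ^+ k)%:C * c k)) <=
    cabs (x 0 j0) * (theta ^+ k * cabs (c k)) / 4.
  rewrite (bigD1 j0)//= addrAC -mulrBr (le_trans (cabsD _ _))//.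
  rewrite (_ : _ / 4 = \sum_(j < m.+1) cabs (x 0 j0) * ((4 * m.+1%:R)^-1 * theta ^+ k * cabs (c k))).
    rewrite [leRHS](bigD1 j0)//= lerD//.
      rewrite cabsM ler_wpM2l ?cabs_ge0//; have := (hFj j0).2 k.
      by rewrite /b km eqxx mul1r.
    rewrite (le_trans (cabs_sum _ _ _))//; apply: ler_sum => j jj0.
    rewrite cabsM; apply: ler_pM; rewrite ?cabs_ge0//.
    have := (hFj j).2 k; rewrite /b km.
    by rewrite (_ : (j0 == j :> nat) = false) ?mul0r ?subr0// eq_sym; apply/negbTE.
  rewrite sumr_const card_ord -[RHS]mulr_natr.
  by apply: quarter_split; rewrite pnatr_eq0.
have h2 : cabs (x 0 j0) * (theta ^+ k * cabs (c k)) / 2 <= cabs (v (d_ (s k))) * cabs (f (d_ (s k))).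
  rewrite -cabsM -fE; set S := \sum_(j < _) _ in h1 *.
  have := cabs_subl (x 0 j0 * ((theta ^+ k)%:C * c k)) S.
  rewrite cabsC !cabsM (cabs_ge0_real (ltW thk)) => h.
  have : 0 <= cabs (x 0 j0) * (theta ^+ k * cabs (c k)) by rewrite !mulr_ge0 ?cabs_ge0 ?(ltW thk).
  exact: half_le_of_near h h1.
have h3 : cabs (v (d_ (s k))) <= theta ^+ (2 * k).
  by rewrite (le_trans (vd (s k)))// ler_wiXn2l ?(ltW th0) ?(ltW th1)// leq_mul2l ks orbT.
have h4 := le_trans h2 (ler_pM (cabs_ge0 _) (cabs_ge0 _) h3 (fB k)).
have e1 : theta ^+ (2 * k) * (B * cabs (c k)) = B * theta ^+ k * (theta ^+ k * cabs (c k)).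
  by rewrite mul2n -addnn exprD mulrACA (mulrC _ B).
have tc : 0 < theta ^+ k * cabs (c k) by rewrite mulr_gt0.
move: h4; rewrite e1 mulrAC ler_pM2r// => h4.
rewrite -exprM; apply: (@le_trans _ _ (theta ^- k)).
  by rewrite lef_pV2 ?posrE ?exprn_gt0// ler_wiXn2l ?(ltW th0) ?(ltW th1)// /k mulnC leq_addr.
rewrite ler_pdivlMr// mulrC ler_pdivrMr//.
by move: h4; rewrite ler_pdivrMr// (mulrC _ 2) mulrA.
Qed.
End EssentialSpectrum.

(** * Fredholm multiplication operators *)

Section Blaschke.
Variable R : realType.
Implicit Types (a z : R[i]).

(** The Blaschke factor of the disc of radius [s] with zero [a]: unimodular on |z| = s, a circle
    inside the unit disk where analytic functions are defined and bounded. *)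
Definition blaschke (s : R) a z : R[i] := s%:C * (z - a) / ((s ^+ 2)%:C - a^*%C * z).

Lemma cabs_sqr z : cabs z ^+ 2 = complex.Re z ^+ 2 + complex.Im z ^+ 2.
Proof. by rewrite cabs_re_im sqr_sqrtr// addr_ge0 ?sqr_ge0. Qed.

Lemma blaschke_identity (s : R) a z :
  cabs ((s ^+ 2)%:C - a^*%C * z) ^+ 2 =
  s ^+ 2 * cabs (z - a) ^+ 2 + (s ^+ 2 - cabs a ^+ 2) * (s ^+ 2 - cabs z ^+ 2).
Proof. by rewrite !cabs_sqr; case: a => a b; case: z => x y /=; ring. Qed.

Section Bounds.
Variables (s r : R) (a z : R[i]).
Hypotheses (r0 : 0 <= r) (rs : r < s ^+ 2) (s0 : 0 < s) (s1 : s < 1) (ar : cabs a <= r) (z1 : cabs z < 1).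

Lemma blaschke_den_ge : s ^+ 2 - r <= cabs ((s ^+ 2)%:C - a^*%C * z).
Proof.
have := cabs_subl (s ^+ 2)%:C (a^*%C * z); rewrite cabsM cabs_conj cabs_ge0_real ?sqr_ge0// => h.
rewrite (le_trans _ h)// lerD2l lerN2 (le_trans _ ar)//.
by rewrite ler_piMr ?cabs_ge0// ltW.
Qed.

Let den0 : 0 < cabs ((s ^+ 2)%:C - a^*%C * z).
Proof. by apply: lt_le_trans blaschke_den_ge; rewrite subr_gt0. Qed.

Lemma blaschke_den_le : cabs ((s ^+ 2)%:C - a^*%C * z) <= 2.
Proof.
rewrite (le_trans (cabsB _ _))// cabsM cabs_conj cabs_ge0_real ?sqr_ge0//.
have s2 : s ^+ 2 <= 1 by rewrite exprn_ile1// ltW.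
have a1 : cabs a <= 1 by rewrite (le_trans ar)// (le_trans (ltW rs)).
rewrite -[leRHS]/(1 + 1) lerD//.
by rewrite -[leRHS](mulr1 1); apply: ler_pM; rewrite ?cabs_ge0// ltW.
Qed.

Lemma cabs_blaschke : cabs (blaschke s a z) = s * cabs (z - a) / cabs ((s ^+ 2)%:C - a^*%C * z).
Proof. by rewrite !cabsM cabsV cabs_ge0_real// ltW. Qed.

Lemma blaschke_le : cabs (blaschke s a z) <= 2 / (s ^+ 2 - r).
Proof.
rewrite cabs_blaschke; apply: ler_pM; rewrite ?invr_ge0 ?mulr_ge0 ?cabs_ge0 ?(ltW s0)//.
  rewrite -[leRHS]mul1r; apply: ler_pM; rewrite ?cabs_ge0 ?(ltW s0) ?(ltW s1)//.
  have a1 : cabs a <= 1 by rewrite (le_trans ar)// (le_trans (ltW rs))// exprn_ile1// ltW.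
  by rewrite (le_trans (cabsB _ _))// -[leRHS]/(1 + 1) lerD// ltW.
by rewrite lef_pV2 ?posrE ?subr_gt0// blaschke_den_ge.
Qed.

(** By [blaschke_identity] and the bound 2 for the denominator, the squared modulus is at most 1 -
    k/4, which is below (1 - k/8)^2. The bound is uniform over zeros |a| <= r and points |z| <=
    q. *)
Lemma blaschke_contract (q : R) : r < s -> cabs z <= q -> q < s ->
  cabs (blaschke s a z) <= 1 - (s ^+ 2 - r ^+ 2) * (s ^+ 2 - q ^+ 2) / 8.
Proof.
move=> rs' zq qs; have z0 := cabs_ge0 z; have a0 := cabs_ge0 a.
set k := (s ^+ 2 - r ^+ 2) * (s ^+ 2 - q ^+ 2).
have s21 : s ^+ 2 <= 1 by rewrite exprn_ile1// ltW.
have h1 : 0 <= s ^+ 2 - r ^+ 2 by rewrite subr_ge0 lerXn2r ?nnegrE// ltW.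
have h2 : 0 <= s ^+ 2 - q ^+ 2 by rewrite subr_ge0 lerXn2r ?nnegrE ?(le_trans z0 zq)// ltW.
have h3 : s ^+ 2 - r ^+ 2 <= s ^+ 2 - cabs a ^+ 2 by rewrite lerD2l lerN2 lerXn2r ?nnegrE.
have h4 : s ^+ 2 - q ^+ 2 <= s ^+ 2 - cabs z ^+ 2.
  by rewrite lerD2l lerN2 lerXn2r ?nnegrE// (le_trans z0).
have k0 : 0 <= k by exact: mulr_ge0.
have k1 : k <= 1.
  rewrite -[leRHS](mulr1 1); apply: ler_pM => //; rewrite (le_trans _ s21)// gerBl sqr_ge0//.
have kle : k <= (s ^+ 2 - cabs a ^+ 2) * (s ^+ 2 - cabs z ^+ 2) by exact: ler_pM.
rewrite -(ler_pXn2r (n := 2)) ?nnegrE ?cabs_ge0//; last by lra.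
rewrite cabs_blaschke expr_div_n exprMn ler_pdivrMr ?exprn_gt0//.
have idn := blaschke_identity s a z; have dl := blaschke_den_le; have dp := den0.
set D := cabs (_ - _) in idn dl dp *; set E := s ^+ 2 * _ in idn *.
have D4 : D ^+ 2 <= 4 by nra.
have D0 : 0 <= D ^+ 2 by rewrite sqr_ge0.
have : (1 - k / 4) * D ^+ 2 <= (1 - k / 8) ^+ 2 * D ^+ 2 by apply: ler_wpM2r => //; nra.
have : k / 4 * D ^+ 2 <= k by nra.
lra.
Qed.

Lemma blaschke_circle : cabs z = s -> r < s -> cabs (blaschke s a z) = 1.
Proof.
move=> zs rs'; have idn := blaschke_identity s a z; move: idn; rewrite zs subrr mulr0 addr0 -exprMn => idn.
rewrite cabs_blaschke; have dp := den0.
have : cabs ((s ^+ 2)%:C - a^*%C * z) = s * cabs (z - a).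
  by move/eqP: idn; rewrite eqrXn2 ?cabs_ge0// ?mulr_ge0 ?cabs_ge0 ?(ltW s0)// => /eqP.
by move=> <-; rewrite divff// gt_eqF.
Qed.

End Bounds.
End Blaschke.

Section Fredholm.
Variable R : realType.
Implicit Types (f g h u v k : disk R -> R[i]) (d a : disk R).
Variables (N N0 : (disk R -> R[i]) -> \bar R) (K C : R).
Hypothesis sN : solid N0 K.
Hypothesis C0 : 0 < C.
Hypothesis N_ge0 : forall f, (0 <= N f)%E.
Hypothesis N_le : forall f (t : R), analytic f -> (N0 f <= t%:E -> N f <= (C * t)%:E)%E.
Hypothesis N0_le : forall f (t : R), analytic f -> (N f <= t%:E -> N0 f <= (C * t)%:E)%E.

Local Notation X := (function_space N).
Local Notation range v := ((fun f d => v d * f d) @` X).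
Let K1 : 1 <= K. Proof. exact: (solid_ge1 sN). Qed.
Let K0 : 0 < K. Proof. exact: lt_le_trans K1. Qed.
Let XP := function_spaceP N_ge0 N_le N0_le.

Lemma analytic_weak_max f (r s M : R) d : analytic f -> 0 <= r -> r < s -> s < 1 ->
  (forall d, cabs (point d) = s -> cabs (f d) <= M) ->
  cabs (point d) <= r -> cabs (f d) <= M / (1 - r / s).
Proof.
move=> /analyticP pf r0 rs s1 fM dr; have s0 : 0 < s by exact: le_lt_trans rs.
rewrite -(ext0_val f).
apply: (papprox_weak_max pf s0 s1 _ r0 rs) => [z|]; last by rewrite subr0.
rewrite subr0 => zs; have [|d' d'z] := @diskP R z; first by rewrite zs.
by rewrite -d'z ext0_val fM// d'z.
Qed.

(** Outside |z| <= r, |h| is at most |f| / (r - |a|). Inside, [h] is bounded by the weak maximum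
    principle from |z| = s, where point evaluation bounds [f]. Both regimes fit one inequality |h|
    <= A |f| + M t |1|, to which [solid_lattice] applies. *)
Lemma solid_divide a : exists2 B : R, 0 < B & forall f h (t : R), analytic f -> analytic h ->
  (forall d, f d = (point d - point a) * h d) -> 0 < t -> (N0 f <= t%:E -> N0 h <= (B * t)%:E)%E.
Proof.
have a1 := disk_cabs a; have a0 := cabs_ge0 (point a).
pose r := (cabs (point a) + 1) / 2; pose s := (r + 1) / 2.
have ar : cabs (point a) < r by rewrite /r; lra.
have rs : r < s by rewrite /s /r; lra.
have s1 : s < 1 by rewrite /s /r; lra.
have r0 : 0 <= r by exact: le_trans (ltW ar).
have as0 : 0 < s - cabs (point a) by rewrite subr_gt0 (lt_trans ar).
have ra0 : 0 < r - cabs (point a) by rewrite subr_gt0.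
have [E E0 hE] := solid_eval sN s1.
have [t1 t10 ht1] := solid_one_pos sN.
have q1 : 0 < 1 - r / s by rewrite subr_gt0 ltr_pdivrMr ?mul1r// (le_lt_trans r0).
pose c := (1 - r / s)^-1; have c0 : 0 < c by rewrite invr_gt0.
pose A := (r - cabs (point a))^-1; have A0 : 0 < A by rewrite invr_gt0.
pose M := c * (E / (s - cabs (point a))); have M0 : 0 < M by rewrite !mulr_gt0// invr_gt0.
exists (K * (A + M * t1)) => [|f h t af ah fh t0 Nf].
  by rewrite mulr_gt0// addr_gt0// mulr_gt0.
have dist d : cabs (point d) - cabs (point a) <= cabs (point d - point a) by exact: cabs_subl.
have fE d : cabs (f d) = cabs (point d - point a) * cabs (h d) by rewrite fh cabsM.
have hs d : cabs (point d) = s -> cabs (h d) <= E * t / (s - cabs (point a)).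
  move=> ds; rewrite ler_pdivlMr// (le_trans _ (hE f t d af Nf _)) ?ds//.
  by rewrite fE mulrC ler_wpM2r ?cabs_ge0// -ds.
have hM d : cabs (h d) <= A * cabs (f d) + M * t * cabs (1 : R[i]).
  rewrite cabs1 mulr1; have [dr|rd] := leP (cabs (point d)) r.
    apply: ler_wpDl; first by rewrite mulr_ge0 ?cabs_ge0// ltW.
    move/analyticP: ah => ph.
    have := papprox_weak_max ph (le_lt_trans r0 rs) s1 (M := E * t / (s - cabs (point a))) _ r0 rs (z := point d).
    rewrite subr0 ext0_val => H; apply: le_trans (H _ dr) _ => [z|].
      rewrite subr0 => zs; have [|d' d'z] := @diskP R z; first by rewrite zs.
      by rewrite -d'z ext0_val hs// d'z.
    by rewrite -/c mulrC /M -!mulrA (mulrC t).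
  apply: ler_wpDr; first by rewrite mulr_ge0// ltW.
  rewrite fE mulrA ler_peMl ?cabs_ge0//.
  rewrite mulrC ler_pdivlMr// mul1r (le_trans _ (dist d))// lerD2r; exact: ltW.
have := solid_lattice sN af (analytic_cst 1) ah (ltW A0) (ltW (mulr_gt0 M0 t0)) hM Nf ht1.
by rewrite (mulrAC M) -mulrDl mulrA.
Qed.

Lemma function_space_one : X (fun=> 1).
Proof.
apply/XP; split; first exact: analytic_cst.
by have [t t0 ht] := solid_one_pos sN; exists t.
Qed.

Lemma function_space_lattice f g h (A B : R) : X f -> X g -> analytic h -> 0 <= A -> 0 <= B ->
  (forall d, cabs (h d) <= A * cabs (f d) + B * cabs (g d)) -> X h.
Proof.
move=> /XP[af [s s0 hs]] /XP[ag [t t0 ht]] ah A0 B0 hh; apply/XP; split=> //.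
exists (K * (A * s + B * t) + 1).
  by rewrite ltr_wpDl// mulr_ge0 ?(ltW K0)// addr_ge0// mulr_ge0// ltW.
by rewrite (le_trans (solid_lattice sN af ag ah A0 B0 hh hs ht))// lee_fin lerDl.
Qed.

Lemma function_space_mul v f (M : R) : analytic v -> 0 <= M -> (forall d, cabs (v d) <= M) ->
  X f -> X (fun d => v d * f d).
Proof.
move=> av M0 vM Xf; have /XP[af _] := Xf.
apply: (function_space_lattice Xf Xf (analyticM av af) M0 (lexx 0)) => d.
by rewrite mul0r addr0 cabsM ler_wpM2r ?cabs_ge0.
Qed.

Lemma function_space_divide a f h : X f -> analytic h ->
  (forall d, f d = (point d - point a) * h d) -> X h.
Proof.
move=> /XP[af [t t0 ht]] ah fh; have [B B0 hB] := solid_divide a.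
by apply/XP; split=> //; exists (B * t); [exact: mulr_gt0|exact: (hB f h)].
Qed.

Lemma range_unit k v (M delta : R) : analytic k -> 0 < M -> 0 < delta ->
  (forall d, cabs (k d) <= M) -> (forall d, delta <= cabs (k d)) ->
  range (fun d => k d * v d) = range v.
Proof.
move=> ak M0 delta0 kM kd.
have kN0 d : k d != 0 by rewrite -cabs_gt0 (lt_le_trans _ (kd d)).
apply/seteqP; split=> [_ [f Xf <-]|_ [f Xf <-]].
  exists (fun d => k d * f d); first exact: (function_space_mul ak (ltW M0) kM Xf).
  by apply/funext => d; rewrite mulrCA mulrA.
exists (fun d => (k d)^-1 * f d).
  apply: (function_space_mul (analyticV ak kN0) (M := delta^-1)) => // [|d].
    by rewrite invr_ge0 ltW.
  by rewrite cabsV lef_pV2 ?posrE// cabs_gt0.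
by apply/funext => d; rewrite mulrA (mulrC (k d)) mulfK.
Qed.

Definition cofinite v := closed_in X N (range v) /\ finite_dim_quotient X (range v).

Lemma cofinite_one : cofinite (fun=> 1).
Proof.
have E : range (fun=> 1) = X.
  apply/seteqP; split=> [_ [f Xf <-]|f Xf]; last by exists f => //; apply/funext => d; rewrite mul1r.
  by rewrite (_ : (fun _ => _) = f)//; apply/funext => d; rewrite mul1r.
rewrite /cofinite E; split=> //; exists 0%N, (fun=> 0); split=> [[]//|x Xx].
by exists (fun=> 0); rewrite big_ord0 subr0.
Qed.

(** The factor z - a adds one condition, vanishing at [a]. A limit of multiples vanishes there
    because evaluation is continuous; divided by z - a it is a limit of multiples of [v], by
    [solid_divide], hence itself a multiple. The codimension grows by at most one. *)
Lemma cofinite_factor a v : analytic v -> cofinite v -> cofinite (fun d => (point d - point a) * v d).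
Proof.
move=> av [clv [n [e [Xe H]]]].
pose lin : disk R -> R[i] := fun d => point d - point a.
have alin : analytic lin.
  rewrite (_ : lin = fun d : disk R => ('X - (point a)%:P).[point d]); first exact: analytic_poly.
  by apply/funext => d; rewrite !hornerE.
have lin2 d : cabs (lin d) <= 2.
  rewrite (le_trans (cabsB _ _))// -[leRHS]/(1 + 1) lerD// ltW// disk_cabs//.
have lina : lin a = 0 by rewrite /lin subrr.
split.
  move=> g Xg gap; have /XP[ag _] := Xg.
  have [E E0 hE] := solid_eval sN (disk_cabs a).
  have C1 : 0 < C by [].
  have appr (eps : R) : 0 < eps -> exists2 f, X f & (N0 (fun d => (g d - lin d * v d * f d)%R) <= eps%:E)%E.
    move=> eps0; have e1 : 0 < eps / C by rewrite divr_gt0.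
    have [_ [f Xf <-] hf] := gap _ e1; exists f => //.
    have /XP[af _] := Xf.
    have := N0_le (analyticB ag (analyticM (analyticM alin av) af)) (ltW hf).
    by rewrite mulrCA divff ?gt_eqF// mulr1.
  have ga : g a = 0.
    apply/eqP; rewrite -cabs_eq0; apply/eqP/le_anti; rewrite cabs_ge0 andbT.
    apply/ler_addgt0Pr => x x0; rewrite add0r.
    have x1 : 0 < x / E by rewrite divr_gt0.
    have [f Xf hf] := appr _ x1; have /XP[af _] := Xf.
    have := hE _ _ a (analyticB ag (analyticM (analyticM alin av) af)) hf (lexx _).
    by rewrite lina !mul0r subr0 mulrCA divff ?gt_eqF// mulr1.
  have [y ay gy] := analytic_div ag ga.
  have Xy : X y by exact: function_space_divide Xg ay gy.
  have [B B0 hB] := solid_divide a.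
  have [|f Xf fy] := clv y Xy.
    move=> eps eps0; have e1 : 0 < eps / 2 / C / B by rewrite !divr_gt0.
    have [f Xf hf] := appr _ e1; have /XP[af _] := Xf.
    exists (fun d => v d * f d); first by exists f.
    have h1 := hB _ (fun d => y d - v d * f d) _ (analyticB ag (analyticM (analyticM alin av) af))
       (analyticB ay (analyticM av af)) _ e1 hf.
    have := N_le (analyticB ay (analyticM av af)) (h1 _).
    rewrite (_ : C * (B * (eps / 2 / C / B)) = eps / 2); last by field; rewrite !gt_eqF.
    move=> h2; apply: (@le_lt_trans _ _ (eps / 2)%:E); last by rewrite lte_fin; lra.
    by apply: h2 => d; rewrite gy /lin; ring.
  by exists f => //; apply/funext => d; rewrite gy -fy mulrA.
(* From x = x(a) + (z - a) y: the constant 1, at index 0, takes care of x(a), and z - a times the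
   old generators takes care of y. *)
pose e' (i : 'I_n.+1) : disk R -> R[i] :=
  if unlift ord0 i is Some j then fun d => lin d * e j d else fun=> 1.
exists n.+1, e'; split=> [i|x Xx].
  rewrite /e'; case: unlift => [j|]; last exact: function_space_one.
  exact: (function_space_mul alin (ler0n _ 2) lin2 (Xe j)).
have /XP[ax _] := Xx.
pose x0 d := x d - x a.
have ax0 : analytic x0 by exact: (analyticB ax (analytic_cst _)).
have [y ay x0y] := analytic_div ax0 (subrr (x a)).
have Xx0 : X x0.
  apply: (function_space_lattice Xx function_space_one ax0 ler01 (cabs_ge0 (x a))) => d.
  by rewrite mul1r cabs1 mulr1 cabsB.
have Xy : X y by exact: function_space_divide Xx0 ay x0y.
have [c [h Xh yE]] := H y Xy.
exists (fun i => if unlift ord0 i is Some j then c j else x a), h => //.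
apply/funext => d.
have yd : v d * h d = y d - \sum_(i < n) c i * e i d.
  rewrite [LHS](congr1 (fun g => g d) yE).
  by rewrite -[LHS]/(y d + - (\sum_(i < n) c i *: e i) d) fct_sumE.
rewrite -[RHS]/(x d + - (\sum_(i < n.+1) _) d) fct_sumE big_ord_recl /e' unlift_none.
under eq_bigr => i _ do rewrite liftK.
rewrite -mulrA yd -[(x a *: _) d]/(x a * 1) mulr1.
rewrite (_ : x d = x a + lin d * y d); last by rewrite /lin -x0y /x0 addrC subrK.
rewrite [X in _ = _ - (_ + X)](eq_bigr (fun i => lin d * (c i * e i d))) => [|i _].
  by rewrite -mulr_sumr mulrBr opprD addrACA subrr add0r.
by rewrite -[LHS]/(c i * (lin d * e i d)) mulrCA.
Qed.

End Fredholm.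

Section EssentialSpectrumSolid.
Variable R : realType.
Implicit Types (f g h u v k : disk R -> R[i]) (d a : disk R).
Variables (N N0 : (disk R -> R[i]) -> \bar R) (K C : R).
Hypothesis sN : solid N0 K.
Hypothesis C0 : 0 < C.
Hypothesis N_ge0 : forall f, (0 <= N f)%E.
Hypothesis N_le : forall f (t : R), analytic f -> (N0 f <= t%:E -> N f <= (C * t)%:E)%E.
Hypothesis N0_le : forall f (t : R), analytic f -> (N f <= t%:E -> N0 f <= (C * t)%:E)%E.

Local Notation X := (function_space N).
Local Notation range v := ((fun f d => v d * f d) @` X).
Let XP := function_spaceP N_ge0 N_le N0_le.

(** 1/v is analytic, hence bounded on |z| <= r, so [v] is bounded below on the whole disk and its
    multiples fill the space. *)
Lemma cofinite_nonvanishing v (r M delta : R) : analytic v -> r < 1 -> 0 < delta ->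
  (forall d, cabs (v d) <= M) -> (forall d, r <= cabs (point d) -> delta <= cabs (v d)) ->
  (forall d, v d != 0) -> cofinite N v.
Proof.
move=> av r1 del0 vM vdel v0.
have [B B0 hB] := analytic_disk_bounded (analyticV av v0) r1.
pose m := Num.min delta B^-1.
have m0 : 0 < m by rewrite lt_min del0 invr_gt0.
have vm d : m <= cabs (v d).
  have /orP[rd|dr] := le_total r (cabs (point d)); first by rewrite ge_min vdel.
  rewrite ge_min; apply/orP; right; have := hB d dr; rewrite cabsV => h.
  by rewrite -[leRHS]invrK lef_pV2 ?posrE ?invr_gt0 ?cabs_gt0.
have M0 : 0 < `|M| + 1 by rewrite ltr_wpDl.
have vM' d : cabs (v d) <= `|M| + 1 by rewrite (le_trans (vM d))// ler_wpDr// ler_norm.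
have E : range v = range (fun=> 1).
  rewrite -{1}(_ : (fun d => v d * 1) = v); last by apply/funext => d; rewrite mulr1.
  exact: (range_unit sN N_ge0 N_le N0_le (fun=> 1) av M0 m0 vM' vm).
by rewrite /cofinite E; exact: cofinite_one.
Qed.

(** All zeros lie in |z| < r. Dividing [v] by the Blaschke factor of a zero preserves its modulus on
    |z| = s and multiplies that at the fixed point [d0] by at least 1/rho. The weak maximum
    principle at [d0] therefore stops the process after finitely many divisions, and
    [cofinite_factor] restores the zeros one at a time, with multiplicity. *)
Lemma cofinite_bounded_below v (r M delta : R) : analytic v -> 0 <= r -> r < 1 -> 0 < delta ->
  (forall d, cabs (v d) <= M) -> (forall d, r <= cabs (point d) -> delta <= cabs (v d)) ->
  cofinite N v.
Proof.
move=> av0 r0 r1 del00 vM0 vdel0.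
(* With this [s], s^2 - r = (1 - r)^2 / 4 > 0, which keeps the Blaschke denominators away from 0.
   The choice r < q < s puts [d0] outside the zeros and inside the comparison circle. *)
pose s := (1 + r) / 2; pose q := (r + s) / 2.
have s0 : 0 < s by rewrite /s; lra.
have s1 : s < 1 by rewrite /s; lra.
have rs : r < s by rewrite /s; lra.
have qs : q < s by rewrite /q; lra.
have rq : r < q by rewrite /q; lra.
have q0 : 0 <= q by rewrite (le_trans r0)// ltW.
have rs2 : r < s ^+ 2.
  have : 0 < (1 - r) ^+ 2 by rewrite exprn_gt0// subr_gt0.
  by rewrite /s; nra.
have s2r : 0 < s ^+ 2 - r by rewrite subr_gt0.
pose rho := 1 - (s ^+ 2 - r ^+ 2) * (s ^+ 2 - q ^+ 2) / 8.
have sr2 : 0 < s ^+ 2 - r ^+ 2 by rewrite subr_gt0 ltrXn2r ?nnegrE// ltW.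
have sq2 : 0 < s ^+ 2 - q ^+ 2 by rewrite subr_gt0 ltrXn2r ?nnegrE// ltW.
have s21 : s ^+ 2 <= 1 by rewrite exprn_ile1// ltW.
have P1 : (s ^+ 2 - r ^+ 2) * (s ^+ 2 - q ^+ 2) <= 1.
  by rewrite -[leRHS](mulr1 1); apply: ler_pM; rewrite ?(ltW sr2) ?(ltW sq2)// (le_trans _ s21)// gerBl sqr_ge0.
have P0 : 0 < (s ^+ 2 - r ^+ 2) * (s ^+ 2 - q ^+ 2) by rewrite mulr_gt0.
have rho0 : 0 < rho by rewrite /rho; lra.
have rho1 : rho < 1 by rewrite /rho; lra.
have [|d0 d0q] := @diskP R q%:C; first by rewrite cabs_ge0_real// (lt_trans qs).
have cd0 : cabs (point d0) = q by rewrite d0q cabs_ge0_real.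
have qs1 : 0 < 1 - q / s by rewrite subr_gt0 ltr_pdivrMr// mul1r.
(* At n = 0 the strict inequality contradicts the weak maximum principle at [d0]; each division uses
   up one factor [rho], so n bounds the number of zeros. [Ms] stays the same, while [M] and [delta]
   may deteriorate at every step. *)
suff H n : forall v (M delta Ms : R), analytic v -> 0 < delta ->
    (forall d, cabs (v d) <= M) -> (forall d, r <= cabs (point d) -> delta <= cabs (v d)) ->
    (forall d, cabs (point d) = s -> cabs (v d) <= Ms) ->
    Ms * rho ^+ n / (1 - q / s) < cabs (v d0) -> cofinite N v.
  have vd0 : 0 < cabs (v d0) by rewrite (lt_le_trans del00)// vdel0// cd0 ltW.
  have /cvgrPdist_lt/(_ _ vd0)[n _ /(_ n (leqnn _))] :=
    @cvg_scaled_geometric R (M / (1 - q / s)) rho 1 (ltW rho0) rho1.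
  rewrite /= divr1 sub0r normrN => /(le_lt_trans (ler_norm _)) h.
  by apply: (H n v M delta M) => //; rewrite mulrAC.
clear v M delta av0 del00 vM0 vdel0; elim: n => [|n ih] v M delta Ms av del0 vM vdel vMs vd0.
  have := analytic_weak_max av q0 qs s1 vMs (_ : cabs (point d0) <= q).
  by rewrite cd0 lexx => /(_ isT); rewrite leNgt; move: vd0; rewrite expr0 mulr1 => ->.
have [v0|] := pselect (forall d, v d != 0); first exact: cofinite_nonvanishing av r1 del0 vM vdel v0.
move=> /existsNP[a /negP]; rewrite negbK => /eqP va.
have ar : cabs (point a) <= r.
  by rewrite leNgt; apply/negP => /ltW/vdel; rewrite va cabs0 leNgt del0.
have [v' av' vE] := analytic_div av va.
pose den d := (s ^+ 2)%:C - (point a)^*%C * point d.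
have aden : analytic den.
  rewrite (_ : den = fun d : disk R => ((s ^+ 2)%:C%:P - (point a)^*%C%:P * 'X).[point d]).
    exact: analytic_poly.
  by apply/funext => d; rewrite !hornerE.
have den_ge d : s ^+ 2 - r <= cabs (den d) by exact: blaschke_den_ge ar (disk_cabs d).
have den0 d : 0 < cabs (den d) by exact: lt_le_trans (den_ge d).
have denN0 d : den d != 0 by rewrite -cabs_gt0.
have sC : s%:C != 0 :> R[i] by rewrite -cabs_gt0 cabs_ge0_real// ltW.
(* The Blaschke factor is (z - a) k with [k] bounded above and below, so k G and G have the same
   multiples: removing z - a or the whole Blaschke factor amounts to the same. *)
pose k d := s%:C * (den d)^-1.
have ak : analytic k by exact: (analyticZ _ (analyticV aden denN0)).
pose G d := v' d * (s%:C^-1 * den d).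
have aG : analytic G by exact: (analyticM av' (analyticZ _ aden)).
have bE d : v d = blaschke s (point a) (point d) * G d.
  by rewrite vE /G /blaschke -/(den d); field; rewrite denN0 sC.
have kG d : v d = (point d - point a) * (k d * G d).
  by rewrite vE /G /k; field; rewrite denN0 sC.
have kle d : cabs (k d) <= s / (s ^+ 2 - r).
  by rewrite cabsM cabsV (cabs_ge0_real (ltW s0)) ler_pM2l// lef_pV2 ?posrE.
have kge d : s / 2 <= cabs (k d).
  rewrite cabsM cabsV (cabs_ge0_real (ltW s0)) ler_pM2l// lef_pV2 ?posrE//.
  exact: blaschke_den_le rs2 s0 s1 ar (disk_cabs d).
have -> : v = fun d => (point d - point a) * (k d * G d) by exact/funext.
apply: (cofinite_factor sN C0 N_ge0 N_le N0_le a (analyticM ak aG)).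
have kM0 : 0 < s / (s ^+ 2 - r) by rewrite divr_gt0.
have km0 : 0 < s / 2 by rewrite divr_gt0.
have E := range_unit sN N_ge0 N_le N0_le G ak kM0 km0 kle kge.
rewrite /cofinite E -/(cofinite N G).
have bge d : s <= cabs (point d) -> s * (s - r) / 2 <= cabs (blaschke s (point a) (point d)).
  move=> sd; rewrite (cabs_blaschke _ _ s0); apply: ler_pM => //.
    by apply: mulr_ge0; [exact: ltW|rewrite subr_ge0 ltW].
    by rewrite ler_pM2l// (le_trans (lerB sd ar))// cabs_subl.
  by rewrite -/(den d) lef_pV2 ?posrE ?den0//; exact: blaschke_den_le rs2 s0 s1 ar (disk_cabs d).
have sr0 : 0 < s * (s - r) / 2 by rewrite divr_gt0// mulr_gt0// subr_gt0.
have [B B0 hB] := analytic_disk_bounded aG s1.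
have M0 : 0 <= M by rewrite (le_trans (cabs_ge0 (v d0))).
apply: (ih G (B + M / (s * (s - r) / 2)) (delta * (s ^+ 2 - r) / 2) Ms) => //.
- by rewrite divr_gt0// mulr_gt0.
- move=> d; have /orP[/hB h|sd] := le_total (cabs (point d)) s.
    by rewrite ler_wpDr// divr_ge0// ltW.
  apply: ler_wpDl; first exact: ltW.
  rewrite ler_pdivlMr// (le_trans _ (vM d))// bE cabsM mulrC ler_wpM2r ?cabs_ge0//.
  exact: bge.
- move=> d rd; have := vdel d rd; rewrite bE cabsM => h.
  have hb := blaschke_le rs2 s0 s1 ar (disk_cabs d).
  have := le_trans h (ler_wpM2r (cabs_ge0 _) hb).
  by rewrite mulrAC ler_pdivlMr// mulrC => h'; rewrite ler_pdivrMr// mulrC -(mulrC 2) mulrC.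
- move=> d ds; have := vMs d ds; rewrite bE cabsM.
  by rewrite (blaschke_circle rs2 s0 ar (disk_cabs d) ds rs) mul1r.
have := vd0; rewrite bE cabsM => h.
have d0q' : cabs (point d0) <= q by rewrite cd0.
have hb := blaschke_contract r0 rs2 s0 s1 ar (disk_cabs d0) rs d0q' qs.
have := lt_le_trans h (ler_wpM2r (cabs_ge0 _) hb).
by rewrite -/rho exprS mulrCA -(mulrA rho) ltr_pM2l.
Qed.

End EssentialSpectrumSolid.

Section EssentialSpectrumTheorem.
Variable R : realType.
Implicit Types (f g h u v k : disk R -> R[i]) (d a : disk R).
Variables (N N0 : (disk R -> R[i]) -> \bar R) (K C : R).
Hypothesis sN : solid N0 K.
Hypothesis C0 : 0 < C.
Hypothesis N_ge0 : forall f, (0 <= N f)%E.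
Hypothesis N_le : forall f (t : R), analytic f -> (N0 f <= t%:E -> N f <= (C * t)%:E)%E.
Hypothesis N0_le : forall f (t : R), analytic f -> (N f <= t%:E -> N0 f <= (C * t)%:E)%E.

Local Notation X := (function_space N).
Local Notation range v := ((fun f d => v d * f d) @` X).
Let XP := function_spaceP N_ge0 N_le N0_le.

Lemma solid_fredholm v (r M delta : R) (T : (disk R -> R[i]) -> disk R -> R[i]) :
  (forall f, T f = fun d => v d * f d) -> analytic v ->
  0 <= r -> r < 1 -> 0 < delta -> (forall d, cabs (v d) <= M) ->
  (forall d, r <= cabs (point d) -> delta <= cabs (v d)) -> fredholm X N T.
Proof.
move=> TE av r0 r1 del0 vM vdel; have M0 : 0 <= M.
  have [|d _] := @diskP R 0; first by rewrite cabs0.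
  exact: le_trans (cabs_ge0 _) (vM d).
have -> : T = (fun f d => v d * f d) by exact/funext.
have [cl fq] := cofinite_bounded_below sN C0 N_ge0 N_le N0_le av r0 r1 del0 vM vdel.
split; [|exact: cl| |exact: fq].
- split=> [f Xf|c f g _ _|].
  + exact: (function_space_mul sN N_ge0 N_le N0_le av M0 vM Xf).
  + apply/funext => d; rewrite -[RHS]/(c * (v d * f d) + v d * g d).
    by rewrite -[(c *: f + g) d]/(c * f d + g d) mulrDr mulrCA.
  exists (C * (K * (M * C))) => f Xf; have [af Nf] := Xf.
  have fin : N f \is a fin_num by rewrite ge0_fin_numE.
  rewrite -(fineK fin); have Nf' : (N f <= (fine (N f))%:E)%E by rewrite fineK.
  have avf := analyticM av af.
  have vf d : cabs (v d * f d) <= M * cabs (f d) by rewrite cabsM ler_wpM2r ?cabs_ge0.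
  have := N_le avf (solid_scale sN af avf M0 vf (N0_le af Nf')).
  by rewrite -EFinM !mulrA.
- exists 0%N, (fun=> 0); split=> [[m m0]|f [Xf vf0]]; first by rewrite ltn0 in m0.
  exists (fun=> 0); rewrite big_ord0 subr0 /=.
  have /XP[af _] := Xf; pose s := (1 + r) / 2.
  have rs : r < s by rewrite /s; lra.
  have s1 : s < 1 by rewrite /s; lra.
  have f0 d : r <= cabs (point d) -> f d = 0.
    move=> rd; have /(congr1 (fun g => g d))/eqP := vf0.
    rewrite -[(0 : disk R -> R[i]) d]/(0 : R[i]) mulf_eq0 => /orP[|/eqP//].
    by rewrite -cabs_eq0 gt_eqF// (lt_le_trans del0)// vdel.
  apply/funext => d; rewrite -[RHS]/(0 : R[i]).
  have /orP[/f0//|dr] := le_total r (cabs (point d)).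
  (* An element of the kernel vanishes for |z| >= r, in particular on |z| = s; the weak maximum
     principle with bound 0 extends this to the smaller disc. *)
  have fs d' : cabs (point d') = s -> cabs (f d') <= 0 by move=> ds; rewrite f0 ?cabs0// ds ltW.
  have := analytic_weak_max af r0 rs s1 fs dr.
  by rewrite mul0r => h; apply/eqP; rewrite -cabs_eq0; apply/eqP/le_anti; rewrite h cabs_ge0.
Qed.

Lemma complex_closureP (A : set R[i]) (l : R[i]) :
  closure A l <-> forall e : R, 0 < e -> exists2 z, A z & cabs (z - l) < e.
Proof.
split=> [cl e e0|H B /nbhs_ballP[e /= e0 Be]].
  have e0' : 0 < e%:C by rewrite ltcR.
  have [z [Az Bz]] := cl _ (nbhsx_ballx l _ e0').
  by exists z => //; move: Bz; rewrite /ball/= cabs_lt cabsC.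
case: e e0 Be => x y; rewrite ltcE/= => /andP[/eqP -> x0] Be.
by have [z Az zl] := H _ x0; exists z; split=> //; apply: Be; rewrite /ball/= complexr0 cabs_lt cabsC.
Qed.

(** Outside the closure for one radius, u - l is bounded below near the circle and [solid_fredholm]
    applies. Inside all of them, values of u - l of any prescribed smallness occur arbitrarily close
    to the circle, which feeds [vanishing_infinite_codim]. *)
Theorem essential_spectrum_solid u : multipliers X u ->
  essential_spectrum X N (mul_op u) =
  \bigcap_(r in [set r : R | 0 < r < 1]) closure (u @` [set z : disk R | r%:C <= `|val z|]).
Proof.
move=> uX; have [M M0 uM] := solid_multiplier_bounded sN N_ge0 N_le N0_le uX.
have [au _] := uX.
have K1 := solid_ge1 sN; have K0 : 0 < K by exact: lt_le_trans K1.
apply/seteqP; split=> [l ess r /= /andP[r0 r1]|l /= cap fred].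
  apply: contrapT => ncl; apply: ess.
  have [delta del0 hdel] : exists2 delta : R, 0 < delta &
      forall d, r <= cabs (point d) -> delta <= cabs (u d - l).
    apply: contrapT => H; apply: ncl; apply/complex_closureP => e e0.
    apply: contrapT => H'; apply: H; exists e => // d rd; rewrite leNgt; apply/negP => h.
    by apply: H'; exists (u d) => //; exists d => //=; rewrite -cabsE lecR.
  have vM d : cabs (u d - l) <= M + cabs l by rewrite (le_trans (cabsB _ _))// lerD2r.
  have TE f : mul_op u f - l *: f = fun d => (u d - l) * f d.
    apply/funext => d; rewrite mulrBl.
    by rewrite -[(_ - _) d]/(u d * f d + - (l * f d)).
  exact: (solid_fredholm TE (analyticB au (analytic_cst l)) (ltW r0) r1 del0 vM hdel).
pose theta : R := (2 * K)^-1.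
have th0 : 0 < theta by rewrite invr_gt0 mulr_gt0.
have th1 : theta <= 1.
  by rewrite invf_le1 ?mulr_gt0// (le_trans K1)// ler_peMl ?(ltW K0)// ler1n.
have [|n r r1|d_ [zeta [z1 dz ud]]] := @boundary_sequence R
    (fun n d => cabs (u d - l) <= theta ^+ (2 * n)).
- move=> n m d nm /le_trans; apply; rewrite ler_wiXn2l ?(ltW th0)//.
  by rewrite leq_mul2l nm orbT.
(* [boundary_sequence] asks for every r < 1, possibly not positive, whereas the intersection runs
   over positive radii. *)
- pose r' := Num.max r (1 / 2).
  have r'01 : 0 < r' < 1 by rewrite lt_max gt_max r1 !divr_gt0 ?orbT//= ltr_pdivrMr// mul1r ltr1n.
  have tn : 0 < theta ^+ (2 * n) by rewrite exprn_gt0.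
  have /complex_closureP/(_ _ tn)[_ [d /= rd <-] /ltW h] := cap r' r'01.
  exists d => //; move: rd; rewrite -cabsE lecR; apply: le_trans.
  by rewrite le_max lexx.
have [_ _ _ fq] := fred.
have E : (fun f => mul_op u f - l *: f) = (fun f d => (u d - l) * f d).
  apply/funext => f; apply/funext => d; rewrite mulrBl.
  by rewrite -[(_ - _) d]/(u d * f d + - (l * f d)).
rewrite E in fq.
exact: (vanishing_infinite_codim sN N_ge0 N_le N0_le z1 dz ud fq).
Qed.

End EssentialSpectrumTheorem.

(** * Hardy spaces *)

Section PowerInequalities.
Variable R : realType.

Lemma powR_add_le (a b p : R) : 0 <= a -> 0 <= b -> 0 <= p ->
  (a + b) `^ p <= 2 `^ p * (a `^ p + b `^ p).
Proof.
move=> a0 b0 p0; rewrite (le_trans (_ : _ <= (2 * Num.max a b) `^ p))//.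
  rewrite ge0_ler_powR ?nnegrE ?addr_ge0 ?mulr_ge0 ?le_max ?a0//.
  by rewrite mulr2n mulrDl mul1r lerD// le_max lexx ?orbT.
rewrite powRM ?le_max ?a0// ler_wpM2l ?powR_ge0//.
by case: (leP a b) => _; rewrite ?lerDr ?lerDl powR_ge0.
Qed.

Lemma poweR_inv_le (I : \bar R) (p t : R) : (0 <= I)%E -> 0 < p -> 0 <= t ->
  (I `^ p^-1 <= t%:E)%E = (I <= (t `^ p)%:E)%E.
Proof.
move=> I0 p0 t0; case: I I0 => [r| |]//; rewrite ?lee_fin => r0.
  apply/idP/idP => h.
    have := ge0_ler_powR (ltW p0) (powR_ge0 r p^-1) t0 h.
    by rewrite -powRrM mulVf ?gt_eqF// powRr1.
  have ip0 : 0 <= p^-1 by rewrite invr_ge0 ltW.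
  have := ge0_ler_powR ip0 r0 (powR_ge0 t p) h.
  by rewrite -powRrM divff ?gt_eqF// powRr1.
by rewrite poweRyr ?invr_eq0 ?gt_eqF// !leNgt !ltry.
Qed.

Lemma cvg_powR_ge0 (u : nat -> R) (a p : R) : 1 <= p -> (forall n, 0 <= u n) ->
  u @ \oo --> a -> (fun n => u n `^ p) @ \oo --> a `^ p.
Proof.
move=> p1 u0 ua; have a0 : 0 <= a by rewrite -(cvg_lim (@Rhausdorff R) ua); apply: limr_ge; [exact: cvgP ua|exact: nearW].
have p0 : 0 < p by exact: lt_le_trans p1.
move: a0; rewrite le_eqVlt => /predU1P[a0|a0].
  rewrite -a0 powR0 ?gt_eqF//.
  apply: (@squeeze_cvgr _ _ _ _ (fun=> 0) u); [|exact: cvg_cst|by rewrite a0].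
  have /cvgrPdist_lt/(_ 1 ltr01) := ua; rewrite -a0; apply: filterS => n.
  rewrite sub0r normrN ger0_norm// => /ltW un; rewrite powR_ge0/=.
  have := u0 n; rewrite le_eqVlt => /predU1P[<-|un0]; first by rewrite powR0 ?gt_eqF.
  by rewrite ge1r_powR// un0.
have cp : {for a, continuous (fun x : R => expR (p * ln x))}.
  apply: continuous_comp; last exact: continuous_expR.
  by apply: continuousM; [exact: cst_continuous|exact: continuous_ln].
rewrite /powR (gt_eqF a0).
have h0 : (fun n => expR (p * ln (u n))) @ \oo --> expR (p * ln a) by exact: (cvg_comp _ _ ua cp).
apply: cvg_trans h0; apply: near_eq_cvg.
have /cvgrPdist_lt/(_ a a0) := ua; apply: filterS => n.
rewrite /powR => h; rewrite gt_eqF//=.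
by have := le_lt_trans (ler_norm _) h; rewrite ltrBlDr ltrDl.
Qed.

End PowerInequalities.

(** * Solid norms defined by weighted p-th power integrals *)

Section WeightedLp.
Variables (R : realType) (d : measure_display) (T : measurableType d).
Variables (mu : {measure set T -> \bar R}) (D : set T) (w : T -> R) (p : R).
Hypotheses (mD : measurable D) (mw : measurable_fun D w) (w0 : forall x, D x -> 0 <= w x) (p1 : 1 <= p).
Implicit Types f g h : T -> R.

Definition lp_integral f : \bar R := (\int[mu]_(x in D) (f x `^ p * w x)%:E)%E.

Let p0 : 0 < p. Proof. exact: lt_le_trans p1. Qed.

Let mint f : measurable_fun D f -> measurable_fun D (fun x => (f x `^ p * w x)%:E).
Proof.
move=> mf; apply/measurable_EFinP; apply: measurable_funM => //.
exact: measurableT_comp (measurable_powR p) mf.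
Qed.

Let int0 f x : D x -> (0 <= (f x `^ p * w x)%:E)%E.
Proof. by move=> Dx; rewrite lee_fin mulr_ge0 ?powR_ge0 ?w0. Qed.

Lemma lp_integral_ge0 f : (0 <= lp_integral f)%E.
Proof. by apply: integral_ge0 => x; exact: int0. Qed.

Lemma lp_integral_lattice f g h (A B s t : R) : measurable_fun D f -> measurable_fun D g ->
  measurable_fun D h -> 0 <= A -> 0 <= B -> 0 <= s -> 0 <= t ->
  (forall x, D x -> 0 <= f x) -> (forall x, D x -> 0 <= g x) -> (forall x, D x -> 0 <= h x) ->
  (forall x, D x -> h x <= A * f x + B * g x) ->
  (lp_integral f <= (s `^ p)%:E -> lp_integral g <= (t `^ p)%:E ->
   lp_integral h <= ((4 * (A * s + B * t)) `^ p)%:E)%E.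
Proof.
move=> mf mg mh A0 B0 s0 t0 f0 g0 h0 hfg If Ig.
have As : 0 <= A * s by exact: mulr_ge0.
have Bt : 0 <= B * t by exact: mulr_ge0.
apply: (@le_trans _ _ (\int[mu]_(x in D) (((2 * A) `^ p)%:E * (f x `^ p * w x)%:E +
    ((2 * B) `^ p)%:E * (g x `^ p * w x)%:E))%E).
  apply: ge0_le_integral => //.
  - by move=> x; exact: int0.
  - exact: mint.
  - apply: emeasurable_funD; apply: emeasurable_funM => //; exact: mint.
  move=> x Dx; rewrite -!EFinM -EFinD lee_fin !mulrA -mulrDl ler_wpM2r ?w0//.
  rewrite (le_trans (_ : _ <= (A * f x + B * g x) `^ p))//.
    by rewrite ge0_ler_powR ?nnegrE ?(ltW p0) ?h0 ?addr_ge0 ?mulr_ge0 ?f0 ?g0 ?hfg.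
  rewrite (le_trans (powR_add_le _ _ (ltW p0))) ?mulr_ge0 ?f0 ?g0//.
  by rewrite mulrDr -!powRM ?mulr_ge0 ?f0 ?g0// !mulrA.
rewrite ge0_integralD//; last 4 first.
- by move=> x Dx; apply: mule_ge0; [rewrite lee_fin powR_ge0|exact: int0].
- by apply: emeasurable_funM => //; exact: mint.
- by move=> x Dx; apply: mule_ge0; [rewrite lee_fin powR_ge0|exact: int0].
- by apply: emeasurable_funM => //; exact: mint.
rewrite !ge0_integralZl_EFin ?powR_ge0//; [|exact: int0|exact: mint|exact: int0|exact: mint].
apply: (@le_trans _ _ (((2 * A) `^ p)%:E * (s `^ p)%:E + ((2 * B) `^ p)%:E * (t `^ p)%:E)%E).
  by rewrite leeD// lee_wpmul2l// lee_fin powR_ge0.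
have A2 : 0 <= 2 * A by exact: mulr_ge0.
have B2 : 0 <= 2 * B by exact: mulr_ge0.
rewrite -!EFinM -EFinD lee_fin -(powRM _ A2 s0) -(powRM _ B2 t0).
rewrite (_ : 4 * (A * s + B * t) = 2 * (2 * (A * s + B * t))); last by ring.
have S0 : 0 <= 2 * (A * s + B * t) by rewrite mulr_ge0 ?addr_ge0.
rewrite (powRM _ _ S0)//.
have h2 : 2 <= 2 `^ p :> R by rewrite -[leLHS]powRr1// ler_powR// ler1n.
apply: le_trans _ (ler_wpM2r (powR_ge0 _ _) h2); rewrite -!mulrA [leRHS]mulr_natl [leRHS]mulr2n.
have As2 : 0 <= 2 * (A * s) by exact: mulr_ge0.
have Bt2 : 0 <= 2 * (B * t) by exact: mulr_ge0.
apply: lerD; apply: (ge0_ler_powR (ltW p0)) => //; rewrite mulrDr.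
  by rewrite lerDl.
by rewrite lerDr.
Qed.

Lemma lp_integral_fatou (F : nat -> T -> R) f (C : R) :
  (forall n, measurable_fun D (F n)) -> (forall n x, D x -> 0 <= F n x) ->
  (forall x, D x -> 0 <= f x) ->
  (forall x, D x -> F ^~ x @ \oo --> f x) ->
  (forall n, (lp_integral (F n) <= C%:E)%E) -> (lp_integral f <= C%:E)%E.
Proof.
move=> mF F0 f0 Ff FC.
have cF x : D x -> (fun n => (F n x `^ p * w x)%:E) @ \oo --> (f x `^ p * w x)%:E.
  move=> Dx; apply: cvg_EFin; first exact: nearW.
  by apply: cvgMl; apply: cvg_powR_ge0 (Ff x Dx) => // n; exact: F0.
rewrite /lp_integral (_ : (\int[mu]_(x in D) (f x `^ p * w x)%:E)%E =
   (\int[mu]_(x in D) limn_einf ((fun n x => (F n x `^ p * w x)%:E) ^~ x))%E); last first.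
  by apply: eq_integral => x; rewrite inE => Dx; rewrite (cvg_limn_einf_sup (cF x Dx)).1.
apply: le_trans (fatou mu mD (fun n => mint (mF n)) _) _; first by move=> n x; exact: int0.
rewrite limn_einf_lim; apply: lime_le; first exact: is_cvg_einfs.
apply: nearW => n; apply: le_trans (FC n).
by apply: ereal_inf_lbound; exists n => //=.
Qed.

End WeightedLp.

Lemma complex_cvg_Re (R : realType) (u : nat -> R[i]) l : u @ \oo --> l ->
  (fun n => complex.Re (u n)) @ \oo --> complex.Re l.
Proof.
move=> /cabs_cvgP h; apply/cvgrPdist_lt => e /h[n hn]; exists n => // m nm.
by rewrite distrC -ReN -ReD (le_lt_trans (Re_le_cabs _))// hn.
Qed.

Lemma complex_cvg_Im (R : realType) (u : nat -> R[i]) l : u @ \oo --> l ->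
  (fun n => complex.Im (u n)) @ \oo --> complex.Im l.
Proof.
move=> /cabs_cvgP h; apply/cvgrPdist_lt => e /h[n hn]; exists n => // m nm.
by rewrite distrC -ImN -ImD (le_lt_trans (Im_le_cabs _))// hn.
Qed.

Lemma complex_cvg_cabs (R : realType) (u : nat -> R[i]) l : u @ \oo --> l ->
  (fun n => cabs (u n)) @ \oo --> cabs l.
Proof.
move=> /cabs_cvgP h; apply/cvgrPdist_lt => e /h[n hn]; exists n => // m nm.
apply: le_lt_trans (hn m nm); rewrite distrC ler_norml.
have h1 := cabsD (u m - l) l; rewrite subrK in h1.
have h2 := cabsD (l - u m) (u m); rewrite subrK -opprB cabsN in h2.
by apply/andP; split; [rewrite lerBrDr addrC lerBlDl|rewrite lerBlDr].
Qed.

Section AnalyticMeasurability.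
Variables (R : realType) (d : measure_display) (T : measurableType d) (D : set T).
Implicit Types (gamma : T -> R[i]).

Lemma cmeasurable_papprox (F : R[i] -> R[i]) gamma : papprox 0 1 F -> cmeasurable D gamma ->
  (forall x, D x -> cabs (gamma x) < 1) -> cmeasurable D (F \o gamma).
Proof.
move=> pF mg g1; have [a ta] := papprox_taylor ltr01 pF.
have cv x : D x -> (fun n => (taylor_poly a 0 n).[gamma x]) @ \oo --> F (gamma x).
  move=> Dx; have := taylor_series_cvg pF ta _; move=> /(_ (gamma x)).
  rewrite subr0 => /(_ (g1 x Dx)) /cabs_cvgP h; apply/cabs_cvgP => e e0.
  have [n hn] := h e e0; exists n => m nm; have := hn m nm.
  by rewrite horner_taylor_poly /series/= big_mkord subr0.
have mt n := cmeasurable_horner (taylor_poly a 0 n) mg.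
split; [apply: (measurable_fun_cvg (h := fun n x => complex.Re (taylor_poly a 0 n).[gamma x]))|
  apply: (measurable_fun_cvg (h := fun n x => complex.Im (taylor_poly a 0 n).[gamma x]))].
- by move=> n; exact: (mt n).1.
- by move=> x Dx; exact: (complex_cvg_Re (cv x Dx)).
- by move=> n; exact: (mt n).2.
- by move=> x Dx; exact: (complex_cvg_Im (cv x Dx)).
Qed.

End AnalyticMeasurability.

Section SolidLp.
Variables (R : realType) (d : measure_display) (T : measurableType d).
Variables (mu : {measure set T -> \bar R}) (D : set T) (w : T -> R) (p : R).
Variables (I : Type) (J : set I) (gamma : I -> T -> R[i]).
Variable N : (disk R -> R[i]) -> \bar R.
Hypotheses (mD : measurable D) (mw : measurable_fun D w) (w0 : forall x, D x -> 0 <= w x) (p1 : 1 <= p).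
Hypotheses (mg : forall i, J i -> cmeasurable D (gamma i))
  (g1 : forall i x, J i -> D x -> cabs (gamma i x) < 1).
Hypothesis N_le : forall f (t : R), analytic f -> (N f <= t%:E)%E <-> 0 <= t /\
  forall i, J i -> (lp_integral mu D w p (fun x => cabs (ext0 f (gamma i x))) <= (t `^ p)%:E)%E.
Hypothesis N_one : exists t : R, (N (fun=> 1%R) <= t%:E)%E.
Hypothesis N_eval : forall r : R, r < 1 -> exists C : R, forall f d, analytic f ->
  (N f <= 1%:E)%E -> cabs (point d) <= r -> cabs (f d) <= C.

Let mf f i : analytic f -> J i -> measurable_fun D (fun x => cabs (ext0 f (gamma i x))).
Proof.
move=> /analyticP af Ji; apply: measurable_cabs.
by apply: cmeasurable_papprox af (mg Ji) _ => x; exact: g1.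
Qed.

Let lattice f g h (A B s t : R) : analytic f -> analytic g -> analytic h ->
  0 <= A -> 0 <= B -> (forall d, cabs (h d) <= A * cabs (f d) + B * cabs (g d)) ->
  (N f <= s%:E -> N g <= t%:E -> N h <= (4 * (A * s + B * t))%:E)%E.
Proof.
move=> af ag ah A0 B0 hfg /(N_le _ af)[s0 Nf] /(N_le _ ag)[t0 Ng].
apply/(N_le _ ah); split; first by rewrite mulr_ge0 ?addr_ge0 ?mulr_ge0.
move=> i Ji; apply: (lp_integral_lattice mD mw w0 p1 (mf af Ji) (mf ag Ji) (mf ah Ji) A0 B0 s0 t0
  _ _ _ _ (Nf i Ji) (Ng i Ji)) => x Dx; try exact: cabs_ge0.
by have /diskP[z <-] := g1 Ji Dx; rewrite !ext0_val.
Qed.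

(** The family [gamma] covers two cases: circles of all radii for the Hardy norm, and a single
    parametrisation of the disk by the plane for the Bergman norm. Evaluation is assumed on the unit
    ball and extended to all bounds by scaling with the lattice inequality. *)
Lemma lp_solid : solid N 4.
Proof.
apply: Solid; [by rewrite ler1n|exact: lattice|exact: N_one| | ].
- move=> r /N_eval[C hC]; exists (4 * (`|C| + 1)).
    by rewrite mulr_gt0 ?ltr_wpDl.
  move=> f t z af Nf zr; have [t0 _] := (N_le _ af).1 Nf.
  (* The bound [t] may be 0, so the function is scaled by a strictly larger [s], which then tends to
     [t]. *)
  suff H s : t < s -> cabs (f z) <= 4 * (`|C| + 1) * s.
    apply/ler_addgt0Pr => e e0; set M := 4 * _.
    have M0 : 0 < M by rewrite mulr_gt0 ?ltr_wpDl.
    have := H (t + e / M); rewrite ltrDl divr_gt0// => /(_ isT).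
    by rewrite mulrDr [M * (e / M)]mulrC divfK ?gt_eqF.
  move=> ts; have s0 : 0 < s by exact: le_lt_trans ts.
  have s4 : 0 < 4 * s by rewrite mulr_gt0.
  have ag := analyticZ ((4 * s)^-1)%:C af.
  have cE y : cabs (((4 * s)^-1)%:C * f y) = (4 * s)^-1 * cabs (f y).
    by rewrite cabsM cabs_ge0_real// invr_ge0 ltW.
  have Ng : (N (fun z => ((4 * s)^-1)%:C%R * f z)%R <= 1%:E)%E.
    have i0 : 0 <= (4 * s)^-1 by rewrite invr_ge0 ltW.
    have Nfs : (N f <= s%:E)%E by apply: le_trans Nf _; rewrite lee_fin ltW.
    have := lattice af af ag i0 (lexx 0) _ Nfs Nfs.
    rewrite mul0r addr0 mulrCA mulVf ?gt_eqF//; apply => y; by rewrite cE mul0r addr0.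
  have := hC _ z ag Ng zr; rewrite cE -ler_pdivlMl ?invr_gt0// invrK mulrC => h.
  apply: (le_trans h); rewrite [leRHS](_ : _ = (`|C| + 1) * (4 * s)); last by ring.
  by rewrite ler_wpM2r ?(ltW s4)// (le_trans (ler_norm C))// lerDl.
- move=> F f C aF af Ff FC; apply/(N_le _ af).
  have C0 : 0 <= C by have [] := (N_le _ (aF 0%N)).1 (FC 0%N).
  split=> // i Ji; apply: (lp_integral_fatou mD mw w0 p1 (F := fun n x => cabs (ext0 (F n) (gamma i x)))).
  - by move=> n; exact: mf (aF n) Ji.
  - by move=> n x _; exact: cabs_ge0.
  - by move=> x _; exact: cabs_ge0.
  - move=> x Dx; apply: complex_cvg_cabs; have /diskP[z <-] := g1 Ji Dx.
    by rewrite ext0_val; under eq_fun do rewrite ext0_val; exact: Ff.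
  - by move=> n; exact: ((N_le _ (aF n)).1 (FC n)).2 i Ji.
Qed.

End SolidLp.

Section CirclesAndCoefficients.
Variable R : realType.
Notation mu := (@lebesgue_measure R).
Implicit Types (F : R[i] -> R[i]) (a : nat -> R[i]).

Lemma cabs_circle (r t : R) : 0 <= r -> cabs (r%:C * cexp t) = r.
Proof. by move=> r0; rewrite cabsM cabs_cexp mulr1 cabs_ge0_real. Qed.

Lemma cabs_le_dist (z w : R[i]) : cabs z <= cabs w + cabs (w - z).
Proof. by have := cabsD w (z - w); rewrite addrC subrK -[cabs (z - w)]cabsN opprB. Qed.

Lemma circle_cauchy_papprox F a (r : R) (k : nat) : papprox 0 1 F -> taylor_coefs 0 1 F a ->
  0 < r -> r < 1 -> ((2 * pi * (cabs (a k) * r ^+ k))%:E <=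
   \int[mu]_(t in `[(- pi)%R, pi]) (cabs (F (r%:C * cexp t)))%:E)%E.
Proof.
move=> pF ta r0 r1; have pi0 := pi_gt0 R.
have mI : measurable (`[- pi, pi]%classic : set R) by exact: measurable_itv.
have mF : measurable_fun `[- pi, pi] (fun t => cabs (F (r%:C * cexp t))).
  apply: measurable_cabs; apply: cmeasurable_papprox pF (cmeasurable_cexp r mI) _ => t _.
  by rewrite cabs_circle ?(ltW r0).
(* The error [dl] enters twice, through the coefficient and through the integral, each time
   multiplied by 2 pi. *)
apply/lee_addgt0Pr => e e0; pose dl := e / (4 * pi).
have dl0 : 0 < dl by rewrite divr_gt0// mulr_gt0.
have dle : dl * (4 * pi) = e by rewrite divfK// gt_eqF// mulr_gt0.
have [q hq] := pF r dl r1 dl0; have hk := ta r dl q r0 r1 hq k.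
have qk : q^`N(k).[0] = q`_k by rewrite horner_coef0 coef_nderivn addn0 binn mulr1n.
apply: (@le_trans _ _ ((2 * pi * (cabs q`_k * r ^+ k))%:E + (2 * pi * dl)%:E)%E).
  rewrite -EFinD lee_fin -mulrDr ler_wpM2l ?mulr_ge0 ?(ltW pi0)//.
  rewrite (le_trans _ (lerD (lexx _) hk))// -mulrDl ler_wpM2r ?exprn_ge0 ?(ltW r0)//.
  by rewrite qk cabs_le_dist.
apply: (@le_trans _ _ ((\int[mu]_(t in `[(- pi)%R, pi]) ((cabs (F (r%:C * cexp t)))%:E + dl%:E)) +
   (2 * pi * dl)%:E)%E).
  rewrite leeD2r//; apply: le_trans (circle_cauchy q k (ltW r0)) _.
  apply: ge0_le_integral => //.
  - by move=> t _; rewrite lee_fin cabs_ge0.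
  - by apply/measurable_EFinP/measurable_cabs/cmeasurable_horner/cmeasurable_cexp.
  - by apply: emeasurable_funD => //; exact/measurable_EFinP.
  move=> t _; rewrite -EFinD lee_fin.
  have := hq (r%:C * cexp t); rewrite subr0 cabs_circle ?(ltW r0)// => /(_ (lexx _)) h.
  by rewrite (le_trans (cabs_le_dist _ (F (r%:C * cexp t))))// lerD2l.
rewrite ge0_integralD//; last 3 first.
- by move=> t _; rewrite lee_fin cabs_ge0.
- exact/measurable_EFinP.
- by move=> t _; rewrite lee_fin ltW.
have muI : mu `[- pi, pi]%classic = (2 * pi)%:E.
  by rewrite lebesgue_measure_itv/= lte_fin gtrN// -EFinB opprK mulr_natl mulr2n.
rewrite integral_cst// [X in (dl%:E * X)%E](_ : _ = (2 * pi)%:E)//.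
rewrite -addeA leeD2l// -EFinM -EFinD lee_fin -dle.
by lra.
Qed.

Lemma coef_bound_eval F a (M rho r : R) z : papprox 0 1 F -> taylor_coefs 0 1 F a ->
  0 < rho -> rho < 1 -> 0 <= r -> r < rho -> (forall k, cabs (a k) * rho ^+ k <= M) ->
  cabs z <= r -> cabs (F z) <= M / (1 - r / rho).
Proof.
move=> pF ta rho0 rho1 r0 rr aM zr.
have z1 : cabs (z - 0) < 1 by rewrite subr0 (le_lt_trans zr)// (lt_trans rr).
have cv := complex_cvg_cabs (taylor_series_cvg pF ta z1).
have q0 : 0 <= r / rho by rewrite divr_ge0// ltW.
have q1 : r / rho < 1 by rewrite ltr_pdivrMr// mul1r.
rewrite -(cvg_lim (@Rhausdorff R) cv); apply: limr_le; first exact: cvgP cv.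
apply: nearW => n; rewrite /series/= big_mkord; apply: le_trans (cabs_sum _ _ _) _.
apply: (@le_trans _ _ (\sum_(i < n) M * (r / rho) ^+ i)).
  apply: ler_sum => i _; rewrite subr0 cabsM cabsX expr_div_n mulrA.
  rewrite ler_pdivlMr ?exprn_gt0// mulrAC ler_pM ?mulr_ge0 ?exprn_ge0 ?cabs_ge0 ?(ltW rho0)//.
  by rewrite lerXn2r ?nnegrE ?cabs_ge0.
rewrite -mulr_sumr ler_wpM2l//; first by rewrite (le_trans _ (aM 0%N))// mulr_ge0 ?cabs_ge0// exprn_ge0// ltW.
by have := geom_sum_le 0 n q0 q1; rewrite big_mkord expr0 mul1r.
Qed.

End CirclesAndCoefficients.

Section HardySpace.
Variables (R : realType) (p : R) (w : R -> R).
Hypotheses (p1 : 1 < p) (Aw : muckenhoupt p w).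
Notation mu := (@lebesgue_measure R).
Let I : set R := `[- pi, pi].
Let dual t := w t `^ (- (p - 1)^-1).

Let mI : measurable I. Proof. exact: measurable_itv. Qed.

Let w0 t : 0 <= w t. Proof. by case: Aw. Qed.

Let mw : measurable_fun I w.
Proof. by case: Aw => _ _ _ /integrableP[/measurable_EFinP]. Qed.

Let mdual : measurable_fun I dual.
Proof. exact: measurableT_comp (measurable_powR _) mw. Qed.

Let w_fin : (\int[mu]_(t in I) (w t)%:E < +oo)%E.
Proof.
case: Aw => _ _ _ /integrableP[_ h] _; apply: le_lt_trans h.
by apply: ge0_le_integral => //; [move=> t _; rewrite lee_fin|exact/measurable_EFinP|
  exact/measurable_EFinP/measurableT_comp|move=> t _; rewrite lee_fin ler_norm].
Qed.

Let w_int0 : (0 <= \int[mu]_(t in I) (w t)%:E)%E.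
Proof. by apply: integral_ge0 => t _; rewrite lee_fin. Qed.

Let dual_int0 : (0 <= \int[mu]_(t in I) (dual t)%:E)%E.
Proof. by apply: integral_ge0 => t _; rewrite lee_fin powR_ge0. Qed.

(** If the dual weight had infinite integral, the Muckenhoupt product over [-pi, pi] would be
    infinite as soon as [w] has nonzero integral. Otherwise w = 0 almost everywhere, and then [dual]
    is 0 there by the convention for powers of 0. *)
Lemma muckenhoupt_dual_integrable : (\int[mu]_(t in I) (dual t)%:E < +oo)%E.
Proof.
rewrite ltey; apply/negP => /eqP Voo.
have [wi0|wi0] := eqVneq (\int[mu]_(t in I) (w t)%:E)%E 0%E.
  have h : ae_eq mu I (EFin \o w) (cst 0%E).
    apply/ae_eq_integral_abs => //; first exact/measurable_EFinP.
    by rewrite -wi0; apply: eq_integral => t _ /=; rewrite ger0_norm.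
  suff : (\int[mu]_(t in I) (dual t)%:E = 0)%E by rewrite Voo.
  rewrite (ae_eq_integral (cst 0%E)) ?integral0//; first exact/measurable_EFinP.
  apply: filterS h => t /= h It; have [wt0] := h It.
  rewrite /dual wt0 powR0//.
  by rewrite oppr_eq0 invr_eq0 subr_eq0 gt_eqF.
case: Aw => _ _ _ _; apply/negP; rewrite -leNgt.
have pi0 := pi_gt0 R.
apply: (@le_trans _ _ (muckenhoupt_product p w (- pi) pi)); last first.
  apply: ereal_sup_ubound; exists (- pi, pi) => //=.
  by apply/andP; split; lra.
rewrite /muckenhoupt_product Voo gt0_muley; last by rewrite lte_fin invr_gt0; lra.
rewrite poweRyr ?subr_eq0 ?gt_eqF// gt0_muley//.
by rewrite mule_gt0 ?lte_fin ?invr_gt0//; [lra|rewrite lt_neqAle eq_sym wi0].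
Qed.

(** If x exceeds [dual t], then x^(p-1) w(t) >= dual(t)^(p-1) w(t) = 1, so x^p w(t) >= x.
    Integrated, this bounds the unweighted L^1 norm on a circle by the weighted p-th power integral
    plus the integral of the dual weight. *)
Let young t x : 0 < w t -> 0 <= x -> x <= dual t + x `^ p * w t.
Proof.
move=> wt x0; have [xd|dx] := leP x (dual t).
  by rewrite (le_trans xd)// lerDl mulr_ge0 ?powR_ge0.
have d0 : 0 < dual t by exact: powR_gt0.
have x1 : 0 < x by exact: lt_trans dx.
rewrite (le_trans (_ : _ <= x `^ p * w t)) ?lerDr ?powR_ge0//.
have -> : x `^ p = x `^ (p - 1) * x.
  by rewrite -[X in _ = _ * X](powRr1 x0) -powRD ?subrK// (gt_eqF x1) implybT.
rewrite mulrAC ler_peMl//.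
have := ge0_ler_powR _ (ltW d0) (ltW x1) (ltW dx); move=> /(_ (p - 1)).
rewrite subr_ge0 (ltW p1) => /(_ isT).
rewrite /dual -powRrM mulNr mulVf ?subr_eq0 ?gt_eqF// powR_inv1 ?(ltW wt)//.
by move=> h; rewrite -(ler_pM2r wt) mulVf ?gt_eqF// in h.
Qed.

Let gamma (r t : R) : R[i] := r%:C * cexp t.
Let J : set R := [set r | 0 < r < 1].

Let hardyE f : hardy_norm p w f = ereal_sup [set
  (lp_integral mu I w p (fun t => cabs (ext0 f (gamma r t))) `^ p^-1)%E | r in J].
Proof.
have gE r t : (r * cos t) +i* (r * sin t) = gamma r t.
  by rewrite /gamma /cexp; apply/eqP; rewrite eq_complex /= !mul0r subr0 addr0 !eqxx.
rewrite /hardy_norm; apply: (congr1 (@ereal_sup R)); apply: eq_imagel => r _.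
apply: (congr1 (fun x => x `^ p^-1)%E); rewrite /lp_integral.
by apply: eq_integral => t _; rewrite gE.
Qed.

Let p0 : 0 < p. Proof. exact: lt_trans p1. Qed.

Let hardy_le f (t : R) : (hardy_norm p w f <= t%:E)%E <-> 0 <= t /\
  forall r, J r -> (lp_integral mu I w p (fun x => cabs (ext0 f (gamma r x))) <= (t `^ p)%:E)%E.
Proof.
have lp0 g : (0 <= lp_integral mu I w p g)%E by apply: lp_integral_ge0.
rewrite hardyE; split=> [h|[t0 h]]; last first.
  by apply: ge_ereal_sup => _ /= [r Jr <-]; rewrite poweR_inv_le// h.
have h1 r : J r -> (lp_integral mu I w p (fun x => cabs (ext0 f (gamma r x))) `^ p^-1 <= t%:E)%E.
  by move=> Jr; apply: le_trans h; apply: ereal_sup_ubound; exists r.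
have t0 : 0 <= t.
  rewrite -lee_fin; apply: le_trans (poweR_ge0 _ _) (h1 2^-1 _).
  by rewrite /J/= invr_gt0 ltr0n/= invf_lt1 ?ltr1n.
by split=> // r Jr; rewrite -poweR_inv_le// h1.
Qed.

Lemma hardy_solid : solid (hardy_norm p w) 4.
Proof.
have mg r : J r -> cmeasurable I (gamma r) by move=> _; exact: cmeasurable_cexp.
have g1 r t : J r -> I t -> cabs (gamma r t) < 1.
  by move=> /andP[r0 r1] _; rewrite cabs_circle ?(ltW r0).
apply: (@lp_solid R _ _ mu I w p R J gamma _ mI mw (fun t _ => w0 t) (ltW p1) mg g1 (fun f t _ => hardy_le f t)).
- exists (fine (\int[mu]_(t in I) (w t)%:E) `^ p^-1); apply/hardy_le; split; first exact: powR_ge0.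
  move=> r Jr; rewrite -powRrM mulVf ?gt_eqF// powRr1 ?fine_ge0//.
  rewrite fineK; last by rewrite ge0_fin_numE.
  rewrite le_eqVlt; apply/orP; left; apply/eqP; apply: eq_integral => t; rewrite inE => It.
  by have /diskP[z <-] := g1 _ _ Jr It; rewrite ext0_val cabs1 powR1 mul1r.
move=> r r1; pose rho := (Num.max r 0 + 1) / 2.
have r'1 : Num.max r 0 < 1 by rewrite gt_max r1 ltr01.
have r'0 : 0 <= Num.max r 0 by rewrite le_max lexx orbT.
have rho0 : 0 < rho by rewrite /rho; lra.
have rho1 : rho < 1 by rewrite /rho; lra.
have rrho : Num.max r 0 < rho by rewrite /rho; lra.
(* By [young], V + 1 bounds the L^1 norm on |z| = rho of a function of norm at most 1. Cauchy's
   estimate on this circle bounds its coefficients, and summing the series on |z| <= r gives the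
   evaluation constant. *)
pose V := fine (\int[mu]_(t in I) (dual t)%:E)%E.
exists ((V + 1) / (2 * pi) / (1 - Num.max r 0 / rho)) => f d /analyticP pf /hardy_le[_ Nf] dr.
have [a ta] := papprox_taylor ltr01 pf.
rewrite -ext0_val; apply: (coef_bound_eval pf ta rho0 rho1 r'0 rrho); last by rewrite (le_trans dr)// le_max lexx.
move=> k; have Jr : J rho by rewrite /J/= rho0 rho1.
have pi2 : 0 < 2 * pi :> R by rewrite mulr_gt0 ?pi_gt0.
rewrite ler_pdivlMr// mulrC -lee_fin.
apply: le_trans (circle_cauchy_papprox k pf ta rho0 rho1) _.
have mf : measurable_fun I (fun t => cabs (ext0 f (gamma rho t))).
  by apply: measurable_cabs; apply: cmeasurable_papprox pf (mg _ Jr) _ => t; exact: g1.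
have mf2 : measurable_fun I (fun t => (cabs (ext0 f (gamma rho t)) `^ p * w t)%:E).
  by apply/measurable_EFinP/measurable_funM => //; exact: measurableT_comp (measurable_powR p) mf.
apply: (@le_trans _ _ (\int[mu]_(t in I) ((dual t)%:E + (cabs (ext0 f (gamma rho t)) `^ p * w t)%:E))%E).
  apply: ae_ge0_le_integral => //.
  - by move=> t _; rewrite lee_fin cabs_ge0.
  - exact/measurable_EFinP.
  - by move=> t _; rewrite adde_ge0// lee_fin ?mulr_ge0 ?powR_ge0.
  - by apply: emeasurable_funD => //; exact/measurable_EFinP.
  case: Aw => _ _ [Z [mZ Z0 wZ]] _ _; exists Z; split=> // t tZ; apply: wZ => wt; apply: tZ => _.
  by rewrite -EFinD lee_fin young ?cabs_ge0.
rewrite ge0_integralD//; last 3 first.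
- by move=> t _; rewrite lee_fin powR_ge0.
- exact/measurable_EFinP.
- by move=> t _; rewrite lee_fin mulr_ge0 ?powR_ge0.
rewrite EFinD leeD//.
  by rewrite /V fineK// ge0_fin_numE// muckenhoupt_dual_integrable.
by have := Nf _ Jr; rewrite powR1.
Qed.

Lemma hardy_norm_ge0 f : (0 <= hardy_norm p w f)%E.
Proof.
have Jh : J 2^-1 by rewrite /J/= invr_gt0 ltr0n/= invf_lt1 ?ltr1n.
rewrite hardyE; apply: (le_trans (poweR_ge0
  (lp_integral mu I w p (fun t => cabs (ext0 f (gamma 2^-1 t)))) p^-1)).
by apply: ereal_sup_ubound; exists 2^-1.
Qed.

End HardySpace.

(** * Bloch spaces *)

Section Derivatives.

(** Stated over a general field with norm so as to serve both the real derivative along a radius and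
    the complex derivative in [bloch_norm]. *)
Lemma cvg_difference_quotient (K : numFieldType) (h : K -> K) (x L C dl : K) : 0 < dl -> 0 < C ->
  (forall e, `|e| <= dl -> `|h (e + x) - h x - e * L| <= C * `|e| ^+ 2) ->
  (fun e => e^-1 *: (h (e + x) - h x)) @ 0^' --> L.
Proof.
move=> dl0 C0 hC; apply/cvgrPdist_le => e e0.
have h1 := dnbhs0_le (V := K) dl0.
have h2 := dnbhs0_le (V := K) (divr_gt0 e0 C0).
near=> y.
have y0 : y != 0 by near: y; exact: nbhs_dnbhs_neq.
have y1 : `|y| <= dl by near: y.
have y2 : `|y| <= e / C by near: y.
rewrite distrC (_ : _ - L = y^-1 * (h (y + x) - h x - y * L)); last first.
  by rewrite [RHS]mulrBr mulKf.
rewrite normrM normfV ler_pdivrMl ?normr_gt0// (le_trans (hC y y1))//.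
by rewrite expr2 mulrCA ler_wpM2l// mulrC -ler_pdivlMr.
Unshelve. all: by end_near.
Qed.

Variable R : realType.

Lemma is_derive_quadratic (h : R -> R) (x L C dl : R) : 0 < dl -> 0 < C ->
  (forall e, `|e| <= dl -> `|h (e + x) - h x - e * L| <= C * `|e| ^+ 2) -> is_derive x 1 h L.
Proof.
move=> dl0 C0 /(cvg_difference_quotient dl0 C0) cv.
have cv' : (fun e => e^-1 *: ((h \o shift x) (e *: 1) - h x)) @ 0^' --> L.
  by under eq_fun do rewrite /= [_ *: 1]mulr1.
by apply: DeriveDef; [exact: cvgP cv'|exact: (cvg_lim (@Rhausdorff R) cv')].
Qed.

Lemma papprox_quadratic (c : R[i]) (rho : R) F a : 0 < rho -> papprox c rho F -> taylor_coefs c rho F a ->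
  exists2 C : R, 0 < C & forall z, cabs (z - c) <= rho / 4 ->
    cabs (F z - F c - (z - c) * a 1%N) <= C * cabs (z - c) ^+ 2.
Proof.
move=> rho0 pF ta; have r0 : 0 < rho / 2 by rewrite divr_gt0.
have rlt : rho / 2 < rho by lra.
have [M M0 hM] := papprox_bounded pF rlt.
exists (M * (2 * (2 / rho) ^+ 2)) => [|z zr]; first by rewrite mulr_gt0// mulr_gt0// exprn_gt0// divr_gt0.
have fM w : cabs (w - c) = rho / 2 -> cabs (F w) <= M by move=> wr; rewrite hM// wr.
have sr : cabs (z - c) < rho / 2 by lra.
have := taylor_remainder 2 pF ta r0 rlt fM (cabs_ge0 _) sr (lexx _).
rewrite big_ord_recr/= big_ord1 expr0 mulr1 expr1 (taylor_coef0 rho0 pF ta) opprD addrA.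
rewrite [a 1%N * _]mulrC => h; apply: (le_trans h).
set q := cabs (z - c) / (rho / 2).
have qE : 2 / rho * cabs (z - c) = q by rewrite /q invfM invrK mulrC [_^-1 * _]mulrC.
have -> : M * (2 * (2 / rho) ^+ 2) * cabs (z - c) ^+ 2 = M * (q ^+ 2 * 2) by rewrite -qE; ring.
rewrite ler_wpM2l ?(ltW M0)//.
have q0 : 0 <= q by rewrite divr_ge0 ?cabs_ge0// ltW.
have q2 : q <= 1 / 2 by rewrite /q ler_pdivrMr//; lra.
rewrite ler_wpM2l ?exprn_ge0//.
by rewrite -[leRHS]invrK lef_pV2 ?posrE; lra.
Qed.

Lemma papprox_derive1 (c : R[i]) (rho : R) F a : 0 < rho -> papprox c rho F -> taylor_coefs c rho F a ->
  F^`()%classic c = a 1%N.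
Proof.
move=> rho0 pF ta; have [C C0 hC] := papprox_quadratic rho0 pF ta.
apply: cvg_lim; first exact: norm_hausdorff.
have r4 : 0 < (rho / 4)%:C :> R[i] by rewrite ltcR divr_gt0.
have C0' : 0 < C%:C :> R[i] by rewrite ltcR.
apply: (cvg_difference_quotient (dl := (rho / 4)%:C) (C := C%:C) r4 C0') => e.
rewrite cabs_le => er; have := hC (e + c); rewrite addrK => /(_ er).
by rewrite -lecR rmorphM rmorphXn/= !cabsE.
Qed.

End Derivatives.

Section RadialDerivative.
Variable R : realType.
Implicit Types (c v : R[i]) (F : R[i] -> R[i]).

Lemma Re_linear_comb c (A B v a : R[i]) (e : R) :
  complex.Re (c * A) - complex.Re (c * B) - e * complex.Re (c * (v * a)) =
  complex.Re (c * (A - B - e%:C * v * a)).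
Proof. by case: c A B v a => [? ?] [? ?] [? ?] [? ?] [? ?] /=; ring. Qed.

Lemma is_derive_radial F c v (x rho : R) : cabs v <= 1 -> 0 < rho -> papprox (x%:C * v) rho F ->
  is_derive x 1 (fun x => complex.Re (c * F (x%:C * v)))
    (complex.Re (c * (v * F^`()%classic (x%:C * v)))).
Proof.
move=> v1 rho0 pF; have [a ta] := papprox_taylor rho0 pF.
rewrite (papprox_derive1 rho0 pF ta); have [C C0 hC] := papprox_quadratic rho0 pF ta.
have dl0 : 0 < rho / 4 by rewrite divr_gt0.
have C1 : 0 < C * (cabs c + 1) by rewrite mulr_gt0// ltr_wpDl// cabs_ge0.
apply: (is_derive_quadratic dl0 C1) => e er.
have zE : (e + x)%:C * v - x%:C * v = e%:C * v by rewrite rmorphD/= mulrDl addrK.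
have ed : cabs (e%:C * v) <= `|e| by rewrite cabsM cabs_real ler_piMr.
have := hC ((e + x)%:C * v); rewrite zE => /(_ (le_trans ed er)) h.
rewrite Re_linear_comb; apply: (le_trans (Re_le_cabs _)).
rewrite cabsM [leRHS]mulrAC [leLHS]mulrC; apply: ler_pM; rewrite ?cabs_ge0 ?lerDl//.
apply: (le_trans h); rewrite ler_wpM2l ?(ltW C0)//.
by rewrite lerXn2r ?nnegrE ?cabs_ge0.
Qed.

End RadialDerivative.

Section BlochSpace.
Variables (R : realType) (alpha : R).
Hypothesis alpha1 : 1 < alpha.
Implicit Types (f : disk R -> R[i]) (d : disk R).
Let gm := alpha - 1.
Let gm0 : 0 < gm. Proof. by rewrite subr_gt0. Qed.
Let wt d : R := 1 - cabs (point d) ^+ 2.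

Let wt0 d : 0 < wt d.
Proof. by rewrite subr_gt0 expr_lt1 ?disk_cabs ?cabs_ge0. Qed.

Let wt1 d : wt d <= 1. Proof. by rewrite gerBl exprn_ge0 ?cabs_ge0. Qed.

Definition growth_norm f : \bar R := ereal_sup [set (wt d `^ gm * cabs (f d))%:E | d in [set: disk R]].

Let growth_le f (t : R) : (growth_norm f <= t%:E)%E <-> forall d, wt d `^ gm * cabs (f d) <= t.
Proof.
split=> [h d|h]; last by apply: ge_ereal_sup => _ [d _ <-]; rewrite lee_fin.
by rewrite -lee_fin; apply: le_trans h; apply: ereal_sup_ubound; exists d.
Qed.

Lemma growth_solid : solid growth_norm 1.
Proof.
apply: Solid => //.
- move=> f g h A B s t _ _ _ A0 B0 hfg /growth_le Nf /growth_le Ng; apply/growth_le => d.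
  rewrite mul1r (le_trans (ler_wpM2l (powR_ge0 _ _) (hfg d)))// mulrDr.
  by rewrite lerD// mulrCA ler_wpM2l.
- exists 1; apply/growth_le => d; rewrite cabs1 mulr1.
  by have := ge0_ler_powR (ltW gm0) (ltW (wt0 d)) ler01 (wt1 d); rewrite powR1.
- move=> r r1; pose q := Num.max r 0.
  have q0 : 0 <= q by rewrite le_max lexx orbT.
  have q1 : q < 1 by rewrite gt_max r1 ltr01.
  have q2 : 0 < 1 - q ^+ 2 by rewrite subr_gt0 expr_lt1.
  exists ((1 - q ^+ 2) `^ gm)^-1 => [|f t d _ /growth_le/(_ d) Nf dr]; first by rewrite invr_gt0 powR_gt0.
  rewrite ler_pdivlMl ?powR_gt0//; apply: le_trans Nf; rewrite ler_wpM2r ?cabs_ge0//.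
  rewrite ge0_ler_powR ?nnegrE ?(ltW gm0) ?(ltW q2) ?(ltW (wt0 d))// lerD2l lerN2 lerXn2r ?nnegrE ?cabs_ge0//.
  by rewrite (le_trans dr)// le_max lexx.
- move=> F f C _ _ Ff FC; apply/growth_le => d.
  have cv : (fun n => wt d `^ gm * cabs (F n d)) @ \oo --> wt d `^ gm * cabs (f d).
    by apply: cvgMr; exact: complex_cvg_cabs.
  rewrite -(cvg_lim (@Rhausdorff R) cv); apply: limr_le; first exact: cvgP cv.
  by apply: nearW => n; have /growth_le := FC n; exact.
Qed.

Let disk0 : disk R := exist _ (0 : R[i]) (eq_ind_r (fun x => x < 1) ltr01 (normr0 _)).

Let bloch_le f (t : R) : (bloch_norm alpha f <= t%:E)%E ->
  [/\ 0 <= t, cabs (ext0 f 0) <= t & forall d, wt d `^ alpha * cabs ((ext0 f)^`()%classic (point d)) <= t].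
Proof.
rewrite /bloch_norm; set E := (X in ereal_sup X) => h.
have s0 : (0 <= ereal_sup E)%E.
  apply: (@le_trans _ _ ((wt disk0 `^ alpha * cabs ((ext0 f)^`()%classic (point disk0)))%:E)).
    by rewrite lee_fin mulr_ge0 ?powR_ge0 ?cabs_ge0.
  by apply: ereal_sup_ubound; exists disk0.
have c0 : cabs (ext0 f 0) <= t by rewrite -lee_fin; apply: le_trans h; rewrite leeDl.
split=> //; first by apply: le_trans c0; exact: cabs_ge0.
move=> d; rewrite -lee_fin; apply: le_trans h.
apply: (@le_trans _ _ (ereal_sup E)); last by rewrite leeDr// lee_fin cabs_ge0.
by apply: ereal_sup_ubound; exists d.
Qed.

Lemma bloch_norm_ge0 f : (0 <= bloch_norm alpha f)%E.
Proof.
rewrite /bloch_norm adde_ge0 ?lee_fin ?cabs_ge0//.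
apply: (@le_trans _ _ ((wt disk0 `^ alpha * cabs ((ext0 f)^`()%classic (point disk0)))%:E)).
  by rewrite lee_fin mulr_ge0 ?powR_ge0 ?cabs_ge0.
by apply: ereal_sup_ubound; exists disk0.
Qed.

(** Cauchy's estimate for the first coefficient on the circle of radius (1 - |d|)/2 around d: there
    the weight is at least a quarter of its value at d, as is the radius. Both quarters together
    account for the factor 4^alpha. *)
Lemma bloch_le_growth f (t : R) : analytic f -> (growth_norm f <= t%:E)%E ->
  (bloch_norm alpha f <= ((1 + 4 `^ alpha) * t)%:E)%E.
Proof.
move=> af /growth_le h; have t0 : 0 <= t.
  by apply: le_trans (h disk0); rewrite mulr_ge0 ?powR_ge0 ?cabs_ge0.
rewrite mulrDl mul1r EFinD leeD//.
  have := h disk0; rewrite /wt/= cabs0 expr0n/= subr0 powR1 mul1r lee_fin.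
  by rewrite -[f disk0]ext0_val.
apply: ge_ereal_sup => _ [d _ <-]; rewrite lee_fin -/(wt d).
have d1 := disk_cabs d; have d0 := cabs_ge0 (point d).
have rho0 : 0 < 1 - cabs (point d) by rewrite subr_gt0.
have pf := @analytic_papprox_at _ f d af; have [a ta] := papprox_taylor rho0 pf.
rewrite (papprox_derive1 rho0 pf ta).
pose r := (1 - cabs (point d)) / 2; have r0 : 0 < r by rewrite divr_gt0.
have rlt : r < 1 - cabs (point d) by rewrite /r; lra.
have rw : wt d / 4 <= r.
  rewrite /wt /r; have : (1 - cabs (point d)) ^+ 2 >= 0 by rewrite sqr_ge0.
  by rewrite expr2; nra.
have w4 : 0 < wt d / 4 by rewrite divr_gt0.
have hc : cabs (a 1%N) * r <= t / (wt d / 4) `^ gm.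
  rewrite -[r in leLHS]expr1; apply: (taylor_cauchy 1 pf ta r0 rlt) => z zr.
  have zd : cabs z <= cabs (point d) + r.
    by rewrite (le_trans (cabs_le_dist z (point d)))// lerD2l cabsC zr.
  have z1 : cabs z < 1 by apply: le_lt_trans zd _; rewrite /r; lra.
  have /diskP[y yz] := z1; rewrite -yz ext0_val.
  rewrite ler_pdivlMr ?powR_gt0// mulrC; apply: le_trans (h y); rewrite ler_wpM2r ?cabs_ge0//.
  rewrite ge0_ler_powR ?nnegrE ?(ltW gm0) ?(ltW w4) ?(ltW (wt0 y))//.
  apply: (le_trans rw); rewrite /wt yz; move: zd z1 (cabs_ge0 z); rewrite /r.
  move: (cabs z) => x; rewrite expr2; nra.
have aE : alpha = gm + 1 by rewrite subrK.
have wE : wt d = 4 * (wt d / 4) by rewrite mulrC divfK.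
rewrite {1}wE powRM ?(ltW w4)// -mulrA ler_wpM2l ?powR_ge0// {1}aE powRD ?(gt_eqF w4) ?implybT//.
rewrite powRr1 ?(ltW w4)// mulrAC -mulrA mulrC -ler_pdivlMr ?powR_gt0//; apply: le_trans hc.
by rewrite ler_wpM2l ?cabs_ge0.
Qed.

(** The derivative is integrated along the radius. Since alpha > 1, t s (1 - x s)^(-alpha) has the
    primitive [G], so [hr - G] is nonincreasing and |f(d) - f(0)| <= G(1). The weight (1 - s^2)^gm
    is at most 2^gm (1 - s)^gm, which cancels the growth of G(1). *)
Lemma growth_le_bloch f (t : R) : analytic f -> (bloch_norm alpha f <= t%:E)%E ->
  (growth_norm f <= ((1 + 2 `^ gm / gm) * t)%:E)%E.
Proof.
move=> af /bloch_le[t0 f0 h]; apply/growth_le => d.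
set s := cabs (point d); have s1 : s < 1 by exact: disk_cabs.
have s0 : 0 <= s by exact: cabs_ge0.
have [c c1 cE] := unimodularP (f d - ext0 f 0).
pose hr (x : R) := complex.Re (c * ext0 f (x%:C * point d)).
pose G (x : R) := t / gm * (1 - x * s) `^ (- gm).
have pos (x : R) : 0 <= x <= 1 -> 0 < 1 - x * s.
  by move=> /andP[x0 x1]; rewrite subr_gt0 (le_lt_trans _ s1)// ler_piMl.
have dG (x : R) : 0 <= x <= 1 -> is_derive x 1 G (t * s * (1 - x * s) `^ (- alpha)).
  move=> /pos xs; have d1 : is_derive x 1 (fun y : R => 1 - y * s) (- s).
    by apply: is_derive_eq; rewrite /GRing.scale/=; ring.
  have d2 := is_derive1_powR (- gm) xs.
  have d3 : is_derive x 1 (fun y => (1 - y * s) `^ (- gm)) (- s * (- gm * (1 - x * s) `^ (- gm - 1))).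
    have := @is_derive1_comp R (fun y => y `^ (- gm)) (fun y => 1 - y * s) x _ _ d2 d1.
    by rewrite mulrC.
  have -> : t * s * (1 - x * s) `^ (- alpha) = t / gm * (- s * (- gm * (1 - x * s) `^ (- gm - 1))).
    rewrite (_ : - gm - 1 = - alpha); last by rewrite /gm; ring.
    by field; rewrite gt_eqF.
  exact: is_deriveZ.
pose L (x : R) := complex.Re (c * (point d * (ext0 f)^`()%classic (x%:C * point d))) - t * s * (1 - x * s) `^ (- alpha).
have dh (x : R) : 0 <= x <= 1 -> is_derive x 1 (fun x : R => hr x - G x) (L x).
  move=> x01; apply: is_deriveB (dG x x01); move: (x01) => /andP[x0 x1].
  have xd : cabs (x%:C * point d) < 1 by rewrite cabsM cabs_ge0_real// -subr_gt0 pos.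
  have [y yE] := diskP xd.
  have rho0 : 0 < 1 - cabs (x%:C * point d) by rewrite subr_gt0.
  apply: (is_derive_radial c (ltW s1) rho0); rewrite -yE; exact: @analytic_papprox_at.
have L0 (x : R) : 0 <= x <= 1 -> L x <= 0.
  move=> x01; rewrite /L subr_le0; apply: le_trans (ler_norm _) _; apply: le_trans (Re_le_cabs _) _.
  rewrite !cabsM c1 mul1r -/s -mulrA mulrCA ler_wpM2l//.
  move: (x01) => /andP[x0 x1].
  have xd : cabs (x%:C * point d) = x * s by rewrite cabsM cabs_ge0_real.
  have x2 : x * s < 1 by rewrite -subr_gt0 pos.
  have /diskP[y yE] : cabs (x%:C * point d) < 1 by rewrite xd.
  rewrite -yE in xd *; have p0 := pos _ x01.
  rewrite powRN ler_pdivlMr ?powR_gt0// mulrC; apply: le_trans (h y).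
  have a0 : 0 <= alpha by rewrite (le_trans _ (ltW alpha1)).
  rewrite ler_wpM2r ?cabs_ge0// ge0_ler_powR ?nnegrE ?(ltW p0) ?(ltW (wt0 y))// /wt xd.
  by rewrite lerD2l lerN2 expr2 ler_piMl ?mulr_ge0// ltW.
have [||x x01 /eqP] := @MVT R (fun x : R => hr x - G x) L 0 1 ltr01.
- by move=> x; rewrite in_itv/= => /andP[/ltW x0 /ltW x1]; apply: dh; rewrite x0 x1.
- apply: derivable_within_continuous => x; rewrite in_itv/= => x01.
  by have := dh x x01; case.
have {x01} xx : L x <= 0 by apply: L0; move: x01; rewrite in_itv/= => /andP[/ltW -> /ltW ->].
rewrite subr0 mulr1 => /eqP e1.
have hE : hr 1 - hr 0 = cabs (f d - ext0 f 0).
  by rewrite /hr mul1r mul0r ext0_val -ReN -ReD -mulrBr cE.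
have G0 : 0 <= G 0 by rewrite mulr_ge0 ?powR_ge0// divr_ge0// ltW.
have fd : cabs (f d) <= t + G 1.
  rewrite (le_trans (cabs_le_dist _ (ext0 f 0)))// lerD// cabsC -hE.
  by move: e1 xx G0; lra.
apply: (le_trans (ler_wpM2l (powR_ge0 _ _) fd)); rewrite mulrDr mulrDl mul1r lerD//.
  rewrite ler_piMl//; have := ge0_ler_powR (ltW gm0) (ltW (wt0 d)) ler01 (wt1 d).
  by rewrite powR1.
have s1' : 0 < 1 - s by rewrite subr_gt0.
rewrite /G mul1r mulrCA powRN.
have tg : 0 <= t / gm by rewrite divr_ge0// ltW.
rewrite (_ : 2 `^ gm / gm * t = t / gm * 2 `^ gm); last by rewrite mulrC -mulrA [gm^-1 * _]mulrC mulrA.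
rewrite ler_wpM2l// ler_pdivrMr ?powR_gt0// -powRM ?(ltW s1')//.
rewrite ge0_ler_powR ?nnegrE ?(ltW gm0) ?(ltW (wt0 d)) ?mulr_ge0 ?(ltW s1')//.
rewrite /wt -/s expr2; nra.
Qed.

End BlochSpace.

(** * Area integrals *)

Section PlaneIntegrals.
Variable R : realType.
Notation mu := (@lebesgue_measure R).
Notation mu2 := (mu \x mu)%E.

(** The image of Lebesgue measure under x -> a + c x, multiplied by |c|, agrees with Lebesgue
    measure on half-open intervals and hence is equal to it. For c < 0 the preimage of such an
    interval has its closed end on the other side. *)
Lemma lebesgue_affine (a c : R) (f : R -> \bar R) : c != 0 -> measurable_fun setT f ->
  (forall x, (0 <= f x)%E) ->
  (\int[mu]_x f (a + c * x)%R = (`|c|^-1)%:E * \int[mu]_x f x)%E.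
Proof.
move=> c0 mf f0; pose phi (x : measurableTypeR R) : measurableTypeR R := a + c * x.
have mphi : measurable_fun setT phi by apply: measurable_funD => //; exact: measurable_funM.
have c1 : 0 < `|c| by rewrite normr_gt0.
pose nc : {nonneg R} := NngNum (ltW c1).
pose phim : {mfun _ >-> _} := HB.pack phi (isMeasurableFun.Build _ _ _ _ _ mphi).
have muE A : measurable A -> mu A = mscale nc (pushforward mu phim) A.
  apply: lebesgue_measure_unique => _ [[u v]] _ <-.
  transitivity (`|c|%:E * mu (phi @^-1` `]u, v]%classic))%E; last by [].
  have [cp|cn] := ltP 0 c.
    have -> : phi @^-1` `]u, v]%classic = `](u - a) / c, (v - a) / c]%classic.
      by apply/seteqP; split => x; rewrite /phi/= !in_itv/= ltr_pdivrMr// ler_pdivlMr// ltrBlDl lerBrDl [x * c]mulrC.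
    rewrite !lebesgue_measure_itv/= !lte_fin ltr_pM2r ?invr_gt0// ltrD2r.
    case: ifPn => _; rewrite ?mule0// -!EFinB -EFinM ger0_norm ?(ltW cp)//; congr EFin.
    by field.
  have {}cn : c < 0 by rewrite lt_neqAle c0.
  have -> : phi @^-1` `]u, v]%classic = `[(v - a) / c, (u - a) / c[%classic.
    by apply/seteqP; split => x; rewrite /phi/= !in_itv/= ltr_ndivlMr// ler_ndivrMr// ltrBlDl lerBrDl [x * c]mulrC andbC.
  rewrite !lebesgue_measure_itv/= !lte_fin ltr_nM2r ?invr_lt0// ltrD2r.
  case: ifPn => _; rewrite ?mule0// -!EFinB -EFinM ler0_norm ?(ltW cn)//; congr EFin.
  by field.
have step : (\int[mu]_x f x = `|c|%:E * \int[mu]_x f (a + c * x)%R)%E.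
  rewrite (eq_measure_integral (mscale nc (pushforward mu phim))); last by move=> A mA _; exact: muE.
  rewrite ge0_integral_mscale//=; congr (_ * _)%E.
  by rewrite (ge0_integral_pushforward mphi)// ?preimage_setT.
by rewrite step muleA -EFinM mulVf ?gt_eqF// mul1e.
Qed.

Implicit Types f : R * R -> \bar R.

Lemma plane_tonelli f : measurable_fun setT f -> (forall q, (0 <= f q)%E) ->
  (\int[mu2]_q f q = \int[mu]_x \int[mu]_y f (x, y))%E.
Proof.
by move=> mf f0; exact: (@fubini_tonelli1 _ _ (measurableTypeR R) (measurableTypeR R) R mu mu f mf f0).
Qed.

Lemma plane_tonelli' f : measurable_fun setT f -> (forall q, (0 <= f q)%E) ->
  (\int[mu2]_q f q = \int[mu]_y \int[mu]_x f (x, y))%E.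
Proof.
by move=> mf f0; exact: (@fubini_tonelli2 _ _ (measurableTypeR R) (measurableTypeR R) R mu mu f mf f0).
Qed.

Lemma measurable_tonelli f : measurable_fun setT f -> (forall q, (0 <= f q)%E) ->
  measurable_fun setT (fun x => \int[mu]_y f (x, y))%E.
Proof.
by move=> mf f0; exact: (@measurable_fun_fubini_tonelli_F _ _ (measurableTypeR R) (measurableTypeR R) R mu f mf f0).
Qed.

Lemma plane_le f g : measurable_fun setT f -> measurable_fun setT g ->
  (forall q, (0 <= f q)%E) -> (forall q, (f q <= g q)%E) ->
  (\int[mu2]_q f q <= \int[mu2]_q g q)%E.
Proof. by move=> mf mg f0 fg; apply: ge0_le_integral. Qed.

Lemma plane_integral_ge0 f : (forall q, (0 <= f q)%E) -> (0 <= \int[mu2]_q f q)%E.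
Proof. by move=> f0; apply: integral_ge0. Qed.

Lemma plane_integralZ (k : R) f : 0 <= k -> measurable_fun setT f -> (forall q, (0 <= f q)%E) ->
  (\int[mu2]_q (k%:E * f q) = k%:E * \int[mu2]_q f q)%E.
Proof. by move=> k0 mf f0; rewrite ge0_integralZl_EFin. Qed.

Lemma plane_integralD f g : measurable_fun setT f -> measurable_fun setT g ->
  (forall q, (0 <= f q)%E) -> (forall q, (0 <= g q)%E) ->
  (\int[mu2]_q (f q + g q) = \int[mu2]_q f q + \int[mu2]_q g q)%E.
Proof. by move=> mf mg f0 g0; rewrite ge0_integralD. Qed.

Lemma measurable_pair1 f x : measurable_fun setT f -> measurable_fun setT (fun y => f (x, y)).
Proof. by move=> mf; apply: measurableT_comp mf _; exact: measurable_fun_pair. Qed.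

Lemma measurable_pair2 f y : measurable_fun setT f -> measurable_fun setT (fun x => f (x, y)).
Proof. by move=> mf; apply: measurableT_comp mf _; exact: measurable_fun_pair. Qed.

Lemma measurable_lin (a b c d : R) f : measurable_fun setT f ->
  measurable_fun setT (fun q : R * R => f (a * q.1 + b * q.2, c * q.1 + d * q.2)).
Proof.
move=> mf; apply: measurableT_comp mf _; apply: measurable_fun_pair;
  by apply: measurable_funD; apply: measurable_funM => //; exact: measurable_fst || exact: measurable_snd.
Qed.

Lemma plane_scale (c : R) f : 0 < c -> measurable_fun setT f -> (forall q, (0 <= f q)%E) ->
  (\int[mu2]_q f (c * q.1, c * q.2)%R = (c ^- 2)%:E * \int[mu2]_q f q)%E.
Proof.
move=> c0 mf f0; have cN0 : c != 0 by rewrite gt_eqF.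
have mg : measurable_fun setT (fun q : R * R => f (c * q.1, c * q.2)).
  have := measurable_lin c 0 0 c mf; congr measurable_fun; apply/funext => q.
  by rewrite !mul0r addr0 add0r.
rewrite !plane_tonelli//=.
pose G (x : R) := (\int[mu]_y f (x, y))%E.
have G0 (x : R) : (0 <= G x)%E by exact: integral_ge0.
have mG : measurable_fun setT G by exact: measurable_tonelli.
transitivity (\int[mu]_x ((c^-1)%:E * G (0 + c * x)%R))%E.
  apply: eq_integral => x _; have := @lebesgue_affine 0 c (fun y => f (c * x, y)) cN0 (measurable_pair1 _ mf) _.
  by rewrite add0r ger0_norm ?(ltW c0)// => <-//; apply: eq_integral => y _; rewrite add0r.
rewrite ge0_integralZl_EFin//; last 2 first.
- by apply: measurableT_comp mG _; apply: measurable_funD => //; exact: measurable_funM.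
- by rewrite invr_ge0 ltW.
rewrite lebesgue_affine// ger0_norm ?(ltW c0)// muleA -EFinM; congr ((_ %:E * _)%E).
by rewrite -invfM.
Qed.

Lemma plane_shear1 (a : R) f : measurable_fun setT f -> (forall q, (0 <= f q)%E) ->
  (\int[mu2]_q f (q.1 + a * q.2, q.2)%R = \int[mu2]_q f q)%E.
Proof.
move=> mf f0.
have mg : measurable_fun setT (fun q : R * R => f (q.1 + a * q.2, q.2)).
  have := measurable_lin 1 a 0 1 mf; congr measurable_fun; apply/funext => q.
  by rewrite !mul0r !mul1r add0r.
rewrite !plane_tonelli'//=; apply: eq_integral => y _.
have := @lebesgue_affine (a * y) 1 (fun x => f (x, y)) (oner_neq0 _) (measurable_pair2 _ mf) _.
rewrite normr1 invr1 mul1e => <-//; apply: eq_integral => x _.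
by rewrite mul1r addrC.
Qed.

Lemma plane_shear2 (a : R) f : measurable_fun setT f -> (forall q, (0 <= f q)%E) ->
  (\int[mu2]_q f (q.1, q.2 + a * q.1)%R = \int[mu2]_q f q)%E.
Proof.
move=> mf f0.
have mg : measurable_fun setT (fun q : R * R => f (q.1, q.2 + a * q.1)).
  have := measurable_lin 1 0 a 1 mf; congr measurable_fun; apply/funext => q.
  by rewrite !mul0r !mul1r addr0 [_ * _ + _]addrC.
rewrite !plane_tonelli//=; apply: eq_integral => x _.
have := @lebesgue_affine (a * x) 1 (fun y => f (x, y)) (oner_neq0 _) (measurable_pair1 _ mf) _.
rewrite normr1 invr1 mul1e => <-//; apply: eq_integral => y _.
by rewrite mul1r addrC.
Qed.

Lemma plane_translate (a b : R) f : measurable_fun setT f -> (forall q, (0 <= f q)%E) ->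
  (\int[mu2]_q f (a + q.1, b + q.2)%R = \int[mu2]_q f q)%E.
Proof.
move=> mf f0.
have mg : measurable_fun setT (fun q : R * R => f (a + q.1, b + q.2)).
  apply: measurableT_comp mf _; apply: measurable_fun_pair; apply: measurable_funD => //.
have mh : measurable_fun setT (fun x => \int[mu]_y f (x, y))%E by exact: measurable_tonelli.
rewrite !plane_tonelli//=.
have := @lebesgue_affine a 1 _ (oner_neq0 _) mh _.
rewrite normr1 invr1 mul1e => <-; last by move=> x; exact: integral_ge0.
apply: eq_integral => x _; rewrite mul1r.
have := @lebesgue_affine b 1 (fun y => f (a + x, y)) (oner_neq0 _) (measurable_pair1 _ mf) _.
by rewrite normr1 invr1 mul1e => <-//; apply: eq_integral => y _; rewrite mul1r.
Qed.

Definition rot (t : R) (q : R * R) : R * R := (cos t * q.1 - sin t * q.2, sin t * q.1 + cos t * q.2).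

Lemma measurable_rot t f : measurable_fun setT f -> measurable_fun setT (f \o rot t).
Proof.
move=> mf; have := measurable_lin (cos t) (- sin t) (sin t) (cos t) mf.
by congr measurable_fun; apply/funext => q; rewrite /= /rot mulNr.
Qed.

Lemma rotD s t q : rot s (rot t q) = rot (s + t) q.
Proof. by rewrite /rot /= cosD sinD; congr (_, _); ring. Qed.

(* A rotation is a composition of three shears. *)
Let plane_rot_cos t f : cos (t / 2) != 0 -> measurable_fun setT f -> (forall q, (0 <= f q)%E) ->
  (\int[mu2]_q f (rot t q) = \int[mu2]_q f q)%E.
Proof.
move=> ch mf f0; pose h := t / 2; have tE : t = h + h by rewrite /h -splitr.
(* The shears are by -tan(t/2), sin t and -tan(t/2); [e1] and [e2] are the identities that make
   their product a rotation. *)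
pose tau := sin h / cos h; have cs := cos2Dsin2 h.
have tc : tau * cos h = sin h by rewrite /tau divfK.
have sE : sin t = 2 * (sin h * cos h) by rewrite tE sinD; ring.
have cE : cos t = cos h ^+ 2 - sin h ^+ 2 by rewrite tE cosD !expr2.
have e1 : 1 - tau * sin t = cos t.
  rewrite sE cE (_ : tau * _ = 2 * (sin h * (tau * cos h))); last by ring.
  by rewrite tc; move: cs; rewrite !expr2; lra.
have e2 : tau * (1 + cos t) = sin t.
  rewrite sE cE (_ : 1 + _ = 2 * (cos h * cos h)); last by move: cs; rewrite !expr2; lra.
  by rewrite -tc; ring.
pose f1 (q : R * R) := f (q.1 + (- tau) * q.2, q.2).
have mf1 : measurable_fun setT f1.
  have := measurable_lin 1 (- tau) 0 1 mf; congr measurable_fun; apply/funext => q.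
  by rewrite /f1 !mul0r !mul1r add0r.
pose f2 (q : R * R) := f1 (q.1, q.2 + sin t * q.1).
have mf2 : measurable_fun setT f2.
  have := measurable_lin 1 0 (sin t) 1 mf1; congr measurable_fun; apply/funext => q.
  by rewrite /f2 !mul0r !mul1r addr0 [_ * _ + _]addrC.
rewrite -(plane_shear1 (- tau) mf f0) -/f1.
rewrite -(plane_shear2 (sin t) mf1 (fun q => f0 _)) -/f2.
rewrite -(plane_shear1 (- tau) mf2 (fun q => f0 _)).
apply: eq_integral => q _; rewrite /f2 /f1 /rot /=; congr (f (_, _)).
  by rewrite -e1 -[X in _ - X * _]e2 -e1; ring.
by rewrite -[X in _ + X * _]e1; ring.
Qed.

Lemma plane_rot t f : measurable_fun setT f -> (forall q, (0 <= f q)%E) ->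
  (\int[mu2]_q f (rot t q) = \int[mu2]_q f q)%E.
Proof.
move=> mf f0; have [ch|] := boolP (cos (t / 2) != 0); first exact: plane_rot_cos.
rewrite negbK => /eqP ch0.
have ch : cos (t / 2 / 2) != 0.
  apply/eqP => c0; have := cosD (t / 2 / 2) (t / 2 / 2).
  rewrite -splitr ch0 c0 mul0r sub0r => /esym/eqP; rewrite oppr_eq0 -expr2 sqrf_eq0 => /eqP s0.
  by have := cos2Dsin2 (t / 2 / 2); rewrite c0 s0 expr0n/= addr0 => /esym/eqP; rewrite oner_eq0.
have := plane_rot_cos ch (measurable_rot (t / 2) mf) (fun q => f0 _).
rewrite (plane_rot_cos ch mf f0) => <-; apply: eq_integral => q _.
by rewrite /= rotD -splitr.
Qed.

End PlaneIntegrals.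

Section Jensen.
Variables (R : realType) (d : measure_display) (T : measurableType d).
Variables (mu : {measure set T -> \bar R}) (D : set T).

(** Young's inequality y <= A + A^(1-p) y^p is integrated against [v]. With the balancing choice of
    A the two resulting terms are equal, whence the factor 2^p, and all integrands stay nonnegative,
    so infinite integrals need no separate theory. *)
Lemma jensen_powR (v h : T -> R) (p V x : R) : measurable D ->
  measurable_fun D v -> measurable_fun D h ->
  (forall y, D y -> 0 <= v y) -> (forall y, D y -> 0 <= h y) -> 1 <= p -> 0 < V -> 0 <= x ->
  (\int[mu]_(y in D) (v y)%:E <= V%:E)%E -> (x%:E <= \int[mu]_(y in D) (v y * h y)%:E)%E ->
  ((x `^ p)%:E <= (2 `^ p * V `^ (p - 1))%:E * \int[mu]_(y in D) (v y * h y `^ p)%:E)%E.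
Proof.
move=> mD mv mh v0 h0 p1 V0 x0 vV xI; have p0 : 0 < p by exact: lt_le_trans p1.
have c0 : 0 < 2 `^ p * V `^ (p - 1) by rewrite mulr_gt0 ?powR_gt0.
have mvh : measurable_fun D (fun y => v y * h y `^ p).
  by apply: measurable_funM => //; exact: measurableT_comp (measurable_powR p) mh.
set I := (X in (_ <= _ * X)%E).
have I0 : (0 <= I)%E by apply: integral_ge0 => y Dy; rewrite lee_fin mulr_ge0 ?powR_ge0 ?v0.
have [->|Ioo] := eqVneq I +oo%E; first by rewrite gt0_muley ?lte_fin// leey.
have Ir : I \is a fin_num by rewrite ge0_fin_numE// ltey.
rewrite -(fineK Ir) -EFinM lee_fin; set r := fine I.
have r0 : 0 <= r by rewrite fine_ge0.
suff H J : r < J -> x `^ p <= 2 `^ p * V `^ (p - 1) * J.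
  apply/ler_addgt0Pr => e e0.
  have := H (r + e / (2 `^ p * V `^ (p - 1))); rewrite ltrDl divr_gt0// => /(_ isT).
  by rewrite mulrDr [X in _ + X]mulrC divfK ?gt_eqF.
move=> rJ; have J0 : 0 < J by exact: le_lt_trans rJ.
(* This A solves A V = A^(1-p) J. Working with J > r instead of the integral [r] itself keeps A
   positive when the integral is 0. *)
pose A := (J / V) `^ p^-1; have JV : 0 < J / V by rewrite divr_gt0.
have A0 : 0 < A by exact: powR_gt0.
have Ap : A `^ p = J / V by rewrite /A -powRrM mulVf ?gt_eqF// powRr1 ?(ltW JV).
have young y : 0 <= y -> y <= A + A `^ (1 - p) * y `^ p.
  move=> y0; have [yA|Ay] := leP y A; first by rewrite (le_trans yA)// lerDl mulr_ge0 ?powR_ge0.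
  have y1 : 0 < y by exact: lt_trans Ay.
  rewrite (le_trans (_ : _ <= A `^ (1 - p) * y `^ p)) ?lerDr ?(ltW A0)//.
  have {1}-> : y = y `^ (1 - p) * y `^ p.
    by rewrite -powRD ?subrK ?powRr1// (gt_eqF y1) implybT.
  rewrite ler_wpM2r ?powR_ge0// -opprB !powRN lef_pV2 ?posrE ?powR_gt0//.
  by rewrite ge0_ler_powR ?nnegrE ?subr_ge0 ?(ltW A0) ?(ltW Ay).
have xb : x <= A * V + A `^ (1 - p) * J.
  rewrite -lee_fin; apply: (le_trans xI).
  apply: (@le_trans _ _ (\int[mu]_(y in D) (A%:E * (v y)%:E + (A `^ (1 - p))%:E * (v y * h y `^ p)%:E))%E).
    apply: ge0_le_integral => //.
    - by move=> y Dy; rewrite lee_fin mulr_ge0 ?v0 ?h0.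
    - by apply/measurable_EFinP/measurable_funM.
    - by apply: emeasurable_funD; apply: emeasurable_funM => //; exact/measurable_EFinP.
    move=> y Dy; rewrite -!EFinM -EFinD lee_fin.
    by rewrite [A * _]mulrC mulrCA -mulrDr ler_wpM2l ?v0 ?young ?h0.
  rewrite ge0_integralD//; last 4 first.
  - by move=> y Dy; rewrite mule_ge0// lee_fin ?v0 ?(ltW A0).
  - by apply: emeasurable_funM => //; exact/measurable_EFinP.
  - by move=> y Dy; rewrite mule_ge0// lee_fin ?mulr_ge0 ?v0 ?powR_ge0.
  - by apply: emeasurable_funM => //; exact/measurable_EFinP.
  rewrite !ge0_integralZl_EFin//; last 5 first.
  - by move=> y Dy; rewrite lee_fin mulr_ge0 ?v0 ?powR_ge0.
  - exact/measurable_EFinP.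
  - exact: powR_ge0.
  - exact/measurable_EFinP.
  - exact: ltW.
  rewrite EFinD !EFinM leeD// lee_wpmul2l ?lee_fin ?powR_ge0 ?(ltW A0)//.
  by rewrite -/I -(fineK Ir) lee_fin ltW.
have AJ : A `^ (1 - p) * J = A * V.
  rewrite powRD ?(gt_eqF A0) ?implybT// powRr1 ?(ltW A0)// powRN Ap invf_div -mulrA divfK ?gt_eqF//.
have {}xb : x <= 2 * (A * V) by rewrite mulr_natl mulr2n -{2}AJ.
have AV : 0 <= A * V by rewrite mulr_ge0 ?(ltW A0) ?(ltW V0).
have := ge0_ler_powR (ltW p0) x0 (mulr_ge0 (ler0n _ 2) AV) xb.
move=> h1; apply: (le_trans h1); rewrite powRM// powRM ?(ltW A0) ?(ltW V0)// Ap -mulrA ler_wpM2l ?powR_ge0//.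
have -> : V `^ p = V `^ (p - 1) * V by rewrite -[X in _ * X]powRr1 ?(ltW V0)// -powRD ?subrK// (gt_eqF V0) implybT.
by rewrite mulrCA divfK ?gt_eqF.
Qed.

End Jensen.

Section DiscMeans.
Variable R : realType.
Notation mu := (@lebesgue_measure R).
Notation mu2 := (mu \x mu)%E.

Definition cpt (q : R * R) : R[i] := q.1 +i* q.2.

Lemma cpt_rot t q : cpt (rot t q) = cexp t * cpt q.
Proof. by rewrite /cpt /rot /cexp; apply/eqP; rewrite eq_complex /= eqxx addrC eqxx. Qed.

Lemma cexp_pi : cexp pi = -1 :> R[i].
Proof. by rewrite /cexp cospi sinpi; apply/eqP; rewrite eq_complex /= oppr0 !eqxx. Qed.

Lemma cmeasurable_cpt D : cmeasurable D cpt.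
Proof. by split; [exact: measurable_funS measurable_fst|exact: measurable_funS measurable_snd]. Qed.

Lemma measurable_ball (c : R[i]) (s : R) : measurable [set q | cabs (cpt q - c) < s].
Proof.
have m : measurable_fun setT (fun q => cabs (cpt q - c)).
  by apply/measurable_cabs/cmeasurableD; [exact: cmeasurable_cpt|exact: cmeasurable_cst].
by rewrite -[X in measurable X]setTI; exact: (measurable_fun_ltr m (measurable_cst s)).
Qed.

Definition ball_ind (c : R[i]) (s : R) : R * R -> R := \1_[set q | cabs (cpt q - c) < s].

Lemma measurable_ball_ind c s : measurable_fun setT (ball_ind c s).
Proof. exact: measurable_indic (measurable_ball c s). Qed.

Lemma ball_indE c s q : ball_ind c s q = (cabs (cpt q - c) < s)%R%:R.
Proof.
rewrite /ball_ind indicE (_ : (_ \in _) = (cabs (cpt q - c) < s)%R)//.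
by apply/idP/idP; rewrite inE.
Qed.

Lemma ball_ind_ge0 c s q : 0 <= ball_ind c s q.
Proof. by rewrite ball_indE. Qed.

Lemma ball_area_le c (s : R) : 0 < s -> (\int[mu2]_q (ball_ind c s q)%:E <= (4 * s ^+ 2)%:E)%E.
Proof.
move=> s0; pose a := complex.Re c; pose b := complex.Im c.
pose A : set R := `[a - s, a + s]%classic; pose B : set R := `[b - s, b + s]%classic.
pose S : set (R * R) := A `*` B.
apply: (@le_trans _ _ (mu2 S)).
  rewrite /ball_ind integral_indic//; last exact: measurable_ball.
  rewrite setIT; apply: le_measure; rewrite ?inE; [exact: measurable_ball|by apply: measurableX; exact: measurable_itv|].
  move=> q /= h; rewrite /S/A/B/=.
  have h1 := le_lt_trans (Re_le_cabs _) h; have h2 := le_lt_trans (Im_le_cabs _) h.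
  move: h1 h2; rewrite ReD ReN ImD ImN/= !ltr_norml -/a -/b !in_itv/=.
  by move=> /andP[? ?] /andP[? ?]; split; apply/andP; split; lra.
have -> : mu2 S = (mu A * mu B)%E.
  by rewrite /S [LHS]product_measure1E; [|exact: measurable_itv|exact: measurable_itv].
rewrite !lebesgue_measure_itv/= !lte_fin.
have -> : a - s < a + s by lra.
have -> : b - s < b + s by lra.
by rewrite -!EFinB -EFinM lee_fin expr2; nra.
Qed.

Lemma ball_area_ge c (s : R) : 0 < s -> ((s ^+ 2)%:E <= \int[mu2]_q (ball_ind c s q)%:E)%E.
Proof.
move=> s0; pose a := complex.Re c; pose b := complex.Im c.
pose A : set R := `]a - s / 2, a + s / 2[%classic; pose B : set R := `]b - s / 2, b + s / 2[%classic.
pose S : set (R * R) := A `*` B.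
have mA : measurable A by exact: measurable_itv.
have mB : measurable B by exact: measurable_itv.
apply: (@le_trans _ _ (mu2 S)).
  have -> : mu2 S = (mu A * mu B)%E by rewrite /S [LHS]product_measure1E.
  rewrite !lebesgue_measure_itv/= !lte_fin.
  have -> : a - s / 2 < a + s / 2 by lra.
  have -> : b - s / 2 < b + s / 2 by lra.
  by rewrite -!EFinB -EFinM lee_fin expr2; nra.
rewrite /ball_ind integral_indic//; last exact: measurable_ball.
rewrite setIT; apply: le_measure; rewrite ?inE; [by apply: measurableX|exact: measurable_ball|].
move=> q /=; rewrite /S/A/B/= !in_itv/= => -[/andP[h1 h2] /andP[h3 h4]].
apply: le_lt_trans (cabs_le_ReIm _) _; rewrite ReD ReN ImD ImN/= -/a -/b.
have k1 : `|q.1 - a| < s / 2 by rewrite ltr_norml; apply/andP; split; lra.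
have k2 : `|q.2 - b| < s / 2 by rewrite ltr_norml; apply/andP; split; lra.
by rewrite (splitr s) ltrD.
Qed.

(* The half sum of P(z) and P(omega z), with omega^(2^m) = -1, keeps P(0) and removes
   the powers z^k with k an odd multiple of 2^m. *)
Lemma disc_mean_poly (P : {poly R[i]}) (s : R) : 0 < s ->
  ((cabs P.[0])%:E * \int[mu2]_q (ball_ind 0 s q)%:E <=
   \int[mu2]_q (ball_ind 0 s q * cabs P.[cpt q])%:E)%E.
Proof.
move=> s0; pose phi (Q : {poly R[i]}) q := (ball_ind 0 s q * cabs Q.[cpt q])%:E.
have mphi Q : measurable_fun setT (phi Q).
  apply/measurable_EFinP/measurable_funM; first exact: measurable_ball_ind.
  by apply/measurable_cabs/cmeasurable_horner/cmeasurable_cpt.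
have phi0 Q q : (0 <= phi Q q)%E by rewrite lee_fin mulr_ge0 ?ball_ind_ge0 ?cabs_ge0.
have mb : measurable_fun setT (fun q : R * R => (ball_ind 0 s q)%:E).
  by apply/measurable_EFinP; exact: measurable_ball_ind.
(* After m steps only coefficients whose index is divisible by 2^m remain; n counts the steps until
   2^(m+n) reaches the size and the constant term alone is left. *)
suff H n : forall m (Q : {poly R[i]}), (size Q <= 2 ^ (m + n))%N ->
    (forall k, ~~ (2 ^ m %| k)%N -> Q`_k = 0) ->
    ((cabs Q.[0])%:E * \int[mu2]_q (ball_ind 0 s q)%:E <= \int[mu2]_q phi Q q)%E.
  apply: (H (size P) 0%N) => [|k]; last by rewrite dvd1n.
  by rewrite ltnW// ltn_expl.
elim: n => [|n ih] m Q sQ Q0.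
  have QE : Q = (Q`_0)%:P.
    apply/polyP => k; rewrite coefC; case: eqP => [->//|/eqP k0].
    have [kQ|Qk] := ltnP k (size Q); last by rewrite nth_default.
    rewrite Q0// gtnNdvd ?lt0n// (leq_trans kQ)//; by rewrite addn0 in sQ.
  have b0 q : (0 <= (ball_ind 0 s q)%:E)%E by rewrite lee_fin ball_ind_ge0.
  rewrite {1}QE hornerC -plane_integralZ ?cabs_ge0//; apply: plane_le => //.
  - by apply: emeasurable_funM => //; exact: mb.
  - by move=> q; rewrite mule_ge0// lee_fin cabs_ge0.
  - by move=> q; rewrite /phi QE hornerC coefC/= -EFinM mulrC.
pose w : R[i] := cexp (pi / (2 ^ m)%:R).
pose Q' := \poly_(k < size Q) (Q`_k * ((1 + w ^+ k) / 2)).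
have Q'z z : Q'.[z] = (Q.[z] + Q.[w * z]) / 2.
  rewrite /Q' horner_poly !horner_coef -big_split/= mulr_suml; apply: eq_bigr => k _.
  by rewrite exprMn; field.
have Q'0 : Q'.[0] = Q.[0] by rewrite Q'z mulr0; field.
have sQ' : (size Q' <= 2 ^ (m.+1 + n))%N by rewrite (leq_trans (size_poly _ _))// addSnnS.
have dQ' k : ~~ (2 ^ m.+1 %| k)%N -> Q'`_k = 0.
  rewrite coef_poly; case: ifP => // _ nk.
  have [/dvdnP[j kE]|/Q0 ->] := boolP (2 ^ m %| k)%N; last by rewrite mul0r.
  have oj : odd j.
    apply: contraNT nk; rewrite -dvdn2 kE => /dvdnP[i ->].
    by rewrite -mulnA -expnS dvdn_mull.
  have wk : w ^+ k = -1.
    have m0 : (2 ^ m)%:R != 0 :> R by rewrite pnatr_eq0 expn_eq0.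
    rewrite cexpX kE natrM -mulrA [_%:R * (pi / _)]mulrC divfK// -cexpX cexp_pi.
    by rewrite -signr_odd oj expr1.
  by rewrite wk subrr mul0r mulr0.
rewrite -Q'0; apply: (le_trans (ih m.+1 Q' sQ' dQ')).
have rotQ : (\int[mu2]_q phi Q (rot (pi / (2 ^ m)%:R) q) = \int[mu2]_q phi Q q)%E.
  exact: plane_rot.
have mr : measurable_fun setT (fun q => phi Q (rot (pi / (2 ^ m)%:R) q)) by exact: measurable_rot.
have md : measurable_fun setT (fun q => phi Q q + phi Q (rot (pi / (2 ^ m)%:R) q))%E.
  exact: emeasurable_funD.
apply: (@le_trans _ _ (\int[mu2]_q ((2^-1)%:E * (phi Q q + phi Q (rot (pi / (2 ^ m)%:R) q))))%E).
  apply: plane_le => //; first exact: emeasurable_funM.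
  move=> q; rewrite /phi -EFinD -EFinM lee_fin !ball_indE !subr0 cpt_rot cabsM cabs_cexp mul1r -mulrDr mulrCA.
  by rewrite ler_wpM2l// Q'z cabsM cabsV cabs_nat mulrC ler_wpM2l ?invr_ge0// cabsD.
rewrite plane_integralZ ?invr_ge0//; last by move=> q; rewrite adde_ge0.
rewrite plane_integralD// rotQ.
case: (\int[mu2]_q phi Q q)%E (plane_integral_ge0 (phi0 Q)) => [r| |]//= r0; last by rewrite leey.
by rewrite -EFinD -EFinM lee_fin; lra.
Qed.

End DiscMeans.

Section PowerIntegrals.
Variable R : realType.
Notation mu := (@lebesgue_measure R).

Lemma is_derive_FTC2 (F f : R -> R) (u v : R) : u < v ->
  (forall x, u <= x <= v -> is_derive x 1 F (f x)) ->
  (forall x, u <= x <= v -> {for x, continuous f}) ->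
  (\int[mu]_(x in `[u, v]) (f x)%:E = (F v - F u)%:E)%E.
Proof.
move=> uv dF cf.
have cF x : u <= x <= v -> {for x, continuous F}.
  by move=> xuv; apply/differentiable_continuous/derivable1_diffP; case: (dF x xuv).
rewrite (@continuous_FTC2 _ f F u v uv) ?EFinB//.
- apply: continuous_in_subspaceT => x; rewrite inE/= in_itv/= => xuv; exact: cf.
- split.
  + by move=> x; rewrite in_itv/= => /andP[/ltW ux /ltW xv]; case: (dF x); rewrite ?ux ?xv.
  + by apply: cvg_at_right_filter; apply: cF; rewrite lexx ltW.
  + by apply: cvg_at_left_filter; apply: cF; rewrite lexx ltW.
- move=> x; rewrite in_itv/= => /andP[/ltW ux /ltW xv].
  have xx : u <= x <= v by rewrite ux xv.
  by have [_ <-] := dF x xx; rewrite derive1E.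
Qed.

Lemma integral_powR_segment (a u v : R) : a != 0 -> 0 < u -> u < v ->
  (\int[mu]_(x in `[u, v]) (x `^ (a - 1))%:E = ((v `^ a - u `^ a) / a)%:E)%E.
Proof.
move=> a0 u0 uv.
have pos x : u <= x <= v -> 0 < x by move=> /andP[ux _]; exact: lt_le_trans ux.
have -> : (v `^ a - u `^ a) / a = a^-1 * v `^ a - a^-1 * u `^ a by rewrite -mulrBr mulrC.
apply: (@is_derive_FTC2 (fun x => a^-1 * x `^ a) (fun x => x `^ (a - 1)) u v uv).
- move=> x /pos x0; have h : is_derive x 1 (fun t : R => t `^ a) (a * x `^ (a - 1)) by exact: is_derive1_powR.
  by have := is_deriveZ a^-1 h; rewrite /GRing.scale/= mulKf.
- move=> x /pos x0; apply/differentiable_continuous/derivable1_diffP.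
  by have h : is_derive x 1 (fun t : R => t `^ (a - 1)) ((a - 1) * x `^ (a - 1 - 1)) by exact: is_derive1_powR; case: h.
Qed.

(** A point where [f] is nonzero lies in all late [A n], so the restrictions converge pointwise to
    [f] and Fatou's lemma applies. *)
Lemma integral_exhaust (A : nat -> set R) (f : R -> R) (C : R) :
  measurable_fun setT f -> (forall x, 0 <= f x) -> (forall n, measurable (A n)) ->
  (forall x, f x != 0 -> \forall n \near \oo, A n x) ->
  (forall n, \int[mu]_(x in A n) (f x)%:E <= C%:E)%E -> (\int[mu]_x (f x)%:E <= C%:E)%E.
Proof.
move=> mf f0 mA Af AC.
pose F n x := (\1_(A n) x * f x)%:E.
have mF n : measurable_fun setT (F n).
  by apply/measurable_EFinP/measurable_funM => //; exact: measurable_indic.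
have F0 n x : setT x -> (0 <= F n x)%E by move=> _; rewrite lee_fin mulr_ge0.
have cF x : F ^~ x @ \oo --> (f x)%:E.
  have [fx0|/Af] := eqVneq (f x) 0.
    rewrite /F fx0; under eq_fun do rewrite mulr0; exact: cvg_cst.
  move=> h; apply: cvg_near_cst; apply: filterS h => n An.
  by rewrite /F indicE mem_set// mul1r.
have e1 n : (\int[mu]_x F n x = \int[mu]_(x in A n) (f x)%:E)%E.
  rewrite [RHS]integral_mkcond; apply: eq_integral => x _; rewrite /F patchE indicE.
  by case: ifPn; rewrite ?mul1r ?mul0r.
rewrite (_ : (\int[mu]_x (f x)%:E)%E = (\int[mu]_x limn_einf (F ^~ x))%E); last first.
  by apply: eq_integral => x _; rewrite (cvg_limn_einf_sup (cF x)).1.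
apply: le_trans (fatou mu measurableT mF F0) _.
rewrite limn_einf_lim; apply: lime_le; first exact: is_cvg_einfs.
apply: nearW => n; apply: le_trans (AC n); rewrite -e1.
by apply: ereal_inf_lbound; exists n => //=.
Qed.

Lemma measurable_powR_itv (i : interval R) (a : R) :
  measurable_fun setT (fun t : R => \1_([set` i]) t * t `^ a).
Proof.
apply: measurable_funM; first exact: measurable_indic (measurable_itv _).
exact: measurable_powR.
Qed.

Lemma integral_powR_near0 (a : R) : 0 < a ->
  (\int[mu]_t (\1_(`]0, 1]%classic : set R) t * t `^ (a - 1))%:E <= (a^-1)%:E)%E.
Proof.
move=> a0; have aN0 : a != 0 by rewrite gt_eqF.
apply: (@integral_exhaust (fun n => `[n.+2%:R^-1, 1]%classic)).
- exact: measurable_powR_itv.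
- by move=> t; rewrite mulr_ge0 ?powR_ge0.
- by move=> n; exact: measurable_itv.
- move=> t; rewrite indicE; case: (boolP (t \in _)) => [|_]; last by rewrite mul0r eqxx.
  rewrite inE/= in_itv/= => /andP[t0 t1] _.
  have [N _ hN] := near_infty_natSinv_lt (PosNum t0).
  exists N => // n /= Nn; rewrite in_itv/= t1 andbT (le_trans _ (ltW (hN n Nn)))//.
  by rewrite lef_pV2 ?posrE// ler_nat.
- move=> n; have n0 : 0 < n.+2%:R^-1 :> R by rewrite invr_gt0.
  have n1 : n.+2%:R^-1 < 1 :> R by rewrite invf_lt1// ltr1n.
  rewrite (_ : (\int[mu]_(t in _) _)%E = (\int[mu]_(t in `[n.+2%:R^-1%R, 1%R]) (t `^ (a - 1))%:E)%E); last first.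
    apply: eq_integral => t; rewrite inE/= in_itv/= => /andP[t0 t1].
    by rewrite indicE mem_set ?mul1r//= in_itv/= t1 (lt_le_trans n0).
  rewrite integral_powR_segment// powR1 lee_fin ler_pdivrMr// mulVf//.
Qed.

Lemma integral_powR_near_infty (e : R) : 0 < e ->
  (\int[mu]_t (\1_(`]1, +oo[%classic : set R) t * t `^ (- e - 1))%:E <= (e^-1)%:E)%E.
Proof.
move=> e0; have eN0 : - e != 0 by rewrite oppr_eq0 gt_eqF.
apply: (@integral_exhaust (fun n => `[1, n.+2%:R]%classic)).
- exact: measurable_powR_itv.
- by move=> t; rewrite mulr_ge0 ?powR_ge0.
- by move=> n; exact: measurable_itv.
- move=> t; rewrite indicE; case: (boolP (t \in _)) => [|_]; last by rewrite mul0r eqxx.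
  rewrite inE/= in_itv/= andbT => t1 _.
  exists (Num.Def.truncn t) => // n /= Nn; rewrite in_itv/= (ltW t1)/=.
  rewrite (le_trans (ltW (truncnS_gt _)))// ler_nat (leq_trans _ (leqnSn _))//.
- move=> n; have n1 : 1 < n.+2%:R :> R by rewrite ltr1n.
  apply: (@le_trans _ _ (\int[mu]_(t in `[1%R, n.+2%:R]) (t `^ (- e - 1))%:E)%E).
    apply: ge0_le_integral => //.
    + by move=> t _; rewrite lee_fin mulr_ge0 ?powR_ge0.
    + by apply/measurable_EFinP; apply: measurable_funS (measurable_powR_itv _ _).
    + by apply/measurable_EFinP; exact: measurable_funS (measurable_powR _).
    by move=> t _; rewrite lee_fin indicE; case: (t \in _); rewrite ?mul1r// mul0r powR_ge0.
  rewrite integral_powR_segment// powR1 lee_fin invrN mulrN -mulNr opprB.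
  by rewrite ler_pdivrMr// mulVf ?gt_eqF// gerBl powR_ge0.
Qed.

End PowerIntegrals.

Section DiscMeansAnalytic.
Variable R : realType.
Notation mu := (@lebesgue_measure R).
Notation mu2 := (mu \x mu)%E.
Implicit Types (F : R[i] -> R[i]) (c : R[i]).

Lemma disc_mean_papprox F c (rho s : R) : papprox c rho F -> cmeasurable setT (F \o @cpt R) ->
  0 < s -> s < rho ->
  ((s ^+ 2 * cabs (F c))%:E <= \int[mu2]_q (ball_ind c s q * cabs (F (cpt q)))%:E)%E.
Proof.
move=> pF mF s0 sr; pose a := complex.Re c; pose b := complex.Im c.
have s20 : 0 < s ^+ 2 by rewrite exprn_gt0.
have mb c' : measurable_fun setT (fun q : R * R => (ball_ind c' s q)%:E).
  by apply/measurable_EFinP; exact: measurable_ball_ind.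
have b0 c' q : (0 <= (ball_ind c' s q)%:E)%E by rewrite lee_fin ball_ind_ge0.
have mphi (G : R[i] -> R[i]) c' : cmeasurable setT (G \o @cpt R) ->
    measurable_fun setT (fun q : R * R => (ball_ind c' s q * cabs (G (cpt q)))%:E).
  move=> mG; apply/measurable_EFinP; apply: measurable_funM; first exact: measurable_ball_ind.
  exact: (measurable_cabs mG).
have phi0 (G : R[i] -> R[i]) c' q : (0 <= (ball_ind c' s q * cabs (G (cpt q)))%:E)%E.
  by rewrite lee_fin mulr_ge0 ?ball_ind_ge0 ?cabs_ge0.
have meanP (P : {poly R[i]}) : ((s ^+ 2 * cabs P.[c])%:E <=
    \int[mu2]_q (ball_ind c s q * cabs P.[cpt q])%:E)%E.
  have := disc_mean_poly (P \Po ('X + c%:P)) s0.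
  rewrite horner_comp !hornerE => h.
  apply: le_trans (_ : (_ <= (cabs P.[c])%:E * \int[mu2]_q (ball_ind 0 s q)%:E)%E) _.
    by rewrite mulrC EFinM lee_wpmul2l ?lee_fin ?cabs_ge0// ball_area_ge.
  apply: (le_trans h).
  have mP := mphi (horner P) c (cmeasurable_horner P (cmeasurable_cpt _)).
  rewrite -(plane_translate a b mP (phi0 (horner P) c)) le_eqVlt; apply/orP; left; apply/eqP.
  apply: eq_integral => q _; have cE : cpt (a + q.1, b + q.2) = cpt q + c.
    by rewrite /cpt /a /b; case: (c) => x y; apply/eqP; rewrite eq_complex /= addrC eqxx/= addrC eqxx.
  by rewrite !ball_indE cE addrK subr0 horner_comp !hornerE.
(* Of the five parts of the error, four come from integrating [e'] over the disc, of area at most 4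
   s^2, and one from the value at the centre. *)
apply/lee_addgt0Pr => e e0; pose e' := e / (5 * s ^+ 2).
have e'0 : 0 < e' by rewrite divr_gt0// mulr_gt0.
have [P hP] := pF s e' sr e'0.
apply: (@le_trans _ _ ((s ^+ 2 * cabs P.[c])%:E + (s ^+ 2 * e')%:E)%E).
  rewrite -EFinD lee_fin -mulrDr ler_wpM2l ?(ltW s20)//.
  rewrite (le_trans (cabs_le_dist (F c) P.[c]))// lerD2l cabsC; apply: hP.
  by rewrite subrr cabs0 ltW.
have mP := mphi (horner P) c (cmeasurable_horner P (cmeasurable_cpt _)).
apply: (@le_trans _ _ (\int[mu2]_q ((ball_ind c s q * cabs (F (cpt q)))%:E + e'%:E * (ball_ind c s q)%:E) +
    (s ^+ 2 * e')%:E)%E).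
  rewrite leeD2r//; apply: le_trans (meanP P) _; apply: plane_le => //.
  - apply: emeasurable_funD; first exact: mphi.
    by apply: emeasurable_funM => //; exact: mb.
  move=> q; rewrite -EFinM -EFinD lee_fin ball_indE.
  case: ltP => h; last by rewrite !mul0r mulr0 addr0.
  by rewrite !mul1r mulr1 (le_trans (cabs_le_dist P.[cpt q] (F (cpt q))))// lerD2l hP// ltW.
rewrite plane_integralD//; last 3 first.
- exact: mphi.
- by apply: emeasurable_funM => //; exact: mb.
- by move=> q; rewrite mule_ge0// lee_fin ltW.
rewrite plane_integralZ ?(ltW e'0)// -addeA leeD2l//.
apply: (@le_trans _ _ (e'%:E * (4 * s ^+ 2)%:E + (s ^+ 2 * e')%:E)%E).
  by rewrite leeD2r// lee_wpmul2l ?lee_fin ?(ltW e'0)// ball_area_le.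
rewrite -EFinM -EFinD lee_fin (_ : _ + _ = e' * (5 * s ^+ 2)); last by ring.
by rewrite divfK// gt_eqF// mulr_gt0.
Qed.

(** [jensen_powR] with weight the indicator of the disc and V = 4 s^2; its constant satisfies 2^p
    4^(p-1) <= 8^p. *)
Lemma disc_mean_powR F c (rho s p : R) : papprox c rho F -> cmeasurable setT (F \o @cpt R) ->
  0 < s -> s < rho -> 1 <= p ->
  ((cabs (F c) `^ p)%:E <=
   (8 `^ p / s ^+ 2)%:E * \int[mu2]_q (ball_ind c s q * cabs (F (cpt q)) `^ p)%:E)%E.
Proof.
move=> pF mF s0 sr p1; have s20 : 0 < s ^+ 2 by rewrite exprn_gt0.
have V0 : 0 < 4 * s ^+ 2 by rewrite mulr_gt0.
have x0 : 0 <= s ^+ 2 * cabs (F c) by rewrite mulr_ge0 ?cabs_ge0 ?(ltW s20).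
have := @jensen_powR R _ _ mu2 setT (ball_ind c s) (fun q => cabs (F (cpt q))) p _ _ measurableT
  (measurable_ball_ind c s) (measurable_cabs mF) (fun q _ => ball_ind_ge0 c s q)
  (fun q _ => cabs_ge0 _) p1 V0 x0 (ball_area_le c s0) (disc_mean_papprox pF mF s0 sr).
set I := (X in (_ <= _ * X)%E); move=> h.
have I0 : (0 <= I)%E.
  by apply: plane_integral_ge0 => q; rewrite lee_fin mulr_ge0 ?ball_ind_ge0 ?powR_ge0.
have sp : 0 < (s ^+ 2) `^ p by rewrite powR_gt0.
have -> : cabs (F c) `^ p = ((s ^+ 2) `^ p)^-1 * (s ^+ 2 * cabs (F c)) `^ p.
  by rewrite powRM ?cabs_ge0 ?(ltW s20)// mulKf// gt_eqF.
rewrite EFinM; apply: le_trans (lee_wpmul2l _ h) _; first by rewrite lee_fin invr_ge0 ltW.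
rewrite muleA -EFinM lee_wpmul2r// lee_fin mulrC ler_pdivrMr//.
have -> : (s ^+ 2) `^ p = (s ^+ 2) `^ (p - 1) * s ^+ 2.
  by rewrite -[X in _ = _ * X]powRr1 ?(ltW s20)// -powRD ?subrK// (gt_eqF s20) implybT.
rewrite mulrACA mulVf ?gt_eqF// mulr1 powRM ?(ltW s20)// mulrA ler_wpM2r ?powR_ge0//.
rewrite (_ : 8 = 2 * 4); last by ring.
rewrite powRM// ler_wpM2l ?powR_ge0// ler_powR ?ler1n// gerBl ler01//.
Qed.

Lemma cmeasurable_ext0 (f : disk R -> R[i]) : analytic f -> cmeasurable setT (ext0 f \o @cpt R).
Proof.
move=> /analyticP af; pose D := [set q | cabs (cpt q - 0) < 1] : set (R * R).
have mD : measurable D by exact: measurable_ball.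
have [mR mI] : cmeasurable D (ext0 f \o @cpt R).
  by apply: cmeasurable_papprox af (cmeasurable_cpt _) _ => q; rewrite /D/= subr0.
have out q : ~ D q -> ext0 f (cpt q) = 0.
  move=> Dq; rewrite /ext0; case: insubP => // d _; rewrite -/(point d) => dq; case: Dq.
  by rewrite /D/= subr0 -dq disk_cabs.
split.
- have /measurable_restrictT := mR => /(_ mD); congr measurable_fun; apply/funext => q.
  by rewrite patchE; case: ifPn => //; rewrite notin_setE => /out /= ->.
- have /measurable_restrictT := mI => /(_ mD); congr measurable_fun; apply/funext => q.
  by rewrite patchE; case: ifPn => //; rewrite notin_setE => /out /= ->.
Qed.

End DiscMeansAnalytic.

(** * Fractional derivatives in weighted Bergman spaces *)

Section Multipliers.
Variable R : realType.
Implicit Types (f g : disk R -> R[i]) (a : nat -> R[i]).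

Definition expands f a := forall z : disk R, series (fun k => a k * point z ^+ k) @ \oo --> f z.

Lemma expands_taylor f a : expands f a -> analytic f /\ taylor_coefs 0 1 (ext0 f) a.
Proof.
move=> fa; have h z : cabs (z - 0) < 1 -> series (fun k => a k * (z - 0) ^+ k) @ \oo --> ext0 f z.
  by rewrite subr0 => /diskP[d <-]; rewrite ext0_val; exact: fa.
have [pf ta] := series_papprox h.
by split; [apply/analyticP|].
Qed.

Lemma taylor_expands f a : analytic f -> taylor_coefs 0 1 (ext0 f) a -> expands f a.
Proof.
move=> /analyticP pf ta z; have z1 : cabs (point z - 0) < 1 by rewrite subr0 disk_cabs.
by have := taylor_series_cvg pf ta z1; rewrite subr0 ext0_val.
Qed.

Lemma analytic_expands f : analytic f -> exists a, expands f a.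
Proof.
move=> af; have pf := (analyticP f).1 af; have [a ta] := papprox_taylor ltr01 pf.
by exists a; exact: taylor_expands.
Qed.

Lemma taylor_coefs_unique F (c : R[i]) (rho : R) a b : 0 < rho -> papprox c rho F ->
  taylor_coefs c rho F a -> taylor_coefs c rho F b -> a = b.
Proof.
move=> rho0 pF ta tb; apply/funext => k; apply/eqP; rewrite -subr_eq0 -cabs_eq0; apply/eqP/le_anti.
rewrite cabs_ge0 andbT; have r0 : 0 < rho / 2 by rewrite divr_gt0.
have rr : rho / 2 < rho by lra.
have rk : 0 < (rho / 2) ^+ k by rewrite exprn_gt0.
apply/ler_addgt0Pr => e e0; rewrite add0r -(ler_pM2r rk).
have e2 : 0 < e * (rho / 2) ^+ k / 2 by rewrite divr_gt0// mulr_gt0.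
have [p hp] := pF _ _ rr e2; have ha := ta _ _ p r0 rr hp k; have hb := tb _ _ p r0 rr hp k.
rewrite (le_trans (ler_wpM2r (ltW rk) (cabs_dist_add (p^`N(k).[c]) _ _)))// mulrDl cabsC.
by rewrite [leRHS]splitr lerD.
Qed.

(** [coefs] chooses some expansion; uniqueness of the Taylor sequence identifies it with the given
    one. *)
Lemma coefs_expands f a : expands f a -> coefs f = a.
Proof.
move=> fa; have [af ta] := expands_taylor fa.
have h : expands f (coefs f) by rewrite /coefs; apply: (@getPex _ [set a | expands f a]); exists a.
by have [_ tc] := expands_taylor h; exact: taylor_coefs_unique ltr01 ((analyticP f).1 af) tc ta.
Qed.

Lemma expands_inj f g a : expands f a -> expands g a -> f = g.
Proof. by move=> fa ga; apply/funext => z; exact: complex_lim_unique (fa z) (ga z). Qed.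

(** A factor k + 1 is absorbed by enlarging the radius from r to (r + 1)/2; this is iterated up to
    an integer exceeding |b|. *)
Lemma power_coef_bound a (b : R) :
  (forall r : R, 0 < r -> r < 1 -> exists M, forall k, cabs (a k) * r ^+ k <= M) ->
  forall r : R, 0 < r -> r < 1 -> exists M, forall k, cabs ((k.+1%:R `^ b)%:C * a k) * r ^+ k <= M.
Proof.
move=> aM; have H n : forall r : R, 0 < r -> r < 1 -> exists M, forall k, k.+1%:R ^+ n * cabs (a k) * r ^+ k <= M.
  elim: n => [|n ih] r r0 r1.
    by have [M hM] := aM r r0 r1; exists M => k; rewrite expr0 mul1r.
  pose s := (r + 1) / 2; have s0 : 0 < s by rewrite /s; lra.
  have s1 : s < 1 by rewrite /s; lra.
  have [M hM] := ih s s0 s1; pose q := r / s.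
  have q0 : 0 <= q by rewrite divr_ge0 ?ltW.
  have q1 : q < 1 by rewrite ltr_pdivrMr// /s; lra.
  have [L L0 hL] := linear_geometric_bound q0 q1; exists (L * M) => k.
  have rE : r = q * s by rewrite divfK// gt_eqF.
  have -> : k.+1%:R ^+ n.+1 * cabs (a k) * r ^+ k = (k.+1%:R * q ^+ k) * (k.+1%:R ^+ n * cabs (a k) * s ^+ k).
    have key (x1 x2 x3 x4 x5 : R) : x5 * x1 * x2 * (x3 * x4) = (x5 * x3) * (x1 * x2 * x4) by ring.
    by rewrite rE exprMn exprS; exact: key.
  by rewrite ler_pM ?hL ?hM// ?mulr_ge0 ?exprn_ge0 ?cabs_ge0 ?(ltW s0).
move=> r r0 r1; pose n := (Num.Def.truncn `|b|).+1.
have bn : b <= n%:R by rewrite (le_trans (ler_norm _))// ltW// truncnS_gt.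
have [M hM] := H n r r0 r1; exists M => k; apply: le_trans (hM k).
rewrite ler_wpM2r ?exprn_ge0 ?(ltW r0)// cabsM ler_wpM2r ?cabs_ge0//.
rewrite cabs_ge0_real ?powR_ge0// -powR_mulrn// ler_powR//.
by rewrite ler1n.
Qed.

(** The coefficient bounds hold for every real exponent, so the [lim] in [IR_pow] is a genuine limit
    also for b < 0, where [IR_pow b] is the fractional integral inverting [IR_pow (- b)]. *)
Lemma IR_pow_expands (b : R) f a : expands f a ->
  expands (IR_pow b f) (fun k => (k.+1%:R `^ b)%:C * a k).
Proof.
move=> fa; have [af ta] := expands_taylor fa; have pf := (analyticP f).1 af.
have aM (r : R) : 0 < r -> r < 1 -> exists M, forall k, cabs (a k) * r ^+ k <= M.
  move=> r0 r1; have [M M0 hM] := papprox_bounded pf r1; exists M => k.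
  by apply: (taylor_cauchy k pf ta r0 r1) => z zr; rewrite hM// zr.
have [G hG] := powerseries_exists 0 (power_coef_bound b aM).
move=> z; have z1 : cabs (point z - 0) < 1 by rewrite subr0 disk_cabs.
have := hG _ z1; rewrite subr0 /IR_pow (coefs_expands fa) => h.
by rewrite (complex_limE h).
Qed.

Lemma analytic_IR_pow (b : R) f : analytic f -> analytic (IR_pow b f).
Proof. by move=> /analytic_expands[a fa]; have [] := expands_taylor (IR_pow_expands (b := b) fa). Qed.

Lemma IR_powD (b c : R) f : analytic f -> IR_pow b (IR_pow c f) = IR_pow (b + c) f.
Proof.
move=> /analytic_expands[a fa].
have h1 := IR_pow_expands (b := b) (IR_pow_expands (b := c) fa); have h2 := IR_pow_expands (b := b + c) fa.
apply: expands_inj h1 _; move: h2; congr (expands _ _); apply/funext => k.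
by rewrite mulrA -rmorphM/= -powRD// pnatr_eq0 implybT.
Qed.

Lemma IR_pow0 f : analytic f -> IR_pow 0 f = f.
Proof.
move=> /analytic_expands[a fa]; have h := IR_pow_expands (b := 0) fa.
apply: expands_inj h _; move: fa; congr (expands _ _); apply/funext => k.
by rewrite powRr0 mul1r.
Qed.

End Multipliers.

Section LineIntegrals.
Variable R : realType.
Notation mu := (@lebesgue_measure R).
Implicit Types f g : R -> \bar R.

Lemma line_le f g : measurable_fun setT f -> measurable_fun setT g ->
  (forall x, (0 <= f x)%E) -> (forall x, (f x <= g x)%E) ->
  (\int[mu]_x f x <= \int[mu]_x g x)%E.
Proof. by move=> mf mg f0 fg; apply: ge0_le_integral. Qed.

Lemma line_integralZ (k : R) f : 0 <= k -> measurable_fun setT f -> (forall x, (0 <= f x)%E) ->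
  (\int[mu]_x (k%:E * f x) = k%:E * \int[mu]_x f x)%E.
Proof. by move=> k0 mf f0; rewrite ge0_integralZl_EFin. Qed.

Lemma line_integralD f g : measurable_fun setT f -> measurable_fun setT g ->
  (forall x, (0 <= f x)%E) -> (forall x, (0 <= g x)%E) ->
  (\int[mu]_x (f x + g x) = \int[mu]_x f x + \int[mu]_x g x)%E.
Proof. by move=> mf mg f0 g0; rewrite ge0_integralD. Qed.

End LineIntegrals.

Section WeightedBergman.
Variable R : realType.
Notation mu := (@lebesgue_measure R).
Notation mu2 := (mu \x mu)%E.
Implicit Types (f g : disk R -> R[i]) (q : R * R).

Definition rweight (gm : R) q : R := (1 - cabs (cpt q) ^+ 2) `^ gm.

(** The p-th power of a weighted Bergman norm up to a constant. The integral is over the whole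
    plane: for p > 0 the integrand vanishes off the disk because [ext0 f] does. *)
Definition berg (gm p : R) f : \bar R :=
  (\int[mu2]_q (cabs (ext0 f (cpt q)) `^ p * rweight gm q)%:E)%E.

Lemma measurable_rweight gm D : measurable_fun D (rweight gm).
Proof.
apply: measurableT_comp (measurable_powR gm) _; apply: measurable_funB => //.
by apply: measurable_funX; apply: measurable_cabs; exact: cmeasurable_cpt.
Qed.

Lemma cabs_cpt2 q : cabs (cpt q) ^+ 2 = q.1 ^+ 2 + q.2 ^+ 2.
Proof. by rewrite cabs_re_im sqr_sqrtr// addr_ge0 ?sqr_ge0. Qed.

Lemma measurable_berg gm p f : analytic f ->
  measurable_fun setT (fun q => (cabs (ext0 f (cpt q)) `^ p * rweight gm q)%:E).
Proof.
move=> af; apply/measurable_EFinP; apply: measurable_funM; last exact: measurable_rweight.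
exact: measurableT_comp (measurable_powR p) (measurable_cabs (cmeasurable_ext0 af)).
Qed.

Lemma berg_integrand_ge0 gm p f q : (0 <= (cabs (ext0 f (cpt q)) `^ p * rweight gm q)%:E)%E.
Proof. by rewrite lee_fin mulr_ge0 ?powR_ge0. Qed.

Lemma berg_ge0 gm p f : (0 <= berg gm p f)%E.
Proof. by apply: plane_integral_ge0 => q; exact: berg_integrand_ge0. Qed.

Let unit_ball : set (R * R) := [set q | cabs (cpt q - 0) < 1].

Lemma ext0_out f q : ~ unit_ball q -> ext0 f (cpt q) = 0.
Proof.
move=> Bq; rewrite /ext0; case: insubP => // d _; rewrite -/(point d) => dq; case: Bq.
by rewrite /unit_ball/= subr0 -dq disk_cabs.
Qed.

Lemma berg_lp_integral gm p f : 0 < p ->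
  berg gm p f = lp_integral mu2 unit_ball (rweight gm) p (fun q => cabs (ext0 f (cpt q))).
Proof.
move=> p0; rewrite /lp_integral [RHS]integral_mkcond; apply: eq_integral => q _.
rewrite patchE; case: ifPn => //; rewrite notin_setE => /ext0_out ->.
by rewrite cabs0 powR0 ?gt_eqF// mul0r.
Qed.

Lemma bergman_norm_berg (p al be : R) f : 0 < p -> -1 < al -> analytic (IR_pow be f) ->
  bergman_norm p al be f = ((((al + 1) / pi)%:E * berg al p (IR_pow be f)) `^ p^-1)%E.
Proof.
move=> p0 al1 ag; rewrite /bergman_norm; apply: (congr1 (fun x => x `^ p^-1)%E).
have c0 : 0 <= (al + 1) / pi by rewrite divr_ge0 ?pi_ge0//; lra.
rewrite /berg -(plane_integralZ c0 (measurable_berg _ _ ag) (berg_integrand_ge0 _ _ _)).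
rewrite [LHS]integral_mkcond; apply: eq_integral => q _; rewrite patchE.
case: ifPn => [_|].
  by rewrite -EFinM /rweight cabs_cpt2; congr EFin; rewrite /cpt; ring.
rewrite notin_setE => Bq; rewrite ext0_out ?cabs0 ?powR0 ?gt_eqF ?mul0r ?mule0//.
rewrite /unit_ball/= subr0 => h; apply: Bq => /=; rewrite -cabs_cpt2.
by rewrite expr_lt1 ?cabs_ge0.
Qed.

(** A lower bound valid for both signs of [gm]: the power is increasing for gm >= 0 and at least 1
    for gm < 0. *)
Lemma powR_min_le (x m gm : R) : 0 < m -> m <= x -> x <= 1 -> Num.min 1 (m `^ gm) <= x `^ gm.
Proof.
move=> m0 mx x1; have x0 : 0 < x by exact: lt_le_trans mx.
have [g0|g0] := leP 0 gm.
  by rewrite (le_trans (_ : _ <= m `^ gm)) ?ge_min ?lexx ?orbT// ge0_ler_powR ?nnegrE ?(ltW m0) ?(ltW x0).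
rewrite (le_trans (_ : _ <= 1)) ?ge_min ?lexx//.
rewrite -[gm]opprK powRN -[leLHS]invr1 lef_pV2 ?posrE ?powR_gt0//.
have ng : 0 <= - gm by rewrite oppr_ge0 ltW.
by have := ge0_ler_powR ng (ltW x0) ler01 x1; rewrite powR1.
Qed.

(** In 1 - u^2 = (1 - u)(1 + u) the factor of the farther endpoint lies between 1 and 2 and costs at
    most 2^|eta|; the other gives the integral of t^eta near 0. *)
Lemma segment_weight_finite (eta : R) : -1 < eta -> exists2 C : R, 0 < C &
  (\int[mu]_u (\1_(`]-1, 1[%classic : set R) u * (1 - u ^+ 2) `^ eta)%:E <= C%:E)%E.
Proof.
move=> eta1; have e0 : 0 < eta + 1 by rewrite -ltrBlDr sub0r.
pose phi (t : R) := \1_(`]0, 1]%classic : set R) t * t `^ (eta + 1 - 1).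
have mphi : measurable_fun setT (EFin \o phi) by apply/measurable_EFinP; exact: measurable_powR_itv.
have phi0 t : (0 <= (EFin \o phi) t)%E by rewrite lee_fin mulr_ge0 ?powR_ge0.
pose K : R := 2 `^ `|eta|; have K0 : 0 < K by exact: powR_gt0.
have mc (a c : R) : measurable_fun setT (fun u : R => (EFin \o phi) (a + c * u)).
  apply: measurableT_comp mphi _; apply: measurable_funD => //; exact: measurable_funM.
have ie (a c : R) : `|c| = 1 -> (\int[mu]_u (EFin \o phi) (a + c * u)%R <= ((eta + 1)^-1)%:E)%E.
  move=> c1; rewrite (lebesgue_affine _ _ mphi phi0) ?c1 ?invr1 ?mul1e; last first.
    by rewrite -normr_eq0 c1 oner_eq0.
  exact: integral_powR_near0.
exists (K * (2 * (eta + 1)^-1)); first by rewrite !mulr_gt0 ?invr_gt0.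
apply: (@le_trans _ _ (\int[mu]_u (K%:E * ((EFin \o phi) (1 + (-1) * u)%R + (EFin \o phi) (1 + 1 * u)%R)))%E).
  apply: ge0_le_integral => //.
  - by move=> u _; rewrite lee_fin mulr_ge0 ?powR_ge0.
  - apply/measurable_EFinP/measurable_funM; first exact: measurable_indic (measurable_itv _).
    by apply: measurableT_comp (measurable_powR eta) _; apply: measurable_funB => //; exact: measurable_funX.
  - by apply: emeasurable_funM => //; apply: emeasurable_funD; exact: mc.
  move=> u _; rewrite /phi /= -EFinD -EFinM lee_fin mul1r mulN1r addrK !indicE.
  case: (boolP (u \in _)) => [|_]; last by rewrite mul0r mulr_ge0 ?(ltW K0)// addr_ge0// mulr_ge0 ?powR_ge0.
  rewrite inE/= in_itv/= => /andP[u1 u2]; rewrite mul1r.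
  have key (v : R) : 0 <= v -> v < 1 -> (1 - v ^+ 2) `^ eta <= K * (1 - v) `^ eta.
    move=> v0 v1; have v1' : 0 < 1 - v by rewrite subr_gt0.
    have v2' : 0 < 1 + v by rewrite ltr_wpDr.
    rewrite (_ : 1 - v ^+ 2 = (1 + v) * (1 - v)); last by ring.
    rewrite powRM ?(ltW v1') ?(ltW v2')// ler_wpM2r ?powR_ge0//.
    rewrite (le_trans (_ : _ <= (1 + v) `^ `|eta|))//.
      by rewrite ler_powR ?ler_norm// lerDl.
    by rewrite ge0_ler_powR ?nnegrE ?(ltW v2')//; lra.
  have [u0|u0] := leP 0 u.
    rewrite (le_trans (key u u0 u2))// ler_wpM2l ?(ltW K0)// mem_set/= ?in_itv/=; last by rewrite subr_gt0 u2 gerBl.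
    by rewrite mul1r lerDl mulr_ge0 ?powR_ge0.
  have nu0 : 0 <= - u by rewrite oppr_ge0 ltW.
  have nu1 : - u < 1 by rewrite ltrNl.
  have := key (- u) nu0 nu1; rewrite sqrrN opprK => h; rewrite (le_trans h)// ler_wpM2l ?(ltW K0)//.
  rewrite [X in _ <= _ + X](_ : _ = (1 + u) `^ eta); first by rewrite lerDr mulr_ge0 ?powR_ge0.
  by rewrite mem_set/= ?mul1r// in_itv/=; apply/andP; split; lra.
rewrite ge0_integralZl_EFin ?(ltW K0)//; last 2 first.
- by move=> u _; rewrite adde_ge0 ?phi0.
- by apply: emeasurable_funD; exact: mc.
rewrite line_integralD// EFinM lee_wpmul2l ?lee_fin ?(ltW K0)// mulr_natl mulr2n EFinD.
by rewrite leeD// ie// ?normrN normr1.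
Qed.

(** On a vertical chord the substitution y = c u, c = sqrt(1 - x^2), turns 1 - x^2 - y^2 into c^2 (1
    - u^2). The chord contributes c^(2 gm + 1), so the outer integral is again one over a segment,
    with exponent gm + 1/2. *)
Lemma disc_weight_finite (gm : R) : -1 < gm -> exists2 C : R, 0 < C &
  (\int[mu2]_q (ball_ind 0 1 q * rweight gm q)%:E <= C%:E)%E.
Proof.
move=> gm1; have [C1 C10 h1] := segment_weight_finite gm1.
pose gh := gm + 2^-1.
have gm2 : -1 < gh by rewrite (lt_trans gm1)// ltrDl invr_gt0.
have [C2 C20 h2] := segment_weight_finite gm2.
exists (C1 * C2); first exact: mulr_gt0.
pose psi (eta u : R) := (\1_(`]-1, 1[%classic : set R) u * (1 - u ^+ 2) `^ eta)%:E.
have psi0 eta u : (0 <= psi eta u)%E by rewrite lee_fin mulr_ge0 ?powR_ge0.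
have mpsi eta : measurable_fun setT (psi eta).
  apply/measurable_EFinP/measurable_funM; first exact: measurable_indic (measurable_itv _).
  by apply: measurableT_comp (measurable_powR eta) _; apply: measurable_funB => //; exact: measurable_funX.
have mW : measurable_fun setT (fun q => (ball_ind 0 1 q * rweight gm q)%:E).
  apply/measurable_EFinP; apply: measurable_funM; [exact: measurable_ball_ind|exact: measurable_rweight].
have W0 q : (0 <= (ball_ind 0 1 q * rweight gm q)%:E)%E by rewrite lee_fin mulr_ge0 ?ball_ind_ge0 ?powR_ge0.
rewrite (plane_tonelli mW W0).
apply: (@le_trans _ _ (\int[mu]_x (C1%:E * psi gh x))%E); last first.
  by rewrite line_integralZ ?(ltW C10)// EFinM lee_wpmul2l ?lee_fin ?(ltW C10).
apply: line_le.
- exact: (measurable_tonelli mW W0).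
- exact: emeasurable_funM.
- by move=> x; apply: integral_ge0 => y _; exact: W0.
move=> x; rewrite /psi indicE; case: (boolP (x \in _)) => [|xo]; last first.
  rewrite mul0r mule0 integral0_eq// => y _; rewrite ball_indE subr0.
  case: ltP => // h; last by rewrite mul0r.
  exfalso; move/negP: xo; apply; rewrite inE/= in_itv/= -ltr_norml.
  exact: le_lt_trans (Re_le_cabs (cpt (x, y))) h.
rewrite inE/= in_itv/= => /andP[x1 x2]; rewrite mul1r.
have c20 : 0 < 1 - x ^+ 2.
  by rewrite (_ : 1 - _ = (1 - x) * (1 + x)); [rewrite mulr_gt0//; lra|ring].
pose c := Num.sqrt (1 - x ^+ 2); have c0 : 0 < c by rewrite sqrtr_gt0.
have cc : c ^+ 2 = 1 - x ^+ 2 by rewrite sqr_sqrtr// ltW.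
have cN0 : c != 0 by rewrite gt_eqF.
pose h y := (ball_ind 0 1 (x, y) * rweight gm (x, y))%:E.
have mh : measurable_fun setT h by exact: (measurable_pair1 x mW).
have h0 y : (0 <= h y)%E by exact: W0.
have := lebesgue_affine 0 cN0 mh h0; rewrite ger0_norm ?(ltW c0)// => e1.
have hE u : h (0 + c * u) = (((c ^+ 2) `^ gm)%R%:E * psi gm u)%E.
  rewrite /h /psi add0r -EFinM; congr EFin.
  have bE : cabs (cpt (x, c * u)) ^+ 2 = 1 - c ^+ 2 * (1 - u ^+ 2).
    by rewrite cabs_cpt2/= exprMn cc; ring.
  rewrite ball_indE subr0 /rweight bE opprB addrCA subrr addr0 indicE.
  have -> : (cabs (cpt (x, c * u)) < 1) = (u \in (`]-1, 1[%classic : set R)).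
    rewrite -(expr_lt1 (n := 2)) ?cabs_ge0// bE gtrBl pmulr_rgt0 ?exprn_gt0// subr_gt0.
    by rewrite mem_setE in_itv/= -ltr_norml -real_normK ?num_real// expr_lt1.
  case: (boolP (u \in _)) => [|_]; last by rewrite !mul0r mulr0.
  rewrite inE/= in_itv/= => /andP[u1 u2].
  rewrite !mul1r powRM ?sqr_ge0//.
  by rewrite (_ : 1 - _ = (1 - u) * (1 + u)); [rewrite mulr_ge0//; lra|ring].
have {}e1 : (\int[mu]_y h y = c%:E * (((c ^+ 2) `^ gm)%:E * \int[mu]_u psi gm u))%E.
  rewrite -line_integralZ ?powR_ge0//.
  rewrite (_ : (\int[mu]_u (_ * _))%E = (\int[mu]_u h (0 + c * u)%R)%E); last by apply: eq_integral => u _; rewrite hE.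
  by rewrite e1 muleA -EFinM divff// mul1e.
have -> : (\int[mu]_y (ball_ind 0 1 (x, y) * rweight gm (x, y))%:E = \int[mu]_y h y)%E by [].
rewrite e1 muleA -EFinM cc (_ : c = (1 - x ^+ 2) `^ 2^-1); last first.
  by rewrite -cc -powR_mulrn ?(ltW c0)// -powRrM divff// powRr1// ltW.
rewrite -powRD ?(gt_eqF c20) ?implybT// [_ + gm]addrC muleC lee_wpmul2r ?lee_fin ?powR_ge0//.
Qed.

Lemma berg_cst gm p f (M : R) : -1 < gm -> 0 < p -> 0 <= M -> (forall d, cabs (f d) <= M) -> analytic f ->
  (berg gm p f <= (M `^ p)%:E * \int[mu2]_q (ball_ind 0 1 q * rweight gm q)%:E)%E.
Proof.
move=> gm1 p0 M0 fM af.
have mW : measurable_fun setT (fun q => (ball_ind 0 1 q * rweight gm q)%:E).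
  apply/measurable_EFinP; apply: measurable_funM; [exact: measurable_ball_ind|exact: measurable_rweight].
have W0 q : (0 <= (ball_ind 0 1 q * rweight gm q)%:E)%E by rewrite lee_fin mulr_ge0 ?ball_ind_ge0 ?powR_ge0.
rewrite -plane_integralZ ?powR_ge0//; apply: plane_le.
- exact: measurable_berg.
- exact: emeasurable_funM.
- exact: berg_integrand_ge0.
move=> q; rewrite -EFinM lee_fin mulrA ler_wpM2r ?powR_ge0// ball_indE.
case: ltP => h.
  rewrite mulr1; move: h; rewrite subr0 => /diskP[d <-].
  by rewrite ext0_val ge0_ler_powR ?nnegrE ?cabs_ge0 ?(ltW p0).
rewrite ext0_out ?cabs0 ?powR0 ?gt_eqF ?mulr0//.
by rewrite /unit_ball/= => /lt_geF; rewrite h.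
Qed.

(** The mean value inequality on discs of radius s = (1 - r')/2 around points of |z| <= r': these
    discs stay in |z| <= 1 - s, where the weight is bounded below. *)
Lemma berg_eval gm p (r : R) : 1 <= p -> r < 1 -> exists2 C : R, 0 < C & forall f d, analytic f ->
  cabs (point d) <= r -> ((cabs (f d) `^ p)%:E <= C%:E * berg gm p f)%E.
Proof.
move=> p1 r1; have p0 : 0 < p by exact: lt_le_trans p1.
pose r' := Num.max r 0; have r'1 : r' < 1 by rewrite gt_max r1 ltr01.
have r'0 : 0 <= r' by rewrite le_max lexx orbT.
pose s := (1 - r') / 2; have s0 : 0 < s by rewrite divr_gt0// subr_gt0.
have s20 : 0 < s ^+ 2 by rewrite exprn_gt0.
pose k := Num.min 1 (s `^ gm); have k0 : 0 < k by rewrite lt_min ltr01 powR_gt0.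
exists (8 `^ p / s ^+ 2 * k^-1) => [|f d af dr]; first by rewrite mulr_gt0 ?invr_gt0// divr_gt0 ?powR_gt0.
have d1 := disk_cabs d.
have dr' : cabs (point d) <= r' by rewrite (le_trans dr)// le_max lexx.
have sr : s < 1 - cabs (point d) by rewrite /s; lra.
have mf := cmeasurable_ext0 af.
have := disc_mean_powR (@analytic_papprox_at _ f d af) mf s0 sr p1.
rewrite ext0_val => h; apply: (le_trans h); rewrite [X in (_ <= X * _)%E]EFinM -muleA lee_wpmul2l//.
  by rewrite lee_fin divr_ge0 ?powR_ge0// ltW.
rewrite /berg -plane_integralZ ?invr_ge0 ?(ltW k0)//; last 2 first.
- exact: measurable_berg.
- exact: berg_integrand_ge0.
apply: plane_le.
- apply/measurable_EFinP; apply: measurable_funM; first exact: measurable_ball_ind.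
  exact: measurableT_comp (measurable_powR p) (measurable_cabs mf).
- by apply: emeasurable_funM => //; exact: measurable_berg.
- by move=> q; rewrite lee_fin mulr_ge0 ?ball_ind_ge0 ?powR_ge0.
move=> q; rewrite -EFinM lee_fin ball_indE; case: ltP => qs; last first.
  by rewrite mul0r !mulr_ge0 ?powR_ge0 ?invr_ge0 ?(ltW k0).
rewrite mul1r mulrCA ler_peMr ?powR_ge0// ler_pdivlMl// mulr1.
have q1 : cabs (cpt q) <= 1 - s.
  by rewrite (le_trans (cabs_le_dist _ (point d)))// cabsC (le_trans (lerD dr' (ltW qs)))// /s; lra.
apply: powR_min_le => //; last by rewrite gerBl sqr_ge0.
have := cabs_ge0 (cpt q); move: q1; move: (cabs (cpt q)) => x; rewrite expr2 => x1 x0.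
have : x * x <= x * 1 by rewrite ler_wpM2l//; lra.
by lra.
Qed.

Definition berg_norm (gm p : R) f : \bar R := (berg gm p f `^ p^-1)%E.

Lemma berg_norm_le gm p f (t : R) : 0 < p ->
  (berg_norm gm p f <= t%:E)%E <-> 0 <= t /\ (berg gm p f <= (t `^ p)%:E)%E.
Proof.
move=> p0; have b0 := berg_ge0 gm p f; split => [h|[t0]]; last by rewrite /berg_norm poweR_inv_le.
have t0 : 0 <= t by rewrite -lee_fin; apply: le_trans h; exact: poweR_ge0.
by split => //; rewrite -poweR_inv_le.
Qed.

Lemma berg_norm_solid gm p : -1 < gm -> 1 <= p -> solid (berg_norm gm p) 4.
Proof.
move=> gm1 p1; have p0 : 0 < p by exact: lt_le_trans p1.
have mB : measurable unit_ball by exact: measurable_ball.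
have Nle f (t : R) : analytic f -> (berg_norm gm p f <= t%:E)%E <-> 0 <= t /\
    forall i : unit, [set: unit] i -> (lp_integral mu2 unit_ball (rweight gm) p (fun q => cabs (ext0 f (cpt q))) <= (t `^ p)%:E)%E.
  move=> _; rewrite berg_norm_le// berg_lp_integral//; split=> -[t0 h]; split=> //.
  exact: (h tt).
have g1 (i : unit) q : [set: unit] i -> unit_ball q -> cabs (cpt q) < 1.
  by move=> _; rewrite /unit_ball/= subr0.
have sol := @lp_solid R _ _ mu2 unit_ball (rweight gm) p unit setT (fun=> @cpt R) (berg_norm gm p) mB
  (measurable_rweight (D := unit_ball) gm) (fun q _ => powR_ge0 _ _) p1
  (fun _ _ => cmeasurable_cpt unit_ball) g1 Nle.
apply: sol.
- have [C C0 hC] := disc_weight_finite gm1; exists (C `^ p^-1); apply/berg_norm_le => //.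
  split; first exact: powR_ge0.
  rewrite -powRrM mulVf ?gt_eqF// powRr1 ?(ltW C0)//.
  apply: le_trans (berg_cst gm1 p0 ler01 _ (analytic_cst 1)) _; first by move=> d; rewrite cabs1.
  by rewrite powR1 mul1e.
move=> r r1; have [C C0 hC] := berg_eval gm p1 r1.
exists (C `^ p^-1) => f d af /(berg_norm_le _ _ _ p0)[_ Nf] dr.
rewrite powR1 in Nf; have := hC f d af dr => /le_trans.
move=> /(_ C%:E); rewrite -{2}[C]mulr1 EFinM lee_wpmul2l ?lee_fin ?(ltW C0)// => /(_ isT) h.
have ip : 0 <= p^-1 by rewrite invr_ge0 ltW.
have := ge0_ler_powR ip (powR_ge0 _ _) (ltW C0) h.
by rewrite -powRrM divff ?gt_eqF// powRr1 ?cabs_ge0.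
Qed.

End WeightedBergman.

(* The product of sigma-finite measures does not carry a sigma-finite instance. *)
Definition plane_measure (R : realType) : set (measurableTypeR R * measurableTypeR R) -> \bar R :=
  (@lebesgue_measure R \x @lebesgue_measure R)%E.
HB.instance Definition _ (R : realType) := Measure.on (@plane_measure R).

Lemma plane_sigma_finite (R : realType) : sigma_finite setT (@plane_measure R).
Proof.
exists (fun n : nat => [set q | cabs (cpt q - 0) < n.+1%:R]).
  apply/seteqP; split=> // q _; exists (Num.Def.truncn (cabs (cpt q))) => //=.
  by rewrite subr0 truncnS_gt.
move=> n; have n0 : 0 < n.+1%:R :> R by [].
split; first exact: measurable_ball.
have := ball_area_le (0 : R[i]) n0; rewrite /ball_ind integral_indic ?setIT; last 2 first.
- exact: measurableT.
- exact: measurable_ball.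
by move=> h; apply: le_lt_trans h _; rewrite ltry.
Qed.

HB.instance Definition _ (R : realType) := Measure_isSigmaFinite.Build _ _ _ (@plane_measure R)
  (plane_sigma_finite R).

(** * Cauchy's estimate for I + R in weighted Bergman spaces *)

Section DerivativeBound.
Variable R : realType.
Notation mu := (@lebesgue_measure R).
Notation mu2 := (mu \x mu)%E.
Implicit Types (f g : disk R -> R[i]) (q : R * R).

Lemma powR_comparable (x y K a : R) : 0 < x -> 0 < y -> 1 <= K -> y <= K * x -> x <= K * y ->
  x `^ a <= K `^ `|a| * y `^ a.
Proof.
move=> x0 y0 K1 yx xy; have K0 : 0 < K by exact: lt_le_trans K1.
have [a0|a0] := leP 0 a.
  rewrite ger0_norm// -powRM ?(ltW K0) ?(ltW y0)//.
  by rewrite ge0_ler_powR ?nnegrE ?mulr_ge0 ?(ltW x0) ?(ltW K0) ?(ltW y0).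
have na0 : 0 <= - a by rewrite oppr_ge0 ltW.
have [b b0 ->] : exists2 b, 0 <= b & a = - b by exists (- a); rewrite ?opprK.
rewrite normrN ger0_norm// !powRN.
rewrite ler_pdivlMr ?powR_gt0// mulrC ler_pdivrMr ?powR_gt0// -powRM ?(ltW K0) ?(ltW x0)//.
by rewrite ge0_ler_powR ?nnegrE ?mulr_ge0 ?(ltW x0) ?(ltW K0) ?(ltW y0).
Qed.

Lemma plane_plane_tonelli (f : (R * R) * (R * R) -> \bar R) : measurable_fun setT f ->
  (forall x, (0 <= f x)%E) ->
  (\int[mu2]_z \int[mu2]_w f (z, w) = \int[mu2]_w \int[mu2]_z f (z, w))%E.
Proof.
move=> mf f0; exact: (@fubini_tonelli _ _ (measurableTypeR R * measurableTypeR R)%type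
  (measurableTypeR R * measurableTypeR R)%type R (@plane_measure R) (@plane_measure R) f mf f0).
Qed.

Lemma measurable_plane_plane (f : (R * R) * (R * R) -> \bar R) : measurable_fun setT f ->
  (forall x, (0 <= f x)%E) -> measurable_fun setT (fun z => \int[mu2]_w f (z, w))%E.
Proof.
move=> mf f0; exact: (@measurable_fun_fubini_tonelli_F _ _ (measurableTypeR R * measurableTypeR R)%type
  (measurableTypeR R * measurableTypeR R)%type R (@plane_measure R) f mf f0).
Qed.

Lemma line_plane_tonelli (f : R * (R * R) -> \bar R) : measurable_fun setT f ->
  (forall x, (0 <= f x)%E) ->
  (\int[mu]_t \int[mu2]_w f (t, w) = \int[mu2]_w \int[mu]_t f (t, w))%E.
Proof.
move=> mf f0; exact: (@fubini_tonelli _ _ (measurableTypeR R)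
  (measurableTypeR R * measurableTypeR R)%type R mu (@plane_measure R) f mf f0).
Qed.

Lemma measurable_line_plane (f : R * (R * R) -> \bar R) : measurable_fun setT f ->
  (forall x, (0 <= f x)%E) -> measurable_fun setT (fun t => \int[mu2]_w f (t, w))%E.
Proof.
move=> mf f0; exact: (@measurable_fun_fubini_tonelli_F _ _ (measurableTypeR R)
  (measurableTypeR R * measurableTypeR R)%type R (@plane_measure R) f mf f0).
Qed.

Lemma measurable_line_plane' (f : R * (R * R) -> \bar R) : measurable_fun setT f ->
  (forall x, (0 <= f x)%E) -> measurable_fun setT (fun w => \int[mu]_t f (t, w))%E.
Proof.
move=> mf f0; exact: (@measurable_fun_fubini_tonelli_G _ _ (measurableTypeR R)
  (measurableTypeR R * measurableTypeR R)%type R mu f mf f0).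
Qed.

Lemma poly_taylor_coefs (P : {poly R[i]}) (c : R[i]) (rho : R) : 0 < rho ->
  taylor_coefs c rho (horner P) (fun k => P^`N(k).[c]).
Proof.
move=> rho0; have pP : papprox c rho (horner P) by exact: papprox_poly.
have [a ta] := papprox_taylor rho0 pP.
suff -> : (fun k => P^`N(k).[c]) = a by [].
apply/funext => k; have r0 : 0 < rho / 2 by rewrite divr_gt0.
have rr : rho / 2 < rho by lra.
have h z : cabs (z - c) <= rho / 2 -> cabs (P.[z] - P.[z]) <= 0 by rewrite subrr cabs0.
have := ta _ _ P r0 rr h k; rewrite pmulr_lle0 ?exprn_gt0// => h0.
by apply/eqP; rewrite -subr_eq0 -cabs_eq0 eq_le h0 cabs_ge0.
Qed.

Lemma partial_sums_uniform f a (s e : R) : expands f a -> 0 <= s -> s < 1 -> 0 < e ->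
  exists N, forall n, (N <= n)%N -> forall z, cabs z <= s ->
    cabs (ext0 f z - \sum_(k < n) a k * z ^+ k) <= e.
Proof.
move=> fa s0 s1 e0; have [af ta] := expands_taylor fa; have pf := (analyticP f).1 af.
pose r := (s + 1) / 2; have r0 : 0 < r by rewrite /r; lra.
have sr : s < r by rewrite /r; lra.
have r1 : r < 1 by rewrite /r; lra.
have [M M0 hM] := papprox_bounded pf r1.
have fM z : cabs (z - 0) = r -> cabs (ext0 f z) <= M by move=> zr; rewrite hM// zr.
have := cvg_scaled_geometric (M / (1 - s / r)) s0 sr => /cvgrPdist_lt/(_ e e0)[N _ hN].
exists N => n Nn z zs; have zs' : cabs (z - 0) <= s by rewrite subr0.
have := taylor_remainder n pf ta r0 r1 fM s0 sr zs'.
under eq_bigr do rewrite subr0; move=> h; apply: (le_trans h).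
have := hN n Nn; rewrite sub0r normrN => h2.
rewrite (_ : M * _ = M / (1 - s / r) * (s / r) ^+ n); last by rewrite mulrA mulrAC.
exact: ltW (le_lt_trans (ler_norm _) h2).
Qed.

(** (I + R) f is the derivative of z f(z), and |z| < 1 on the circle, so Cauchy's estimate for z f
    loses nothing. It is applied to the polynomials [G n], z times a partial sum of [f]. *)
Lemma IR_pow1_cauchy f d (M r : R) : analytic f -> 0 < r -> r < 1 - cabs (point d) ->
  (forall z, cabs (z - point d) = r -> cabs (ext0 f z) <= M) -> cabs (IR_pow 1 f d) * r <= M.
Proof.
move=> af r0 rd fM; have [a fa] := analytic_expands af; have f1 := IR_pow_expands (b := 1) fa.
pose G n : {poly R[i]} := \sum_(k < n) a k *: 'X^(k.+1).
have Gz n z : (G n).[z] = z * \sum_(k < n) a k * z ^+ k.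
  by rewrite horner_sum mulr_sumr; apply: eq_bigr => k _; rewrite hornerZ hornerXn exprS mulrCA.
have dG n : (G n)^`N(1).[point d] = series (fun k => (k.+1%:R `^ 1)%:C * a k * point d ^+ k) n.
  rewrite nderivn1 /G raddf_sum/= horner_sum /series/= big_mkord; apply: eq_bigr => k _.
  rewrite derivZ derivXn hornerZ hornerMn hornerXn/= powRr1// -mulr_natl mulrA rmorph_nat.
  by rewrite [a k * _]mulrC.
have d0 := cabs_ge0 (point d); have d1 := disk_cabs d; pose s := cabs (point d) + r.
have s0 : 0 <= s by rewrite addr_ge0 ?(ltW r0).
have s1 : s < 1 by rewrite /s; lra.
have cv := complex_cvg_cabs (f1 d).
have Gd n (e : R) : (forall z, cabs z <= s -> cabs (ext0 f z - \sum_(k < n) a k * z ^+ k) <= e) ->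
    cabs ((G n)^`N(1).[point d]) * r <= M + e.
  move=> he; have rho0 : 0 < 1 - cabs (point d) by rewrite subr_gt0.
  have pG : papprox (point d) (1 - cabs (point d)) (horner (G n)) by exact: papprox_poly.
  have := taylor_cauchy 1 pG (poly_taylor_coefs rho0) r0 rd.
  rewrite expr1; apply => z zr.
  have zs : cabs z <= s by rewrite (le_trans (cabs_le_dist z (point d)))// lerD2l cabsC zr.
  rewrite Gz cabsM (le_trans (ler_piMl (cabs_ge0 _) (ltW (le_lt_trans zs s1))))//.
  by rewrite (le_trans (cabs_le_dist _ (ext0 f z)))// lerD ?fM// he.
apply/ler_addgt0Pr => e e0; have [N hN] := partial_sums_uniform fa s0 s1 e0.
rewrite -ler_pdivlMr// -(cvg_lim (@Rhausdorff R) cv); apply: limr_le; first exact: cvgP cv.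
by exists N => // n /= Nn; rewrite ler_pdivlMr// -dG; apply: Gd; exact: hN.
Qed.

Let lt1_of_near (x c : R) : c < 1 -> x <= c + (1 - c) / 4 -> x < 1.
Proof. by lra. Qed.

Let quarter_lt_one_sub (x c : R) : c < 1 -> x <= c + (1 - c) / 4 -> (1 - c) / 4 < 1 - x.
Proof. by lra. Qed.

Let add_quarter_lt_half (x D : R) : x < D / 4 -> x + D / 4 < D / 2.
Proof. by lra. Qed.

Let quarter_lt (D : R) : 0 < D -> D / 4 < D.
Proof. by lra. Qed.

(** Cauchy's estimate on the circle of radius s = D/4, with [f] bounded there by means over discs of
    radius s, all contained in the disc of radius D/2. The constant is 8^p / s^2 = 16 8^p D^(-2)
    times s^(-p) = 4^p D^(-p). *)
Lemma IR_pow1_local f (p : R) (z : R * R) : 1 <= p -> analytic f -> cabs (cpt z) < 1 ->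
  ((cabs (ext0 (IR_pow 1 f) (cpt z)) `^ p)%:E <=
   (16 * 32 `^ p * (1 - cabs (cpt z)) `^ (- p - 2))%:E *
   \int[mu2]_w (ball_ind (cpt z) ((1 - cabs (cpt z)) / 2) w * cabs (ext0 f (cpt w)) `^ p)%:E)%E.
Proof.
move=> p1 af z1; have p0 : 0 < p by exact: lt_le_trans p1.
have [d dz] := diskP z1; rewrite -dz in z1 *; rewrite ext0_val.
set D := 1 - cabs (point d); have D0 : 0 < D by rewrite subr_gt0.
have mf := cmeasurable_ext0 af.
have mFp : measurable_fun setT (fun w => cabs (ext0 f (cpt w)) `^ p).
  exact: measurableT_comp (measurable_powR p) (measurable_cabs mf).
have mJ c s : measurable_fun setT (fun w => (ball_ind c s w * cabs (ext0 f (cpt w)) `^ p)%:E).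
  by apply/measurable_EFinP; apply: measurable_funM => //; exact: measurable_ball_ind.
have J0' c s w : (0 <= (ball_ind c s w * cabs (ext0 f (cpt w)) `^ p)%:E)%E.
  by rewrite lee_fin mulr_ge0 ?ball_ind_ge0 ?powR_ge0.
set J := (\int[mu2]_w _)%E; have J0 : (0 <= J)%E by exact: plane_integral_ge0.
have c0 : 0 < 16 * 32 `^ p * D `^ (- p - 2) by rewrite !mulr_gt0 ?powR_gt0.
have [->|Joo] := eqVneq J +oo%E; first by rewrite gt0_muley ?lte_fin// leey.
have Jr : J \is a fin_num by rewrite ge0_fin_numE// ltey.
pose s := D / 4; have s0 : 0 < s by rewrite divr_gt0.
have s20 : 0 < s ^+ 2 by rewrite exprn_gt0.
pose M := (8 `^ p / s ^+ 2 * fine J) `^ p^-1.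
have fM z' : cabs (z' - point d) = s -> cabs (ext0 f z') <= M.
  move=> zs; have zd : cabs z' <= cabs (point d) + s by rewrite (le_trans (cabs_le_dist z' (point d)))// lerD2l cabsC zs.
  have /diskP[y yz] : cabs z' < 1 by exact: lt1_of_near z1 zd.
  have sy : s < 1 - cabs (point y) by rewrite yz; exact: quarter_lt_one_sub z1 zd.
  have := disc_mean_powR (@analytic_papprox_at _ f y af) mf s0 sy p1.
  rewrite yz => h.
  have {}h : ((cabs (ext0 f z') `^ p)%:E <= (8 `^ p / s ^+ 2 * fine J)%:E)%E.
    apply: (le_trans h); rewrite [leRHS]EFinM fineK//; apply: lee_wpmul2l.
      by rewrite lee_fin divr_ge0 ?powR_ge0 ?(ltW s20).
    apply: plane_le => // w; rewrite lee_fin ler_wpM2r ?powR_ge0// !ball_indE.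
    case: ltP => // h1; case: ltP => //.
    rewrite leNgt => /negP; case; apply: (le_lt_trans (cabs_dist_add z' _ _)).
    by rewrite zs; exact: add_quarter_lt_half h1.
  rewrite lee_fin in h; have ip : 0 <= p^-1 by rewrite invr_ge0 ltW.
  have := ge0_ler_powR ip (powR_ge0 _ _) _ h.
  rewrite -powRrM divff ?gt_eqF// powRr1 ?cabs_ge0//; apply.
  by rewrite nnegrE mulr_ge0 ?fine_ge0// divr_ge0 ?powR_ge0 ?(ltW s20).
have sD : s < 1 - cabs (point d) by exact: quarter_lt D0.
have := IR_pow1_cauchy af s0 sD fM; rewrite -ler_pdivlMr// => h.
have M0 : 0 <= M by exact: powR_ge0.
have := ge0_ler_powR (ltW p0) (cabs_ge0 _) (divr_ge0 M0 (ltW s0)) h.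
rewrite -(fineK Jr) -EFinM lee_fin => h1; apply: (le_trans h1).
rewrite powRM ?invr_ge0 ?(ltW s0)// /M -powRrM mulVf ?gt_eqF// powRr1; last first.
  by rewrite mulr_ge0 ?fine_ge0// divr_ge0 ?powR_ge0 ?(ltW s20).
rewrite mulrAC ler_wpM2r ?fine_ge0//.
have -> : D `^ (- p - 2) = D `^ (- p) * D ^- 2.
  by rewrite powRD ?(gt_eqF D0) ?implybT// powRN -[in X in _ = _ * X]powR_mulrn ?(ltW D0)// powRN.
have -> : s^-1 `^ p = 4 `^ p * D `^ (- p).
  have i0 : 0 <= D^-1 by rewrite invr_ge0 ltW.
  rewrite /s invfM invrK mulrC powRM// -[D^-1]powR_inv1 ?(ltW D0)// -powRrM mulN1r//.
have -> : s ^+ 2 = D ^+ 2 / 16 by rewrite /s expr_div_n; congr (_ / _); ring.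
have -> : 32 `^ p = 8 `^ p * 4 `^ p by rewrite -powRM//; congr (_ `^ _); ring.
rewrite le_eqVlt; apply/orP; left; apply/eqP; move: (8 `^ p) (4 `^ p) (D `^ (- p)) => A B C.
by rewrite invfM invrK; field; rewrite gt_eqF.
Qed.

(* z and w stand for |z| and |w|, e for |w - z|. *)
Let lt_one_sub_of_near (z w e : R) : w <= z + e -> e < (1 - z) / 2 -> e < 1 - w.
Proof. by lra. Qed.

Let comparable4 (x x' : R) : 0 < x -> x <= x' -> x' <= 2 * x -> x <= 4 * x' /\ x' <= 4 * x.
Proof. by move=> *; split; lra. Qed.

Let one_sub_comparable (z w e Y : R) : w <= z + e -> z <= w + e -> e < (1 - z) / 2 -> 1 - w <= Y ->
  Y <= 2 * (1 - w) -> Y <= 4 * (1 - z) /\ 1 - z <= 4 * Y.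
Proof. by move=> *; split; lra. Qed.

Lemma one_sub_sqr_bounds (z : R) : 0 <= z -> z < 1 ->
  1 - z <= 1 - z ^+ 2 /\ 1 - z ^+ 2 <= 2 * (1 - z).
Proof. by move=> z0 z1; rewrite expr2; split; nra. Qed.

(** The local bound is integrated and the order exchanged. For |w - z| < (1 - |z|)/2 the distances
    of z and w to the circle are comparable, so for given w the points z lie in a disc of area O((1
    - |w|)^2), and the exponents add up to (-p - 2) + (gm + p) + 2 = gm. *)
Lemma berg_IR_pow1 (gm p : R) : 1 <= p -> exists2 C : R, 0 < C & forall f, analytic f ->
  (berg (gm + p) p (IR_pow 1 f) <= C%:E * berg gm p f)%E.
Proof.
move=> p1; have p0 : 0 < p by exact: lt_le_trans p1.
pose K0 : R := 16 * 32 `^ p; have K00 : 0 < K0 by rewrite mulr_gt0 ?powR_gt0.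
pose K1 : R := 4 `^ `|gm + p| * 4 `^ `|gm - 2|; have K10 : 0 < K1 by rewrite mulr_gt0 ?powR_gt0.
exists (K0 * K1 * 4); first by rewrite !mulr_gt0.
move=> f af; have mf := cmeasurable_ext0 af.
have mFp : measurable_fun setT (fun w => cabs (ext0 f (cpt w)) `^ p).
  exact: measurableT_comp (measurable_powR p) (measurable_cabs mf).
have mD : measurable_fun setT (fun z : R * R => 1 - cabs (cpt z)).
  by apply: measurable_funB => //; apply: measurable_cabs; exact: cmeasurable_cpt.
pose k (z : R * R) : R := K0 * (ball_ind 0 1 z * (1 - cabs (cpt z)) `^ (- p - 2) * rweight (gm + p) z).
have mk : measurable_fun setT k.
  apply: measurable_funM => //; apply: measurable_funM; last exact: measurable_rweight.
  apply: measurable_funM; first exact: measurable_ball_ind.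
  exact: measurableT_comp (measurable_powR _) mD.
have k0 z : 0 <= k z by rewrite !mulr_ge0 ?ball_ind_ge0 ?powR_ge0 ?(ltW K00).
pose S : set ((R * R) * (R * R)) := [set x | cabs (cpt x.2 - cpt x.1) < (1 - cabs (cpt x.1)) / 2].
have mS : measurable S.
  have m1 : measurable_fun setT (fun x : (R * R) * (R * R) => cabs (cpt x.2 - cpt x.1)).
    rewrite (_ : (fun x => _) = (fun x : (R * R) * (R * R) => cabs (cpt x.2 + (-1) * cpt x.1))).
      apply/measurable_cabs/cmeasurableD.
        by have [h1 h2] := cmeasurable_cpt (R := R) setT; split; [exact: measurableT_comp h1 measurable_snd|exact: measurableT_comp h2 measurable_snd].
      apply: cmeasurableM; first exact: cmeasurable_cst.
      by have [h1 h2] := cmeasurable_cpt (R := R) setT; split; [exact: measurableT_comp h1 measurable_fst|exact: measurableT_comp h2 measurable_fst].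
    by apply/funext => x; rewrite mulN1r.
  have m2 : measurable_fun setT (fun x : (R * R) * (R * R) => (1 - cabs (cpt x.1)) / 2).
    by apply: measurable_funM => //; exact: measurableT_comp mD measurable_fst.
  by rewrite -[X in measurable X]setTI; exact: (measurable_fun_ltr m1 m2).
pose Phi (x : (R * R) * (R * R)) : \bar R := (k x.1 * (\1_S x * cabs (ext0 f (cpt x.2)) `^ p))%:E.
have mPhi : measurable_fun setT Phi.
  apply/measurable_EFinP; apply: measurable_funM; first exact: measurableT_comp mk measurable_fst.
  apply: measurable_funM; first exact: measurable_indic.
  exact: measurableT_comp mFp measurable_snd.
have Phi0 x : (0 <= Phi x)%E by rewrite lee_fin !mulr_ge0 ?powR_ge0.
have SE z w : \1_S (z, w) = ball_ind (cpt z) ((1 - cabs (cpt z)) / 2) w :> R.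
  rewrite indicE ball_indE (_ : (_ \in S) = (cabs (cpt w - cpt z) < (1 - cabs (cpt z)) / 2)%R)//.
  by apply/idP/idP; rewrite inE.
have a1 := analytic_IR_pow 1 af.
apply: (@le_trans _ _ (\int[mu2]_z \int[mu2]_w Phi (z, w))%E).
  apply: plane_le.
  - exact: measurable_berg.
  - exact: measurable_plane_plane.
  - exact: berg_integrand_ge0.
  move=> z; have [z1|z1] := ltP (cabs (cpt z)) 1; last first.
    rewrite ext0_out ?cabs0 ?powR0 ?gt_eqF ?mul0r//; last by rewrite /= subr0 => /lt_geF; rewrite z1.
    by apply: plane_integral_ge0 => w; exact: Phi0.
  rewrite (_ : (\int[mu2]_w Phi (z, w))%E = (k z)%:E * \int[mu2]_w
      (ball_ind (cpt z) ((1 - cabs (cpt z)) / 2) w * cabs (ext0 f (cpt w)) `^ p)%:E)%E; last first.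
    set g := (fun w : R * R => (ball_ind (cpt z) ((1 - cabs (cpt z)) / 2) w * cabs (ext0 f (cpt w)) `^ p)%:E).
    have mg : measurable_fun setT g.
      by apply/measurable_EFinP; apply: measurable_funM => //; exact: measurable_ball_ind.
    have g0 w : (0 <= g w)%E by rewrite lee_fin mulr_ge0 ?ball_ind_ge0 ?powR_ge0.
    rewrite -(plane_integralZ (k0 z) mg g0); apply: eq_integral => w _.
    by rewrite /Phi/= SE EFinM.
  rewrite EFinM; apply: le_trans (lee_wpmul2r _ (IR_pow1_local p1 af z1)) _.
    by rewrite lee_fin powR_ge0.
  rewrite muleAC -EFinM /k ball_indE subr0 z1 mul1r /K0; apply: lee_wpmul2r.
    by apply: plane_integral_ge0 => w; rewrite lee_fin mulr_ge0 ?ball_ind_ge0 ?powR_ge0.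
  by rewrite lee_fin !mulrA.
rewrite plane_plane_tonelli// /berg -plane_integralZ; last 3 first.
- by rewrite !mulr_ge0 ?(ltW K00) ?(ltW K10).
- exact: measurable_berg.
- exact: berg_integrand_ge0.
have mswap : measurable_fun setT (fun w => \int[mu2]_z Phi (z, w))%E.
  have ms : measurable_fun setT (fun x : (R * R) * (R * R) => Phi (x.2, x.1)).
    by apply: measurableT_comp mPhi _; apply: measurable_fun_pair; [exact: measurable_snd|exact: measurable_fst].
  exact: (measurable_plane_plane ms (fun x => Phi0 _)).
apply: plane_le.
- exact: mswap.
- by apply: emeasurable_funM => //; exact: measurable_berg.
- by move=> w; apply: plane_integral_ge0 => z; exact: Phi0.
move=> w; have [w1|w1] := ltP (cabs (cpt w)) 1; last first.
  rewrite ext0_out ?cabs0 ?powR0 ?gt_eqF ?mul0r ?mule0//; last by rewrite /= subr0 => /lt_geF; rewrite w1.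
  rewrite integral0_eq// => z _; rewrite /Phi/= ext0_out ?cabs0 ?powR0 ?gt_eqF ?mulr0//.
  by rewrite /= subr0 => /lt_geF; rewrite w1.
have Dw : 0 < 1 - cabs (cpt w) by rewrite subr_gt0.
have w0 := cabs_ge0 (cpt w).
set Y := 1 - cabs (cpt w) ^+ 2.
have [Y1 Y2] : 1 - cabs (cpt w) <= Y /\ Y <= 2 * (1 - cabs (cpt w)) by exact: one_sub_sqr_bounds.
have Y0 : 0 < Y by exact: lt_le_trans Y1.
apply: (@le_trans _ _ (\int[mu2]_z ((K0 * K1 * (Y `^ (gm - 2) * cabs (ext0 f (cpt w)) `^ p))%:E *
    (ball_ind (cpt w) (1 - cabs (cpt w)) z)%:E))%E); last first.
  rewrite plane_integralZ; last 3 first.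
  - by rewrite !mulr_ge0 ?powR_ge0 ?(ltW K00) ?(ltW K10).
  - by apply/measurable_EFinP; exact: measurable_ball_ind.
  - by move=> z; rewrite lee_fin ball_ind_ge0.
  apply: le_trans (lee_wpmul2l _ (ball_area_le (cpt w) Dw)) _.
    by rewrite lee_fin !mulr_ge0 ?powR_ge0 ?(ltW K00) ?(ltW K10).
  rewrite -!EFinM lee_fin /rweight -/Y.
  have -> : Y `^ gm = Y `^ (gm - 2) * Y ^+ 2.
    by rewrite -powR_mulrn ?(ltW Y0)// -powRD ?subrK// (gt_eqF Y0) implybT.
  rewrite (_ : K0 * K1 * 4 * _ = K0 * K1 * (Y `^ (gm - 2) * cabs (ext0 f (cpt w)) `^ p) * (4 * Y ^+ 2)); last by ring.
  rewrite ler_wpM2l ?mulr_ge0 ?powR_ge0 ?(ltW K00) ?(ltW K10)//.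
  by rewrite ler_wpM2l// lerXn2r ?nnegrE ?(ltW Dw) ?(ltW Y0).
apply: plane_le.
- by apply: measurableT_comp mPhi _; apply: measurable_fun_pair.
- apply: emeasurable_funM; first exact: measurable_cst.
  by apply/measurable_EFinP; exact: measurable_ball_ind.
- by move=> z; exact: Phi0.
move=> z; rewrite -EFinM lee_fin /= SE /k !ball_indE subr0.
case: (ltP (cabs (cpt z)) 1) => z1; last by rewrite !mul0r mulr0 mul0r !mulr_ge0 ?powR_ge0 ?(ltW K00) ?(ltW K10).
case: (ltP _ ((1 - cabs (cpt z)) / 2)) => zw; last by rewrite mul0r mulr0 !mulr_ge0 ?powR_ge0 ?(ltW K00) ?(ltW K10).
have Dz : 0 < 1 - cabs (cpt z) by rewrite subr_gt0.
have z0 := cabs_ge0 (cpt z).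
have h1 := cabs_le_dist (cpt w) (cpt z); rewrite cabsC in h1.
have h2 := cabs_le_dist (cpt z) (cpt w).
rewrite (_ : (cabs (cpt z - cpt w) < 1 - cabs (cpt w)) = true); last first.
  by rewrite cabsC; exact: lt_one_sub_of_near h1 zw.
rewrite !mul1r mulr1 -!mulrA ler_wpM2l ?(ltW K00)// !mulrA ler_wpM2r ?powR_ge0//.
have [y1 y2] := one_sub_comparable h1 h2 zw Y1 Y2; have [x1 x2] := one_sub_sqr_bounds z0 z1.
set x := 1 - cabs (cpt z) in Dz y1 y2 x1 x2 *.
set x' := 1 - cabs (cpt z) ^+ 2 in x1 x2 *.
have x'0 : 0 < x' by exact: lt_le_trans x1.
have [x3 x4] := comparable4 Dz x1 x2; have l14 : 1 <= 4 :> R by rewrite ler1n.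
have e1 : x' `^ (gm + p) <= 4 `^ `|gm + p| * x `^ (gm + p) by exact: powR_comparable.
have e2 : x `^ (gm - 2) <= 4 `^ `|gm - 2| * Y `^ (gm - 2) by exact: powR_comparable.
rewrite /rweight -/x' /K1.
rewrite -!mulrA ler_wpM2l ?powR_ge0//; apply: le_trans (ler_wpM2l (powR_ge0 _ _) e1) _.
rewrite mulrCA -powRD ?(gt_eqF Dz) ?implybT// (_ : - p - 2 + (gm + p) = gm - 2); last by ring.
by rewrite ler_wpM2l ?powR_ge0.
Qed.

End DerivativeBound.

(** * Gamma and beta integrals *)

Section GammaBeta.
Variable R : realType.
Notation mu := (@lebesgue_measure R).
Variable s : R.
Hypothesis s0 : 0 < s.

Definition pos_ind : R -> R := \1_(`]0, +oo[%classic : set R).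

Lemma pos_indE t : pos_ind t = (0 < t)%R%:R.
Proof. by rewrite /pos_ind indicE mem_setE in_itv/= andbT. Qed.

Lemma pos_ind_ge0 t : 0 <= pos_ind t. Proof. by rewrite pos_indE. Qed.

Lemma measurable_pos_ind : measurable_fun setT pos_ind.
Proof. exact: measurable_indic (measurable_itv _). Qed.

Lemma integral_beta_tail (b : R) : s < b ->
  (\int[mu]_t (pos_ind t * t `^ (s - 1) * (1 + t) `^ (- b))%:E <= (s^-1 + (b - s)^-1)%:E)%E.
Proof.
move=> sb; have bs : 0 < b - s by rewrite subr_gt0.
pose f1 (t : R) := (\1_(`]0, 1]%classic : set R) t * t `^ (s - 1))%:E.
pose f2 (t : R) := (\1_(`]1, +oo[%classic : set R) t * t `^ (- (b - s) - 1))%:E.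
have mf1 : measurable_fun setT f1 by apply/measurable_EFinP; exact: measurable_powR_itv.
have mf2 : measurable_fun setT f2 by apply/measurable_EFinP; exact: measurable_powR_itv.
have f10 t : (0 <= f1 t)%E by rewrite lee_fin mulr_ge0 ?powR_ge0.
have f20 t : (0 <= f2 t)%E by rewrite lee_fin mulr_ge0 ?powR_ge0.
apply: (@le_trans _ _ (\int[mu]_t (f1 t + f2 t))%E); last first.
  by rewrite line_integralD// EFinD leeD ?integral_powR_near0 ?integral_powR_near_infty.
apply: line_le.
- apply/measurable_EFinP; apply: measurable_funM.
    by apply: measurable_funM; [exact: measurable_pos_ind|exact: measurable_powR].
  by apply: measurableT_comp (measurable_powR _) _; exact: measurable_funD.
- exact: emeasurable_funD.
- by move=> t; rewrite lee_fin !mulr_ge0 ?powR_ge0 ?pos_ind_ge0.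
move=> t; rewrite /f1 /f2 -EFinD lee_fin pos_indE !indicE !mem_setE !in_itv/= andbT.
case: (ltP 0 t) => t0; last by rewrite !mul0r addr_ge0// mulr_ge0 ?powR_ge0.
rewrite mul1r; case: (leP t 1) => t1 /=; rewrite ?mul1r ?mul0r ?addr0 ?add0r.
  rewrite ler_piMr ?powR_ge0// powRN invf_le1 ?powR_gt0 ?addr_gt0//.
  have b0 : 0 <= b by rewrite ltW// (lt_trans s0).
  have h1 : 1 <= 1 + t by rewrite lerDl ltW.
  have := ge0_ler_powR b0 ler01 (le_trans ler01 h1) h1; by rewrite powR1.
rewrite (_ : - (b - s) - 1 = (s - 1) + - b); last by ring.
rewrite [X in _ <= X]powRD ?(gt_eqF t0) ?implybT// ler_wpM2l ?powR_ge0// !powRN lef_pV2 ?posrE ?powR_gt0 ?addr_gt0//.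
have b0 : 0 <= b by rewrite ltW// (lt_trans s0).
by rewrite ge0_ler_powR ?nnegrE ?addr_ge0 ?(ltW t0)// lerDr.
Qed.

Definition gamma_kernel (t : R) : R := pos_ind t * t `^ (s - 1) * expR (- t).

Lemma gamma_kernel_ge0 t : 0 <= gamma_kernel t.
Proof. by rewrite !mulr_ge0 ?pos_ind_ge0 ?powR_ge0 ?expR_ge0. Qed.

Lemma measurable_gamma_kernel : measurable_fun setT gamma_kernel.
Proof.
apply: measurable_funM; first by apply: measurable_funM; [exact: measurable_pos_ind|exact: measurable_powR].
apply: continuous_measurable_fun => t; apply: continuous_comp; [exact: opp_continuous|exact: continuous_expR].
Qed.

(** For b >= 1, 1 + t <= b (1 + t/b) <= b e^(t/b); raising this to the power b trades exponential
    decay for the decay in [integral_beta_tail]. *)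
Lemma exp_powR_bound (b t : R) : 1 <= b -> 0 < t -> expR (- t) <= b `^ b * (1 + t) `^ (- b).
Proof.
move=> b1 t0; have b0 : 0 < b by exact: lt_le_trans b1.
have t1 : 0 < 1 + t by rewrite addr_gt0.
rewrite powRN expRN ler_pdivlMr ?powR_gt0// mulrC ler_pdivrMr ?expR_gt0//.
have h : 1 + t <= b * expR (t / b).
  apply: (@le_trans _ _ (b * (1 + t / b))); last by rewrite ler_wpM2l ?(ltW b0) ?expR_ge1Dx.
  by rewrite mulrDr mulr1 mulrCA divff ?gt_eqF// mulr1 lerD2r.
have := ge0_ler_powR (ltW b0) (ltW t1) (mulr_ge0 (ltW b0) (expR_ge0 _)) h.
rewrite powRM ?expR_ge0 ?(ltW b0)// => h1; apply: (le_trans h1).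
by rewrite ler_wpM2l ?powR_ge0// -expRM divfK// gt_eqF.
Qed.

Definition gamma : R := fine (\int[mu]_t (gamma_kernel t)%:E)%E.

Lemma integral_gamma : (\int[mu]_t (gamma_kernel t)%:E = gamma%:E)%E.
Proof.
rewrite /gamma fineK// ge0_fin_numE; last by apply: integral_ge0 => t _; rewrite lee_fin gamma_kernel_ge0.
pose b := s + 1; have b1 : 1 <= b by rewrite lerDr ltW.
have sb : s < b by rewrite ltrDl.
have mg : measurable_fun setT (fun t => (pos_ind t * t `^ (s - 1) * (1 + t) `^ (- b))%:E).
  apply/measurable_EFinP; apply: measurable_funM.
    by apply: measurable_funM; [exact: measurable_pos_ind|exact: measurable_powR].
  by apply: measurableT_comp (measurable_powR _) _; exact: measurable_funD.
have g0 t : (0 <= (pos_ind t * t `^ (s - 1) * (1 + t) `^ (- b))%:E)%E.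
  by rewrite lee_fin !mulr_ge0 ?powR_ge0 ?pos_ind_ge0.
apply: (@le_lt_trans _ _ ((b `^ b)%:E * (s^-1 + (b - s)^-1)%:E)%E); last by rewrite -EFinM ltry.
apply: le_trans (lee_wpmul2l _ (integral_beta_tail sb)); last by rewrite lee_fin powR_ge0.
rewrite -line_integralZ ?powR_ge0//; apply: line_le.
- by apply/measurable_EFinP; exact: measurable_gamma_kernel.
- exact: emeasurable_funM.
- by move=> t; rewrite lee_fin gamma_kernel_ge0.
move=> t; rewrite -EFinM lee_fin /gamma_kernel mulrCA pos_indE.
case: (ltP 0 t) => t0; last by rewrite !mul0r.
by rewrite ler_wpM2l ?mulr_ge0 ?powR_ge0 ?exp_powR_bound.
Qed.

Lemma gamma_gt0 : 0 < gamma.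
Proof.
rewrite -lte_fin -integral_gamma.
pose m := Num.min 1 (2^-1 `^ (s - 1)) * expR (-1); have m0 : 0 < m.
  by rewrite mulr_gt0 ?expR_gt0// lt_min ltr01 powR_gt0.
apply: (@lt_le_trans _ _ (\int[mu]_(t in `[2^-1%R, 1%R]) (cst m%:E t))%E).
  rewrite integral_cst//.
  have i1 : (2^-1 : R) < 1 by rewrite invf_lt1// ltr1n.
  have muI : mu (`[2^-1, 1]%classic : set R) = (1 - 2^-1)%:E.
    by rewrite lebesgue_measure_itv/= lte_fin i1 -EFinB.
  rewrite [X in (_ * X)%E](_ : _ = (1 - 2^-1)%:E)//.
  by rewrite -EFinM lte_fin mulr_gt0// subr_gt0.
rewrite integral_mkcond; apply: line_le.
- have mi : measurable (`[2^-1, 1]%classic : set R) by exact: measurable_itv.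
  exact: ((measurable_restrictT (cst m%:E) mi).1 (measurable_cst _)).
- by apply/measurable_EFinP; exact: measurable_gamma_kernel.
- by move=> t; rewrite patchE; case: ifP => // _; rewrite lee_fin ltW.
move=> t; rewrite patchE; case: ifPn => [|_]; last by rewrite lee_fin gamma_kernel_ge0.
rewrite inE/= in_itv/= => /andP[t1 t2]; have t0 : 0 < t by rewrite (lt_le_trans _ t1)// invr_gt0.
rewrite lee_fin /gamma_kernel pos_indE t0 mul1r; apply: ler_pM; rewrite ?expR_ge0 ?ler_expR ?lerN2//.
by apply: powR_min_le => //; rewrite invr_gt0.
Qed.

(** The substitution t -> (k + 1) t. Applied term by term to a power series it yields the multiplier
    (k + 1)^(-s) of [IR_pow (- s)]. *)
Lemma gamma_moment (k : nat) :
  (\int[mu]_t (gamma_kernel t * expR (- t) ^+ k)%:E = (gamma * k.+1%:R `^ (- s))%:E)%E.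
Proof.
have k0 : 0 < k.+1%:R :> R by [].
have mg : measurable_fun setT (fun t => (gamma_kernel t)%:E).
  by apply/measurable_EFinP; exact: measurable_gamma_kernel.
have g0 t : (0 <= (gamma_kernel t)%:E)%E by rewrite lee_fin gamma_kernel_ge0.
have kN0 : k.+1%:R != 0 :> R by rewrite gt_eqF.
have := lebesgue_affine 0 kN0 mg g0; rewrite integral_gamma ger0_norm ?(ltW k0)// => e1.
have e2 t : (gamma_kernel t * expR (- t) ^+ k)%:E =
    ((k.+1%:R `^ (1 - s))%:E * (gamma_kernel (0 + k.+1%:R * t))%:E)%E.
  rewrite add0r -EFinM; congr EFin; rewrite /gamma_kernel !pos_indE pmulr_rgt0//.
  case: (ltP 0 t) => t0; last by rewrite !mul0r mulr0.
  rewrite !mul1r powRM ?(ltW k0) ?(ltW t0)// -[in RHS]mulrA mulrCA.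
  rewrite mulrA -powRD ?(gt_eqF k0) ?implybT// subrKA subrr powRr0 mul1r.
  by rewrite -mulrA -exprS -expRM_natl mulrN.
have -> : (\int[mu]_t (gamma_kernel t * expR (- t) ^+ k)%:E =
    \int[mu]_t ((k.+1%:R `^ (1 - s))%:E * (gamma_kernel (0 + k.+1%:R * t)%R)%:E))%E.
  by apply: eq_integral => t _; exact: e2.
rewrite line_integralZ ?powR_ge0//; last first.
  by apply: measurableT_comp mg _; apply: measurable_funD => //; exact: measurable_funM.
rewrite e1 -!EFinM; congr EFin; rewrite mulrA mulrC; congr (_ * _).
by rewrite -powR_inv1 ?(ltW k0)// -powRD ?(gt_eqF k0) ?implybT//; congr (_ `^ _); ring.
Qed.

(** Scaling by T reduces to the unit interval, with exponent (s - 1) + eta + 1. At t = 1/2 the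
    integral is split; on each half the factor of the farther endpoint is comparable to 1. *)
Lemma integral_beta (eta : R) : -1 < eta -> exists2 C : R, 0 < C & forall T, 0 < T ->
  (\int[mu]_t (\1_(`]0, T[%classic : set R) t * t `^ (s - 1) * (T - t) `^ eta)%:E <= (C * T `^ (s + eta))%:E)%E.
Proof.
move=> eta1; have e0 : 0 < eta + 1 by rewrite -ltrBlDr sub0r.
pose L : R := 2 `^ `|s - 1| + 2 `^ `|eta|; have L0 : 0 < L by rewrite addr_gt0 ?powR_gt0.
pose phi (t : R) := \1_(`]0, 1[%classic : set R) t * t `^ (s - 1) * (1 - t) `^ eta.
have mphi : measurable_fun setT (EFin \o phi).
  apply/measurable_EFinP; apply: measurable_funM.
    by apply: measurable_funM; [exact: measurable_indic (measurable_itv _)|exact: measurable_powR].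
  by apply: measurableT_comp (measurable_powR _) _; exact: measurable_funB.
have phi0 t : (0 <= (EFin \o phi) t)%E by rewrite lee_fin !mulr_ge0 ?powR_ge0.
pose f1 (t : R) := (\1_(`]0, 1]%classic : set R) t * t `^ (s - 1))%:E.
pose f2 (t : R) := (\1_(`]0, 1]%classic : set R) t * t `^ (eta + 1 - 1))%:E.
have mf1 : measurable_fun setT f1 by apply/measurable_EFinP; exact: measurable_powR_itv.
have mf2 : measurable_fun setT f2 by apply/measurable_EFinP; exact: measurable_powR_itv.
have f10 t : (0 <= f1 t)%E by rewrite lee_fin mulr_ge0 ?powR_ge0.
have f20 t : (0 <= f2 t)%E by rewrite lee_fin mulr_ge0 ?powR_ge0.
have mf2' : measurable_fun setT (fun t : R => f2 (1 + (-1) * t)).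
  by apply: measurableT_comp mf2 _; apply: measurable_funD => //; exact: measurable_funM.
have If2 : (\int[mu]_t f2 (1 + (-1) * t)%R <= ((eta + 1)^-1)%:E)%E.
  rewrite (lebesgue_affine _ _ mf2 f20) ?oppr_eq0 ?oner_eq0// normrN normr1 invr1 mul1e.
  exact: integral_powR_near0.
have key : (\int[mu]_t (EFin \o phi) t <= (L * (s^-1 + (eta + 1)^-1))%:E)%E.
  apply: (@le_trans _ _ (\int[mu]_t (L%:E * (f1 t + f2 (1 + (-1) * t)%R)))%E); last first.
    rewrite line_integralZ ?(ltW L0)//; last 2 first.
    - exact: emeasurable_funD.
    - by move=> t; rewrite adde_ge0.
    rewrite line_integralD// EFinM lee_wpmul2l ?lee_fin ?(ltW L0)// EFinD leeD//.
    exact: integral_powR_near0.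
  apply: line_le => //; first by apply: emeasurable_funM => //; exact: emeasurable_funD.
  move=> t; rewrite /f1 /f2 /phi/= -EFinD -EFinM lee_fin addrK mulN1r !indicE !mem_setE !in_itv/=.
  case: (ltP 0 t) => t0 /=; last first.
    by rewrite !mul0r add0r mulr_ge0 ?(ltW L0)// mulr_ge0 ?powR_ge0.
  case: (ltP t 1) => t1 /=; last first.
    by rewrite !mul0r mulr_ge0 ?(ltW L0)// addr_ge0// mulr_ge0 ?powR_ge0.
  have t1' : 0 < 1 - t by rewrite subr_gt0.
  rewrite (ltW t1) t1' gerBl (ltW t0)/= !mul1r /L mulrDl [leRHS]addrC.
  have [th|th] := leP t 2^-1.
    rewrite (le_trans (_ : _ <= 2 `^ `|eta| * t `^ (s - 1)))//; last first.
      rewrite -[leLHS]addr0 lerD ?mulr_ge0 ?addr_ge0 ?powR_ge0//.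
      by rewrite ler_wpM2l ?powR_ge0// lerDl powR_ge0.
    rewrite mulrC ler_wpM2r ?powR_ge0//.
    have := @powR_comparable R (1 - t) 1 2 eta t1' ltr01; rewrite powR1 !mulr1; apply.
    - by rewrite ler1n.
    - by move: th t0; lra.
    - by move: th t0; lra.
  rewrite (le_trans (_ : _ <= 2 `^ `|s - 1| * (1 - t) `^ eta))//; last first.
    rewrite -[leLHS]add0r lerD ?mulr_ge0 ?addr_ge0 ?powR_ge0//.
    by rewrite ler_wpM2l ?powR_ge0// lerDr powR_ge0.
  rewrite ler_wpM2r ?powR_ge0//.
  have := @powR_comparable R t 1 2 (s - 1) t0 ltr01; rewrite powR1 !mulr1; apply.
  - by rewrite ler1n.
  - by move: th; lra.
  - by move: th t1; lra.
exists (L * (s^-1 + (eta + 1)^-1)) => [|T T0]; first by rewrite mulr_gt0// addr_gt0 ?invr_gt0.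
have TN0 : T^-1 != 0 by rewrite invr_eq0 gt_eqF.
have T1 : 0 < T^-1 by rewrite invr_gt0.
have := lebesgue_affine 0 TN0 mphi phi0; rewrite ger0_norm ?(ltW T1)// invrK => e1.
have e2 t : (\1_(`]0, T[%classic : set R) t * t `^ (s - 1) * (T - t) `^ eta)%:E =
    ((T `^ (s - 1 + eta))%:E * (EFin \o phi) (0 + T^-1 * t)%R)%E.
  rewrite add0r -EFinM; congr EFin; rewrite /phi !indicE !mem_setE !in_itv/= pmulr_rgt0//.
  rewrite [T^-1 * t]mulrC ltr_pdivrMr// mul1r.
  case: (ltP 0 t) => t0 /=; last by rewrite !mul0r mulr0.
  case: (ltP t T) => tT /=; last by rewrite !mul0r mulr0.
  have tE : 1 - t / T = (T - t) / T by rewrite mulrBl divff ?gt_eqF.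
  rewrite tE !mul1r powRM ?(ltW t0) ?(ltW T1)// [X in _ = _ * (_ * X)]powRM ?subr_ge0 ?(ltW tT) ?(ltW T1)//.
  have Ti x : T^-1 `^ x = (T `^ x)^-1 by rewrite -[T^-1]powR_inv1 ?(ltW T0)// -powRrM mulN1r powRN.
  rewrite !Ti [T `^ (s - 1 + eta)]powRD ?(gt_eqF T0) ?implybT//.
  have n1 : T `^ (s - 1) != 0 by rewrite gt_eqF ?powR_gt0.
  have n2 : T `^ eta != 0 by rewrite gt_eqF ?powR_gt0.
  by field; rewrite n1 n2.
have -> : (\int[mu]_t (\1_(`]0%R, T[%classic : set R) t * t `^ (s - 1) * (T - t) `^ eta)%:E =
    \int[mu]_t ((T `^ (s - 1 + eta))%:E * (EFin \o phi) (0 + T^-1 * t)%R))%E.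
  by apply: eq_integral => t _; exact: e2.
rewrite line_integralZ ?powR_ge0//; last first.
  by apply: measurableT_comp mphi _; apply: measurable_funD => //; exact: measurable_funM.
rewrite e1 muleA -EFinM (_ : T `^ (s - 1 + eta) * T = T `^ (s + eta)); last first.
  rewrite -[X in _ * X]powRr1 ?(ltW T0)// -powRD ?(gt_eqF T0) ?implybT//.
  by congr (_ `^ _); ring.
by rewrite mulrC EFinM lee_wpmul2l ?lee_fin ?powR_ge0.
Qed.

End GammaBeta.

(** * Fractional integration as an average over dilations *)

Section FractionalIntegral.
Variable R : realType.
Notation mu := (@lebesgue_measure R).
Notation mu2 := (mu \x mu)%E.
Implicit Types (f g : disk R -> R[i]) (a : nat -> R[i]).
Variable s : R.
Hypothesis s0 : 0 < s.

Let kern := gamma_kernel s.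
Let kern0 t : 0 <= kern t. Proof. exact: gamma_kernel_ge0. Qed.
Let mkern : measurable_fun setT kern. Proof. exact: measurable_gamma_kernel. Qed.

Lemma measurable_expRN : measurable_fun setT (fun t : R => expR (- t)).
Proof.
by apply: continuous_measurable_fun => t; apply: continuous_comp; [exact: opp_continuous|exact: continuous_expR].
Qed.

Lemma integral_gamma_exp_sum (n : nat) (x : nat -> R) : (forall k, 0 <= x k) ->
  (\int[mu]_t (kern t * \sum_(k < n) x k * expR (- t) ^+ k)%:E =
   (gamma s * \sum_(k < n) x k * k.+1%:R `^ (- s))%:E)%E.
Proof.
move=> x0; elim: n => [|n ih].
  rewrite big_ord0 mulr0 integral0_eq// => t _; by rewrite big_ord0 mulr0.
have m1 (k : nat) : measurable_fun setT (fun t => kern t * expR (- t) ^+ k).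
  apply: measurable_funM => //; apply: measurable_funX.
  exact: measurable_expRN.
have m2 : measurable_fun setT (fun t => (kern t * \sum_(k < n) x k * expR (- t) ^+ k)%:E).
  apply/measurable_EFinP; apply: measurable_funM => //.
  apply: measurable_sum => k; apply: measurable_funM => //; apply: measurable_funX.
  exact: measurable_expRN.
have e t : (kern t * \sum_(k < n.+1) x k * expR (- t) ^+ k)%:E =
   ((kern t * \sum_(k < n) x k * expR (- t) ^+ k)%:E + (x n)%:E * (kern t * expR (- t) ^+ n)%:E)%E.
  by rewrite big_ord_recr/= mulrDr EFinD -EFinM; congr (_ + _%:E)%E; rewrite mulrCA.
have -> : (\int[mu]_t (kern t * \sum_(k < n.+1) x k * expR (- t) ^+ k)%:E =
    \int[mu]_t ((kern t * \sum_(k < n) x k * expR (- t) ^+ k)%:E + (x n)%:E * (kern t * expR (- t) ^+ n)%:E))%E.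
  by apply: eq_integral => t _; exact: e.
have m3 : measurable_fun setT (fun t => (kern t * expR (- t) ^+ n)%:E) by exact/measurable_EFinP.
have p3 t : (0 <= (kern t * expR (- t) ^+ n)%:E)%E by rewrite lee_fin mulr_ge0// exprn_ge0 ?expR_ge0.
rewrite line_integralD//; last 3 first.
- exact: emeasurable_funM.
- by move=> t; rewrite lee_fin mulr_ge0// sumr_ge0// => k _; rewrite mulr_ge0 ?exprn_ge0 ?expR_ge0.
- by move=> t; apply: mule_ge0; [rewrite lee_fin x0|exact: p3].
rewrite ih line_integralZ// (gamma_moment s0) -EFinM -EFinD big_ord_recr/= mulrDr.
by congr (_ + _)%:E; rewrite mulrCA.
Qed.

(* The signed sum is split into its positive and negative parts so that only
   integrals of nonnegative functions occur. *)
Lemma gamma_integral_poly (n : nat) a (z : R[i]) :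
  ((gamma s * cabs (\sum_(k < n) (k.+1%:R `^ (- s))%:C * a k * z ^+ k))%:E <=
   \int[mu]_t (kern t * cabs (\sum_(k < n) a k * ((expR (- t))%:C * z) ^+ k))%:E)%E.
Proof.
have [u u1 uE] := unimodularP (\sum_(k < n) (k.+1%:R `^ (- s))%:C * a k * z ^+ k).
pose x k := complex.Re (u * (a k * z ^+ k)).
pose xp k := Num.max (x k) 0; pose xn k := Num.max (- x k) 0.
have xp0 k : 0 <= xp k by rewrite le_max lexx orbT.
have xn0 k : 0 <= xn k by rewrite le_max lexx orbT.
have xE k : x k = xp k - xn k.
  rewrite /xp /xn; have [h|h] := leP (x k) 0.
    by rewrite max_l ?oppr_ge0// opprK add0r.
  by rewrite max_r ?oppr_le0 ?(ltW h)// subr0.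
have ReC (y : R) (w : R[i]) : complex.Re (y%:C * w) = y * complex.Re w.
  by case: w => p q /=; rewrite mul0r subr0.
have cE : cabs (\sum_(k < n) (k.+1%:R `^ (- s))%:C * a k * z ^+ k) = \sum_(k < n) x k * k.+1%:R `^ (- s).
  transitivity (complex.Re (u * \sum_(k < n) (k.+1%:R `^ (- s))%:C * a k * z ^+ k)); first by rewrite uE.
  rewrite mulr_sumr Re_sum; apply: eq_bigr => k _.
  by rewrite -mulrA mulrCA ReC mulrC.
have pE t : \sum_(k < n) x k * expR (- t) ^+ k <= cabs (\sum_(k < n) a k * ((expR (- t))%:C * z) ^+ k).
  rewrite (_ : \sum_(k < n) _ = complex.Re (u * \sum_(k < n) a k * ((expR (- t))%:C * z) ^+ k)).
    by rewrite (le_trans (ler_norm _))// (le_trans (Re_le_cabs _))// cabsM u1 mul1r.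
  rewrite mulr_sumr Re_sum; apply: eq_bigr => k _.
  by rewrite exprMn -rmorphXn/= [a k * _]mulrCA [u * _]mulrCA ReC mulrC.
set I := (X in (_ <= X)%E).
have mI : measurable_fun setT (fun t => (kern t * cabs (\sum_(k < n) a k * ((expR (- t))%:C * z) ^+ k))%:E).
  apply/measurable_EFinP; apply: measurable_funM => //.
  pose P : {poly R[i]} := \poly_(k < n) a k.
  rewrite (_ : (fun t => _) = (fun t => cabs P.[(expR (- t))%:C * z])).
    apply/measurable_cabs/cmeasurable_horner/cmeasurableM; last exact: cmeasurable_cst.
    split; last exact: measurable_cst.
    exact: measurable_expRN.
  by apply/funext => t; rewrite horner_poly.
have I0 t : (0 <= (kern t * cabs (\sum_(k < n) a k * ((expR (- t))%:C * z) ^+ k))%:E)%E.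
  by rewrite lee_fin mulr_ge0 ?cabs_ge0.
have ms (y : nat -> R) : measurable_fun setT (fun t => (kern t * \sum_(k < n) y k * expR (- t) ^+ k)%:E).
  apply/measurable_EFinP; apply: measurable_funM => //.
  apply: measurable_sum => k; apply: measurable_funM => //; apply: measurable_funX.
  exact: measurable_expRN.
have s0' (y : nat -> R) : (forall k, 0 <= y k) -> forall t, (0 <= (kern t * \sum_(k < n) y k * expR (- t) ^+ k)%:E)%E.
  by move=> y0 t; rewrite lee_fin mulr_ge0// sumr_ge0// => k _; rewrite mulr_ge0 ?exprn_ge0 ?expR_ge0.
have := @line_le R (fun t => (kern t * \sum_(k < n) xp k * expR (- t) ^+ k)%:E)
  (fun t => (kern t * cabs (\sum_(k < n) a k * ((expR (- t))%:C * z) ^+ k))%:E +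
     (kern t * \sum_(k < n) xn k * expR (- t) ^+ k)%:E)%E (ms _) (emeasurable_funD mI (ms _)) (s0' _ xp0).
rewrite line_integralD//; last exact: s0'.
rewrite !integral_gamma_exp_sum// -/I => h.
have {}h : ((gamma s * \sum_(k < n) xp k * k.+1%:R `^ (- s))%:E <=
    I + (gamma s * \sum_(k < n) xn k * k.+1%:R `^ (- s))%:E)%E.
  apply: h => t; rewrite -EFinD lee_fin -mulrDr ler_wpM2l// -lerBlDr.
  rewrite -sumrB (le_trans _ (pE t))// le_eqVlt; apply/orP; left; apply/eqP.
  by apply: eq_bigr => k _; rewrite -mulrBl -xE.
rewrite -leeBlDr// -EFinB -mulrBr -sumrB in h.
apply: le_trans h; rewrite lee_fin cE le_eqVlt; apply/orP; left; apply/eqP.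
by congr (_ * _); apply: eq_bigr => k _; rewrite -mulrBl -xE.
Qed.

(** The inequality for partial sums passes to the limit: all dilates of d lie in |z| <= |d|, where
    the series converges uniformly, and an error e / gamma(s) integrates to e against the kernel. *)
Lemma gamma_integral_bound g (d : disk R) : analytic g ->
  ((gamma s * cabs (IR_pow (- s) g d))%:E <=
   \int[mu]_t (kern t * cabs (ext0 g ((expR (- t))%:C * point d)))%:E)%E.
Proof.
move=> ag; have [a ga] := analytic_expands ag; have g1 := IR_pow_expands (b := - s) ga.
have gam0 := gamma_gt0 s0; have d1 := disk_cabs d; have d0 := cabs_ge0 (point d).
have cv := complex_cvg_cabs (g1 d).
have ec : cmeasurable setT (fun t : R => (expR (- t))%:C * point d).
  apply/cmeasurableM; last exact: cmeasurable_cst.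
  split; last exact: measurable_cst.
  exact: measurable_expRN.
have mG : measurable_fun setT (fun t => (kern t * cabs (ext0 g ((expR (- t))%:C * point d)))%:E).
  have [h1 h2] := cmeasurable_ext0 ag; have [c1 c2] := ec.
  have mpt : measurable_fun setT (fun t : R => (complex.Re ((expR (- t))%:C * point d), complex.Im ((expR (- t))%:C * point d))).
    exact: measurable_fun_pair.
  apply/measurable_EFinP; apply: measurable_funM => //.
  have := measurableT_comp (measurable_cabs (cmeasurable_ext0 ag)) mpt; apply: eq_measurable_fun => t _.
  by rewrite /= /cpt; congr (cabs (ext0 g _)); case: (_ * _).
have G0 t : (0 <= (kern t * cabs (ext0 g ((expR (- t))%:C * point d)))%:E)%E.
  by rewrite lee_fin mulr_ge0 ?cabs_ge0.
apply/lee_addgt0Pr => e e0; pose e1 := e / gamma s.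
have e10 : 0 < e1 by rewrite divr_gt0.
have [N hN] := partial_sums_uniform ga d0 d1 e10.
set I := (\int[mu]_t _)%E.
suff H n : (N <= n)%N -> ((gamma s * cabs (series (fun k => (k.+1%:R `^ (- s))%:C * a k * point d ^+ k) n))%:E <= I + e%:E)%E.
  have [->|Ioo] := eqVneq I +oo%E; first by rewrite addye// leey.
  have Ir : I \is a fin_num.
    by rewrite ge0_fin_numE ?ltey//; apply: integral_ge0 => t _; exact: G0.
  rewrite -(fineK Ir) -EFinD lee_fin mulrC -ler_pdivlMr//.
  rewrite -(cvg_lim (@Rhausdorff R) cv); apply: limr_le; first exact: cvgP cv.
  exists N => // n /= Nn; rewrite ler_pdivlMr// mulrC -lee_fin EFinD fineK//.
  exact: H.
move=> Nn; rewrite /series/= big_mkord; apply: le_trans (gamma_integral_poly n a (point d)) _.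
have mk : measurable_fun setT (fun t => (kern t)%:E) by exact/measurable_EFinP.
have k0 t : (0 <= (kern t)%:E)%E by rewrite lee_fin.
have -> : (e%:E = \int[mu]_t (e1%:E * (kern t)%:E))%E.
  by rewrite line_integralZ ?(ltW e10)// (integral_gamma s0) -EFinM divfK// gt_eqF.
rewrite -line_integralD//; last 2 first.
- exact: emeasurable_funM.
- by move=> t; rewrite mule_ge0// lee_fin ltW.
apply: line_le.
- apply/measurable_EFinP; apply: measurable_funM => //.
  pose P : {poly R[i]} := \poly_(k < n) a k.
  rewrite (_ : (fun t => _) = (fun t => cabs P.[(expR (- t))%:C * point d])).
    by apply/measurable_cabs/cmeasurable_horner; exact: ec.
  by apply/funext => t; rewrite horner_poly.
- by apply: emeasurable_funD => //; exact: emeasurable_funM.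
- by move=> t; rewrite lee_fin mulr_ge0 ?cabs_ge0.
move=> t; rewrite -EFinM -EFinD lee_fin [e1 * _]mulrC -mulrDr.
have [t0|t0] := ltP 0 t; last by rewrite /kern /gamma_kernel pos_indE ltNge t0 !mul0r.
have zs : cabs ((expR (- t))%:C * point d) <= cabs (point d).
  by rewrite cabsM cabs_ge0_real ?expR_ge0// ler_piMl// -expR0 ler_expR oppr_le0 ltW.
rewrite ler_wpM2l// (le_trans (cabs_le_dist _ (ext0 g ((expR (- t))%:C * point d))))// lerD2l.
exact: hN.
Qed.

End FractionalIntegral.

(** * The two kernel integrals of the Schur test *)

Section SchurTest.
Variable R : realType.
Notation mu := (@lebesgue_measure R).
Notation mu2 := (mu \x mu)%E.

Lemma one_sub_exp (u : R) : 0 < u -> u <= 2 ->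
  [/\ 0 < 1 - expR (- u), 1 - expR (- u) <= u & u <= 3 * (1 - expR (- u))].
Proof.
move=> u0 u2; have h1 : 1 - u <= expR (- u) by exact: expR_ge1Dx.
have h2 : expR (- u) <= (1 + u)^-1.
  by rewrite expRN lef_pV2 ?posrE ?expR_gt0 ?addr_gt0// expR_ge1Dx.
have h3 : u / (1 + u) <= 1 - expR (- u).
  rewrite lerBrDl -lerBrDr (le_trans h2)// -[leLHS]mul1r ler_pdivrMr ?addr_gt0//.
  by rewrite mulrBl mul1r divfK ?addrK// gt_eqF ?addr_gt0.
split.
- by apply: lt_le_trans h3; rewrite divr_gt0// addr_gt0.
- by rewrite lerBlDr -lerBlDl.
- apply: (@le_trans _ _ (3 * (u / (1 + u)))); last by rewrite ler_wpM2l.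
  by rewrite mulrA ler_pdivlMr ?addr_gt0// [leRHS]mulrC ler_wpM2l ?(ltW u0)//; move: u2; lra.
Qed.

Lemma one_sub_exp_mul (r t : R) : 2^-1 <= r -> r < 1 -> 0 < t -> t <= 1 ->
  ((1 - r) + t) / 4 <= 1 - expR (- t) * r.
Proof.
move=> r1 r2 t0 t1; have r0 : 0 < r by rewrite (lt_le_trans _ r1)// invr_gt0.
have h2 : expR (- t) <= 1 - t / 2.
  rewrite expRN -[leLHS]mul1r ler_pdivrMr ?expR_gt0//.
  apply: (@le_trans _ _ ((1 - t / 2) * (1 + t))); first by nra.
  by rewrite ler_wpM2l ?expR_ge1Dx//; lra.
have h3 := ler_wpM2r (ltW r0) h2.
apply: (@le_trans _ _ (1 - (1 - t / 2) * r)); last by rewrite lerD2l lerN2.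
by nra.
Qed.

Section Fixed.
Variable s : R.
Hypothesis s0 : 0 < s.

(** The part t <= 1 of the gamma kernel, with e^(-t) bounded by 1. For t >= 1 the dilate e^(-t) z
    lies in |z| < 1/2 and is treated by a plain bound. *)
Definition unit_power (t : R) : R := \1_(`]0, 1]%classic : set R) t * t `^ (s - 1).

Lemma unit_powerE t : unit_power t = ((0 < t) && (t <= 1))%R%:R * t `^ (s - 1).
Proof. by rewrite /unit_power indicE mem_setE in_itv. Qed.

Lemma unit_power_ge0 t : 0 <= unit_power t.
Proof. by rewrite mulr_ge0 ?powR_ge0. Qed.

Lemma measurable_unit_power : measurable_fun setT unit_power.
Proof. exact: measurable_powR_itv. Qed.

(** For t <= 1 and r >= 1/2, 1 - e^(-t) r is at least ((1 - r) + t)/4; scaling t by 1 - r leaves the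
    integral of t^(s-1) (1 + t)^(-b), which converges because b > s. *)
Lemma schur_first (b r : R) : s < b -> 2^-1 <= r -> r < 1 ->
  (\int[mu]_t (unit_power t * (1 - expR (- t) * r) `^ (- b))%:E <=
   (4 `^ b * (s^-1 + (b - s)^-1) * (1 - r) `^ (s - b))%:E)%E.
Proof.
move=> sb r1 r2; pose rho := 1 - r; have rho0 : 0 < rho by rewrite subr_gt0.
have b0 : 0 < b by exact: lt_trans sb.
pose phi (t : R) := (pos_ind t * t `^ (s - 1) * (1 + t) `^ (- b))%:E.
have mphi : measurable_fun setT phi.
  apply/measurable_EFinP; apply: measurable_funM.
    by apply: measurable_funM; [exact: measurable_pos_ind|exact: measurable_powR].
  by apply: measurableT_comp (measurable_powR _) _; exact: measurable_funD.
have phi0 t : (0 <= phi t)%E by rewrite lee_fin !mulr_ge0 ?powR_ge0 ?pos_ind_ge0.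
have c0 : rho^-1 != 0 by rewrite invr_eq0 gt_eqF.
have c1 : 0 < rho^-1 by rewrite invr_gt0.
have := lebesgue_affine 0 c0 mphi phi0; rewrite ger0_norm ?(ltW c1)// invrK => e1.
have mphi' : measurable_fun setT (fun t : R => phi (0 + rho^-1 * t)).
  by apply: measurableT_comp mphi _; apply: measurable_funD => //; exact: measurable_funM.
pose k := 4 `^ b * rho `^ (s - 1 - b); have k0 : 0 <= k by rewrite mulr_ge0 ?powR_ge0.
apply: (@le_trans _ _ (\int[mu]_t (k%:E * phi (0 + rho^-1 * t)%R))%E); last first.
  rewrite line_integralZ// e1 muleA -EFinM.
  have -> : k * rho = 4 `^ b * rho `^ (s - b).
    rewrite /k -mulrA; congr (_ * _); rewrite -[X in _ * X]powRr1 ?(ltW rho0)//.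
    by rewrite -powRD ?(gt_eqF rho0) ?implybT//; congr (_ `^ _); ring.
  have -> : 4 `^ b * (s^-1 + (b - s)^-1) * (1 - r) `^ (s - b) = 4 `^ b * rho `^ (s - b) * (s^-1 + (b - s)^-1).
    by rewrite -/rho mulrAC.
  rewrite [X in (_ <= X)%E]EFinM; apply: lee_wpmul2l; first by rewrite lee_fin mulr_ge0 ?powR_ge0.
  exact: integral_beta_tail.
apply: line_le.
- apply/measurable_EFinP; apply: measurable_funM; first exact: measurable_unit_power.
  apply: measurableT_comp (measurable_powR _) _; apply: measurable_funB => //.
  by apply: measurable_funM => //; exact: measurable_expRN.
- exact: emeasurable_funM.
- by move=> t; rewrite lee_fin mulr_ge0 ?unit_power_ge0 ?powR_ge0.
move=> t; rewrite /phi -EFinM lee_fin add0r unit_powerE pos_indE pmulr_rgt0//.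
case: (ltP 0 t) => t0 /=; last by rewrite !mul0r mulr0.
case: (leP t 1) => t1 /=; last by rewrite !mul0r mulr_ge0// !mulr_ge0 ?powR_ge0.
rewrite !mul1r; have h := one_sub_exp_mul r1 r2 t0 t1; rewrite -/rho in h.
have rt : 0 < rho + t by rewrite addr_gt0.
have -> : k * ((rho^-1 * t) `^ (s - 1) * (1 + rho^-1 * t) `^ (- b)) =
    t `^ (s - 1) * ((rho + t) / 4) `^ (- b).
  have Ti x : rho^-1 `^ x = (rho `^ x)^-1 by rewrite -[rho^-1]powR_inv1 ?(ltW rho0)// -powRrM mulN1r powRN.
  have -> : 1 + rho^-1 * t = (rho + t) * rho^-1 by rewrite mulrDl divff ?gt_eqF// mulrC.
  rewrite powRM ?(ltW c1) ?(ltW t0)// [X in _ * (_ * X)]powRM ?(ltW rt) ?(ltW c1)//.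
  rewrite [X in _ = _ * X]powRM ?(ltW rt) ?invr_ge0// !Ti.
  have -> : (4^-1 : R) `^ (- b) = 4 `^ b by rewrite -[4^-1]powR_inv1// -powRrM mulN1r opprK.
  rewrite /k powRD ?(gt_eqF rho0) ?implybT//.
  have n1 : rho `^ (s - 1) != 0 by rewrite gt_eqF ?powR_gt0.
  have n2 : rho `^ (- b) != 0 by rewrite gt_eqF ?powR_gt0.
  move: (rho `^ (s - 1)) (rho `^ (- b)) (t `^ (s - 1)) ((rho + t) `^ (- b)) (4 `^ b) n1 n2 => A B X Y Z n1 n2.
  by field; rewrite n1 n2.
rewrite ler_wpM2l ?powR_ge0// !powRN lef_pV2 ?posrE ?powR_gt0 ?divr_gt0//; last first.
  by apply: lt_le_trans h; rewrite divr_gt0.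
by rewrite ge0_ler_powR ?nnegrE ?(ltW b0) ?divr_ge0 ?(ltW rt)// (le_trans _ h)// divr_ge0 ?(ltW rt).
Qed.

(** The cut at 1/2 is the range of moduli in which [schur_first] applies. *)
Definition annulus_power (eta x : R) : R := \1_(`[2^-1, 1[%classic : set R) x * (1 - x) `^ eta.

Lemma annulus_powerE eta x : annulus_power eta x = ((2^-1 <= x) && (x < 1))%R%:R * (1 - x) `^ eta.
Proof. by rewrite /annulus_power indicE mem_setE in_itv. Qed.

Lemma annulus_power_ge0 eta x : 0 <= annulus_power eta x.
Proof. by rewrite mulr_ge0 ?powR_ge0. Qed.

Lemma measurable_annulus_power eta : measurable_fun setT (annulus_power eta).
Proof.
apply: measurable_funM; first exact: measurable_indic (measurable_itv _).
by apply: measurableT_comp (measurable_powR eta) _; exact: measurable_funB.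
Qed.

(** Writing x = e^(-T) gives 1 - e^t x = 1 - e^(-(T-t)), comparable to T - t while T <= 2, and a
    beta integral results. If x < e^(-2), then e^t x < 1/2 for t <= 1 and the integrand vanishes. *)
Lemma schur_second (eta : R) : -1 < eta -> exists2 C : R, 0 < C & forall x, 0 <= x -> x < 1 ->
  (\int[mu]_t (unit_power t * annulus_power eta (expR t * x))%:E <= (C * (1 - x) `^ (s + eta))%:E)%E.
Proof.
move=> eta1; have [CB CB0 hB] := integral_beta s0 eta1.
pose C := 3 `^ `|eta| * CB * 3 `^ `|s + eta|.
exists C; first by rewrite !mulr_gt0 ?powR_gt0.
move=> x x0 x1.
have l2 : expR (-1) <= 2^-1 :> R.
  by rewrite expRN lef_pV2 ?posrE ?expR_gt0//; have := expR_ge1Dx (1 : R); rewrite -[1 + 1]/(2%:R).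
have [xe|xe] := leP (expR (-2)) x; last first.
  rewrite integral0_eq ?lee_fin ?mulr_ge0 ?powR_ge0 ?(ltW CB0)// => t _.
  rewrite unit_powerE annulus_powerE; case: (ltP 0 t) => t0 /=; last by rewrite !mul0r.
  case: (leP t 1) => t1 /=; last by rewrite !mul0r.
  rewrite (_ : (2^-1 <= expR t * x) = false) /= ?mul0r ?mulr0//; apply/negbTE; rewrite -ltNge.
  apply: (lt_le_trans _ l2); apply: (@lt_le_trans _ _ (expR t * expR (-2))).
    by rewrite ltr_pM2l ?expR_gt0.
  by rewrite -expRD ler_expR; move: t1; lra.
have xpos : 0 < x by apply: lt_le_trans xe; exact: expR_gt0.
pose T := - ln x; have xE : x = expR (- T) by rewrite opprK lnK.
have T0 : 0 < T by rewrite oppr_gt0 ln_lt0// xpos x1.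
have T2 : T <= 2 by move: xe; rewrite xE ler_expR lerN2.
pose f (t : R) := (\1_(`]0, T[%classic : set R) t * t `^ (s - 1) * (T - t) `^ eta)%:E.
have mf : measurable_fun setT f.
  apply/measurable_EFinP; apply: measurable_funM.
    by apply: measurable_funM; [exact: measurable_indic (measurable_itv _)|exact: measurable_powR].
  by apply: measurableT_comp (measurable_powR _) _; exact: measurable_funB.
have f0 t : (0 <= f t)%E by rewrite lee_fin !mulr_ge0 ?powR_ge0.
apply: (@le_trans _ _ (\int[mu]_t ((3 `^ `|eta|)%:E * f t))%E).
  apply: line_le.
  - apply/measurable_EFinP; apply: measurable_funM; first exact: measurable_unit_power.
    apply: measurableT_comp (measurable_annulus_power _) _.
    by apply: measurable_funM => //; exact: measurable_expR.
  - exact: emeasurable_funM.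
  - by move=> t; rewrite lee_fin mulr_ge0 ?unit_power_ge0 ?annulus_power_ge0.
  move=> t; rewrite /f -EFinM lee_fin unit_powerE annulus_powerE indicE mem_setE in_itv/=.
  case: (ltP 0 t) => t0 /=; last by rewrite !mul0r mulr0.
  case: (leP t 1) => t1 /=; last by rewrite !mul0r mulr_ge0 ?powR_ge0// !mulr_ge0 ?powR_ge0.
  have -> : expR t * x = expR (- (T - t)) by rewrite xE -expRD opprB.
  case: (ltP t T) => tT; last first.
    rewrite (_ : (expR (- (T - t)) < 1) = false) ?andbF ?mul0r ?mulr0//.
    by apply/negbTE; rewrite -leNgt -expR0 ler_expR oppr_ge0 subr_le0.
  have u0 : 0 < T - t by rewrite subr_gt0.
  have u2 : T - t <= 2 by move: T2 t0; lra.
  have [h1 h2 h3] := one_sub_exp u0 u2.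
  case: (_ && _) => /=; last by rewrite !mul0r mulr0 !mulr_ge0 ?powR_ge0.
  rewrite !mul1r mulrCA ler_wpM2l ?powR_ge0//.
  apply: powR_comparable => //; first by rewrite ler1n.
  by rewrite (le_trans h2)// ler_peMl ?(ltW u0)// ler1n.
rewrite line_integralZ ?powR_ge0//.
apply: le_trans (lee_wpmul2l _ (hB T T0)) _; first by rewrite lee_fin powR_ge0.
rewrite -EFinM lee_fin /C mulrA -[leRHS]mulrA ler_wpM2l ?mulr_ge0 ?powR_ge0 ?(ltW CB0)//.
have [h1 h2 h3] := one_sub_exp T0 T2; rewrite -xE in h1 h2 h3.
apply: powR_comparable => //; first by rewrite ler1n.
by rewrite (le_trans h2)// ler_peMl ?(ltW T0)// ler1n.
Qed.

End Fixed.
End SchurTest.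

(** * Fractional integration between weighted Bergman spaces *)

Section FractionalBound.
Variable R : realType.
Notation mu := (@lebesgue_measure R).
Notation mu2 := (mu \x mu)%E.
Implicit Types (f g : disk R -> R[i]) (q : R * R).

Lemma kernel_le (k T B B' c m : R) : 0 <= k -> k <= T -> 0 <= c -> 0 <= m -> B' * B = 1 ->
  k * c <= T * B' * (B * c) + m * k.
Proof.
move=> k0 kT c0 m0 e; have -> : T * B' * (B * c) = T * c * (B' * B) by ring.
by rewrite e mulr1 -[leLHS]addr0 lerD ?mulr_ge0 ?ler_wpM2r.
Qed.

Lemma mul_rearrange1 (a c x r t e f h : R) :
  a * (c * x) * r * (t * e * (f * h)) = a * c * t * e * f * h * (x * r).
Proof. by ring. Qed.

Lemma mul_rearrange2 (a c w t x e f h : R) :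
  a * c * w * (t * x * (e * f * h)) = a * c * t * e * f * h * (w * x).
Proof. by ring. Qed.

Lemma one_sub_sqr_powR (y a : R) : 0 <= y -> y < 1 ->
  (1 - y ^+ 2) `^ a <= 2 `^ `|a| * (1 - y) `^ a /\ (1 - y) `^ a <= 2 `^ `|a| * (1 - y ^+ 2) `^ a.
Proof.
move=> y0 y1; have [h1 h2] := one_sub_sqr_bounds y0 y1.
have x0 : 0 < 1 - y by rewrite subr_gt0.
have x'0 : 0 < 1 - y ^+ 2 by exact: lt_le_trans h1.
have h3 : 1 - y <= 2 * (1 - y ^+ 2) by rewrite (le_trans h1)// ler_peMl ?(ltW x'0)// ler1n.
by split; apply: powR_comparable => //; rewrite ler1n.
Qed.

Lemma plane_dilation_le (f h : R * R -> \bar R) (c a : R) : 0 < c -> c ^- 2 <= a ->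
  measurable_fun setT h -> (forall q, (0 <= h q)%E) -> (forall q, f q = h (c * q.1, c * q.2)) ->
  (\int[mu2]_q f q <= a%:E * \int[mu2]_q h q)%E.
Proof.
move=> c0 ca mh h0 fh; have -> : f = (fun q => h (c * q.1, c * q.2)) by apply/funext.
rewrite (plane_scale c0 mh h0); apply: lee_wpmul2r; last by rewrite lee_fin.
exact: plane_integral_ge0.
Qed.

Lemma plane_integral0_le (f : R * R -> \bar R) (a : \bar R) : (forall q, f q = 0%E) ->
  (0 <= a)%E -> (\int[mu2]_q f q <= a)%E.
Proof. by move=> f0 a0; rewrite integral0_eq. Qed.

Lemma line_integral0 (f : R -> \bar R) : (forall t, f t = 0%E) -> (\int[mu]_t f t = 0)%E.
Proof. by move=> f0; apply: integral0_eq => t _. Qed.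

Lemma iterated_integral_bound (F G : R * (R * R) -> \bar R) (W : R * R -> \bar R) (a c : R) :
  measurable_fun setT F -> measurable_fun setT G -> measurable_fun setT W ->
  (forall x, (0 <= F x)%E) -> (forall x, (0 <= G x)%E) -> (forall q, (0 <= W q)%E) ->
  0 <= a -> 0 <= c ->
  (forall t, (\int[mu2]_q F (t, q) <= a%:E * \int[mu2]_q G (t, q))%E) ->
  (forall q, (\int[mu]_t G (t, q) <= c%:E * W q)%E) ->
  (\int[mu2]_q \int[mu]_t F (t, q) <= (a * c)%:E * \int[mu2]_q W q)%E.
Proof.
move=> mF mG mW F0 G0 W0 a0 c0 FG GW.
have -> := esym (line_plane_tonelli mF F0).
apply: (@le_trans _ _ (\int[mu]_t (a%:E * \int[mu2]_q G (t, q)))%E).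
  apply: line_le.
  - exact: measurable_line_plane mF F0.
  - apply: emeasurable_funM; [exact: measurable_cst|exact: measurable_line_plane mG G0].
  - by move=> t; apply: plane_integral_ge0 => q; exact: F0.
  - exact: FG.
have mG1 := measurable_line_plane mG G0.
have G1 t : (0 <= \int[mu2]_q G (t, q))%E by apply: plane_integral_ge0 => q; exact: G0.
have -> := line_integralZ a0 mG1 G1.
rewrite EFinM -muleA; apply: lee_wpmul2l; first by rewrite lee_fin.
have -> := line_plane_tonelli mG G0.
have <- := plane_integralZ c0 mW W0.
apply: plane_le.
- exact: measurable_line_plane' mG G0.
- apply: emeasurable_funM; [exact: measurable_cst|exact: mW].
- by move=> q; apply: integral_ge0 => t _; exact: G0.
- exact: GW.
Qed.

Variables (s gm p b eta : R).
Hypotheses (s0 : 0 < s) (p1 : 1 <= p).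
Hypothesis etaE : eta = gm + (s - b) * (p - 1).
Variables (Cs KV : R).
Hypotheses (Cs0 : 0 < Cs) (KV0 : 0 < KV).
Hypothesis hCs : forall x, 0 <= x -> x < 1 ->
  (\int[mu]_t (unit_power s t * annulus_power eta (expR t * x))%:E <= (Cs * (1 - x) `^ (s + eta))%:E)%E.
Hypothesis hKV : forall r, 2^-1 <= r -> r < 1 ->
  (\int[mu]_t (unit_power s t * (1 - expR (- t) * r) `^ (- b))%:E <= (KV * (1 - r) `^ (s - b))%:E)%E.

Let p0 : 0 < p. Proof. exact: lt_le_trans p1. Qed.

Section OneFunction.
Variable g : disk R -> R[i].
Hypothesis ag : analytic g.

Let H (q : R * R) := cabs (ext0 g (cpt q)) `^ p.
Let H0 q : 0 <= H q. Proof. exact: powR_ge0. Qed.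
Let mH : measurable_fun setT H.
Proof. exact: measurableT_comp (measurable_powR p) (measurable_cabs (cmeasurable_ext0 ag)). Qed.

Let mod q := cabs (cpt q).
Let mmod : measurable_fun setT mod. Proof. by apply: measurable_cabs; exact: cmeasurable_cpt. Qed.

Let dil (t : R) q : R * R := (expR (- t) * q.1, expR (- t) * q.2).

Let cpt_dil t q : cpt (dil t q) = (expR (- t))%:C * cpt q.
Proof. by rewrite /cpt /dil; apply/eqP; rewrite eq_complex /= !mul0r subr0 addr0 !eqxx. Qed.

Let mod_dil t q : mod (dil t q) = expR (- t) * mod q.
Proof. by rewrite /mod cpt_dil cabsM cabs_ge0_real ?expR_ge0. Qed.

(** The integrand after Jensen's inequality. The exponent b (p - 1) is b p from the p-th power minus
    b from the weight; [eta] combines [gm] with (s - b)(p - 1), the power of the total mass bounded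
    by [schur_first]. *)
Let Phi (x : R * (R * R)) : \bar R :=
  (unit_power s x.1 * annulus_power eta (mod x.2) *
   ((1 - expR (- x.1) * mod x.2) `^ (b * (p - 1)) * H (dil x.1 x.2)))%:E.

(** [Phi] in the variable w = e^(-t) z. The substitution costs e^(2t), at most e^2 since t <= 1. *)
Let Psi (x : R * (R * R)) : \bar R :=
  (unit_power s x.1 * annulus_power eta (expR x.1 * mod x.2) *
   ((1 - mod x.2) `^ (b * (p - 1)) * H x.2))%:E.

Let Phi0 x : (0 <= Phi x)%E.
Proof. by rewrite lee_fin !mulr_ge0 ?unit_power_ge0 ?annulus_power_ge0 ?powR_ge0. Qed.

Let Psi0 x : (0 <= Psi x)%E.
Proof. by rewrite lee_fin !mulr_ge0 ?unit_power_ge0 ?annulus_power_ge0 ?powR_ge0. Qed.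

Let mexpN : measurable_fun setT (fun x : R * (R * R) => expR (- x.1)).
Proof. by apply: (measurableT_comp (@measurable_expRN R)); exact: measurable_fst. Qed.

Let mexp : measurable_fun setT (fun x : R * (R * R) => expR x.1).
Proof. by apply: (measurableT_comp (@measurable_expR R)); exact: measurable_fst. Qed.

Let mmod2 : measurable_fun setT (fun x : R * (R * R) => mod x.2).
Proof. by apply: (measurableT_comp mmod); exact: measurable_snd. Qed.

Let mup : measurable_fun setT (fun x : R * (R * R) => unit_power s x.1).
Proof. by apply: (measurableT_comp (measurable_unit_power s)); exact: measurable_fst. Qed.

Let mPhi : measurable_fun setT Phi.
Proof.
apply/measurable_EFinP; apply: measurable_funM.
  by apply: measurable_funM => //; exact: (measurableT_comp (measurable_annulus_power eta) mmod2).
apply: measurable_funM.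
  apply: (measurableT_comp (measurable_powR (b * (p - 1)))).
  by apply: measurable_funB => //; exact: measurable_funM.
apply: (measurableT_comp mH); apply: measurable_fun_pair; apply: measurable_funM => //.
- by apply: (measurableT_comp measurable_fst); exact: measurable_snd.
- by apply: (measurableT_comp measurable_snd); exact: measurable_snd.
Qed.

Let mPsi : measurable_fun setT Psi.
Proof.
apply/measurable_EFinP; apply: measurable_funM.
  apply: measurable_funM => //; apply: (measurableT_comp (measurable_annulus_power eta)).
  exact: measurable_funM.
apply: measurable_funM; last by apply: (measurableT_comp mH); exact: measurable_snd.
by apply: (measurableT_comp (measurable_powR (b * (p - 1)))); exact: measurable_funB.
Qed.

Let scale_t t : (\int[mu2]_q Phi (t, q) <= (expR 2)%:E * \int[mu2]_q Psi (t, q))%E.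
Proof.
have mPt : measurable_fun setT (fun q => Psi (t, q)).
  by apply: (measurableT_comp mPsi); exact: measurable_fun_pair.
have pos := expR_gt0 (- t).
have [/andP[t0 t1]|nt] := boolP ((0 < t) && (t <= 1)); last first.
  have Phi00 q : Phi (t, q) = 0%E by rewrite /Phi/= unit_powerE (negbTE nt) !mul0r.
  apply: (plane_integral0_le Phi00); apply: mule_ge0; first by rewrite lee_fin expR_ge0.
  by apply: plane_integral_ge0 => q; exact: Psi0.
have e q : Phi (t, q) = Psi (t, (expR (- t) * q.1, expR (- t) * q.2)).
  rewrite /Phi /Psi/= -/(dil t q) mod_dil.
  by have -> : expR t * (expR (- t) * mod q) = mod q by rewrite mulrA -expRD subrr expR0 mul1r.
apply: (plane_dilation_le pos _ mPt (fun q => Psi0 _) e).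
by rewrite -expRM_natl -expRN ler_expR; move: t1; lra.
Qed.

Let Ci := Cs * 2 `^ `|gm + p * s|.

(** [schur_second] integrates out t; the exponents b (p - 1) + s + eta add up to gm + p s. *)
Let inner_bound q :
  (\int[mu]_t Psi (t, q) <= (Ci * (H q * rweight (gm + p * s) q))%:E)%E.
Proof.
have [q1|q1] := ltP (mod q) 1; last first.
  have Hq : H q = 0.
    rewrite /H ext0_out ?cabs0 ?powR0 ?gt_eqF//=; rewrite subr0 => /lt_geF.
    by rewrite -/(mod q) q1.
  have Psi00 t : Psi (t, q) = 0%E by rewrite /Psi/= Hq !mulr0.
  by rewrite (line_integral0 Psi00) Hq mul0r mulr0.
have q0 : 0 <= mod q by exact: cabs_ge0.
set x := 1 - mod q; have x0 : 0 < x by rewrite subr_gt0.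
have mu1 : measurable_fun setT (fun t => (unit_power s t * annulus_power eta (expR t * mod q))%:E).
  apply/measurable_EFinP; apply: measurable_funM; first exact: measurable_unit_power.
  apply: (measurableT_comp (measurable_annulus_power eta)).
  by apply: measurable_funM => //; exact: measurable_expR.
have -> : (\int[mu]_t Psi (t, q) = (x `^ (b * (p - 1)) * H q)%:E *
    \int[mu]_t (unit_power s t * annulus_power eta (expR t * mod q))%:E)%E.
  rewrite -line_integralZ ?mulr_ge0 ?powR_ge0//; last first.
    by move=> t; rewrite lee_fin mulr_ge0 ?unit_power_ge0 ?annulus_power_ge0.
  by apply: eq_integral => t _; rewrite /Psi/= -EFinM; congr EFin; rewrite mulrC.
apply: le_trans (lee_wpmul2l _ (hCs q0 q1)) _; first by rewrite lee_fin mulr_ge0 ?powR_ge0.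
rewrite -EFinM lee_fin -/x.
have xE : x `^ (gm + p * s) = x `^ (b * (p - 1)) * x `^ (s + eta).
  by rewrite -powRD ?(gt_eqF x0) ?implybT//; congr (_ `^ _); rewrite etaE; ring.
have -> : x `^ (b * (p - 1)) * H q * (Cs * x `^ (s + eta)) = Cs * H q * x `^ (gm + p * s).
  by rewrite xE; move: (x `^ _) (x `^ _) (H q) Cs => X Y Z W; ring.
have [_ h] := one_sub_sqr_powR (gm + p * s) q0 q1.
have -> : Ci * (H q * rweight (gm + p * s) q) =
    Cs * H q * (2 `^ `|gm + p * s| * (1 - mod q ^+ 2) `^ (gm + p * s)).
  by rewrite /Ci mulrACA.
by rewrite ler_wpM2l ?mulr_ge0 ?(ltW Cs0).
Qed.

Let Ci0 : 0 < Ci. Proof. by rewrite mulr_gt0 ?powR_gt0. Qed.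

Let double_bound :
  (\int[mu2]_q \int[mu]_t Phi (t, q) <= (expR 2 * Ci)%:E * berg (gm + p * s) p g)%E.
Proof.
apply: (iterated_integral_bound mPhi mPsi (measurable_berg _ _ ag) Phi0 Psi0).
- exact: berg_integrand_ge0.
- exact: expR_ge0.
- exact: ltW.
- exact: scale_t.
- by move=> q; rewrite -EFinM; exact: inner_bound.
Qed.

(* Main part of the Schur test: Jensen's inequality with the weight
   t^(s-1) (1 - e^-t |z|)^-b. *)
Let pointwise (d : disk R) q (m : R) : point d = cpt q -> 2^-1 <= mod q -> 0 <= m ->
  (forall t, 1 <= t -> cabs (ext0 g (cpt (dil t q))) <= m) -> m <= cabs (IR_pow (- s) g d) ->
  (((gamma s * (cabs (IR_pow (- s) g d) - m)) `^ p * rweight gm q)%:E <=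
   (2 `^ p * KV `^ (p - 1) * 2 `^ `|gm|)%:E * \int[mu]_t Phi (t, q))%E.
Proof.
move=> dq q2 m0 hm mv; set v := cabs (IR_pow (- s) g d) in mv *.
have gam0 := gamma_gt0 s0.
have q1 : mod q < 1 by rewrite /mod -dq disk_cabs.
set r := mod q in q1 q2 *; pose rho := 1 - r; have rho0 : 0 < rho by rewrite subr_gt0.
have G t : cabs (ext0 g ((expR (- t))%:C * point d)) = cabs (ext0 g (cpt (dil t q))).
  by rewrite cpt_dil dq.
have mG : measurable_fun setT (fun t => cabs (ext0 g (cpt (dil t q)))).
  apply: (measurableT_comp (measurable_cabs (cmeasurable_ext0 ag))).
  by apply: measurable_fun_pair; apply: measurable_funM => //; exact: measurable_expRN.
pose vv (t : R) := unit_power s t * (1 - expR (- t) * r) `^ (- b).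
pose h (t : R) := (1 - expR (- t) * r) `^ b * cabs (ext0 g (cpt (dil t q))).
have mbase : measurable_fun setT (fun t : R => 1 - expR (- t) * r).
  by apply: measurable_funB => //; apply: measurable_funM => //; exact: measurable_expRN.
have mv' : measurable_fun setT vv.
  apply: measurable_funM; first exact: measurable_unit_power.
  exact: (measurableT_comp (measurable_powR (- b)) mbase).
have mh : measurable_fun setT h.
  by apply: measurable_funM => //; exact: (measurableT_comp (measurable_powR b) mbase).
have vv0 t : setT t -> 0 <= vv t by move=> _; rewrite mulr_ge0 ?unit_power_ge0 ?powR_ge0.
have h0 t : setT t -> 0 <= h t by move=> _; rewrite mulr_ge0 ?cabs_ge0 ?powR_ge0.
have V0 : 0 < KV * rho `^ (s - b) by rewrite mulr_gt0 ?powR_gt0.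
have x0 : 0 <= gamma s * (v - m) by rewrite mulr_ge0 ?(ltW gam0) ?subr_ge0.
(* For t > 1 the dilates contribute at most [m] times the kernel, in total at most gamma(s) m;
   moving this to the left produces v - m. *)
have xI : ((gamma s * (v - m))%:E <= \int[mu]_t (vv t * h t)%:E)%E.
  have mk : measurable_fun setT (fun t => (gamma_kernel s t)%:E).
    by apply/measurable_EFinP; exact: measurable_gamma_kernel.
  have k0 t : (0 <= (gamma_kernel s t)%:E)%E by rewrite lee_fin gamma_kernel_ge0.
  have mvh : measurable_fun setT (fun t => (vv t * h t)%:E).
    by apply/measurable_EFinP; exact: measurable_funM.
  have vh0 t : (0 <= (vv t * h t)%:E)%E by rewrite lee_fin mulr_ge0 ?vv0 ?h0.
  have e1 : ((gamma s * m)%:E = \int[mu]_t (m%:E * (gamma_kernel s t)%:E))%E.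
    by rewrite line_integralZ// (integral_gamma s0) -EFinM mulrC.
  rewrite mulrBr EFinB leeBlDr// e1 -line_integralD//; last 2 first.
  - exact: emeasurable_funM.
  - by move=> t; apply: mule_ge0; rewrite ?lee_fin ?gamma_kernel_ge0.
  apply: le_trans (gamma_integral_bound s0 d ag) _; apply: line_le.
  - apply/measurable_EFinP; apply: measurable_funM; first exact: measurable_gamma_kernel.
    by apply: eq_measurable_fun mG => t _; rewrite G.
  - by apply: emeasurable_funD => //; exact: emeasurable_funM.
  - by move=> t; rewrite lee_fin mulr_ge0 ?cabs_ge0 ?gamma_kernel_ge0.
  move=> t; rewrite G -EFinM -EFinD lee_fin /vv /h unit_powerE.
  have [t0|t0] := ltP 0 t; last by rewrite /gamma_kernel pos_indE ltNge t0 /= !mul0r mulr0 add0r.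
  have [t1|t1] := leP t 1; last first.
    rewrite andbF !mul0r add0r [leRHS]mulrC ler_wpM2l ?gamma_kernel_ge0// hm//.
    exact: ltW.
  have p2 : 0 < 1 - expR (- t) * r.
    by apply: lt_le_trans (one_sub_exp_mul q2 q1 t0 t1); rewrite divr_gt0// addr_gt0.
  rewrite /= mul1r; apply: kernel_le; rewrite ?gamma_kernel_ge0 ?cabs_ge0//.
    rewrite /gamma_kernel pos_indE t0 mul1r ler_piMr ?powR_ge0//.
    by rewrite -expR0 ler_expR oppr_le0 ltW.
  by rewrite powRN mulVf// gt_eqF ?powR_gt0.
have VI : (\int[mu]_t (vv t)%:E <= (KV * rho `^ (s - b))%:E)%E by exact: hKV.
have := @jensen_powR R _ _ mu setT vv h p _ _ measurableT mv' mh vv0 h0 p1 V0 x0 VI xI.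
move=> J; rewrite [X in (X <= _)%E]EFinM.
apply: le_trans (lee_wpmul2r _ J) _; first by rewrite lee_fin powR_ge0.
have mvhp : measurable_fun setT (fun t => (vv t * h t `^ p)%:E).
  apply/measurable_EFinP; apply: measurable_funM => //.
  exact: (measurableT_comp (measurable_powR p) mh).
have vhp0 t : (0 <= (vv t * h t `^ p)%:E)%E by rewrite lee_fin mulr_ge0 ?vv0 ?powR_ge0.
have mPq : measurable_fun setT (fun t => Phi (t, q)).
  by apply: (measurableT_comp mPhi); exact: measurable_fun_pair.
rewrite muleAC -EFinM -line_integralZ//; last by rewrite !mulr_ge0 ?powR_ge0.
rewrite -line_integralZ//; last by rewrite !mulr_ge0 ?powR_ge0.
apply: line_le.
- exact: emeasurable_funM.
- exact: emeasurable_funM.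
- by move=> t; apply: mule_ge0 => //; rewrite lee_fin !mulr_ge0 ?powR_ge0.
move=> t; rewrite /Phi/= -!EFinM lee_fin /vv unit_powerE -/r.
have [t0|t0] := ltP 0 t; last by rewrite /= !mul0r !mulr0.
have [t1|t1] := leP t 1; last by rewrite /= !mul0r !mulr0.
rewrite /= !mul1r annulus_powerE q1 q2/= mul1r -/rho.
have p2 : 0 < 1 - expR (- t) * r.
  by apply: lt_le_trans (one_sub_exp_mul q2 q1 t0 t1); rewrite divr_gt0// addr_gt0.
have -> : h t `^ p = (1 - expR (- t) * r) `^ (b * p) * H (dil t q).
  by rewrite /h powRM ?powR_ge0 ?cabs_ge0// -powRrM.
have -> : (KV * rho `^ (s - b)) `^ (p - 1) = KV `^ (p - 1) * rho `^ ((s - b) * (p - 1)).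
  by rewrite powRM ?(ltW KV0) ?powR_ge0// -powRrM.
have -> : (1 - expR (- t) * r) `^ (b * (p - 1)) =
    (1 - expR (- t) * r) `^ (- b) * (1 - expR (- t) * r) `^ (b * p).
  by rewrite -powRD ?(gt_eqF p2) ?implybT//; congr (_ `^ _); ring.
have rw : rho `^ ((s - b) * (p - 1)) * rweight gm q <= 2 `^ `|gm| * rho `^ eta.
  rewrite etaE powRD ?(gt_eqF rho0) ?implybT// mulrA mulrC ler_wpM2r ?powR_ge0//.
  by have [] := one_sub_sqr_powR gm (cabs_ge0 _ : 0 <= r) q1.
have -> : 2 `^ p * (KV `^ (p - 1) * rho `^ ((s - b) * (p - 1))) * rweight gm q *
    (t `^ (s - 1) * (1 - expR (- t) * r) `^ (- b) * ((1 - expR (- t) * r) `^ (b * p) * H (dil t q))) =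
    2 `^ p * KV `^ (p - 1) * t `^ (s - 1) * (1 - expR (- t) * r) `^ (- b) *
    (1 - expR (- t) * r) `^ (b * p) * H (dil t q) * (rho `^ ((s - b) * (p - 1)) * rweight gm q).
  exact: mul_rearrange1.
have -> : 2 `^ p * KV `^ (p - 1) * 2 `^ `|gm| * (t `^ (s - 1) * rho `^ eta *
    ((1 - expR (- t) * r) `^ (- b) * (1 - expR (- t) * r) `^ (b * p) * H (dil t q))) =
    2 `^ p * KV `^ (p - 1) * t `^ (s - 1) * (1 - expR (- t) * r) `^ (- b) *
    (1 - expR (- t) * r) `^ (b * p) * H (dil t q) * (2 `^ `|gm| * rho `^ eta).
  exact: mul_rearrange2.
by rewrite ler_wpM2l// !mulr_ge0 ?powR_ge0.
Qed.

(** For |d| <= 1/2 all dilates stay in |z| <= 1/2, so the average inherits the bound [m]. *)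
Let small_bound (d : disk R) (m : R) : 0 <= m ->
  (forall z, cabs z <= 2^-1 -> cabs (ext0 g z) <= m) -> cabs (point d) <= 2^-1 ->
  cabs (IR_pow (- s) g d) <= m.
Proof.
move=> m0 hm d2; have gam0 := gamma_gt0 s0.
rewrite -(ler_pM2l gam0) -lee_fin; apply: le_trans (gamma_integral_bound s0 d ag) _.
have k0 t : (0 <= (gamma_kernel s t)%:E)%E by rewrite lee_fin gamma_kernel_ge0.
have mk : measurable_fun setT (fun t => (gamma_kernel s t)%:E).
  by apply/measurable_EFinP; exact: measurable_gamma_kernel.
rewrite mulrC EFinM -(integral_gamma s0).
have <- := line_integralZ m0 mk k0.
apply: line_le.
- apply/measurable_EFinP; apply: measurable_funM; first exact: measurable_gamma_kernel.
  have [q dq] : exists q, point d = cpt q by exists (complex.Re (point d), complex.Im (point d)); case: (point d).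
  rewrite (_ : (fun t => _) = (fun t => cabs (ext0 g (cpt (dil t q))))); last first.
    by apply/funext => t; rewrite cpt_dil dq.
  apply: (measurableT_comp (measurable_cabs (cmeasurable_ext0 ag))).
  by apply: measurable_fun_pair; apply: measurable_funM => //; exact: measurable_expRN.
- apply: emeasurable_funM; [exact: measurable_cst|exact: mk].
- by move=> t; rewrite lee_fin mulr_ge0 ?cabs_ge0 ?gamma_kernel_ge0.
move=> t; rewrite -EFinM lee_fin mulrC.
have [t0|t0] := ltP 0 t; last by rewrite /gamma_kernel pos_indE ltNge t0 /= !mul0r !mulr0.
rewrite ler_wpM2r ?gamma_kernel_ge0// hm// cabsM cabs_ge0_real ?expR_ge0//.
apply: le_trans d2; rewrite ler_piMl ?cabs_ge0//.
by rewrite -expR0 ler_expR oppr_le0 ltW.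
Qed.

(** Where |v| <= m the constant bound and the finite mass of the weight suffice. Elsewhere |z| >=
    1/2 by [small_bound], so [pointwise] controls the excess |v| - m. *)
Lemma berg_IR_powN_bound (m Cd : R) : -1 < gm -> 0 <= m ->
  (forall z, cabs z <= 2^-1 -> cabs (ext0 g z) <= m) ->
  (\int[mu2]_q (ball_ind 0 1 q * rweight gm q)%:E <= Cd%:E)%E ->
  (berg gm p (IR_pow (- s) g) <= (2 `^ p * m `^ p * Cd)%:E +
   (2 `^ p * (gamma s)^-1 `^ p * (2 `^ p * KV `^ (p - 1) * 2 `^ `|gm|) * (expR 2 * Ci))%:E *
   berg (gm + p * s) p g)%E.
Proof.
move=> gm1 m0 hm hCd; have gam0 := gamma_gt0 s0.
set v := IR_pow (- s) g; have av : analytic v by exact: analytic_IR_pow.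
set c1 := 2 `^ p * m `^ p; set c3 := 2 `^ p * KV `^ (p - 1) * 2 `^ `|gm|.
set c2 := 2 `^ p * (gamma s)^-1 `^ p.
have c10 : 0 <= c1 by rewrite mulr_ge0 ?powR_ge0.
have c20 : 0 <= c2 by rewrite mulr_ge0 ?powR_ge0.
have c30 : 0 <= c3 by rewrite !mulr_ge0 ?powR_ge0.
have c230 : 0 <= c2 * c3 by exact: mulr_ge0.
pose W q := (ball_ind 0 1 q * rweight gm q)%:E.
pose P q := (\int[mu]_t Phi (t, q))%E.
have W0 q : (0 <= W q)%E by rewrite lee_fin mulr_ge0 ?ball_ind_ge0 ?powR_ge0.
have mW : measurable_fun setT W.
  apply/measurable_EFinP; apply: measurable_funM; [exact: measurable_ball_ind|exact: measurable_rweight].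
have P0 q : (0 <= P q)%E by apply: integral_ge0 => t _; exact: Phi0.
have mP : measurable_fun setT P by exact: measurable_line_plane' mPhi Phi0.
have key q : ((cabs (ext0 v (cpt q)) `^ p * rweight gm q)%:E <= c1%:E * W q + (c2 * c3)%:E * P q)%E.
  have rhs0 : (0 <= c1%:E * W q + (c2 * c3)%:E * P q)%E.
    apply: adde_ge0; apply: mule_ge0; [by rewrite lee_fin|exact: W0|by rewrite lee_fin|exact: P0].
  have [q1|q1] := ltP (cabs (cpt q)) 1; last first.
    rewrite ext0_out; last by rewrite /= subr0 => /lt_geF; rewrite q1.
    by rewrite cabs0 powR0 ?(gt_eqF p0)// mul0r.
  have [d dq] := diskP q1.
  rewrite -dq ext0_val /W ball_indE subr0 q1 mul1r.
  have rw0 : 0 <= rweight gm q by exact: powR_ge0.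
  have [vm|mv] := leP (cabs (v d)) m.
    rewrite -[leLHS]adde0; apply: leeD; last by apply: mule_ge0; [rewrite lee_fin|exact: P0].
    rewrite -EFinM lee_fin ler_wpM2r//.
    apply: (@le_trans _ _ (m `^ p)); first by rewrite ge0_ler_powR ?nnegrE ?(ltW p0) ?cabs_ge0.
    have two : 1 <= 2 `^ p :> R by have := ler_powR (ler1n R 2 : 1 <= 2) (ltW p0); rewrite powRr0.
    by rewrite /c1 ler_peMl ?powR_ge0.
  have q2 : 2^-1 <= mod q.
    rewrite leNgt; apply/negP => h; move: mv; apply/negP; rewrite -leNgt.
    by apply: small_bound => //; rewrite dq; exact: ltW.
  have hm' t : 1 <= t -> cabs (ext0 g (cpt (dil t q))) <= m.
    move=> t1; apply: hm; rewrite -/(mod _) mod_dil.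
    apply: (@le_trans _ _ (expR (- t))); first by rewrite ler_piMr ?expR_ge0// ltW.
    apply: (@le_trans _ _ (expR (-1))); first by rewrite ler_expR lerN2.
    by rewrite expRN lef_pV2 ?posrE ?expR_gt0//; have := expR_ge1Dx (1 : R); rewrite -[1 + 1]/(2%:R).
  have J := pointwise dq q2 m0 hm' (ltW mv).
  have J' : (c2%:E * ((gamma s * (cabs (v d) - m)) `^ p * rweight gm q)%:E <= (c2 * c3)%:E * P q)%E.
    by rewrite [X in (_ <= X * _)%E]EFinM -muleA; apply: lee_wpmul2l; [rewrite lee_fin|exact: J].
  apply: le_trans (leeD2l _ J').
  rewrite -!EFinM -EFinD lee_fin mulrA -mulrDl ler_wpM2r//.
  have x0 : 0 <= gamma s * (cabs (v d) - m) by rewrite mulr_ge0 ?(ltW gam0) ?subr_ge0 ?(ltW mv).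
  have vE : cabs (v d) = m + (gamma s)^-1 * (gamma s * (cabs (v d) - m)).
    by rewrite mulKf ?(gt_eqF gam0)// addrC subrK.
  move: x0 vE; move: (gamma s * (cabs (v d) - m)) => x x0 ->.
  apply: le_trans (powR_add_le m0 _ (ltW p0)) _; first by rewrite mulr_ge0 ?invr_ge0 ?(ltW gam0).
  by rewrite mulrDr lerD2l powRM ?invr_ge0 ?(ltW gam0)// mulrA.
apply: (@le_trans _ _ (\int[mu2]_q (c1%:E * W q + (c2 * c3)%:E * P q))%E).
  apply: plane_le.
  - exact: measurable_berg.
  - apply: emeasurable_funD; apply: emeasurable_funM => //.
  - exact: berg_integrand_ge0.
  - exact: key.
have mcW : measurable_fun setT (fun q => c1%:E * W q)%E by exact: emeasurable_funM.
have mcP : measurable_fun setT (fun q => (c2 * c3)%:E * P q)%E by exact: emeasurable_funM.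
have cW0 q : (0 <= c1%:E * W q)%E by apply: mule_ge0; [rewrite lee_fin|exact: W0].
have cP0 q : (0 <= (c2 * c3)%:E * P q)%E by apply: mule_ge0; [rewrite lee_fin|exact: P0].
have -> := plane_integralD mcW mcP cW0 cP0.
have -> := plane_integralZ c10 mW W0.
have -> := plane_integralZ c230 mP P0.
apply: leeD; first by rewrite [X in (_ <= X)%E]EFinM; apply: lee_wpmul2l; [rewrite lee_fin|exact: hCd].
rewrite [X in (_ <= X * _)%E]EFinM -muleA; apply: lee_wpmul2l; first by rewrite lee_fin.
exact: double_bound.
Qed.

End OneFunction.
End FractionalBound.

(** With a finite right-hand side B, [berg_eval] provides m = (Ce B)^(1/p) as a bound on |z| <= 1/2,
    so the term in m^p is a multiple of B as well. *)
Theorem berg_IR_powN (R : realType) (s gm p : R) : 0 < s -> -1 < gm -> 1 <= p ->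
  exists2 C : R, 0 < C & forall g : disk R -> R[i], analytic g ->
    (berg gm p (IR_pow (- s) g) <= C%:E * berg (gm + p * s) p g)%E.
Proof.
move=> s0 gm1 p1; have p0 : 0 < p by exact: lt_le_trans p1.
(* [schur_first] needs b > s and [schur_second] needs eta > -1; with this choice eta + 1 = (gm +
   1)(p + 1)/(2 p). *)
pose b := s + (gm + 1) / (2 * p); pose eta := gm + (s - b) * (p - 1).
have g1 : 0 < gm + 1 by rewrite -ltrBlDr sub0r.
have sb : s < b by rewrite ltrDl divr_gt0 ?mulr_gt0.
have b0 : 0 < b by exact: lt_trans sb.
have eta1 : -1 < eta.
  suff : 0 < eta + 1 by move: (eta) => x; lra.
  have -> : eta + 1 = (gm + 1) * ((p + 1) / (2 * p)) by rewrite /eta /b; field; rewrite gt_eqF.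
  by rewrite mulr_gt0// divr_gt0 ?mulr_gt0// addr_gt0.
have [Cs Cs0 hCs] := schur_second s0 eta1.
pose KV := 4 `^ b * (s^-1 + (b - s)^-1).
have KV0 : 0 < KV by rewrite mulr_gt0 ?powR_gt0// addr_gt0 ?invr_gt0// subr_gt0.
have hKV (r : R) (r1 : 2^-1 <= r) (r2 : r < 1) := schur_first s0 sb r1 r2.
have [Cd Cd0 hCd] := disc_weight_finite gm1.
have gps : -1 < gm + p * s by rewrite (lt_trans gm1)// ltrDl mulr_gt0.
have h2 : 2^-1 < 1 :> R by rewrite invf_lt1// ltr1n.
have [Ce Ce0 hCe] := berg_eval (gm + p * s) p1 h2.
pose K := 2 `^ p * (gamma s)^-1 `^ p * (2 `^ p * KV `^ (p - 1) * 2 `^ `|gm|) *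
  (expR 2 * (Cs * 2 `^ `|gm + p * s|)).
have K0 : 0 < K.
  by rewrite !mulr_gt0 ?powR_gt0 ?expR_gt0 ?invr_gt0 ?gamma_gt0.
have C0 : 0 < 2 `^ p * Ce * Cd + K by apply: addr_gt0 => //; rewrite !mulr_gt0 ?powR_gt0.
exists (2 `^ p * Ce * Cd + K) => // g ag.
have B0 := berg_ge0 (gm + p * s) p g.
have [->|[B BE B0']] : berg (gm + p * s) p g = +oo%E \/ (exists2 B : R, berg (gm + p * s) p g = B%:E & 0 <= B).
- by move: B0; case: (berg _ _ _) => [B| |]//; [right; exists B|left].
- rewrite gt0_muley; [exact: leey|by rewrite lte_fin].
pose m := (Ce * B) `^ p^-1; have m0 : 0 <= m by exact: powR_ge0.
have mp : m `^ p = Ce * B by rewrite -powRrM mulVf ?(gt_eqF p0)// powRr1// mulr_ge0 ?(ltW Ce0).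
have hm z : cabs z <= 2^-1 -> cabs (ext0 g z) <= m.
  move=> z2; have [d dz] := diskP (le_lt_trans z2 h2); rewrite -dz in z2 *; rewrite ext0_val.
  have := hCe g d ag z2; rewrite BE -EFinM lee_fin -mp => h.
  by rewrite leNgt; apply/negP => mv; move: h; apply/negP; rewrite -ltNge gt0_ltr_powR ?nnegrE ?cabs_ge0.
have := berg_IR_powN_bound s0 p1 (erefl eta) Cs0 KV0 hCs hKV ag gm1 m0 hm hCd.
rewrite mp BE => h; apply: le_trans h _.
by rewrite -!EFinM -EFinD lee_fin -/K mulrDl lerD2r !mulrA mulrAC.
Qed.

(** * Equivalence of the Bergman norms *)

Section BergmanNorms.
Variable R : realType.
Implicit Types (f g : disk R -> R[i]).

Lemma berg_IR_pow_nat (p : R) (m : nat) : 1 <= p -> forall gm : R,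
  exists2 C : R, 0 < C & forall f, analytic f ->
    (berg (gm + m%:R * p) p (IR_pow m%:R f) <= C%:E * berg gm p f)%E.
Proof.
move=> p1; elim: m => [|m IH] gm.
  by exists 1 => // f af; rewrite IR_pow0// mul0r addr0 mul1e.
have [C C0 hC] := IH gm; have [D D0 hD] := berg_IR_pow1 (gm + m%:R * p) p1.
exists (D * C) => [|f af]; first exact: mulr_gt0.
have -> : gm + m.+1%:R * p = gm + m%:R * p + p by rewrite -natr1 mulrDl mul1r addrA.
have -> : IR_pow m.+1%:R f = IR_pow 1 (IR_pow m%:R f) by rewrite (IR_powD _ _ af) nat1r.
apply: le_trans (hD _ (analytic_IR_pow _ af)) _.
by rewrite EFinM -muleA; apply: lee_wpmul2l; [rewrite lee_fin ltW|exact: hC].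
Qed.

(** One inequality is [berg_IR_powN] for [IR_pow beta f]. For the other, [f] is differentiated an
    integer number m > beta of times and then integrated by the order m - beta. *)
Lemma berg_IR_pow_equiv (p alpha beta : R) : 1 <= p -> -1 < alpha - p * beta -> 0 <= beta ->
  exists2 C : R, 0 < C & forall f, analytic f ->
    (berg (alpha - p * beta) p f <= C%:E * berg alpha p (IR_pow beta f))%E /\
    (berg alpha p (IR_pow beta f) <= C%:E * berg (alpha - p * beta) p f)%E.
Proof.
move=> p1 g1; rewrite le_eqVlt => /orP[/eqP<-|b0].
  by exists 1 => // f af; rewrite IR_pow0// mulr0 subr0 mul1e.
have p0 : 0 < p by exact: lt_le_trans p1.
set gm := alpha - p * beta in g1 *.
have a1 : -1 < alpha by apply: lt_le_trans g1 _; rewrite gerBl mulr_ge0 ?(ltW p0) ?(ltW b0).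
have [C1 C10 h1] := berg_IR_powN b0 g1 p1.
pose m := (Num.Def.truncn beta).+1; have bm : beta < m%:R by exact: truncnS_gt.
have s0 : 0 < m%:R - beta by rewrite subr_gt0.
have [C2 C20 h2] := berg_IR_powN s0 a1 p1.
have [C3 C30 h3] := berg_IR_pow_nat m p1 gm.
exists (C1 + C2 * C3) => [|f af]; first by rewrite addr_gt0// mulr_gt0.
have B0 := berg_ge0 gm p f.
have B0' := berg_ge0 alpha p (IR_pow beta f).
split.
  have af' := analytic_IR_pow beta af.
  have := h1 _ af'; rewrite (IR_powD _ _ af) addNr (IR_pow0 af) /gm subrK => h.
  apply: le_trans h _; apply: lee_wpmul2r; first exact: B0'.
  by rewrite lee_fin lerDl ltW// mulr_gt0.
have := h2 _ (analytic_IR_pow m%:R af); rewrite (IR_powD _ _ af) opprB subrK => h.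
apply: le_trans h _.
have -> : alpha + p * (m%:R - beta) = gm + m%:R * p by rewrite /gm; ring.
apply: le_trans (lee_wpmul2l _ (h3 _ af)) _; first by rewrite lee_fin ltW.
rewrite muleA -EFinM; apply: lee_wpmul2r; first exact: B0.
by rewrite lee_fin lerDr ltW.
Qed.

Lemma poweR_inv_scale (A B : \bar R) (p C t : R) : 0 < p -> 0 < C -> (0 <= A)%E -> (0 <= B)%E ->
  (A <= C%:E * B)%E -> (B `^ p^-1 <= t%:E)%E -> (A `^ p^-1 <= (C `^ p^-1 * t)%:E)%E.
Proof.
move=> p0 C0 A0 B0 AB Bt; have t0 : 0 <= t by rewrite -lee_fin; apply: le_trans Bt; exact: poweR_ge0.
move: Bt; rewrite (poweR_inv_le B0 p0 t0) => Bt.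
rewrite (poweR_inv_le A0 p0) ?mulr_ge0 ?powR_ge0// powRM ?powR_ge0// -powRrM mulVf ?(gt_eqF p0)//.
rewrite powRr1 ?(ltW C0)//; apply: le_trans AB _.
by rewrite [X in (_ <= X)%E]EFinM; apply: lee_wpmul2l; [rewrite lee_fin ltW|exact: Bt].
Qed.

Lemma bergman_norm_equiv (p alpha beta : R) : 1 <= p -> -1 < alpha - p * beta -> 0 <= beta ->
  exists2 C : R, 0 < C & forall f t, analytic f ->
    ((berg_norm (alpha - p * beta) p f <= t%:E)%E -> (bergman_norm p alpha beta f <= (C * t)%:E)%E) /\
    ((bergman_norm p alpha beta f <= t%:E)%E -> (berg_norm (alpha - p * beta) p f <= (C * t)%:E)%E).
Proof.
move=> p1 g1 b0; have p0 : 0 < p by exact: lt_le_trans p1.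
have [C C0 hC] := berg_IR_pow_equiv p1 g1 b0.
set gm := alpha - p * beta in g1 hC *.
have a1 : -1 < alpha by apply: lt_le_trans g1 _; rewrite gerBl mulr_ge0 ?(ltW p0).
pose c := (alpha + 1) / pi.
have c0 : 0 < c by rewrite divr_gt0 ?pi_gt0// -ltrBlDr sub0r.
have cC0 : 0 < c * C by exact: mulr_gt0.
have Cc0 : 0 < C / c by exact: divr_gt0.
pose k1 := (c * C) `^ p^-1; pose k2 := (C / c) `^ p^-1.
have k10 : 0 < k1 by exact: powR_gt0.
have k20 : 0 < k2 by exact: powR_gt0.
exists (k1 + k2) => [|f t af]; first exact: addr_gt0.
have [h1 h2] := hC f af.
rewrite (bergman_norm_berg p0 a1 (analytic_IR_pow beta af)) -/c /berg_norm.
have A0 := berg_ge0 gm p f; have B0 := berg_ge0 alpha p (IR_pow beta f).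
move: h1 h2 A0 B0; move: (berg gm p f) (berg alpha p _) => A B h1 h2 A0 B0.
have cB0 : (0 <= c%:E * B)%E by apply: mule_ge0; [rewrite lee_fin ltW|exact: B0].
have tge (X : \bar R) : (X `^ p^-1 <= t%:E)%E -> 0 <= t.
  by move=> h; rewrite -lee_fin; apply: le_trans h; exact: poweR_ge0.
split=> h; have t0 := tge _ h.
- have AB : (c%:E * B <= (c * C)%:E * A)%E.
    by rewrite [X in (_ <= X * _)%E]EFinM -muleA; apply: lee_wpmul2l; [rewrite lee_fin ltW|exact: h2].
  apply: le_trans (poweR_inv_scale p0 cC0 cB0 A0 AB h) _.
  by rewrite lee_fin ler_wpM2r// lerDl ltW.
- have AB : (A <= (C / c)%:E * (c%:E * B))%E.
    by rewrite muleA -EFinM divfK ?(gt_eqF c0).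
  apply: le_trans (poweR_inv_scale p0 Cc0 A0 cB0 AB h) _.
  by rewrite lee_fin ler_wpM2r// lerDr ltW.
Qed.

End BergmanNorms.

Theorem corollary4p6 (R : realType) (N : (disk R -> R[i]) -> \bar R)
    (u : disk R -> R[i]) :
  (exists p alpha beta : R,
     [/\ 1 <= p, -1 < alpha, 0 <= beta < (1 + alpha) / p
       & N = bergman_norm p alpha beta]) \/
  (exists alpha : R, 1 < alpha /\ N = bloch_norm alpha) \/
  (exists (p : R) (w : R -> R),
     [/\ 1 < p, muckenhoupt p w & N = hardy_norm p w]) ->
  multipliers (function_space N) u ->
  essential_spectrum (function_space N) N (mul_op u) =
  \bigcap_(r in [set r : R | 0 < r < 1])
    closure (u @` [set z : disk R | r%:C <= `|val z|]).
Proof.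
move=> [[p [alpha [beta [p1 alpha1 /andP[b0 b1] ->]]]]|[[alpha [alpha1 ->]]|[p [w [p1 Aw ->]]]]].
- have p0 : 0 < p by exact: lt_le_trans p1.
  (* The bound on [beta] says that the equivalent weight, of exponent alpha - p beta, is
     integrable. *)
  have g1 : -1 < alpha - p * beta by move: b1; rewrite ltr_pdivlMr// mulrC; lra.
  have [C C0 hC] := bergman_norm_equiv p1 g1 b0.
  apply: (essential_spectrum_solid (berg_norm_solid g1 p1) C0).
  + by move=> f; exact: poweR_ge0.
  + by move=> f t af; exact: (hC f t af).1.
  + by move=> f t af; exact: (hC f t af).2.
- pose k1 := 1 + 4 `^ alpha; pose k2 := 1 + 2 `^ (alpha - 1) / (alpha - 1).
  have k10 : 0 < k1 by rewrite addr_gt0 ?powR_gt0.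
  have k20 : 0 < k2 by rewrite addr_gt0// divr_gt0 ?powR_gt0// subr_gt0.
  have C0 : 0 < k1 + k2 by exact: addr_gt0.
  apply: (essential_spectrum_solid (growth_solid alpha1) C0).
  + by move=> f; exact: bloch_norm_ge0.
  + move=> f t af h; have t0 : 0 <= t.
      have := le_trans (bloch_norm_ge0 alpha f) (bloch_le_growth alpha1 af h).
      by rewrite lee_fin pmulr_rge0.
    by apply: le_trans (bloch_le_growth alpha1 af h) _; rewrite lee_fin ler_wpM2r// lerDl ltW.
  + move=> f t af h; have t0 : 0 <= t by rewrite -lee_fin; apply: le_trans h; exact: bloch_norm_ge0.
    by apply: le_trans (growth_le_bloch alpha1 af h) _; rewrite lee_fin ler_wpM2r// lerDr ltW.
- apply: (essential_spectrum_solid (hardy_solid p1 Aw) ltr01).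
  + by move=> f; exact: hardy_norm_ge0.
  + by move=> f t af h; rewrite mul1r.
  + by move=> f t af h; rewrite mul1r.
Qed.
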